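(* Let $T_i$ be a symmetrically non-degenerate Calderón–Zygmund operator on $\mathbb{R}^{d_i}$, $i=1,2$, let $p_i,q_i\in(1,\infty)$ with $p_i\le q_i$, $i=1,2$, set $\beta_i:=d_i\left(\frac1{p_i}-\frac1{q_i}\right)$ and $p_i':=p_i/(p_i-1)$, and let $b\in L^2_{\mathrm{loc}}(\mathbb{R}^d)$, $\mathbb{R}^d=\mathbb{R}^{d_1}\times\mathbb{R}^{d_2}$. If the bi-commutator $[T_1,[b,T_2]]$ is a compact operator $L^{p_1}L^{p_2}\to L^{q_1}L^{q_2}$, then $b\in\mathrm{VMO}^{\beta_1,\beta_2}_{p_1',p_2'}$.
   Context: Write $x=(x_1,x_2)\in\mathbb{R}^{d_1}\times\mathbb{R}^{d_2}$. $L^{p_1}L^{p_2}=L^{p_1}(\mathbb{R}^{d_1};L^{p_2}(\mathbb{R}^{d_2}))$ has norm $\big\|\,\|f(x_1,x_2)\|_{L^{p_2}_{x_2}}\big\|_{L^{p_1}_{x_1}}$. A standard kernel on $\mathbb{R}^{n}$ is a function $K(x,y)$, $x\ne y$, with $|K(x,y)|\le C|x-y|^{-n}$ and, for some $\alpha\in(0,1]$, $|K(x,y)-K(x',y)|+|K(y,x)-K(y,x')|\le C\frac{|x-x'|^{\alpha}}{|x-y|^{n+\alpha}}$ whenever $|x-x'|\le|x-y|/2$. A Calderón–Zygmund operator (CZO) $T$ on $\mathbb{R}^n$ is a linear operator bounded on $L^p(\mathbb{R}^n)$ for all $p\in(1,\infty)$ with $\langle Tf,g\rangle=\iint K(x,y)f(y)g(x)\,dy\,dx$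 for nice $f,g$ with disjoint supports, for some standard kernel $K$. It is symmetrically non-degenerate if there is $c_0>0$ such that for every $y\in\mathbb{R}^n$ and $r>0$ there is $x\notin B(y,r)$ with $|K(x,y)|\ge\frac1{c_0r^n}$ and $|K(y,x)|\ge\frac1{c_0r^n}$. $T_1,T_2$ act on functions on $\mathbb{R}^d$ in the variable $x_1$, $x_2$ respectively. $[T_1,[b,T_2]]f=T_1(bT_2f)-T_1T_2(bf)-bT_2T_1f+T_2(bT_1f)$, understood weakly: for bounded compactly supported $f,g$, $\langle[T_1,[b,T_2]]f,g\rangle=\int b\,\big(T_2f\cdot T_1^*g-f\cdot T_1^*T_2^*g-T_1T_2f\cdot g+T_1f\cdot T_2^*g\big)$; compactness means that it extends to a compact operator. For $1\le v_i<\infty$ and rectangles $R=I_1\times I_2$ ($I_i\subset\mathbb{R}^{d_i}$ cubes of side length $\ell(I_i)$), $$\mathcal{O}^{\beta_1,\beta_2}_{v_1,v_2}(b,R):=\ell(I_1)^{-\beta_1}\ell(I_2)^{-\beta_2}\,\frac{\|b-\langle b\rangle_{I_1}-\langle b\rangle_{I_2}+\langle b\rangle_R\|_{L^{v_1}_{x_1}L^{v_2}_{x_2}(R)}}{|I_1|^{1/v_1}|I_2|^{1/v_2}},$$ where $\langle b\rangle_{I_i}$ denotes averaging over $I_i$ in the variable $x_i$ only (a function of the other variable) and $\langle b\rangle_R$ the average over $R$. $b\in\mathrm{VMO}^{\beta_1,\beta_2}_{v_1,v_2}$ means that $\sup_R\mathcal{O}^{\beta_1,\beta_2}_{v_1,v_2}(b,R)<\infty$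 and for all $\varepsilon>0$ there exists $t>0$ so that $\mathcal{O}^{\beta_1,\beta_2}_{v_1,v_2}(b,R)<\varepsilon$ whenever $\ell(I_i)<t$ or $\ell(I_i)>t^{-1}$ for $i=1$ or $i=2$, or $\mathrm{dist}(R,\{0\})>t^{-1}$. *)

(* Defs.v *)
From HB Require Import structures.
From mathcomp Require Import all_boot all_order all_algebra.
From mathcomp Require Import complex.
From mathcomp Require Import all_classical all_reals all_analysis.

Set Implicit Arguments.
Unset Strict Implicit.
Unset Printing Implicit Defensive.
Import Order.TTheory GRing.Theory Num.Theory.
Import numFieldNormedType.Exports.

Local Open Scope classical_set_scope.
Local Open Scope ring_scope.

Notation Rn R n := (n.-tuple (measurableTypeR R)).

Lemma sigma_finite_prod {R : realType} {e1 e2 : measure_display}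
    {T1 : measurableType e1} {T2 : measurableType e2}
    (m1 : {sigma_finite_measure set T1 -> \bar R})
    (m2 : {sigma_finite_measure set T2 -> \bar R}) :
  sigma_finite setT (m1 \x m2)%E.
Proof.
have /sigma_finiteP[F [TF ndF Foo]] := sigma_finiteT m1.
have /sigma_finiteP[G [TG ndG Goo]] := sigma_finiteT m2.
exists (fun n => F n `*` G n).
  rewrite -setXTT TF TG predeqE => -[x y]; split.
    move=> [/= [n _ Fnx] [k _ Gky]]; exists (maxn n k) => //; split.
    - by move: x Fnx; exact/subsetPset/ndF/leq_maxl.
    - by move: y Gky; exact/subsetPset/ndG/leq_maxr.
  by move=> [n _ []/= ? ?]; split; exists n.
move=> k; have [? ?] := Foo k; have [? ?] := Goo k.
split; first exact: measurableX.
by rewrite product_measure1E// lte_mul_pinfty// ge0_fin_numE.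
Qed.

Section lebesgue_Rn.
Context {R : realType}.

Definition cons_Rn n (p : measurableTypeR R * Rn R n) : Rn R n.+1 :=
  [tuple of p.1 :: p.2].

Lemma measurable_cons_Rn n : measurable_fun [set: _] (@cons_Rn n).
Proof. exact: measurable_cons. Qed.

Section step.
Context n (m : {sigma_finite_measure set (Rn R n) -> \bar R}).

Definition leb_cons : set (Rn R n.+1) -> \bar R :=
  pushforward (@lebesgue_measure R \x m)%E (@cons_Rn n).

Let leb_cons0 : leb_cons set0 = 0%E.
Proof. by rewrite /leb_cons /pushforward preimage_set0 measure0. Qed.

Let leb_cons_ge0 A : (0 <= leb_cons A)%E.
Proof. by rewrite /leb_cons /pushforward; exact: measure_ge0. Qed.

Let leb_cons_sigma_additive : semi_sigma_additive leb_cons.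
Proof.
move=> F mF tF mUF; rewrite /leb_cons /pushforward preimage_bigcup.
apply: measure_semi_sigma_additive.
- by move=> k; rewrite -[X in measurable X]setTI; exact: measurable_cons_Rn.
- apply/trivIsetP => /= i j _ _ ij; rewrite -preimage_setI.
  by move/trivIsetP : tF => /(_ _ _ _ _ ij) ->//; rewrite preimage_set0.
- rewrite -preimage_bigcup -[X in measurable X]setTI.
  exact: measurable_cons_Rn.
Qed.

HB.instance Definition _ := isMeasure.Build _ _ _ leb_cons
  leb_cons0 leb_cons_ge0 leb_cons_sigma_additive.

Let leb_cons_sigma_finite : sigma_finite setT leb_cons.
Proof.
have [F FT Ffin] := sigma_finite_prod (@lebesgue_measure R) m.
pose un (t : Rn R n.+1) : measurableTypeR R * Rn R n := (thead t, [tuple of behead t]).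
have unK t : cons_Rn (un t) = t by rewrite [RHS]tuple_eta.
have consK p : un (cons_Rn p) = p.
  by case: p => a t; rewrite /un /cons_Rn; congr pair; apply/val_inj.
have mun : measurable_fun setT un.
  apply/measurable_fun_pairP; split => /=; first exact: measurable_tnth.
  exact: measurable_behead.
exists (fun k => un @^-1` F k).
  by rewrite -preimage_bigcup -FT preimage_setT.
move=> k; have [mF Fk] := Ffin k; split.
  by rewrite -[X in measurable X]setTI; exact: mun.
rewrite /leb_cons /pushforward (_ : _ @^-1` _ = F k)//.
by apply/seteqP; split => p /=; rewrite consK.
Qed.

HB.instance Definition _ :=
  @Measure_isSigmaFinite.Build _ _ _ leb_cons leb_cons_sigma_finite.

End step.

(* Lebesgue measure on R^n, transporting [lebesgue_measure \x leb n'] along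
   [(a, t) |-> a :: t]. *)
Fixpoint leb n : {sigma_finite_measure set (Rn R n) -> \bar R} :=
  if n is n'.+1 then leb_cons (leb n') else \d_([tuple] : Rn R 0).

End lebesgue_Rn.

(* Functions and kernels are complex-valued; measurability and integrals are
   taken on the real and imaginary parts. *)
Section complex_functions.
Context {R : realType} {d : measure_display} {T : measurableType d}.
Variable mu : {measure set T -> \bar R}.
Implicit Types f : T -> R[i].

Definition cabs (z : R[i]) : R := ComplexField.Normc.normc z.

Definition cmeasurable f :=
  measurable_fun [set: T] (fun x => complex.Re (f x)) /\
  measurable_fun [set: T] (fun x => complex.Im (f x)).

Definition cintegral (D : set T) f : R[i] :=
  Complex (\int[mu]_(x in D) complex.Re (f x))
          (\int[mu]_(x in D) complex.Im (f x)).

Definition Lp_norm (p : R) f : \bar R :=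
  Lnorm mu p%:E (fun x => (cabs (f x))%:E).

Definition in_Lp p f := cmeasurable f /\ (Lp_norm p f < +oo)%E.

Definition avg (D : set T) f : R[i] :=
  ((fine (mu D))^-1)%:C%C * cintegral D f.

End complex_functions.

Section euclidean.
Context {R : realType}.

Definition enorm n (x : Rn R n) : R := Num.sqrt (\sum_(i < n) tnth x i ^+ 2).

Definition edist n (x y : Rn R n) : R :=
  Num.sqrt (\sum_(i < n) (tnth x i - tnth y i) ^+ 2).

Definition enorm2 d1 d2 (x : Rn R d1 * Rn R d2) : R :=
  Num.sqrt (enorm x.1 ^+ 2 + enorm x.2 ^+ 2).

Definition supp n (f : Rn R n -> R[i]) : set (Rn R n) :=
  [set x | forall r : R, 0 < r -> exists2 y, edist x y < r & f y != 0].

(* Bounded, measurable, and vanishing outside a ball of the norm [nrm]. *)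
Definition bounded_cpt_supp d (T : measurableType d) (nrm : T -> R)
    (f : T -> R[i]) :=
  [/\ cmeasurable f,
      exists M : R, forall x, cabs (f x) <= M &
      exists r : R, forall x, f x != 0 -> nrm x <= r].

End euclidean.

Section calderon_zygmund.
Context {R : realType}.
Implicit Types n : nat.

Definition standard_kernel n (K : Rn R n -> Rn R n -> R[i]) :=
  exists C alpha : R, [/\ 0 < alpha <= 1,
    forall x y, x != y -> cabs (K x y) <= C * edist x y ^- n &
    forall x x' y, x != y -> edist x x' <= edist x y / 2 ->
      cabs (K x y - K x' y) + cabs (K y x - K y x') <=
        C * (edist x x' `^ alpha / edist x y `^ (n%:R + alpha))].

(* Operators are maps on representatives; linearity is up to null sets, and
   together with boundedness it makes [T] compatible with a.e. equality. *)
Definition Lp_bounded_operator n (T : (Rn R n -> R[i]) -> (Rn R n -> R[i])) :=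
  forall p : R, 1 < p ->
    (forall (a : R[i]) f g, in_Lp (leb n) p f -> in_Lp (leb n) p g ->
       {ae leb n, forall x, T (fun y => a * f y + g y) x = a * T f x + T g x})
    /\ exists M : R, forall f, in_Lp (leb n) p f ->
         in_Lp (leb n) p (T f) /\
         (Lp_norm (leb n) p (T f) <= M%:E * Lp_norm (leb n) p f)%E.

Definition has_kernel n (T : (Rn R n -> R[i]) -> (Rn R n -> R[i]))
    (K : Rn R n -> Rn R n -> R[i]) :=
  forall f g, bounded_cpt_supp (@enorm R n) f ->
    bounded_cpt_supp (@enorm R n) g -> supp f `&` supp g = set0 ->
    cintegral (leb n) setT (fun x => T f x * g x) =
    cintegral (leb n) setT (fun x =>
      cintegral (leb n) setT (fun y => K x y * f y * g x)).

Definition CZO n (T : (Rn R n -> R[i]) -> (Rn R n -> R[i]))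
    (K : Rn R n -> Rn R n -> R[i]) :=
  [/\ Lp_bounded_operator T, standard_kernel K & has_kernel T K].

Definition symmetrically_nondegenerate n (K : Rn R n -> Rn R n -> R[i]) :=
  exists2 c0 : R, 0 < c0 & forall y (r : R), 0 < r ->
    exists x, [/\ r <= edist x y,
      1 / (c0 * r ^+ n) <= cabs (K x y) & 1 / (c0 * r ^+ n) <= cabs (K y x)].

(* The adjoint for the bilinear pairing [\int f g] (no complex conjugation),
   in accordance with the kernel representation. *)
Definition adjoint_operator n (T Ts : (Rn R n -> R[i]) -> (Rn R n -> R[i])) :=
  Lp_bounded_operator Ts /\
  forall p : R, 1 < p -> forall f g, in_Lp (leb n) p f ->
    in_Lp (leb n) (p / (p - 1)) g ->
    cintegral (leb n) setT (fun x => T f x * g x) =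
    cintegral (leb n) setT (fun x => f x * Ts g x).

End calderon_zygmund.

Section two_parameters.
Context {R : realType} {d1 d2 : nat}.
Notation R12 := (Rn R d1 * Rn R d2)%type.
Implicit Types (f g b : R12 -> R[i]).

Definition leb2 : {measure set R12 -> \bar R} := (leb d1 \x leb d2)%E.

Definition mixed_norm (p1 p2 : R) f : \bar R :=
  Lnorm (leb d1) p1%:E (fun x1 => Lp_norm (leb d2) p2 (fun x2 => f (x1, x2))).

Definition in_mixed (p1 p2 : R) f :=
  cmeasurable f /\ (mixed_norm p1 p2 f < +oo)%E.

Definition in_L2loc b :=
  cmeasurable b /\ forall r : R,
    (\int[leb2]_(x in [set x | (enorm2 x <= r)%R]) (cabs (b x) ^+ 2)%:E < +oo)%E.

(* The action of [T] in one variable.  Applying [T] to each slice only gives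
   each slice up to a null set; the jointly measurable function with these
   slices is unique up to a null set, and is selected by [xget]. *)
Definition act1 (T : (Rn R d1 -> R[i]) -> (Rn R d1 -> R[i])) f : R12 -> R[i] :=
  xget (fun=> 0) [set h | cmeasurable h /\
    {ae leb d2, forall x2, {ae leb d1, forall x1,
       h (x1, x2) = T (fun y1 => f (y1, x2)) x1}}].

Definition act2 (T : (Rn R d2 -> R[i]) -> (Rn R d2 -> R[i])) f : R12 -> R[i] :=
  xget (fun=> 0) [set h | cmeasurable h /\
    {ae leb d1, forall x1, {ae leb d2, forall x2,
       h (x1, x2) = T (fun y2 => f (x1, y2)) x2}}].

(* [<[T1, [b, T2]] f, g>], where [T1s], [T2s] are the adjoints. *)
Definition bicommutator_form T1 T1s T2 T2s b f g : R[i] :=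
  cintegral leb2 setT (fun x => b x *
    (act2 T2 f x * act1 T1s g x - f x * act1 T1s (act2 T2s g) x
     - act1 T1 (act2 T2 f) x * g x + act1 T1 f x * act2 T2s g x)).

Definition compact_operator (p1 p2 q1 q2 : R)
    (U : (R12 -> R[i]) -> (R12 -> R[i])) :=
  [/\ forall (a : R[i]) f g, in_mixed p1 p2 f -> in_mixed p1 p2 g ->
        {ae leb2, forall x, U (fun y => a * f y + g y) x = a * U f x + U g x},
      forall f, in_mixed p1 p2 f -> in_mixed q1 q2 (U f) &
      forall F : nat -> R12 -> R[i], (forall k, in_mixed p1 p2 (F k)) ->
        (exists M : R, forall k, (mixed_norm p1 p2 (F k) <= M%:E)%E) ->
        exists (phi : nat -> nat) (h : R12 -> R[i]),
          [/\ {homo phi : m n / (m < n)%N}, in_mixed q1 q2 h &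
            mixed_norm q1 q2 (fun x => U (F (phi k)) x - h x) @[k --> \oo]
              --> 0%E]].

Definition compact_bicommutator T1 T1s T2 T2s b (p1 p2 q1 q2 : R) :=
  exists2 U, compact_operator p1 p2 q1 q2 U &
    forall f g, bounded_cpt_supp (@enorm2 R d1 d2) f ->
      bounded_cpt_supp (@enorm2 R d1 d2) g ->
      cintegral leb2 setT (fun x => U f x * g x) =
      bicommutator_form T1 T1s T2 T2s b f g.

End two_parameters.

Section vmo.
Context {R : realType}.

Definition cube n (a : Rn R n) (l : R) : set (Rn R n) :=
  [set x | forall i, tnth a i <= tnth x i <= tnth a i + l].

Context {d1 d2 : nat}.
Notation R12 := (Rn R d1 * Rn R d2)%type.

(* The oscillation over [R = cube a1 l1 `*` cube a2 l2]; it is extended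
   real-valued since [b] is only assumed to be locally square integrable. *)
Definition osc (beta1 beta2 v1 v2 : R) (b : R12 -> R[i])
    (a1 : Rn R d1) (l1 : R) (a2 : Rn R d2) (l2 : R) : \bar R :=
  let I1 := cube a1 l1 in
  let I2 := cube a2 l2 in
  let db := fun x : R12 =>
    b x - avg (leb d1) I1 (fun y1 => b (y1, x.2))
        - avg (leb d2) I2 (fun y2 => b (x.1, y2))
        + avg leb2 (I1 `*` I2) b in
  ((l1 `^ (- beta1) * l2 `^ (- beta2) /
    (fine (leb d1 I1) `^ v1^-1 * fine (leb d2 I2) `^ v2^-1))%:E *
   mixed_norm v1 v2 (fun x => if x \in I1 `*` I2 then db x else 0%R))%E.

Definition VMO (beta1 beta2 v1 v2 : R) (b : R12 -> R[i]) :=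
  (ereal_sup [set o : \bar R | exists a1 (l1 : R) a2 (l2 : R),
     [/\ (0 < l1)%R, (0 < l2)%R & o = osc beta1 beta2 v1 v2 b a1 l1 a2 l2]]
   < +oo)%E /\
  forall eps : R, 0 < eps -> exists2 t : R, 0 < t &
    forall a1 (l1 : R) a2 (l2 : R), 0 < l1 -> 0 < l2 ->
      [\/ l1 < t \/ t^-1 < l1, l2 < t \/ t^-1 < l2 |
        t^-1 < inf [set enorm2 x | x in cube a1 l1 `*` cube a2 l2]] ->
      (osc beta1 beta2 v1 v2 b a1 l1 a2 l2 < eps%:E)%E.

End vmo.

(* Main.v *)
(** Let [Y] be a cube at a distance from a cube [X], comparable to their common
    side and chosen by symmetric nondegeneracy, such that the kernel is nearly
    constant on [Y * X].  With [v = 1_X / T^* 1_Y], the map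
    [P f = 1_Y T (v f)] preserves the mean of functions supported in [X] and is
    small on those of mean zero.  For the maps [P_1], [P_2] of the two variables
    and a finite sum [s] of tensor products, the bi-commutator tested on
    [(v_1 (x) v_2) s] and [1_(Y_1 * Y_2)] gives [- <b, (1 - P_1)(1 - P_2) s>].
    With maps [Q_1], [Q_2] from [Y_i] back to [X_i], the expression
    [(1 - Q_1 P_1)(1 - Q_2 P_2) s] is a sum of four terms of this kind, while
    [Q_i P_i] contracts functions of mean zero.  Iterating bounds [<b, s>], for [s]
    of mean zero in each variable, by the norm of [s] and the size of the form on
    rectangles, and mixed-norm duality turns this into a bound on the oscillation
    of [b].

    If the form did not become small on rectangles [W] with degenerating
    parameters, compactness would give normalized test functions whose images
    converge in [L^q1 L^q2] to some [h], although the normalized pairing of a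
    fixed [h] with [1_W] tends to zero along such rectangles.

    Tensor products are used throughout because the operators, given on
    functions of one variable, act on them factor by factor. *)

From Pilot Require Import Defs.
From mathcomp Require Import all_boot all_order all_algebra.
From mathcomp Require Import complex.
From mathcomp Require Import all_classical all_reals all_analysis.
From mathcomp Require Import measurable_realfun ring lra.

Set Implicit Arguments.
Unset Strict Implicit.
Unset Printing Implicit Defensive.
Import Order.TTheory GRing.Theory Num.Theory.
Import numFieldNormedType.Exports.
Import Pilot.Defs.
Local Open Scope classical_set_scope.
Local Open Scope ring_scope.

(** * Complex modulus, measurability and integration *)

(** The weight is chosen so that means are preserved exactly: the integral of [1_Y T(v f)] is that
    of [v f] against the adjoint image of [1_Y], which is the integral of [f]. Approximate
    preservation would not do, since the contraction holds on mean zero only and is applied again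
    after each step. [X] and [Y] have the same side, so averages have norm one in both directions,
    and the factor of each map is its deviation [theta] from an average. With [theta = 1/6] the
    three remainders [Q1 P1], [Q2 P2] and [Q1 P1 Q2 P2] together lose a factor 2.

    The obstacle is that [b] is only locally square integrable: its oscillation in the dual mixed
    norm may be infinite a priori, so it cannot be absorbed into one side of an inequality. Hence a
    second bound, in plain L^2, is carried through the iteration; there the pairing with [b] is
    finite by Cauchy-Schwarz, and its contribution tends to zero.

    The normalization of the oscillation is the inverse of the norm of [1_W] in the dual of
    [L^q1 L^q2], up to the conjugate exponents of [p]; this norm is the scale on which both the
    bound and the decay of the form are measured. *)

Section cabs_theory.
Context {R : realType}.
Implicit Types z w : R[i].

Lemma cabsE z : cabs z = Num.sqrt (complex.Re z ^+ 2 + complex.Im z ^+ 2).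
Proof. by case: z. Qed.

Lemma cabs_ge0 z : 0 <= cabs z.
Proof. by rewrite cabsE sqrtr_ge0. Qed.

Lemma sqr_cabs z : cabs z ^+ 2 = complex.Re z ^+ 2 + complex.Im z ^+ 2.
Proof. by rewrite cabsE sqr_sqrtr// addr_ge0// sqr_ge0. Qed.

Lemma cabs0 : cabs (0 : R[i]) = 0.
Proof. exact: ComplexField.Normc.normc0. Qed.

Lemma cabs1 : cabs (1 : R[i]) = 1.
Proof. exact: ComplexField.Normc.normc1. Qed.

Lemma cabs_eq0 z : cabs z = 0 -> z = 0.
Proof. exact: ComplexField.Normc.eq0_normc. Qed.

Lemma cabs_gt0 z : z != 0 -> 0 < cabs z.
Proof.
by move=> z0; rewrite lt_def cabs_ge0 andbT; apply: contra_neq z0 => /cabs_eq0.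
Qed.

Lemma cabsM z w : cabs (z * w) = cabs z * cabs w.
Proof. exact: ComplexField.Normc.normcM. Qed.

Lemma cabsV z : cabs z^-1 = (cabs z)^-1.
Proof. exact: ComplexField.Normc.normcV. Qed.

Lemma cabsN z : cabs (- z) = cabs z.
Proof. exact: normcN. Qed.

Lemma ler_cabsD z w : cabs (z + w) <= cabs z + cabs w.
Proof. exact: le_normcD. Qed.

Lemma ler_cabsB z w : cabs (z - w) <= cabs z + cabs w.
Proof. by rewrite -(cabsN w) ler_cabsD. Qed.

Lemma cabs_distC z w : cabs (z - w) = cabs (w - z).
Proof. by rewrite -opprB cabsN. Qed.

Lemma cabs_real (r : R) : cabs r%:C%C = `|r|.
Proof. by rewrite cabsE/= expr0n/= addr0 sqrtr_sqr. Qed.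

Lemma ReD z w : complex.Re (z + w) = complex.Re z + complex.Re w.
Proof. by case: z => ? ?; case: w. Qed.

Lemma ImD z w : complex.Im (z + w) = complex.Im z + complex.Im w.
Proof. by case: z => ? ?; case: w. Qed.

Lemma ReN z : complex.Re (- z) = - complex.Re z.
Proof. by case: z. Qed.

Lemma ImN z : complex.Im (- z) = - complex.Im z.
Proof. by case: z. Qed.

Lemma ReM z w :
  complex.Re (z * w) = complex.Re z * complex.Re w - complex.Im z * complex.Im w.
Proof. by case: z => ? ?; case: w. Qed.

Lemma ImM z w :
  complex.Im (z * w) = complex.Re z * complex.Im w + complex.Im z * complex.Re w.
Proof. by case: z => ? ?; case: w => ? ?. Qed.

Lemma ler_Re_cabs z : `|complex.Re z| <= cabs z.
Proof. by rewrite cabsE -sqrtr_sqr ler_wsqrtr// lerDl sqr_ge0. Qed.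

Lemma ler_Im_cabs z : `|complex.Im z| <= cabs z.
Proof. by rewrite cabsE -sqrtr_sqr ler_wsqrtr// lerDr sqr_ge0. Qed.

Definition cconj z : R[i] := Complex (complex.Re z) (- complex.Im z).

Lemma cconjM z : z * cconj z = (cabs z ^+ 2)%:C%C.
Proof.
rewrite sqr_cabs /cconj; case: z => x y /=.
by apply/eqP; rewrite eq_complex /=; apply/andP; split; apply/eqP; ring.
Qed.

Lemma cabs_conj z : cabs (cconj z) = cabs z.
Proof. by rewrite !cabsE /= sqrrN. Qed.

Lemma inv_complexE z : z^-1 = ((cabs z ^+ 2)^-1)%:C%C * cconj z.
Proof.
rewrite sqr_cabs; case: z => x y /=.
have -> : (x +i* y)%C^-1 = ((x / (x ^+ 2 + y ^+ 2)) -i* (y / (x ^+ 2 + y ^+ 2)))%C.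
  by [].
by apply/eqP; rewrite eq_complex /=; apply/andP; split; apply/eqP; ring.
Qed.

End cabs_theory.

Section cmeasurable_theory.
Context {R : realType} {d : measure_display} {T : measurableType d}.
Implicit Types (f g : T -> R[i]) (A : set T).

Lemma cmeasurable_cst (c : R[i]) : cmeasurable (fun _ : T => c).
Proof. by split; exact: measurable_cst. Qed.

Lemma cmeasurableD f g : cmeasurable f -> cmeasurable g ->
  cmeasurable (fun x => f x + g x).
Proof.
move=> [f1 f2] [g1 g2]; split; under eq_fun do rewrite ?ReD ?ImD;
  exact: measurable_funD.
Qed.

Lemma cmeasurableN f : cmeasurable f -> cmeasurable (fun x => - f x).
Proof.
move=> [f1 f2]; split; under eq_fun do rewrite ?ReN ?ImN;
  exact: measurableT_comp.
Qed.

Lemma cmeasurableB f g : cmeasurable f -> cmeasurable g ->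
  cmeasurable (fun x => f x - g x).
Proof. by move=> mf mg; apply: cmeasurableD => //; exact: cmeasurableN. Qed.

Lemma cmeasurableM f g : cmeasurable f -> cmeasurable g ->
  cmeasurable (fun x => f x * g x).
Proof.
move=> [f1 f2] [g1 g2]; split; under eq_fun do rewrite ?ReM ?ImM.
  by apply: measurable_funB; exact: measurable_funM.
by apply: measurable_funD; exact: measurable_funM.
Qed.

Lemma cmeasurable_real (r : T -> R) : measurable_fun [set: T] r ->
  cmeasurable (fun x => (r x)%:C%C).
Proof. by move=> mr; split => //=; exact: measurable_cst. Qed.

Lemma cmeasurable_if (P : T -> bool) f g : measurable_fun [set: T] P ->
  cmeasurable f -> cmeasurable g -> cmeasurable (fun x => if P x then f x else g x).
Proof.
move=> mP [f1 f2] [g1 g2]; split.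
  rewrite (_ : (fun x => _) =
    fun x => if P x then complex.Re (f x) else complex.Re (g x)).
    exact: measurable_fun_ifT.
  by apply/funext => x; case: ifP.
rewrite (_ : (fun x => _) =
  fun x => if P x then complex.Im (f x) else complex.Im (g x)).
  exact: measurable_fun_ifT.
by apply/funext => x; case: ifP.
Qed.

Lemma cmeasurable_sum I (s : seq I) (F : I -> T -> R[i]) :
  (forall i, cmeasurable (F i)) -> cmeasurable (fun x => \sum_(i <- s) F i x).
Proof.
move=> mF; elim: s => [|i s ih].
  by under eq_fun do rewrite big_nil; exact: cmeasurable_cst.
by under eq_fun do rewrite big_cons; exact: cmeasurableD.
Qed.

Lemma measurable_sqrt (D : set R) : measurable_fun D (@Num.sqrt R).
Proof.
rewrite (_ : Num.sqrt = fun x : R => Num.max x 0 `^ 2^-1).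
  (* The real power agrees with the square root on nonnegative arguments only; [Num.sqrt] vanishes
     on negative ones, hence the maximum with 0. *)
  apply: (measurable_funS measurableT) => //.
  apply: (measurableT_comp (measurable_powR _)).
  exact: measurable_maxr.
apply/funext => x; rewrite powR12_sqrt ?le_max ?lexx ?orbT//.
by have [//|x0] := lerP 0 x; rewrite sqrtr0 ler0_sqrtr// ltW.
Qed.

Lemma measurable_cabs f : cmeasurable f ->
  measurable_fun [set: T] (fun x => cabs (f x)).
Proof.
move=> [f1 f2]; under eq_fun do rewrite cabsE.
apply: measurableT_comp; first exact: measurable_sqrt.
by apply: measurable_funD; exact: measurable_funX.
Qed.

Lemma emeasurable_cabs f : cmeasurable f ->
  measurable_fun [set: T] (fun x => (cabs (f x))%:E).
Proof. by move=> mf; apply/measurable_EFinP; exact: measurable_cabs. Qed.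

Lemma cmeasurable_conj f : cmeasurable f -> cmeasurable (fun x => cconj (f x)).
Proof. by move=> [f1 f2]; split => //=; exact: measurable_funN. Qed.

Lemma cmeasurableV f : cmeasurable f -> cmeasurable (fun x => (f x)^-1).
Proof.
move=> mf; under eq_fun do rewrite inv_complexE.
apply: cmeasurableM; last exact: cmeasurable_conj.
apply: cmeasurable_real.
(* Inversion is written as the real power [-1], which is measurable and, like inversion, takes the
   value 0 at 0. *)
rewrite (_ : (fun x => _) = fun x => (cabs (f x) ^+ 2) `^ (-1)).
  apply: (measurableT_comp (measurable_powR _)).
  by apply: measurable_funX; exact: measurable_cabs.
by apply/funext => x; rewrite powR_inv1// sqr_ge0.
Qed.

Lemma cmeasurable_comp d' (T' : measurableType d') (h : T' -> T) f :
  measurable_fun [set: T'] h -> cmeasurable f -> cmeasurable (f \o h).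
Proof. by move=> mh [f1 f2]; split; [exact: (measurableT_comp f1)|exact: (measurableT_comp f2)]. Qed.

Lemma measurable_cabs_le f g : cmeasurable f -> cmeasurable g ->
  measurable [set x | cabs (f x) <= cabs (g x)].
Proof.
move=> mf mg; rewrite -[X in measurable X]setTI.
rewrite (_ : [set x | _] =
  (fun x => cabs (f x) <= cabs (g x)) @^-1` [set true]); last first.
  by apply/seteqP; split => x /=.
by apply: (measurable_fun_ler (measurable_cabs mf) (measurable_cabs mg)).
Qed.

Definition chi A : T -> R[i] := fun x => (\1_A x)%:C%C.

Lemma chiE A x : chi A x = if x \in A then 1 else 0.
Proof. by rewrite /chi indicE; case: (x \in A). Qed.

Lemma cmeasurable_chi A : measurable A -> cmeasurable (chi A).
Proof. by move=> mA; apply: cmeasurable_real; exact: measurable_indic. Qed.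

End cmeasurable_theory.

Section complex_integral.
Context {R : realType} {d : measure_display} {T : measurableType d}.
Variable mu : {measure set T -> \bar R}.
Implicit Types (f g : T -> R[i]) (A : set T).

(** Absolute integrability of the modulus. [cintegral] is total and has conventional values off the
    integrable functions, so the rules of linearity and Fubini below are stated under [cint]. *)
Definition cint f :=
  cmeasurable f /\ (\int[mu]_x (cabs (f x))%:E < +oo)%E.

Lemma cint_integrable f : cint f ->
  mu.-integrable setT (fun x => (cabs (f x))%:E).
Proof.
move=> [mf f1]; apply/integrableP; split; first exact: emeasurable_cabs.
by under eq_integral do rewrite gee0_abs ?lee_fin ?cabs_ge0//.
Qed.

Lemma cint_ReIm f : cint f ->
  mu.-integrable setT (fun x => (complex.Re (f x))%:E) /\
  mu.-integrable setT (fun x => (complex.Im (f x))%:E).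
Proof.
move=> cf; have [[f1 f2] _] := cf.
split; apply: (le_integrable _ _ _ (cint_integrable cf)) => //;
  try (by apply/measurable_EFinP); move=> x _ /=; rewrite lee_fin.
  by rewrite (ger0_norm (cabs_ge0 _)) ler_Re_cabs.
by rewrite (ger0_norm (cabs_ge0 _)) ler_Im_cabs.
Qed.

Lemma cint_dom f g : cmeasurable f -> cint g ->
  {ae mu, forall x, cabs (f x) <= cabs (g x)} -> cint f.
Proof.
move=> mf [mg g1] fg; split => //; apply: le_lt_trans g1.
apply: ae_ge0_le_integral => //.
- by move=> x _; rewrite lee_fin cabs_ge0.
- exact: emeasurable_cabs.
- by move=> x _; rewrite lee_fin cabs_ge0.
- exact: emeasurable_cabs.
- by apply: filterS fg => x h _; rewrite lee_fin.
Qed.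

Lemma cint_le f g : cmeasurable f -> cint g ->
  (forall x, cabs (f x) <= cabs (g x)) -> cint f.
Proof. by move=> mf cg fg; apply: cint_dom cg _ => //; exact: aeW. Qed.

Lemma cintD f g : cint f -> cint g -> cint (fun x => f x + g x).
Proof.
move=> cf cg; have [mf _] := cf; have [mg _] := cg; split.
  exact: cmeasurableD.
have := integrableD measurableT (cint_integrable cf) (cint_integrable cg).
move=> /integrableP[_]; apply: le_lt_trans.
apply: ge0_le_integral => //.
- by move=> x _; rewrite lee_fin cabs_ge0.
- by apply: emeasurable_cabs; exact: cmeasurableD.
- apply: measurableT_comp => //; apply: emeasurable_funD; exact: emeasurable_cabs.
- move=> x _; rewrite -EFinD lee_fin ger0_norm ?ler_cabsD//.
  by rewrite addr_ge0// cabs_ge0.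
Qed.

Lemma cintZ (c : R[i]) f : cint f -> cint (fun x => c * f x).
Proof.
move=> [mf f1]; split; first exact/cmeasurableM/mf/cmeasurable_cst.
under eq_integral do rewrite cabsM EFinM.
rewrite ge0_integralZl_EFin ?cabs_ge0//; last exact: emeasurable_cabs.
- by rewrite lte_mul_pinfty// ?lee_fin ?cabs_ge0.
- by move=> x _; rewrite lee_fin cabs_ge0.
Qed.

Lemma cint0 : cint (fun _ => 0).
Proof.
split; first exact: cmeasurable_cst.
by under eq_integral do rewrite cabs0; rewrite integral0.
Qed.

Lemma cintN f : cint f -> cint (fun x => - f x).
Proof. by move=> /(cintZ (-1)); under eq_fun do rewrite mulN1r. Qed.

Lemma cintB f g : cint f -> cint g -> cint (fun x => f x - g x).
Proof. by move=> cf cg; apply: cintD => //; exact: cintN. Qed.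

Lemma cint_sum I (s : seq I) (F : I -> T -> R[i]) :
  (forall i, cint (F i)) -> cint (fun x => \sum_(i <- s) F i x).
Proof.
move=> iF; elim: s => [|i s ih].
  by under eq_fun do rewrite big_nil; exact: cint0.
by under eq_fun do rewrite big_cons; exact: cintD.
Qed.

Lemma cint_bounded f A (M : R) : measurable A -> (mu A < +oo)%E ->
  cmeasurable f -> (forall x, cabs (f x) <= M) -> (forall x, ~ A x -> f x = 0) ->
  cint f.
Proof.
move=> mA Aoo mf fM f0; split => //.
have fM' x : cabs (f x) <= `|M| * \1_A x.
  rewrite indicE; case: (boolP (x \in A)) => [_|/negP xA].
    by rewrite mulr1; apply: le_trans (fM x) (ler_norm _).
  by rewrite f0 ?cabs0 ?mulr0// => Ax; apply: xA; rewrite inE.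
apply: (@le_lt_trans _ _ (\int[mu]_x (`|M|%:E * (\1_A x)%:E))%E).
  apply: ge0_le_integral => //.
  - by move=> x _; rewrite lee_fin cabs_ge0.
  - exact: emeasurable_cabs.
  - apply: emeasurable_funM => //; apply/measurable_EFinP.
    exact: measurable_indic.
  - by move=> x _; rewrite -EFinM lee_fin.
rewrite ge0_integralZl_EFin//; last first.
  by apply/measurable_EFinP; exact: measurable_indic.
by rewrite integral_indic// setIT lte_mul_pinfty.
Qed.

Local Notation "\cint f" := (cintegral mu setT f) (at level 10).

Lemma cintegralD f g : cint f -> cint g ->
  \cint (fun x => f x + g x) = \cint f + \cint g.
Proof.
move=> /cint_ReIm[f1 f2] /cint_ReIm[g1 g2]; rewrite /cintegral.
apply/eqP; rewrite eq_complex /=; apply/andP; split; apply/eqP.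
  by under eq_Rintegral do rewrite ReD; rewrite RintegralD.
by under eq_Rintegral do rewrite ImD; rewrite RintegralD.
Qed.

Lemma cintegralZ (c : R[i]) f : cint f ->
  \cint (fun x => c * f x) = c * \cint f.
Proof.
move=> /cint_ReIm[f1 f2]; rewrite /cintegral.
have Z (r : R) (g : T -> R) : mu.-integrable setT (fun x => (g x)%:E) ->
    mu.-integrable setT (fun x => (r * g x)%:E).
  by move=> /(integrableZl measurableT r); apply: eq_integrable.
apply/eqP; rewrite eq_complex; apply/andP; split; apply/eqP.
  rewrite ReM /=; under eq_Rintegral do rewrite ReM.
  by rewrite RintegralB//; [rewrite !RintegralZl|exact: Z|exact: Z].
rewrite ImM /=; under eq_Rintegral do rewrite ImM.
by rewrite RintegralD//; [rewrite !RintegralZl|exact: Z|exact: Z].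
Qed.

Lemma cintegral0 : \cint (fun _ => 0) = 0.
Proof. by rewrite /cintegral !Rintegral_cst//= !mul0r. Qed.

Lemma cintegralN f : cint f -> \cint (fun x => - f x) = - \cint f.
Proof.
by move=> cf; under eq_fun do rewrite -mulN1r; rewrite cintegralZ// mulN1r.
Qed.

Lemma cintegralB f g : cint f -> cint g ->
  \cint (fun x => f x - g x) = \cint f - \cint g.
Proof. by move=> cf cg; rewrite cintegralD ?cintegralN//; exact: cintN. Qed.

Lemma cintegral_sum I (s : seq I) (F : I -> T -> R[i]) :
  (forall i, cint (F i)) ->
  \cint (fun x => \sum_(i <- s) F i x) = \sum_(i <- s) \cint (F i).
Proof.
move=> iF; elim: s => [|i s ih].
  by under eq_fun do rewrite big_nil; rewrite big_nil cintegral0.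
under eq_fun do rewrite big_cons.
by rewrite big_cons cintegralD ?ih//; exact: cint_sum.
Qed.

Lemma ae_eq_cintegral f g : cmeasurable f -> cmeasurable g ->
  {ae mu, forall x, f x = g x} -> \cint f = \cint g.
Proof.
move=> [f1 f2] [g1 g2] fg; rewrite /cintegral /Rintegral.
congr Complex; congr fine; apply: ae_eq_integral => //;
  try (by apply/measurable_EFinP); by apply: filterS fg => x -> _.
Qed.

(** Multiplication by the unimodular [w] with [w * z = |z|] turns the modulus of the integral into
    the integral of a real part, which the modulus of [f] dominates. *)
Lemma le_cabs_cintegral f : cint f ->
  ((cabs (\cint f))%:E <= \int[mu]_x (cabs (f x))%:E)%E.
Proof.
move=> cf; set z := \cint f.
have [->|z0] := eqVneq z 0.
  by rewrite cabs0 integral_ge0// => x _; rewrite lee_fin cabs_ge0.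
pose w := cconj z * ((cabs z)^-1)%:C%C.
have w1 : cabs w = 1.
  rewrite cabsM cabs_conj cabs_real ger0_norm ?invr_ge0 ?cabs_ge0//.
  by rewrite divff// gt_eqF// cabs_gt0.
have wz : w * z = (cabs z)%:C%C.
  have := cabs_gt0 z0; rewrite /w mulrAC (mulrC _ z) cconjM -rmorphM expr2.
  by move=> /gt_eqF/negbT z1; rewrite mulfK.
have cwf := cintZ w cf; have [[r1 _] _] := cwf.
have -> : (cabs z)%:E = (\int[mu]_x (complex.Re (w * f x))%:E)%E.
  have /(congr1 (@complex.Re R)) := cintegralZ w cf; rewrite -/z wz/= => <-.
  have [i1 _] := cint_ReIm cwf.
  by rewrite /Rintegral fineK//; apply: integrable_fin_num.
apply: le_integral => //; first by have [] := cint_ReIm cwf.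
  exact: cint_integrable.
move=> x _; rewrite lee_fin; apply: le_trans (ler_norm _) _.
by apply: le_trans (ler_Re_cabs _) _; rewrite cabsM w1 mul1r.
Qed.

End complex_integral.

Section complex_fubini.
Context {R : realType} {d1 d2 : measure_display}
  {T1 : measurableType d1} {T2 : measurableType d2}.
Variables (m1 : {sigma_finite_measure set T1 -> \bar R})
  (m2 : {sigma_finite_measure set T2 -> \bar R}).
Implicit Types f : T1 * T2 -> R[i].

Lemma cmeasurable_slice1 f x : cmeasurable f -> cmeasurable (fun y => f (x, y)).
Proof. by apply: cmeasurable_comp; exact: pair1_measurable. Qed.

Lemma cmeasurable_slice2 f y : cmeasurable f -> cmeasurable (fun x => f (x, y)).
Proof. by apply: cmeasurable_comp; exact: pair2_measurable. Qed.

Lemma cmeasurable_cintegral2 f : cint (m1 \x m2)%E f ->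
  cmeasurable (fun x => cintegral m2 setT (fun y => f (x, y))).
Proof.
move=> /cint_ReIm[r i]; split => /=; apply: measurableT_comp => //.
- exact: (measurable_fubini_F r).
- exact: (measurable_fubini_F i).
Qed.

Lemma cmeasurable_cintegral1 f : cint (m1 \x m2)%E f ->
  cmeasurable (fun y => cintegral m1 setT (fun x => f (x, y))).
Proof.
move=> /cint_ReIm[r i]; split => /=; apply: measurableT_comp => //.
- exact: (measurable_fubini_G r).
- exact: (measurable_fubini_G i).
Qed.

Lemma cfubini1 f : cint (m1 \x m2)%E f ->
  cintegral (m1 \x m2)%E setT f =
  cintegral m1 setT (fun x => cintegral m2 setT (fun y => f (x, y))).
Proof.
move=> cf; have [r i] := cint_ReIm cf.
rewrite /cintegral /Rintegral /=; congr Complex; congr fine.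
  (* The inner integrals of [cintegral] pass through [fine]; almost every slice is integrable, so
     this changes them on a null set only. *)
  rewrite -integral12_prod_meas1//; apply: ae_eq_integral => //.
  - exact: (measurable_fubini_F r).
  - apply/measurable_EFinP/measurableT_comp => //; exact: (measurable_fubini_F r).
  - have := ae_integrable1 r; apply: filterS => x ix _.
    by rewrite fineK//; apply: integrable_fin_num.
rewrite -integral12_prod_meas1//; apply: ae_eq_integral => //.
- exact: (measurable_fubini_F i).
- apply/measurable_EFinP/measurableT_comp => //; exact: (measurable_fubini_F i).
- have := ae_integrable1 i; apply: filterS => x ix _.
  by rewrite fineK//; apply: integrable_fin_num.
Qed.

Lemma cfubini2 f : cint (m1 \x m2)%E f ->
  cintegral (m1 \x m2)%E setT f =
  cintegral m2 setT (fun y => cintegral m1 setT (fun x => f (x, y))).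
Proof.
move=> cf; have [r i] := cint_ReIm cf.
rewrite /cintegral /Rintegral /=; congr Complex; congr fine.
  rewrite -integral21_prod_meas1//; apply: ae_eq_integral => //.
  - exact: (measurable_fubini_G r).
  - apply/measurable_EFinP/measurableT_comp => //; exact: (measurable_fubini_G r).
  - have := ae_integrable2 r; apply: filterS => x ix _.
    by rewrite fineK//; apply: integrable_fin_num.
rewrite -integral21_prod_meas1//; apply: ae_eq_integral => //.
- exact: (measurable_fubini_G i).
- apply/measurable_EFinP/measurableT_comp => //; exact: (measurable_fubini_G i).
- have := ae_integrable2 i; apply: filterS => x ix _.
  by rewrite fineK//; apply: integrable_fin_num.
Qed.

End complex_fubini.

(** * Mixed norms *)

Section real_power.
Context {R : realType}.

(** At a positive limit the power is [exp (r ln u)], a continuous expression. At the limit 0 the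
    logarithm breaks down, and [u < e^(1/r)] is used instead. *)
Lemma cvg_powR (u : nat -> R) (a r : R) : 0 < r -> (forall n, 0 <= u n) ->
  u @ \oo --> a -> (fun n => u n `^ r) @ \oo --> a `^ r.
Proof.
move=> r0 u0 ua.
have rn0 : r != 0 by rewrite gt_eqF.
have a0 : 0 <= a.
  rewrite -(cvg_lim _ ua)//; apply: limr_ge; first by apply/cvg_ex; exists a.
  exact: nearW.
move: a0; rewrite le_eqVlt => /predU1P[a0|a0].
  rewrite -a0 powR0 ?gt_eqF//; apply/cvgrPdist_lt => e e0.
  move: ua; rewrite -a0 => /cvgrPdist_lt/(_ (e `^ r^-1)).
  move=> /(_ (powR_gt0 _ e0)); apply: filterS => n.
  rewrite !sub0r !normrN !ger0_norm ?powR_ge0// => une.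
  rewrite -[ltRHS](@powRr1 _ e) ?ltW// -(mulVf rn0).
  rewrite powRrM; apply: gt0_ltr_powR => //; rewrite ?nnegrE ?powR_ge0//.
have ->: a `^ r = expR (r * ln a) by rewrite /powR gt_eqF.
have C : (fun n => expR (r * ln (u n))) @ \oo --> expR (r * ln a).
  apply: continuous_cvg; first exact: continuous_expR.
  by apply: cvgMr; apply: continuous_cvg ua; exact: continuous_ln.
apply: cvg_trans C; apply: near_eq_cvg.
have : \forall n \near \oo, 0 < u n by exact: (cvgr_gt _ ua).
by apply: filterS => n un; rewrite /powR gt_eqF.
Qed.

Lemma cvg_poweR (u : nat -> \bar R) (a : \bar R) (r : R) : 0 < r ->
  (forall n, (0 <= u n)%E) -> u @ \oo --> a ->
  (fun n => u n `^ r)%E @ \oo --> (a `^ r)%E.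
Proof.
move=> r0 u0; case: a => [a| |].
- move=> /fine_cvgP[ufin ua]; rewrite poweR_EFin; apply/fine_cvgP; split.
    by apply: filterS ufin => n; exact: fin_num_poweR.
  rewrite (_ : fine \o _ = fun n => fine (u n) `^ r); last first.
    by apply/funext => n /=; rewrite fine_poweR.
  by apply: cvg_powR => // n; rewrite fine_ge0.
- move=> /cvgeyPge uy; rewrite poweRyr ?gt_eqF//; apply/cvgeyPge => A.
  apply: filterS (uy (`|A| `^ r^-1)) => n un.
  apply: (@le_trans _ _ (((`|A| `^ r^-1)%:E) `^ r)%E).
    rewrite poweR_EFin lee_fin -powRrM mulVf ?gt_eqF// powRr1//.
    exact: ler_norm.
  apply: gt0_ler_poweR => //; first exact: ltW.
    by rewrite in_itv/= lee_fin powR_ge0 leey.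
  by rewrite in_itv/= u0 leey.
- move=> /cvgeNyPle/(_ (-1)) [N _ /(_ N (leqnn N))/=].
  by move=> /(le_trans (u0 N)); rewrite lee_fin oppr_ge0 leNgt ltr01.
Qed.

Lemma le_poweR (r : R) (x y : \bar R) : 0 <= r -> (0 <= x)%E -> (x <= y)%E ->
  (x `^ r <= y `^ r)%E.
Proof.
move=> r0 x0 xy; apply: gt0_ler_poweR => //; rewrite in_itv/= ?leey ?andbT//.
exact: le_trans xy.
Qed.

Lemma poweRK (r : R) (x : \bar R) : r != 0 -> (0 <= x)%E ->
  ((x `^ r) `^ r^-1 = x)%E.
Proof. by move=> r0 x0; rewrite -poweRrM divff// poweRe1. Qed.

Lemma poweRVK (r : R) (x : \bar R) : r != 0 -> (0 <= x)%E ->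
  ((x `^ r^-1) `^ r = x)%E.
Proof. by move=> r0 x0; rewrite -poweRrM mulVf// poweRe1. Qed.

End real_power.

Section one_measure.
Context {R : realType} {d : measure_display} {T : measurableType d}.
Variable mu : {measure set T -> \bar R}.
Implicit Types (f g : T -> R) (A : set T).

Lemma measurable_powR_fun f r : measurable_fun [set: T] f ->
  measurable_fun [set: T] (fun x => (f x `^ r)%:E).
Proof.
move=> mf; apply/measurable_EFinP.
exact: (measurableT_comp (measurable_powR _)).
Qed.

Lemma ge0_hoelder f g p q : measurable_fun setT f -> measurable_fun setT g ->
  (forall x, 0 <= f x) -> (forall x, 0 <= g x) -> 0 < p -> 0 < q ->
  p^-1 + q^-1 = 1 ->
  (\int[mu]_x (f x * g x)%:E <= (\int[mu]_x (f x `^ p)%:E) `^ p^-1 *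
    (\int[mu]_x (g x `^ q)%:E) `^ q^-1)%E.
Proof.
move=> mf mg f0 g0 p0 q0 pq; have := hoelder mu mf mg p0 q0 pq.
rewrite Lnorm1 unlock/=.
under eq_integral do rewrite ger0_norm ?mulr_ge0//.
have nE (h : T -> R) r : (forall x, 0 <= h x) ->
    (\int[mu]_x (`|h x| `^ r)%:E = \int[mu]_x (h x `^ r)%:E)%E.
  by move=> h0; apply: eq_integral => x _; rewrite ger0_norm.
by rewrite (nE f p f0) (nE g q g0).
Qed.

Lemma integral_powR_lty f A p M : measurable A -> (mu A < +oo)%E -> 0 < p ->
  measurable_fun setT f -> (forall x, 0 <= f x <= M) ->
  (forall x, ~ A x -> f x = 0) -> (\int[mu]_x (f x `^ p)%:E < +oo)%E.
Proof.
move=> mA Aoo p0 mf fM f0.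
apply: (@le_lt_trans _ _ (\int[mu]_x ((`|M| `^ p)%:E * (\1_A x)%:E))%E).
  apply: ge0_le_integral => //.
  - by move=> x _; rewrite lee_fin powR_ge0.
  - exact: measurable_powR_fun.
  - apply: emeasurable_funM => //; apply/measurable_EFinP.
    exact: measurable_indic.
  - move=> x _; rewrite -EFinM lee_fin indicE.
    case: (boolP (x \in A)) => [_|/negP xA]; rewrite ?mulr1 ?mulr0.
      have /andP[? ?] := fM x; rewrite ge0_ler_powR ?nnegrE//; first exact: ltW.
      by rewrite (le_trans _ (ler_norm M)).
    by rewrite f0 ?powR0 ?gt_eqF// => Ax; apply: xA; rewrite inE.
rewrite ge0_integralZl_EFin ?powR_ge0//; last first.
  by apply/measurable_EFinP; exact: measurable_indic.
by rewrite integral_indic// setIT lte_mul_pinfty// lee_fin powR_ge0.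
Qed.

(** Hölder's inequality against the indicator of [A], whose conjugate exponent is
    [q = 1 / (1 - 1/p)]. *)
Lemma integral_le_power f A p : measurable A ->  1 < p ->
  measurable_fun setT f -> (forall x, 0 <= f x) -> (forall x, ~ A x -> f x = 0) ->
  (\int[mu]_x (f x)%:E <=
    mu A `^ (1 - p^-1) * (\int[mu]_x (f x `^ p)%:E) `^ p^-1)%E.
Proof.
move=> mA p1 mf f0 fA; have p0 : 0 < p by rewrite (lt_trans _ p1).
pose q := (1 - p^-1)^-1.
have q0 : 0 < q by rewrite invr_gt0 subr_gt0 invf_lt1.
have mi : measurable_fun setT (\1_A : T -> R) by exact: measurable_indic.
have i0 x : 0 <= (\1_A x : R) by [].
have pq : p^-1 + q^-1 = 1 by rewrite invrK addrC subrK.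
have qE : (\int[mu]_x (\1_A x `^ q)%:E = mu A)%E.
  transitivity (\int[mu]_x (\1_A x)%:E)%E; last first.
    by rewrite integral_indic// setIT.
  apply: eq_integral => x _; congr EFin.
  by rewrite indicE; case: (x \in A); rewrite ?powR1// powR0// gt_eqF.
have := @ge0_hoelder f \1_A p q mf mi f0 i0 p0 q0 pq; rewrite qE invrK.
rewrite muleC; apply: le_trans; rewrite le_eqVlt; apply/orP; left; apply/eqP.
apply: eq_integral => x _; congr EFin; rewrite indicE.
case: (boolP (x \in A)) => [_|/negP xA]; rewrite ?mulr1// mulr0 fA// => Ax.
by apply: xA; rewrite inE.
Qed.

(* Ereal-valued outer functions occur because inner norms may be infinite. *)
Lemma integral_le_poweR (f : T -> \bar R) A p : measurable A -> 1 < p ->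
  measurable_fun setT f -> (forall x, 0 <= f x)%E ->
  (forall x, ~ A x -> f x = 0%E) ->
  (\int[mu]_x (f x) <=
    mu A `^ (1 - p^-1) * (\int[mu]_x (f x `^ p)) `^ p^-1)%E.
Proof.
move=> mA p1 mf f0 fA; have p0 : 0 < p by rewrite (lt_trans _ p1).
have mfp : measurable_fun setT (fun x => f x `^ p)%E.
  exact: (measurableT_comp (measurable_poweR _)).
have fp0 x : (0 <= f x `^ p)%E by exact: poweR_ge0.
(* For a null set [A] the right-hand side is 0 even if the power integral is infinite, so the
   left-hand side is shown to vanish. *)
have [A0|A0] := eqVneq (mu A) 0%E.
  rewrite (_ : \int[mu]_x f x = 0)%E ?mule_ge0 ?poweR_ge0//.
  transitivity (\int[mu]_(x in A) f x)%E.
    rewrite [RHS]integral_mkcond; apply: eq_integral => x _; rewrite patchE.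
    by case: (boolP (x \in A)) => // /negP xA; rewrite fA// => Ax; apply: xA; rewrite inE.
  by apply: null_set_integral => //; exact: measurable_funS mf.
have Ap : (0 < mu A `^ (1 - p^-1))%E.
  by apply: poweR_gt0; rewrite lt0e A0 measure_ge0.
have [fy|fny] := eqVneq (\int[mu]_x (f x `^ p))%E +oo%E.
  by rewrite fy poweRyr ?invr_eq0 ?gt_eqF// gt0_muley// leey.
have ip : mu.-integrable setT (fun x => f x `^ p)%E.
  apply/integrableP; split => //; under eq_integral do rewrite gee0_abs//.
  by rewrite ltey.
have ffin : {ae mu, forall x, f x = (fine (f x))%:E}.
  have := integrable_ae measurableT ip; apply: filterS => x /(_ I).
  rewrite ge0_fin_numE// => /lty_poweRy; rewrite gt_eqF// => /(_ isT) fx.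
  by rewrite fineK// ge0_fin_numE.
rewrite (ae_eq_integral (fun x => (fine (f x))%:E))//; last 2 first.
  by apply/measurable_EFinP/measurableT_comp.
  by apply: filterS ffin => x ? _.
rewrite (ae_eq_integral (fun x => (fine (f x) `^ p)%:E)
  (fun x => f x `^ p)%E)//; last 2 first.
- by apply: measurable_powR_fun; exact: measurableT_comp.
- by apply: filterS ffin => x /= fx _; rewrite [in LHS]fx poweR_EFin.
apply: integral_le_power => //; first exact: measurableT_comp.
- by move=> x; rewrite fine_ge0.
- by move=> x /fA ->.
Qed.

End one_measure.

Section null_sets.
Context {R : realType}.

Lemma ae_notP {d : measure_display} {T : measurableType d}
    (mu : {measure set T -> \bar R}) (A : set T) : measurable A ->
  {ae mu, forall x, ~ A x} <-> mu A = 0%E.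
Proof.
move=> mA; split=> [[N [mN N0 AN]]|A0].
  by apply: (subset_measure0 mA mN _ N0) => x Ax; apply: AN => /=; apply.
by exists A; split => // x /= /contrapT.
Qed.

Context {d1 d2 : measure_display}
  {T1 : measurableType d1} {T2 : measurableType d2}.
Variables (m1 : {sigma_finite_measure set T1 -> \bar R})
  (m2 : {sigma_finite_measure set T2 -> \bar R}).
Implicit Types A : set (T1 * T2).

(** The measure of [A] is the integral of the measures of its sections, and a nonnegative integral
    vanishes exactly when its integrand does almost everywhere. *)
Lemma ae_prod1P A : measurable A ->
  {ae (m1 \x m2)%E, forall z, ~ A z} <->
  {ae m1, forall x, {ae m2, forall y, ~ A (x, y)}}.
Proof.
move=> mA; rewrite (ae_notP _ mA).
have mf : measurable_fun setT (fun x => (m2 \o xsection A) x).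
  exact: measurable_fun_xsection.
have AE : (m1 \x m2)%E A = (\int[m1]_x `|(m2 \o xsection A) x|)%E.
  by apply: eq_integral => x _; rewrite gee0_abs.
have sE x : {ae m2, forall y, ~ A (x, y)} <-> m2 (xsection A x) = 0%E.
  rewrite -(ae_notP _ (measurable_xsection _ mA)).
  by split; apply: filterS => y; rewrite xsectionE.
rewrite [X in X = 0%E <-> _]AE (ae_eq_integral_abs m1 measurableT mf); split; apply: filterS => x.
  by move=> /(_ I) ?; apply/sE.
by move=> /sE ? _.
Qed.

Lemma ae_prod2P A : measurable A ->
  {ae (m1 \x m2)%E, forall z, ~ A z} <->
  {ae m2, forall y, {ae m1, forall x, ~ A (x, y)}}.
Proof.
move=> mA; rewrite (ae_notP _ mA).
have mf : measurable_fun setT (fun x => (m1 \o ysection A) x).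
  exact: measurable_fun_ysection.
have AE : (m1 \x m2)%E A = (\int[m2]_x `|(m1 \o ysection A) x|)%E.
  (* The product measure is defined by integrating sections over the first factor; for the other
     order Tonelli's theorem intervenes. *)
  transitivity (\int[(m1 \x m2)%E]_z (\1_A z)%:E)%E.
    by rewrite integral_indic// setIT.
  rewrite fubini_tonelli2//; last first.
    by apply/measurable_EFinP; exact: measurable_indic.
  apply: eq_integral => y _; rewrite gee0_abs//= /fubini_G.
  rewrite -[in RHS](setIT (ysection _ _)) -integral_indic//; last first.
    exact: measurable_ysection.
  apply: eq_integral => x _; rewrite !indicE; congr ((_ _)%:E).
  by rewrite mem_ysection.
have sE y : {ae m1, forall x, ~ A (x, y)} <-> m1 (ysection A y) = 0%E.
  rewrite -(ae_notP _ (measurable_ysection _ mA)).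
  by split; apply: filterS => x; rewrite ysectionE.
rewrite [X in X = 0%E <-> _]AE (ae_eq_integral_abs m2 measurableT mf); split; apply: filterS => x.
  by move=> /(_ I) ?; apply/sE.
by move=> /sE ? _.
Qed.

(** The two almost-everywhere quantifiers are exchanged through the product measure, which
    presupposes a jointly measurable exceptional set. *)
Lemma ae_prod_swap A : measurable A ->
  {ae m2, forall y, {ae m1, forall x, ~ A (x, y)}} ->
  {ae m1, forall x, {ae m2, forall y, ~ A (x, y)}}.
Proof. by move=> mA /(ae_prod2P mA)/(ae_prod1P mA). Qed.

End null_sets.

Section mixed_integrals.
Context {R : realType} {d1 d2 : measure_display}
  {T1 : measurableType d1} {T2 : measurableType d2}.
Variables (m1 : {sigma_finite_measure set T1 -> \bar R})
  (m2 : {sigma_finite_measure set T2 -> \bar R}).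
Implicit Types (F G : T1 * T2 -> R) (p : R) (f : T1 * T2 -> R[i]).

Definition inr p F x := (\int[m2]_y (F (x, y) `^ p)%:E)%E.

(** The [p1]-th power of the mixed norm. The exponent [p1 / p2] merges the root of the inner norm
    with the outer power, so that estimates are made on integrals and roots are taken only at the
    end. *)
Definition mixI p1 p2 F := (\int[m1]_x (inr p2 F x `^ (p1 / p2)))%E.

Definition mixnorm p1 p2 f :=
  Lnorm m1 p1%:E (fun x => Lp_norm m2 p2 (fun y => f (x, y))).

Lemma mixnormE p1 p2 f : 0 < p1 -> 0 < p2 ->
  mixnorm p1 p2 f = (mixI p1 p2 (fun z => cabs (f z)) `^ p1^-1)%E.
Proof.
move=> p10 p20; rewrite /mixnorm /mixI /inr unlock /=; congr poweR.
apply: eq_integral => x _; rewrite /Lp_norm unlock/=.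
have -> : (\int[m2]_y (`|cabs (f (x, y))| `^ p2)%:E =
    \int[m2]_y (cabs (f (x, y)) `^ p2)%:E)%E.
  by apply: eq_integral => y _; rewrite ger0_norm ?cabs_ge0.
rewrite gee0_abs; last exact: poweR_ge0.
by rewrite -poweRrM (mulrC p2^-1).
Qed.

Lemma inr_ge0 p F x : (0 <= inr p F x)%E.
Proof. by apply: integral_ge0 => y _; rewrite lee_fin powR_ge0. Qed.

Lemma mixI_ge0 p1 p2 F : (0 <= mixI p1 p2 F)%E.
Proof. by apply: integral_ge0 => y _; exact: poweR_ge0. Qed.

Lemma mixnorm_le p1 p2 f (r : R) : 0 < p1 -> 0 < p2 -> 0 <= r ->
  (mixnorm p1 p2 f <= r%:E)%E <->
  (mixI p1 p2 (fun z => cabs (f z)) <= (r `^ p1)%:E)%E.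
Proof.
move=> p10 p20 r0; rewrite mixnormE//; set J := mixI _ _ _.
have J0 : (0 <= J)%E by exact: mixI_ge0.
split => [|] h.
  rewrite -[leLHS](@poweRVK _ p1)// ?gt_eqF//.
  rewrite -poweR_EFin; apply: le_poweR => //; first exact: ltW.
  exact: poweR_ge0.
rewrite -[leRHS](@poweRK _ p1)// ?gt_eqF// poweR_EFin.
by apply: le_poweR => //; rewrite invr_ge0 ltW.
Qed.

Lemma measurable_inr p F : measurable_fun setT F -> measurable_fun setT (inr p F).
Proof.
move=> mF.
apply: (@measurable_fun_fubini_tonelli_F _ _ _ _ _ m2 (fun z => (F z `^ p)%:E)).
  exact: measurable_powR_fun.
by move=> z; rewrite lee_fin powR_ge0.
Qed.

Lemma measurable_inr_pow p r F : measurable_fun setT F ->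
  measurable_fun setT (fun x => inr p F x `^ r)%E.
Proof.
move=> mF; apply: (measurableT_comp (measurable_poweR _)).
exact: measurable_inr.
Qed.

Lemma inr_mono p F G x : measurable_fun setT F -> measurable_fun setT G ->
  (forall z, 0 <= F z) -> (forall z, 0 <= G z) -> 0 < p ->
  {ae m2, forall y, F (x, y) <= G (x, y)} -> (inr p F x <= inr p G x)%E.
Proof.
move=> mF mG F0 G0 p0 FG; apply: ae_ge0_le_integral => //.
- by move=> y _; rewrite lee_fin powR_ge0.
- by apply: measurable_powR_fun; exact: (measurableT_comp mF (pair1_measurable x)).
- by move=> y _; rewrite lee_fin powR_ge0.
- by apply: measurable_powR_fun; exact: (measurableT_comp mG (pair1_measurable x)).
- apply: filterS FG => y FG _.
  by rewrite lee_fin ge0_ler_powR ?nnegrE//; exact: ltW.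
Qed.

Lemma mixI_mono p1 p2 F G : measurable_fun setT F -> measurable_fun setT G ->
  (forall z, 0 <= F z) -> (forall z, 0 <= G z) -> 0 < p1 -> 0 < p2 ->
  {ae m1, forall x, {ae m2, forall y, F (x, y) <= G (x, y)}} ->
  (mixI p1 p2 F <= mixI p1 p2 G)%E.
Proof.
move=> mF mG F0 G0 p10 p20 FG; apply: ae_ge0_le_integral => //.
- by move=> x _; exact: poweR_ge0.
- exact: measurable_inr_pow.
- by move=> x _; exact: poweR_ge0.
- exact: measurable_inr_pow.
- apply: filterS FG => x FG _; apply: le_poweR.
  + by rewrite divr_ge0// ltW.
  + exact: inr_ge0.
  + exact: inr_mono.
Qed.

Lemma inrZ p (c : R) F x : measurable_fun setT F -> (forall z, 0 <= F z) ->
  0 <= c -> (inr p (fun z => (c * F z)%R) x = (c `^ p)%:E * inr p F x)%E.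
Proof.
move=> mF F0 c0; rewrite /inr -ge0_integralZl_EFin ?powR_ge0//; last first.
- by apply: measurable_powR_fun; exact: (measurableT_comp mF (pair1_measurable x)).
- by move=> y _; rewrite lee_fin powR_ge0.
by apply: eq_integral => y _; rewrite powRM// EFinM.
Qed.

Lemma mixIZ p1 p2 (c : R) F : measurable_fun setT F -> (forall z, 0 <= F z) ->
  0 <= c -> 0 < p1 -> 0 < p2 ->
  (mixI p1 p2 (fun z => (c * F z)%R) = (c `^ p1)%:E * mixI p1 p2 F)%E.
Proof.
move=> mF F0 c0 p10 p20; rewrite /mixI -ge0_integralZl_EFin ?powR_ge0//; last first.
- exact: measurable_inr_pow.
- by move=> x _; exact: poweR_ge0.
apply: eq_integral => x _; rewrite inrZ// poweRM ?lee_fin ?powR_ge0 ?inr_ge0//.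
by rewrite poweR_EFin -powRrM mulrCA divff ?mulr1// gt_eqF.
Qed.

Lemma bounded_support_inr_lty (X1 : set T1) (X2 : set T2) F p M x :
  measurable X2 -> (m2 X2 < +oo)%E -> measurable_fun setT F ->
  (forall z, 0 <= F z <= M) -> (forall z, ~ (X1 `*` X2) z -> F z = 0) ->
  0 < p -> (inr p F x < +oo)%E.
Proof.
move=> mX2 X2y mF FM F0 p0.
apply: (integral_powR_lty mX2 X2y p0 (M := M)).
- exact: (measurableT_comp mF (pair1_measurable x)).
- by move=> y; exact: FM.
- by move=> y X2y'; apply: F0 => -[].
Qed.

(* Minkowski's integral inequality, from the Hölder inequality applied to
   [\int H `^ p = \int_x \int_y F (x, y) * H y `^ (p - 1)]. *)
Lemma minkowski_integral (X1 : set T1) (X2 : set T2) F p M (H : T2 -> R) :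
  measurable X1 -> measurable X2 -> (m1 X1 < +oo)%E -> (m2 X2 < +oo)%E ->
  measurable_fun setT F -> (forall z, 0 <= F z <= M) ->
  (forall z, ~ (X1 `*` X2) z -> F z = 0) -> 1 < p ->
  (forall y, (H y)%:E = \int[m1]_x (F (x, y))%:E)%E ->
  ((\int[m2]_y (H y `^ p)%:E) `^ p^-1 <= \int[m1]_x (inr p F x `^ p^-1))%E.
Proof.
move=> mX1 mX2 X1y X2y mF FM F0 p1 HE.
have p0 : 0 < p by rewrite (lt_trans _ p1).
have Fge z : 0 <= F z by have /andP[] := FM z.
have FEge z : (0 <= (F z)%:E)%E by rewrite lee_fin.
have mFE : measurable_fun setT (fun z => (F z)%:E) by apply/measurable_EFinP.
have H0 y : 0 <= H y.
  by rewrite -lee_fin HE integral_ge0// => x _; rewrite lee_fin.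
have mH : measurable_fun setT H.
  apply/measurable_EFinP; rewrite (_ : EFin \o H = fubini_G m1 (fun z => (F z)%:E)).
    exact: measurable_fun_fubini_tonelli_G.
  by apply/funext => y /=; rewrite HE.
set K := (\int[m2]_y (H y `^ p)%:E)%E.
have K0 : (0 <= K)%E by apply: integral_ge0 => y _; rewrite lee_fin powR_ge0.
(* Finiteness of [K] permits the final division by [K^(1/q)]; it comes from the boundedness of [F]
   on a set of finite measure. *)
have Kfin : (K < +oo)%E.
  apply: (@integral_powR_lty _ _ _ _ _ X2 _ (`|M| * fine (m1 X1))) => //.
    move=> y; rewrite H0/= -lee_fin HE EFinM fineK ?ge0_fin_numE//.
    apply: (@le_trans _ _ (\int[m1]_x (`|M|%:E * (\1_X1 x)%:E))%E).
      apply: ge0_le_integral => //.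
      - exact: (measurableT_comp mFE (pair2_measurable y)).
      - apply: emeasurable_funM => //; apply/measurable_EFinP.
        exact: measurable_indic.
      - move=> x _; rewrite -EFinM lee_fin indicE.
        case: (boolP (x \in X1)) => [_|/negP xA]; rewrite ?mulr1 ?mulr0.
          by have /andP[_ /le_trans] := FM (x, y); apply; exact: ler_norm.
        by rewrite F0// => -[/= Xx _]; apply: xA; rewrite inE.
    rewrite ge0_integralZl_EFin//; last first.
      by apply/measurable_EFinP; exact: measurable_indic.
    by rewrite integral_indic// setIT.
  move=> y X2y'; apply/eqP; rewrite -eqe HE; apply/eqP.
  by apply: integral0_eq => x _; rewrite F0// => -[].
have [K00|K00] := eqVneq K 0%E.
  rewrite K00 poweR0r ?invr_eq0 ?gt_eqF//.
  by apply: integral_ge0 => x _; exact: poweR_ge0.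
pose q := (1 - p^-1)^-1.
have q0 : 0 < q by rewrite invr_gt0 subr_gt0 invf_lt1.
have pq : p^-1 + q^-1 = 1 by rewrite invrK addrC subrK.
have pN0 : p != 0 by rewrite gt_eqF.
have p1N0 : p - 1 != 0 by rewrite gt_eqF// subr_gt0.
have pqE : (p - 1) * q = p.
  by rewrite /q; field; rewrite pN0 p1N0.
pose Phi z := F z * H z.2 `^ (p - 1).
have mPhi : measurable_fun setT (fun z => (Phi z)%:E).
  apply/measurable_EFinP; apply: measurable_funM => //.
  apply: (measurableT_comp (measurable_powR _)).
  exact: (measurableT_comp mH measurable_snd).
have Phi0 z : (0 <= (Phi z)%:E)%E by rewrite lee_fin mulr_ge0// powR_ge0.
have KE : K = (\int[m1]_x \int[m2]_y (Phi (x, y))%:E)%E.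
  transitivity (\int[m2]_y \int[m1]_x (Phi (x, y))%:E)%E; last first.
    exact: (esym (fubini_tonelli _ mPhi Phi0)).
  apply: eq_integral => y _.
  rewrite (_ : H y `^ p = H y `^ (p - 1) * H y)%R; last first.
    rewrite -[in X in _ * X](powRr1 (H0 y)) -powRD ?subrK//.
    by apply/implyP => /eqP p00; rewrite p00 eqxx in pN0.
  rewrite EFinM HE -ge0_integralZl_EFin ?powR_ge0//; last first.
    exact: (measurableT_comp mFE (pair2_measurable y)).
  by apply: eq_integral => x _; rewrite -EFinM mulrC.
have Kle : (K <= (\int[m1]_x (inr p F x `^ p^-1)) * K `^ q^-1)%E.
  rewrite {1}KE muleC -(@fineK _ (K `^ q^-1)); last first.
    by rewrite fin_num_poweR// ge0_fin_numE.
  rewrite -ge0_integralZl_EFin; last 4 first.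
  - by [].
  - by move=> x _; exact: poweR_ge0.
  - exact: measurable_inr_pow.
  - by rewrite fine_ge0// poweR_ge0.
  rewrite fineK; last by rewrite fin_num_poweR// ge0_fin_numE.
  apply: ge0_le_integral => //.
  - by move=> x _; apply: integral_ge0.
  - exact: (measurable_fun_fubini_tonelli_F _ mPhi Phi0).
  - apply: emeasurable_funM => //; exact: measurable_inr_pow.
  - move=> x _; rewrite muleC.
    apply: le_trans (ge0_hoelder m2 (f := fun y => F (x, y))
      (g := fun y => H y `^ (p - 1)) _ _ _ _ p0 q0 pq) _.
    + exact: (measurableT_comp mF (pair1_measurable x)).
    + exact: (measurableT_comp (measurable_powR _)).
    + by [].
    + by move=> y; exact: powR_ge0.
    have -> : (\int[m2]_y ((H y `^ (p - 1)) `^ q)%:E = K)%E; last exact: lexx.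
    by apply: eq_integral => y _; rewrite -powRrM pqE.
have Kq : (0 < K `^ q^-1)%E by rewrite poweR_gt0// lt0e K00.
rewrite -(@lee_pmul2r _ (K `^ q^-1))//; last first.
  by rewrite fin_num_poweR// ge0_fin_numE.
apply: le_trans Kle; rewrite -poweRD ?pq ?poweRe1//.
by apply: add_neq0_poweRD_def; rewrite pq.
Qed.

End mixed_integrals.

Section mixed_integrals_estimates.
Context {R : realType} {d1 d2 : measure_display}
  {T1 : measurableType d1} {T2 : measurableType d2}.
Variables (m1 : {sigma_finite_measure set T1 -> \bar R})
  (m2 : {sigma_finite_measure set T2 -> \bar R}).
Implicit Types (F G : T1 * T2 -> R) (p : R).

Local Notation inr := (inr m2).
Local Notation mixI := (mixI m1 m2).

Lemma integral_cst_indic {d : measure_display} {T : measurableType d}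
    (mu : {measure set T -> \bar R}) (A : set T) (c : R) : measurable A ->
  0 <= c -> (\int[mu]_x (c%:E * (\1_A x)%:E) = c%:E * mu A)%E.
Proof.
move=> mA c0; rewrite ge0_integralZl_EFin//; last first.
  by apply/measurable_EFinP; exact: measurable_indic.
by rewrite integral_indic// setIT.
Qed.

Lemma emeasurable_indic {d : measure_display} {T : measurableType d} (A : set T) :
  measurable A -> measurable_fun setT (fun x => (\1_A x : R)%:E).
Proof. by move=> mA; apply/measurable_EFinP; exact: measurable_indic. Qed.

Lemma inr_off (X1 : set T1) (X2 : set T2) F p x : 0 < p ->
  (forall z, ~ (X1 `*` X2) z -> F z = 0) -> ~ X1 x -> inr p F x = 0%E.
Proof.
move=> p0 F0 Xx; apply: integral0_eq => y _.
by rewrite F0 ?powR0 ?gt_eqF// => -[].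
Qed.

(** Averaging in the outer variable crosses the inner norm, hence Minkowski: the inner norm of [H]
    is at most the integral over [X1] of the inner norms of [F], and Hölder on [X1] bounds this by
    [V^(1-1/p1) r]. The outer integral over [Y1] contributes [V^(1/p1)]; the equal measures of [X1]
    and [Y1] make the product exactly [V r]. *)
Lemma mixI_avg1 (X1 Y1 : set T1) (X2 Y2 : set T2) F G H p1 p2 (M V c r : R) :
  measurable X1 -> measurable Y1 -> measurable X2 ->
  (m1 X1 = V%:E)%E -> (m1 Y1 = V%:E)%E -> (m2 X2 < +oo)%E ->
  measurable_fun setT F -> (forall z, 0 <= F z <= M) ->
  (forall z, ~ (X1 `*` X2) z -> F z = 0) ->
  measurable_fun setT G -> (forall z, 0 <= G z) ->
  (forall z, ~ (Y1 `*` Y2) z -> G z = 0) -> 1 < p1 -> 1 < p2 ->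
  (forall y, (H y)%:E = \int[m1]_x (F (x, y))%:E)%E -> 0 <= c -> 0 <= r ->
  {ae m1, forall x, {ae m2, forall y, G (x, y) <= c * H y}} ->
  (mixI p1 p2 F <= (r `^ p1)%:E)%E ->
  (mixI p1 p2 G <= ((c * V * r) `^ p1)%:E)%E.
Proof.
move=> mX1 mY1 mX2 X1V Y1V X2y mF FM F0 mG Gge G0 p11 p21 HE c0 r0 GH Fr.
have p10 : 0 < p1 by rewrite (lt_trans _ p11).
have p20 : 0 < p2 by rewrite (lt_trans _ p21).
have Fge z : 0 <= F z by have /andP[] := FM z.
have FEge z : (0 <= (F z)%:E)%E by rewrite lee_fin.
have mFE : measurable_fun setT (fun z => (F z)%:E) by apply/measurable_EFinP.
have Hge y : 0 <= H y.
  by rewrite -lee_fin HE integral_ge0// => x _; rewrite lee_fin.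
have mH : measurable_fun setT H.
  apply/measurable_EFinP; rewrite (_ : EFin \o H = fubini_G m1 (fun z => (F z)%:E)).
    exact: measurable_fun_fubini_tonelli_G.
  by apply/funext => y /=; rewrite HE.
have V0 : 0 <= V by rewrite -lee_fin -X1V.
pose K := (\int[m2]_y (H y `^ p2)%:E)%E.
have K0 : (0 <= K)%E by apply: integral_ge0 => y _; rewrite lee_fin powR_ge0.
have KV : (K `^ p2^-1 <= (V `^ (1 - p1^-1) * r)%:E)%E.
  have X1y : (m1 X1 < +oo)%E by rewrite X1V ltry.
  apply: le_trans (minkowski_integral mX1 mX2 X1y X2y mF FM F0 p21 HE) _.
  apply: le_trans (integral_le_poweR m1 mX1 p11 _ _ _) _.
  - exact: measurable_inr_pow.
  - by move=> x; exact: poweR_ge0.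
  - move=> x Xx; rewrite (inr_off p20 F0 Xx) poweR0r// invr_eq0.
    by rewrite gt_eqF.
  rewrite [X in (X `^ _ * _)%E]X1V poweR_EFin EFinM; apply: lee_pmul => //.
  - by rewrite lee_fin powR_ge0.
  - exact: poweR_ge0.
  under eq_integral do rewrite -poweRrM mulrC.
  rewrite -/(mixI p1 p2 F); apply: le_trans (le_poweR _ _ Fr) _ => //.
  - by rewrite invr_ge0 ltW.
  - exact: mixI_ge0.
  by rewrite poweR_EFin -powRrM divff ?gt_eqF// powRr1.
pose g x := ((c `^ p2)%:E * K * (\1_Y1 x)%:E)%E.
have Gg : {ae m1, forall x, inr p2 G x <= g x}%E.
  apply: filterS GH => x GH; rewrite /g indicE.
  case: (boolP (x \in Y1)) => [_|/negP xA]; last first.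
    by rewrite (inr_off p20 G0) ?mule0// => Yx; apply: xA; rewrite inE.
  rewrite mule1 /K -ge0_integralZl_EFin ?powR_ge0//; last 2 first.
  - by move=> y _; rewrite lee_fin powR_ge0.
  - exact: measurable_powR_fun.
  apply: ae_ge0_le_integral => //.
  - by move=> y _; rewrite lee_fin powR_ge0.
  - by apply: measurable_powR_fun; exact: (measurableT_comp mG (pair1_measurable x)).
  - by move=> y _; rewrite mule_ge0// lee_fin powR_ge0.
  - by apply: emeasurable_funM => //; exact: measurable_powR_fun.
  - apply: filterS GH => y GH _; rewrite -EFinM lee_fin -powRM//.
    by rewrite ge0_ler_powR ?nnegrE ?mulr_ge0//; exact: ltW.
have g0 x : (0 <= g x)%E by rewrite /g !mule_ge0// lee_fin powR_ge0.
have mg : measurable_fun setT g.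
  by apply: emeasurable_funM => //; exact: emeasurable_indic.
have p120 : 0 <= p1 / p2 by rewrite divr_ge0// ltW.
apply: (@le_trans _ _ (\int[m1]_x (((c * (V `^ (1 - p1^-1) * r)) `^ p1)%:E *
    (\1_Y1 x)%:E))%E).
  apply: ae_ge0_le_integral => //.
  - by move=> x _; exact: poweR_ge0.
  - exact: measurable_inr_pow.
  - by move=> x _; rewrite mule_ge0// lee_fin powR_ge0.
  - by apply: emeasurable_funM => //; exact: emeasurable_indic.
  apply: filterS Gg => x Gg _.
  apply: le_trans (le_poweR p120 (inr_ge0 _ _ _ _) Gg) _.
  rewrite /g indicE; case: (x \in Y1); last first.
    by rewrite !mule0 poweR0r// mulf_neq0 ?invr_eq0 ?gt_eqF.
  rewrite !mule1 (_ : p1 / p2 = p2^-1 * p1); last exact: mulrC.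
  rewrite poweRrM -(poweR_EFin (c * _)); apply: le_poweR; first exact: ltW.
    exact: poweR_ge0.
  rewrite poweRM ?lee_fin ?powR_ge0// poweR_EFin -powRrM divff ?gt_eqF//.
  by rewrite powRr1// [leRHS]EFinM lee_pmul// ?lee_fin// poweR_ge0.
rewrite integral_cst_indic ?powR_ge0// [X in (_ * X <= _)%E]Y1V -EFinM lee_fin.
rewrite !powRM// ?powR_ge0 ?mulr_ge0 ?powR_ge0// -powRrM mulrBl mul1r.
rewrite mulVf ?gt_eqF// -!mulrA ler_wpM2l ?powR_ge0//.
have -> : V `^ p1 = V `^ (p1 - 1) * V.
  rewrite -[in X in _ * X](powRr1 V0) -powRD ?subrK//.
  by rewrite gt_eqF.
by rewrite (mulrC _ V) mulrA.
Qed.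

(** In the inner variable Hölder on each slice suffices: it gives [L^p2 <= V^(p2-1)] times the inner
    integral of [F], and the integral of a constant over [Y2] supplies the missing factor [V]. *)
Lemma mixI_avg2 (X1 Y1 : set T1) (X2 Y2 : set T2) F G L p1 p2 (V c : R) :
  measurable X2 -> measurable Y2 -> (m2 X2 = V%:E)%E -> (m2 Y2 = V%:E)%E ->
  measurable_fun setT F -> (forall z, 0 <= F z) ->
  (forall z, ~ (X1 `*` X2) z -> F z = 0) ->
  measurable_fun setT G -> (forall z, 0 <= G z) ->
  (forall z, ~ (Y1 `*` Y2) z -> G z = 0) -> 1 < p1 -> 1 < p2 ->
  (forall x, (L x)%:E = \int[m2]_y (F (x, y))%:E)%E -> 0 <= c ->
  {ae m1, forall x, {ae m2, forall y, G (x, y) <= c * L x}} ->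
  (mixI p1 p2 G <= ((c * V) `^ p1)%:E * mixI p1 p2 F)%E.
Proof.
move=> mX2 mY2 X2V Y2V mF Fge F0 mG Gge G0 p11 p21 LE c0 GL.
have p10 : 0 < p1 by rewrite (lt_trans _ p11).
have p20 : 0 < p2 by rewrite (lt_trans _ p21).
have V0 : 0 <= V by rewrite -lee_fin -X2V.
have L0 x : 0 <= L x.
  by rewrite -lee_fin LE integral_ge0// => y _; rewrite lee_fin.
have cV0 : 0 <= c * V by rewrite mulr_ge0.
have main : {ae m1, forall x, inr p2 G x <= ((c * V) `^ p2)%:E * inr p2 F x}%E.
  apply: filterS GL => x GL.
  have Lx : ((L x `^ p2)%:E <= (V `^ (p2 - 1))%:E * inr p2 F x)%E.
    have FX y : ~ X2 y -> F (x, y) = 0 by move=> Xy; apply: F0 => -[].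
    have := integral_le_power m2 mX2 p21
      (measurableT_comp mF (pair1_measurable x)) (fun y => Fge (x, y)) FX.
    rewrite -LE [X in (_ <= X `^ _ * _)%E -> _]X2V => h; rewrite -poweR_EFin.
    have LE0 : (0 <= (L x)%:E)%E by rewrite lee_fin.
    apply: le_trans (le_poweR (ltW p20) LE0 h) _.
    rewrite poweRM ?poweR_ge0// poweRVK ?gt_eqF//; last exact: inr_ge0.
    by rewrite poweR_EFin poweR_EFin -powRrM mulrBl mul1r mulVf ?gt_eqF.
  apply: (@le_trans _ _ (\int[m2]_y (((c * L x) `^ p2)%:E * (\1_Y2 y)%:E))%E).
    apply: ae_ge0_le_integral => //.
    - by move=> y _; rewrite lee_fin powR_ge0.
    - apply: measurable_powR_fun.
      exact: (measurableT_comp mG (pair1_measurable x)).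
    - by move=> y _; rewrite mule_ge0// lee_fin powR_ge0.
    - by apply: emeasurable_funM => //; exact: emeasurable_indic.
    apply: filterS GL => y GL _; rewrite indicE.
    case: (boolP (y \in Y2)) => [_|/negP xA]; last first.
      rewrite G0 ?mule0 ?powR0 ?gt_eqF// => -[/= _ Yx].
      by apply: xA; rewrite inE.
    rewrite mule1 lee_fin ge0_ler_powR ?nnegrE ?mulr_ge0//; exact: ltW.
  rewrite integral_cst_indic ?powR_ge0// [X in (_ * X <= _)%E]Y2V powRM// EFinM.
  apply: (@le_trans _ _ ((c `^ p2)%:E * ((V `^ (p2 - 1))%:E * inr p2 F x) * V%:E)%E).
    by rewrite lee_wpmul2r ?lee_fin// lee_wpmul2l// lee_fin powR_ge0.
  have -> (a b v : R) (e : \bar R) : (a%:E * (b%:E * e) * v%:E = (a * b * v)%:E * e)%E.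
    by rewrite muleA -EFinM muleAC -EFinM.
  rewrite lee_wpmul2r ?inr_ge0// lee_fin powRM//.
  rewrite -mulrA ler_wpM2l ?powR_ge0// -[in X in _ * X](powRr1 V0) -powRD ?subrK//.
  by rewrite gt_eqF.
have p120 : 0 <= p1 / p2 by rewrite divr_ge0// ltW.
rewrite /mixI -ge0_integralZl_EFin ?powR_ge0//; last 2 first.
- by move=> x _; exact: poweR_ge0.
- exact: measurable_inr_pow.
apply: ae_ge0_le_integral => //.
- by move=> x _; exact: poweR_ge0.
- exact: measurable_inr_pow.
- by move=> x _; rewrite mule_ge0// ?lee_fin ?powR_ge0 ?poweR_ge0.
- by apply: emeasurable_funM => //; exact: measurable_inr_pow.
apply: filterS main => x h _.
apply: le_trans (le_poweR p120 (inr_ge0 _ _ _ _) h) _.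
rewrite poweRM ?lee_fin ?powR_ge0 ?inr_ge0// poweR_EFin -powRrM.
by rewrite mulrCA divff ?gt_eqF// mulr1.
Qed.

(** Hölder in the inner and then in the outer variable. The numerical factor is the norm of the
    indicator of the rectangle in the dual mixed space. *)
Lemma mixI_rectangle (A1 : set T1) (A2 : set T2) F p1 p2 (V1 V2 : R) :
  measurable A1 -> measurable A2 -> (m1 A1 = V1%:E)%E -> (m2 A2 = V2%:E)%E ->
  measurable_fun setT F -> (forall z, 0 <= F z) ->
  (forall z, ~ (A1 `*` A2) z -> F z = 0) -> 1 < p1 -> 1 < p2 ->
  (\int[(m1 \x m2)%E]_z (F z)%:E <=
   (V1 `^ (1 - p1^-1) * V2 `^ (1 - p2^-1))%:E * mixI p1 p2 F `^ p1^-1)%E.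
Proof.
move=> mA1 mA2 A1V A2V mF Fge F0 p11 p21.
have p10 : 0 < p1 by rewrite (lt_trans _ p11).
have p20 : 0 < p2 by rewrite (lt_trans _ p21).
have FEge z : (0 <= (F z)%:E)%E by rewrite lee_fin.
have mFE : measurable_fun setT (fun z => (F z)%:E) by apply/measurable_EFinP.
rewrite fubini_tonelli1//.
apply: (@le_trans _ _ (\int[m1]_x ((V2 `^ (1 - p2^-1))%:E * inr p2 F x `^ p2^-1))%E).
  apply: ge0_le_integral => //.
  - by move=> x _; apply: integral_ge0.
  - exact: measurable_fun_fubini_tonelli_F.
  - by apply: emeasurable_funM => //; exact: measurable_inr_pow.
  move=> x _; rewrite -poweR_EFin -A2V; apply: integral_le_power => //.
  - exact: (measurableT_comp mF (pair1_measurable x)).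
  - by move=> y Xy; apply: F0 => -[].
rewrite ge0_integralZl_EFin ?powR_ge0//; last 2 first.
- by move=> x _; exact: poweR_ge0.
- exact: measurable_inr_pow.
rewrite mulrC EFinM -muleA lee_wpmul2l ?lee_fin ?powR_ge0//.
apply: le_trans (integral_le_poweR m1 mA1 p11 _ _ _) _.
- exact: measurable_inr_pow.
- by move=> x; exact: poweR_ge0.
- by move=> x /(inr_off p20 F0) ->; rewrite poweR0r// invr_eq0 gt_eqF.
rewrite [X in (X `^ _ * _)%E]A1V poweR_EFin lee_wpmul2l ?lee_fin ?powR_ge0//.
by under eq_integral do rewrite -poweRrM mulrC.
Qed.

Lemma mixI_bounded_lty (X1 : set T1) (X2 : set T2) F p1 p2 M :
  measurable X1 -> measurable X2 -> (m1 X1 < +oo)%E -> (m2 X2 < +oo)%E ->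
  measurable_fun setT F -> (forall z, 0 <= F z <= M) ->
  (forall z, ~ (X1 `*` X2) z -> F z = 0) -> 0 < p1 -> 0 < p2 ->
  (mixI p1 p2 F < +oo)%E.
Proof.
move=> mX1 mX2 X1y X2y mF FM F0 p10 p20.
have Mx x : (inr p2 F x <= (`|M| `^ p2)%:E * m2 X2)%E.
  rewrite -integral_cst_indic ?powR_ge0//; apply: ge0_le_integral => //.
  - by move=> y _; rewrite lee_fin powR_ge0.
  - apply: measurable_powR_fun.
    exact: (measurableT_comp mF (pair1_measurable x)).
  - by apply: emeasurable_funM => //; exact: emeasurable_indic.
  move=> y _; rewrite indicE; case: (boolP (y \in X2)) => [_|/negP xA].
    have /andP[Fp Fm] := FM (x, y).
    rewrite mule1 lee_fin ge0_ler_powR ?nnegrE//; first exact: ltW.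
    exact: le_trans (ler_norm M).
  rewrite F0 ?mule0 ?powR0 ?gt_eqF// => -[/= _ Yx].
  by apply: xA; rewrite inE.
have p120 : 0 <= p1 / p2 by rewrite divr_ge0// ltW.
pose C := fine ((`|M| `^ p2)%:E * m2 X2)%E.
have CE : ((`|M| `^ p2)%:E * m2 X2 = C%:E)%E.
  rewrite fineK// ge0_fin_numE ?mule_ge0 ?lee_fin ?powR_ge0//.
  by rewrite lte_mul_pinfty// lee_fin powR_ge0.
have C0 : 0 <= C by rewrite fine_ge0// mule_ge0 ?lee_fin ?powR_ge0.
apply: (@le_lt_trans _ _ (\int[m1]_x ((C `^ (p1 / p2))%:E * (\1_X1 x)%:E))%E).
  apply: ge0_le_integral => //.
  - by move=> x _; exact: poweR_ge0.
  - exact: measurable_inr_pow.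
  - by apply: emeasurable_funM => //; exact: emeasurable_indic.
  move=> x _; rewrite indicE; case: (boolP (x \in X1)) => [_|/negP xA].
    rewrite mule1 -poweR_EFin; apply: le_poweR => //; first exact: inr_ge0.
    by rewrite -CE.
  rewrite mule0 (inr_off p20 F0) ?poweR0r// ?gt_eqF ?divr_gt0// => Xx.
  by apply: xA; rewrite inE.
by rewrite integral_cst_indic ?powR_ge0// lte_mul_pinfty// lee_fin powR_ge0.
Qed.

(** Dominated convergence in each variable: finiteness of the mixed integral of [F0] makes its inner
    integrals finite for almost every [x], where the inner theorem applies, and gives the majorant
    for the outer one. *)
Lemma mixI_dominated (Fn : nat -> T1 * T2 -> R) F F0 p1 p2 :
  (forall n, measurable_fun setT (Fn n)) -> measurable_fun setT F ->
  measurable_fun setT F0 -> (forall n z, 0 <= Fn n z <= F0 z) ->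
  (forall z, 0 <= F z) ->
  {ae m1, forall x, {ae m2, forall y, (fun n => Fn n (x, y)) @ \oo --> F (x, y)}} ->
  0 < p1 -> 0 < p2 -> (mixI p1 p2 F0 < +oo)%E ->
  (fun n => mixI p1 p2 (Fn n)) @ \oo --> mixI p1 p2 F.
Proof.
move=> mFn mF mF0 FnF0 Fge Fcvg p10 p20 F0y.
have p120 : 0 < p1 / p2 by rewrite divr_gt0.
have Fn0 n z : 0 <= Fn n z by have /andP[] := FnF0 n z.
have F0ge z : 0 <= F0 z.
  by have /andP[/le_trans h /h] := FnF0 0%N z.
have mI : m1.-integrable setT (fun x => inr p2 F0 x `^ (p1 / p2))%E.
  apply/integrableP; split; first exact: measurable_inr_pow.
  by under eq_integral do rewrite gee0_abs ?poweR_ge0//.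
have F0fin : {ae m1, forall x, inr p2 F0 x < +oo}%E.
  have := integrable_ae measurableT mI; apply: filterS => x /(_ I).
  rewrite ge0_fin_numE ?poweR_ge0// => /lty_poweRy; apply.
  by rewrite gt_eqF.
have [] // := @dominated_convergence _ _ _ m1 setT measurableT
  (fun n x => inr p2 (Fn n) x `^ (p1 / p2))%E
  (fun x => inr p2 F x `^ (p1 / p2))%E
  (fun x => inr p2 F0 x `^ (p1 / p2))%E.
- by move=> n; exact: measurable_inr_pow.
- exact: measurable_inr_pow.
- apply: filterS2 Fcvg F0fin => x Fcvg F0x _; apply: cvg_poweR => //.
    by move=> n; exact: inr_ge0.
  have [] // := @dominated_convergence _ _ _ m2 setT measurableT
    (fun n y => (Fn n (x, y) `^ p2)%:E)
    (fun y => (F (x, y) `^ p2)%:E) (fun y => (F0 (x, y) `^ p2)%:E).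
  + move=> n; apply: measurable_powR_fun.
    exact: (measurableT_comp (mFn n) (pair1_measurable x)).
  + by apply: measurable_powR_fun; exact: (measurableT_comp mF (pair1_measurable x)).
  + apply: filterS Fcvg => y Fcvg _; apply: cvg_EFin; first exact: nearW.
    exact: cvg_powR.
  + apply/integrableP; split.
      apply: measurable_powR_fun.
      exact: (measurableT_comp mF0 (pair1_measurable x)).
    by under eq_integral do rewrite gee0_abs ?lee_fin ?powR_ge0//.
  + apply: aeW => y n _; rewrite gee0_abs; last by rewrite lee_fin powR_ge0.
    rewrite lee_fin.
    have /andP[? ?] := FnF0 n (x, y).
    by rewrite ge0_ler_powR ?nnegrE//; exact: ltW.
- apply: aeW => x n _; rewrite gee0_abs; last exact: poweR_ge0.
  apply: le_poweR.
  + exact: ltW.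
  + exact: inr_ge0.
  + apply: inr_mono => //; apply: aeW => y.
    by have /andP[] := FnF0 n (x, y).
Qed.

End mixed_integrals_estimates.

Lemma powR_mulpred {R : realType} (a s : R) : 0 <= a -> s != 0 ->
  a `^ s = a * a `^ (s - 1).
Proof.
move=> a0 s0; rewrite -{2}(powRr1 a0) -powRD; last first.
  by rewrite addrC subrK (negbTE s0).
by rewrite addrC subrK.
Qed.

Lemma cintegral_real {R : realType} d (T : measurableType d)
    (mu : {measure set T -> \bar R}) (r : T -> R) :
  cintegral mu setT (fun x => (r x)%:C%C) = (\int[mu]_x r x)%:C%C.
Proof. by rewrite /cintegral /= Rintegral_cst// mul0r. Qed.

(** * Duality of mixed norms *)

Section converse_hoelder.
Context {R : realType} {d1 d2 : measure_display}
  {T1 : measurableType d1} {T2 : measurableType d2}.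
Variables (m1 : {sigma_finite_measure set T1 -> \bar R})
  (m2 : {sigma_finite_measure set T2 -> \bar R}).

Local Notation inr := (inr m2).
Local Notation mixI := (mixI m1 m2).

Variables (X1 : set T1) (X2 : set T2) (h : T1 * T2 -> R[i]) (p1 p2 : R).
Hypotheses (mX1 : measurable X1) (mX2 : measurable X2)
  (X1y : (m1 X1 < +oo)%E) (X2y : (m2 X2 < +oo)%E).
Hypotheses (mh : cmeasurable h) (h0 : forall z, ~ (X1 `*` X2) z -> h z = 0).
Hypotheses (p11 : 1 < p1) (p21 : 1 < p2).

Let v1 := p1 / (p1 - 1).
Let v2 := p2 / (p2 - 1).
Let p10 : 0 < p1. Proof. by rewrite (lt_trans _ p11). Qed.
Let p20 : 0 < p2. Proof. by rewrite (lt_trans _ p21). Qed.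
Let p1B : 0 < p1 - 1. Proof. by rewrite subr_gt0. Qed.
Let p2B : 0 < p2 - 1. Proof. by rewrite subr_gt0. Qed.
Let v10 : 0 < v1. Proof. by rewrite divr_gt0. Qed.
Let v20 : 0 < v2. Proof. by rewrite divr_gt0. Qed.
Let v12 : 0 < v1 / v2. Proof. by rewrite divr_gt0. Qed.
Let v2B : 0 < v2 - 1.
Proof. by rewrite subr_gt0 ltr_pdivlMr// mul1r gtrBl. Qed.

(** The extremal function in the mixed Hölder inequality is [conj h |h|^(v2-2)] times the power
    [v1/v2 - 1] of the inner integral. [F] truncates [|h|] at height [n], and [E] keeps the slices
    whose inner integral is at least [1/(n+1)], because that power may be negative. Both cuts make
    the test function [psi] bounded. *)
Let D z := cabs (h z).
Let F (n : nat) z := if D z <= n%:R then D z else 0.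
Let E n x := ((n.+1%:R^-1)%:E <= inr v2 (F n) x)%E.
Let k n x := fine (inr v2 (F n) x).
Let w n x := if E n x then k n x `^ (v1 / v2 - 1) else 0.
Let psi n z := cconj (h z) * (((D z)^-1 * (F n z `^ (v2 - 1) * w n z.1))%:C%C).
Let t n x := (if E n x then inr v2 (F n) x `^ (v1 / v2) else 0)%E.

Let mD : measurable_fun setT D. Proof. exact: measurable_cabs. Qed.

Let mF n : measurable_fun setT (F n).
Proof.
apply: measurable_fun_ifT => //.
by apply: measurable_fun_ler => //; exact: measurable_cst.
Qed.

Let F0 n z : 0 <= F n z <= n%:R.
Proof. by rewrite /F; case: ifP; rewrite ?cabs_ge0// lexx ler0n. Qed.

Let Fge n z : 0 <= F n z. Proof. by have /andP[] := F0 n z. Qed.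

Let Foff n z : ~ (X1 `*` X2) z -> F n z = 0.
Proof. by move=> /h0; rewrite /F /D => ->; rewrite cabs0 ler0n. Qed.

Let inr_fin n x : inr v2 (F n) x = (k n x)%:E.
Proof.
rewrite /k fineK// ge0_fin_numE ?inr_ge0//.
exact: (bounded_support_inr_lty _ mX2 X2y (mF n) (F0 n) (Foff n)).
Qed.

Let k0 n x : 0 <= k n x. Proof. by rewrite -lee_fin -inr_fin inr_ge0. Qed.

Let mE n : measurable_fun setT (E n).
Proof.
rewrite (_ : E n = fun x => n.+1%:R^-1 <= k n x); last first.
  by apply/funext => x; rewrite /E inr_fin lee_fin.
apply: measurable_fun_ler; first exact: measurable_cst.
by apply: measurableT_comp => //; exact: measurable_inr.
Qed.

Let mk n : measurable_fun setT (k n).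
Proof. by apply: measurableT_comp => //; exact: measurable_inr. Qed.

Let mw n : measurable_fun setT (w n).
Proof.
apply: measurable_fun_ifT => //.
exact: (measurableT_comp (measurable_powR _)).
Qed.

Let w0 n x : 0 <= w n x.
Proof. by rewrite /w; case: ifP => // _; exact: powR_ge0. Qed.

Let mt n : measurable_fun setT (t n).
Proof.
apply: measurable_fun_ifT => //.
exact: measurable_inr_pow.
Qed.

Let mpsi n : cmeasurable (psi n).
Proof.
apply: cmeasurableM; first exact: cmeasurable_conj.
apply: cmeasurable_real; apply: measurable_funM.
  rewrite (_ : (fun x => (D x)^-1) = fun x => D x `^ (-1)).
    exact: (measurableT_comp (measurable_powR _)).
  by apply/funext => z; rewrite powR_inv1// cabs_ge0.
apply: measurable_funM; first exact: (measurableT_comp (measurable_powR _)).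
exact: (measurableT_comp (mw n) measurable_fst).
Qed.

Let F_D n z : F n z != 0 -> F n z = D z.
Proof. by rewrite /F; case: ifP => //; rewrite eqxx. Qed.

Let cabs_psi n z : cabs (psi n z) = F n z `^ (v2 - 1) * w n z.1.
Proof.
rewrite /psi cabsM cabs_conj cabs_real ger0_norm; last first.
  by rewrite !mulr_ge0// ?invr_ge0 ?cabs_ge0 ?powR_ge0.
rewrite mulrA -/(D z); have [->|Fz] := eqVneq (F n z) 0.
  by rewrite powR0 ?gt_eqF// mul0r mulr0.
by rewrite divff ?mul1r// -(F_D Fz).
Qed.

Let h_psi n z : h z * psi n z = (F n z `^ v2 * w n z.1)%:C%C.
Proof.
rewrite /psi mulrA cconjM -rmorphM/= -/(D z); congr (_%:C%C).
have [->|Fz] := eqVneq (F n z) 0.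
  by rewrite powR0 ?gt_eqF// powR0 ?gt_eqF// !mul0r !mulr0.
have DF := F_D Fz; rewrite -DF expr2 -!mulrA (mulrA (F n z) (F n z)^-1).
rewrite divff// mul1r mulrA; congr (_ * _).
by rewrite -powR_mulpred// gt_eqF.
Qed.

Let psi_off n z : ~ (X1 `*` X2) z -> psi n z = 0.
Proof.
move=> /Foff Fz; apply: cabs_eq0.
by rewrite cabs_psi Fz powR0 ?gt_eqF// mul0r.
Qed.

Let psi_bounded n : exists M : R, forall z, cabs (psi n z) <= M.
Proof.
pose B := (n%:R `^ v2) * fine (m2 X2); pose s := v1 / v2 - 1.
have B0 : 0 <= B by rewrite mulr_ge0 ?powR_ge0 ?fine_ge0.
have kB x : k n x <= B.
  rewrite -lee_fin -inr_fin EFinM fineK ?ge0_fin_numE//.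
  rewrite -integral_cst_indic ?powR_ge0//; apply: ge0_le_integral => //.
  - by move=> y _; rewrite lee_fin powR_ge0.
  - apply: measurable_powR_fun.
    exact: (measurableT_comp (mF n) (pair1_measurable x)).
  - by apply: emeasurable_funM => //; exact: emeasurable_indic.
  move=> y _; rewrite indicE; case: (boolP (y \in X2)) => [_|/negP yX].
    have /andP[? ?] := F0 n (x, y).
    by rewrite mule1 lee_fin ge0_ler_powR ?nnegrE ?ler0n//; exact: ltW.
  rewrite Foff ?powR0 ?gt_eqF ?mule0// => -[/= _ ?].
  by apply: yX; rewrite inE.
exists (n%:R `^ (v2 - 1) * (B `^ s + n.+1%:R^-1 `^ s)) => z.
have /andP[Fz Fn] := F0 n z.
rewrite cabs_psi; apply: ler_pM => //; rewrite ?powR_ge0//.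
  by rewrite ge0_ler_powR ?nnegrE ?ler0n//; exact: ltW.
rewrite /w; case: ifPn => [|_]; last by rewrite addr_ge0 ?powR_ge0.
rewrite /E inr_fin lee_fin -/s => kn.
have [s0|s0] := leP 0 s.
  apply: (@le_trans _ _ (B `^ s)); last by rewrite lerDl powR_ge0.
  by rewrite ge0_ler_powR ?nnegrE.
apply: (@le_trans _ _ (n.+1%:R^-1 `^ s)); last by rewrite lerDr powR_ge0.
have n0 : 0 < (n.+1%:R^-1 : R) by rewrite invr_gt0 ltr0n.
have kn0 : 0 < k n z.1 by exact: lt_le_trans kn.
rewrite -(opprK s) powRN (powRN n.+1%:R^-1) lef_pV2 ?posrE ?powR_gt0//.
by apply: ge0_ler_powR; rewrite ?nnegrE ?oppr_ge0// ltW.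
Qed.

Let tE n x : t n x = (w n x * k n x)%:E.
Proof.
rewrite /t /w; case: ifPn; last by rewrite mul0r.
rewrite /E inr_fin lee_fin => kn.
have k1 : 0 < k n x by apply: lt_le_trans kn; rewrite invr_gt0 ltr0n.
by rewrite poweR_EFin (powR_mulpred (k0 n x)) ?gt_eqF// mulrC.
Qed.

Let t0 n x : (0 <= t n x)%E.
Proof. by rewrite /t; case: ifP => // _; exact: poweR_ge0. Qed.

Let integral_hpsi n :
  (\int[(m1 \x m2)%E]_z (F n z `^ v2 * w n z.1)%:E = \int[m1]_x t n x)%E.
Proof.
rewrite fubini_tonelli1; last 2 first.
- apply/measurable_EFinP; apply: measurable_funM.
    exact: (measurableT_comp (measurable_powR _)).
  exact: (measurableT_comp (mw n) measurable_fst).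
- by move=> z; rewrite lee_fin mulr_ge0// powR_ge0.
apply: eq_integral => x _; rewrite tE EFinM -inr_fin -ge0_integralZl_EFin//.
- by apply: eq_integral => y _; rewrite -EFinM mulrC.
- by move=> y _; rewrite lee_fin powR_ge0.
- apply: measurable_powR_fun.
  exact: (measurableT_comp (mF n) (pair1_measurable x)).
Qed.

Let mixI_psi n :
  mixI p1 p2 (fun z => cabs (psi n z)) = (\int[m1]_x t n x)%E.
Proof.
apply: eq_integral => x _.
have -> : inr p2 (fun z => cabs (psi n z)) x = ((w n x `^ p2 * k n x)%:E)%E.
  rewrite EFinM -inr_fin /inr -ge0_integralZl_EFin ?powR_ge0//.
  - apply: eq_integral => y _; rewrite cabs_psi -EFinM mulrC powRM ?powR_ge0//.
    rewrite -powRrM; congr (_ * _ `^ _)%:E.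
    by rewrite /v2; field; rewrite gt_eqF.
  - by move=> y _; rewrite lee_fin powR_ge0.
  - apply: measurable_powR_fun.
    exact: (measurableT_comp (mF n) (pair1_measurable x)).
rewrite poweR_EFin tE; congr EFin; rewrite /w; case: ifPn => [|_]; last first.
  by rewrite powR0 ?gt_eqF// !mul0r powR0// gt_eqF// divr_gt0.
rewrite /E inr_fin lee_fin => kn.
have k1 : 0 < k n x by apply: lt_le_trans kn; rewrite invr_gt0 ltr0n.
have kk : (k n x == 0) = false by rewrite gt_eqF.
rewrite -powRrM -{2}(powRr1 (k0 n x)) -powRD ?kk ?implybT// -powRrM.
rewrite -{3}(powRr1 (k0 n x)) -powRD ?kk ?implybT//.
by congr (_ `^ _); rewrite /v1 /v2; field; rewrite !gt_eqF.
Qed.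

Lemma converse_hoelder (C : R) : 0 <= C ->
  (forall psi, cmeasurable psi -> (exists M : R, forall z, cabs (psi z) <= M) ->
    (forall z, ~ (X1 `*` X2) z -> psi z = 0) ->
    ((cabs (cintegral (m1 \x m2)%E setT (fun z => (h z * psi z)%R)))%:E <=
      C%:E * mixnorm m1 m2 p1 p2 psi)%E) ->
  (mixnorm m1 m2 v1 v2 h <= C%:E)%E.
Proof.
move=> C0 hC; apply/mixnorm_le => //.
(* The pairing of [h] with [psi n] and the [p1]-th power of the norm of [psi n] are the same number
   [X], the integral of [t n]. The hypothesis reads [X <= C X^(1/p1)]; since truncation makes [X]
   finite, [X^(1-1/p1) <= C]. *)
have tle n : (\int[m1]_x t n x <= (C `^ v1)%:E)%E.
  have ty : (\int[m1]_x t n x < +oo)%E.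
    have [M psiM] := psi_bounded n; rewrite -mixI_psi.
    apply: (mixI_bounded_lty (M := M) mX1 mX2 X1y X2y) => //.
    - exact: measurable_cabs.
    - by move=> z; rewrite cabs_ge0 psiM.
    - by move=> z /(psi_off n) ->; rewrite cabs0.
  have tge : (0 <= \int[m1]_x t n x)%E by apply: integral_ge0.
  have := hC (psi n) (mpsi n) (psi_bounded n) (psi_off n).
  rewrite mixnormE// mixI_psi.
  have -> : (cabs (cintegral (m1 \x m2)%E setT (fun z => h z * psi n z)%R))%:E =
      (\int[m1]_x t n x)%E.
    rewrite -integral_hpsi (_ : (fun z => h z * psi n z) =
      fun z => (F n z `^ v2 * w n z.1)%:C%C); last first.
      by apply/funext => z; rewrite h_psi.
    rewrite cintegral_real cabs_real /Rintegral ger0_norm; last first.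
      by rewrite fine_ge0// integral_hpsi.
    by rewrite fineK// integral_hpsi ge0_fin_numE.
  rewrite -(@fineK _ (\int[m1]_x t n x)) ?ge0_fin_numE//.
  set X := fine _; have X0 : 0 <= X by rewrite fine_ge0.
  rewrite poweR_EFin -EFinM !lee_fin => XC.
  have [->|Xn] := eqVneq X 0; first exact: powR_ge0.
  have Xp : 0 < X by rewrite lt_def Xn.
  have XC' : X `^ (1 - p1^-1) <= C.
    rewrite -(@ler_pM2r _ (X `^ p1^-1)) ?powR_gt0//.
    by rewrite -powRD ?subrK ?powRr1// Xn implybT.
  have -> : X = (X `^ (1 - p1^-1)) `^ v1.
    rewrite -powRrM (_ : _ * v1 = 1) ?powRr1//.
    by rewrite /v1; field; rewrite !gt_eqF.
  by rewrite ge0_ler_powR ?nnegrE ?powR_ge0// ltW.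
have Fmono m n z : (m <= n)%N -> F m z <= F n z.
  move=> mn; rewrite /F; case: ifPn => [Dm|_]; last by case: ifP; rewrite ?cabs_ge0.
  by rewrite ifT//; apply: le_trans Dm _; rewrite ler_nat.
have inrmono m n x : (m <= n)%N -> (inr v2 (F m) x <= inr v2 (F n) x)%E.
  by move=> mn; apply: inr_mono => //; apply: aeW => y; exact: Fmono.
have Emono m n x : (m <= n)%N -> E m x -> E n x.
  move=> mn; rewrite /E => Em; apply: le_trans (inrmono _ _ _ mn).
  by apply: le_trans Em; rewrite lee_fin lef_pV2 ?posrE ?ltr0n// ler_nat.
have tmono x : {homo t^~ x : m n / (m <= n)%N >-> (m <= n)%E}.
  move=> m n mn; have [Em|Em] := boolP (E m x); last first.
    by rewrite [t m x]/t (negbTE Em); exact: t0.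
  rewrite /t Em (Emono _ _ _ mn Em); apply: le_poweR; first exact: ltW.
    exact: inr_ge0.
  exact: inrmono.
have inrcvg x : (fun n => inr v2 (F n) x) @ \oo --> inr v2 D x.
  rewrite (_ : inr v2 D x =
      \int[m2]_y (limn (fun n => (F n (x, y) `^ v2)%:E)))%E; last first.
    apply: eq_integral => y _; apply/esym/cvg_lim => //.
    apply: cvg_near_cst; near=> n; rewrite /F ifT//; near: n.
    exact: nbhs_infty_ger.
  apply: cvg_monotone_convergence => //.
  - move=> n; apply: measurable_powR_fun.
    exact: (measurableT_comp (mF n) (pair1_measurable x)).
  - by move=> n y _; rewrite lee_fin powR_ge0.
  - move=> y _ m n mn; rewrite lee_fin ge0_ler_powR ?nnegrE//; first exact: ltW.
    exact: Fmono.
have tcvg x : t^~ x @ \oo --> (inr v2 D x `^ (v1 / v2))%E.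
  have := inr_ge0 m2 v2 D x; rewrite le_eqVlt => /predU1P[D0|D0].
    rewrite -D0 poweR0r ?gt_eqF// (_ : t^~ x = cst 0%E); first exact: cvg_cst.
    apply/funext => n; rewrite /t; case: ifPn => // _.
    rewrite (_ : inr v2 (F n) x = 0)%E ?poweR0r ?gt_eqF//.
    apply/eqP; rewrite eq_le inr_ge0 andbT D0; apply: inr_mono => //.
      by move=> z; exact: cabs_ge0.
    by apply: aeW => y; rewrite /F; case: ifP => // _; exact: cabs_ge0.
  (* As soon as one truncation has a positive inner integral on this slice, the threshold [1/(n+1)]
     is passed for all large [n]. *)
  have [N kN] : exists N, 0 < k N x.
    apply/not_existsP => kle; move: D0; rewrite lt_neqAle => /andP[/eqP + _].
    apply; apply: (cvg_unique _ _ (inrcvg x)) => //.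
    rewrite (_ : (fun n => inr v2 (F n) x) = cst 0%E); first exact: cvg_cst.
    apply/funext => n; rewrite inr_fin; congr EFin; apply/eqP.
    by rewrite eq_le k0 andbT leNgt; apply/negP/kle.
  have := cvg_poweR v12 (fun n => inr_ge0 _ _ _ _) (inrcvg x).
  apply: cvg_trans; apply: near_eq_cvg; near=> n.
  suff En : E n x by rewrite /t En.
  rewrite /E; apply: (@le_trans _ _ (inr v2 (F N) x)); last first.
    by apply: inrmono; near: n; exact: nbhs_infty_ge.
  rewrite inr_fin lee_fin invf_ple ?posrE ?ltr0n//.
  apply: (@le_trans _ _ n%:R); last by rewrite ler_nat.
  by near: n; exact: nbhs_infty_ger.
have mc := cvg_monotone_convergence (mu := m1) measurableT mt (fun n x _ => t0 n x)
  (fun x _ => tmono x).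
have /cvg_lim tl := mc.
rewrite /mixI (_ : (\int[m1]_x (inr v2 D x `^ (v1 / v2)))%E =
  (\int[m1]_x (limn (t^~ x)))%E); last first.
  by apply: eq_integral => x _; apply/esym/cvg_lim.
rewrite -tl//; apply: lime_le; [exact: cvgP mc|exact: nearW].
Unshelve. all: by end_near. Qed.

End converse_hoelder.

(** * Tensor products of bounded functions *)

Section bounded_functions.
Context {R : realType} {d : measure_display} {T : measurableType d}.

(** Bounded measurable functions vanishing off [X], bundled so that finite sums of products can be
    plain lists of factors. For [X] of finite measure they lie in every L^p. *)
Record bfun (X : set T) := BFun {
  bfun_val :> T -> R[i];
  bfun_meas : cmeasurable bfun_val;
  bfun_bound : exists M : R, forall x, cabs (bfun_val x) <= M;
  bfun_off : forall x, ~ X x -> bfun_val x = 0 }.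

Lemma bfunZ_subproof X (c : R[i]) (f : bfun X) :
  exists M : R, forall x, cabs (c * f x) <= M.
Proof.
have [M fM] := bfun_bound f; exists (cabs c * M) => x.
by rewrite cabsM ler_wpM2l ?cabs_ge0.
Qed.

Definition bfunZ X (c : R[i]) (f : bfun X) : bfun X.
Proof.
refine (@BFun X (fun x => c * f x) _ (bfunZ_subproof c f) _).
- by apply: cmeasurableM; [exact: cmeasurable_cst|exact: bfun_meas].
- by move=> x /(bfun_off f) ->; rewrite mulr0.
Defined.

Definition bfunM X (f g : bfun X) : bfun X.
Proof.
refine (@BFun X (fun x => f x * g x) _ _ _).
- by apply: cmeasurableM; exact: bfun_meas.
- have [M fM] := bfun_bound f; have [N gN] := bfun_bound g.
  by exists (M * N) => x; rewrite cabsM ler_pM ?cabs_ge0.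
- by move=> x /(bfun_off f) ->; rewrite mul0r.
Defined.

Definition bfunD X (f g : bfun X) : bfun X.
Proof.
refine (@BFun X (fun x => f x + g x) _ _ _).
- by apply: cmeasurableD; exact: bfun_meas.
- have [M fM] := bfun_bound f; have [N gN] := bfun_bound g.
  by exists (M + N) => x; apply: le_trans (ler_cabsD _ _) _; exact: lerD.
- by move=> x Xx; rewrite !bfun_off// addr0.
Defined.

Definition bfun0 X : bfun X.
Proof.
refine (@BFun X (fun x => 0) (cmeasurable_cst _) _ _) => //.
by exists 0 => x; rewrite cabs0.
Defined.

Definition bfun_chi X (A : set T) (mA : measurable A) (mX : measurable X) : bfun X.
Proof.
refine (@BFun X (chi (A `&` X)) _ _ _).
- by apply: cmeasurable_chi; exact: measurableI.
- by exists 1 => x; rewrite chiE; case: ifP; rewrite ?cabs1 ?cabs0.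
- by move=> x Xx; rewrite chiE ifF//; apply/negP; rewrite inE => -[].
Defined.

Lemma bfun_chiE X A (mA : measurable A) (mX : measurable X) x :
  bfun_chi mA mX x = chi (A `&` X) x.
Proof. by []. Qed.

Lemma bfun_cint (mu : {measure set T -> \bar R}) X (f : bfun X) :
  measurable X -> (mu X < +oo)%E -> cint mu f.
Proof.
move=> mX Xy; have [M fM] := bfun_bound f.
by apply: (cint_bounded mX Xy _ fM); [exact: bfun_meas|exact: bfun_off].
Qed.

End bounded_functions.

Section tensors.
Context {R : realType} {d1 d2 : measure_display}
  {T1 : measurableType d1} {T2 : measurableType d2}.


(** A representation by factors is kept, not the function on the product, because the operators act
    on the factors; several lists may have the same evaluation [ev]. *)
Definition tensor (X1 : set T1) (X2 : set T2) :=
  seq (@bfun R _ _ X1 * @bfun R _ _ X2).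

Definition ev X1 X2 (s : tensor X1 X2) (z : T1 * T2) : R[i] :=
  \sum_(t <- s) t.1 z.1 * t.2 z.2.

Lemma ev_meas X1 X2 (s : tensor X1 X2) : cmeasurable (ev s).
Proof.
apply: cmeasurable_sum => t; apply: cmeasurableM.
  exact: (cmeasurable_comp measurable_fst (bfun_meas t.1)).
exact: (cmeasurable_comp measurable_snd (bfun_meas t.2)).
Qed.

Lemma ev_bound X1 X2 (s : tensor X1 X2) :
  exists M : R, forall z, cabs (ev s z) <= M.
Proof.
elim: s => [|t s [M sM]].
  by exists 0 => z; rewrite /ev big_nil cabs0.
have [M1 tM1] := bfun_bound t.1; have [M2 tM2] := bfun_bound t.2.
exists (M1 * M2 + M) => z; rewrite /ev big_cons; apply: le_trans (ler_cabsD _ _) _.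
apply: lerD; last exact: sM.
by rewrite cabsM; apply: ler_pM; rewrite ?cabs_ge0.
Qed.

Lemma ev_off X1 X2 (s : tensor X1 X2) z : ~ (X1 `*` X2) z -> ev s z = 0.
Proof.
move=> Xz; rewrite /ev big1// => t _.
have [X1z|X1z] := pselect (X1 z.1); last by rewrite bfun_off// mul0r.
by rewrite (bfun_off t.2) ?mulr0// => X2z; apply: Xz.
Qed.

Lemma ev_cat X1 X2 (s t : tensor X1 X2) z : ev (s ++ t) z = ev s z + ev t z.
Proof. by rewrite /ev big_cat. Qed.

Definition tensZ X1 X2 (c : R[i]) (s : tensor X1 X2) : tensor X1 X2 :=
  [seq (bfunZ c t.1, t.2) | t <- s].

Lemma ev_Z X1 X2 c (s : tensor X1 X2) z : ev (tensZ c s) z = c * ev s z.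
Proof.
rewrite /ev big_map mulr_sumr; apply: eq_bigr => t _ /=; by rewrite mulrA.
Qed.

Definition tensM X1 X2 (s t : tensor X1 X2) : tensor X1 X2 :=
  [seq (bfunM u.1 v.1, bfunM u.2 v.2) | u <- s, v <- t].

Lemma ev_M X1 X2 (s t : tensor X1 X2) z : ev (tensM s t) z = ev s z * ev t z.
Proof.
rewrite /ev /tensM big_allpairs_dep mulr_suml; apply: eq_bigr => u _.
by rewrite mulr_sumr; apply: eq_bigr => v _ /=; rewrite mulrACA.
Qed.

End tensors.

Lemma if_mul {R : realType} (b c : bool) :
  (if b then 1 else 0) * (if c then 1 else 0) = (if b && c then 1 else 0) :> R[i].
Proof. by case: b; case: c; rewrite ?mulr1 ?mulr0. Qed.

(* What remains of [r] in [0, 1] once its first [k] binary digits are removed. *)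
Fixpoint dyadic_rem {R : realType} (r : R) (k : nat) : R :=
  if k is k'.+1 then dyadic_rem r k' -
    (if 2^-1 ^+ k <= dyadic_rem r k' then 2^-1 ^+ k else 0) else r.

(** * Approximation of bounded functions by tensor products *)

Section density.
Context {R : realType} {d1 d2 : measure_display}
  {T1 : measurableType d1} {T2 : measurableType d2}.
Variables (m1 : {sigma_finite_measure set T1 -> \bar R})
  (m2 : {sigma_finite_measure set T2 -> \bar R}).
Variables (X1 : set T1) (X2 : set T2).
Hypotheses (mX1 : measurable X1) (mX2 : measurable X2)
  (X1y : (m1 X1 < +oo)%E) (X2y : (m2 X2 < +oo)%E).

Local Notation mu := (m1 \x m2)%E.
Let X := X1 `*` X2.
Let mX : measurable X. Proof. exact: measurableX. Qed.
Let Xy : (mu X < +oo)%E.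
Proof. by rewrite product_measure1E// lte_mul_pinfty// ge0_fin_numE. Qed.

Let bad (s : tensor X1 X2) psi (e : R) :=
  X `&` [set z | ~ (cabs (ev s z - psi z) <= e)].

Let mbad s psi e : cmeasurable psi -> measurable (bad s psi e).
Proof.
move=> mpsi; apply: measurableI => //; apply: measurableC.
have [e0|e0] := leP 0 e.
  have -> : e = cabs (e%:C%C) by rewrite cabs_real ger0_norm.
  apply: measurable_cabs_le; last exact: cmeasurable_cst.
  by apply: cmeasurableB => //; exact: ev_meas.
rewrite [X in measurable X](_ : _ = set0); first exact: measurable0.
by apply/seteqP; split => z //=; rewrite leNgt (lt_le_trans e0) ?cabs_ge0.
Qed.

Let mbadchi s E : measurable E -> measurable (bad s (chi E) 0).
Proof. by move=> mE; apply: mbad; exact: cmeasurable_chi. Qed.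

(** The tensors are to equal the indicator exactly off a small set and to take the values 0 and 1
    everywhere. Then [1 - s] serves for a complement and a product of tensors for an intersection,
    and these sets form a sigma-algebra containing the rectangles. *)
Let approx_set (E : set (T1 * T2)) := measurable E /\ forall e : R, 0 < e ->
  exists s : tensor X1 X2, (forall z, ev s z = 0 \/ ev s z = 1) /\
    (mu (bad s (chi E) 0) < e%:E)%E.

Let ones : tensor (R := R) X1 X2 := [:: (bfun_chi measurableT mX1, bfun_chi measurableT mX2)].

Let ev_ones z : X z -> ev ones z = 1.
Proof.
move=> [z1 z2]; rewrite /ev /ones big_seq1/= !chiE !setTI !mem_set// mulr1 //.
Qed.

Let approxC E : approx_set E -> approx_set (~` E).
Proof.
move=> [mE aE]; split; first exact: measurableC.
move=> e /aE[s [s01 se]].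
have [u uE] : exists u : tensor X1 X2, forall z, X z -> ev u z = 1 - ev s z.
  by exists (ones ++ tensZ (-1) s) => z Xz; rewrite ev_cat ev_Z ev_ones// mulN1r.
exists u; split.
  move=> z; have [Xz|Xz] := pselect (X z); last by left; exact: ev_off.
  by rewrite uE//; have [->|->] := s01 z; [right; rewrite subr0|left; rewrite subrr].
apply: le_lt_trans se; apply: le_measure; rewrite ?inE.
- by apply: mbadchi; exact: measurableC.
- exact: mbadchi.
move=> z [Xz /= h]; split => //= h'; apply: h; move: h'.
rewrite uE// !chiE in_setC; case: (z \in E) => /= h'.
  by rewrite subr0 cabs_distC.
by move: h'; rewrite subr0 addrAC subrr sub0r cabsN.
Qed.

Let approxI E F : approx_set E -> approx_set F -> approx_set (E `&` F).
Proof.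
move=> [mE aE] [mF aF]; split; first exact: measurableI.
move=> e e0; have e2 : 0 < e / 2 by rewrite divr_gt0.
have [s [s01 se]] := aE _ e2; have [t [t01 te]] := aF _ e2.
exists (tensM s t); split.
  move=> z; rewrite ev_M; have [->|->] := s01 z; rewrite ?mul0r ?mul1r//.
  by left.
have -> : e%:E = ((e / 2)%:E + (e / 2)%:E)%E by rewrite -EFinD -splitr.
apply: le_lt_trans (lteD se te).
apply: le_trans (measureU2 _ _ _); [|exact: mbadchi|exact: mbadchi].
apply: le_measure; rewrite ?inE.
- by apply: mbad; apply: cmeasurable_chi; exact: measurableI.
- by apply: measurableU; exact: mbadchi.
move=> z [Xz /= h]; have [?|h1] := pselect (bad s (chi E) 0 z); first by left.
have [?|h2] := pselect (bad t (chi F) 0 z); first by right.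
exfalso; apply: h.
have {}h1 : cabs (ev s z - chi E z) <= 0 by apply: contrapT => h1'; apply: h1; split.
have {}h2 : cabs (ev t z - chi F z) <= 0 by apply: contrapT => h2'; apply: h2; split.
have /eqP : cabs (ev s z - chi E z) == 0 by rewrite eq_le h1 cabs_ge0.
have /eqP : cabs (ev t z - chi F z) == 0 by rewrite eq_le h2 cabs_ge0.
move=> /cabs_eq0/eqP; rewrite subr_eq0 => /eqP tE.
move=> /cabs_eq0/eqP; rewrite subr_eq0 => /eqP sE.
rewrite ev_M tE sE !chiE in_setI.
by rewrite if_mul subrr cabs0.
Qed.

Let approx0 : approx_set set0.
Proof.
split => // e e0; exists [::]; split; first by move=> z; left; rewrite /ev big_nil.
rewrite (_ : bad _ _ _ = set0) ?measure0//; apply/seteqP; split => // z [_ /=].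
by rewrite chiE in_set0 /ev big_nil subrr cabs0 lexx.
Qed.

Let approx_rect A B : measurable A -> measurable B -> approx_set (A `*` B).
Proof.
move=> mA mB; split; first exact: measurableX.
move=> e e0; exists [:: (bfun_chi mA mX1, bfun_chi mB mX2)]; split.
  move=> z; rewrite /ev big_seq1/= !chiE.
  by case: ifP; case: ifP; rewrite ?mulr0 ?mulr1; [right|left|left|left].
rewrite (_ : bad _ _ _ = set0) ?measure0//; apply/seteqP; split => // z [[z1 z2]].
apply; rewrite /ev big_seq1 !bfun_chiE !chiE [_ \in A `&` X1]in_setI [_ \in B `&` X2]in_setI (mem_set z1) (mem_set z2) !andbT.
rewrite (_ : (z \in A `*` B) = (z.1 \in A) && (z.2 \in B)); last first.
  apply/idP/andP => [/set_mem[? ?]|[/set_mem ? /set_mem ?]].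
    by split; exact: mem_set.
  exact: mem_set.
by rewrite if_mul subrr cabs0.
Qed.

Let approxU E F : approx_set E -> approx_set F -> approx_set (E `|` F).
Proof.
move=> aE aF; rewrite -(setCK (E `|` F)) setCU.
by apply: approxC; apply: approxI; exact: approxC.
Qed.

(** What the finite unions leave out of the full union decreases to the empty set inside [X], so its
    measure tends to 0 by continuity from above, [X] having finite measure. *)
Let approx_bigcup (F : nat -> set (T1 * T2)) : (forall n, approx_set (F n)) ->
  approx_set (\bigcup_n F n).
Proof.
move=> aF; have mF n : measurable (F n) by have [] := aF n.
split; first exact: bigcup_measurable.
move=> e e0; have e2 : 0 < e / 2 by rewrite divr_gt0.
pose G n := \big[setU/set0]_(i < n) F i.
have aG n : approx_set (G n).
  by apply: big_ind => [|A B|i _]; [exact: approx0|exact: approxU|exact: aF].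
have mG n : measurable (G n) by have [] := aG n.
pose H n := X `&` (\bigcup_n F n `\` G n).
have mH n : measurable (H n).
  by apply: measurableI => //; apply: measurableD => //; exact: bigcup_measurable.
have H0 : \bigcap_n H n = set0.
  apply/seteqP; split => // z Hz.
  have [_ [[n _ Fz] _]] := Hz 0%N I.
  have [_ [_]] := Hz n.+1 I; apply.
  by rewrite /G big_ord_recr/=; right.
have : (mu \o H) n @[n --> \oo] --> mu (\bigcap_n H n).
  apply: nonincreasing_cvg_mu => //.
  - apply: le_lt_trans Xy; apply: le_measure; rewrite ?inE// => z; by case.
  - by rewrite H0.
  - move=> m n mn; apply/subsetPset => z [Xz [Fz Gz]]; split => //; split => //.
    by move=> Gm; apply: Gz; move: z Gm {Xz Fz}; exact: subset_bigsetU.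
rewrite H0 measure0 => /fine_cvgP[Hfin] /cvgrPdist_lt/(_ _ e2).
move=> [N _ /(_ N (leqnn N))] /=; rewrite sub0r normrN ger0_norm ?fine_ge0//.
move=> HN; have HNy : (mu (H N) < (e / 2)%:E)%E.
  rewrite -(@fineK _ (mu (H N))) ?lte_fin// ge0_fin_numE//.
  by apply: le_lt_trans Xy; apply: le_measure; rewrite ?inE// => z; case.
have [_ /(_ _ e2)[s [s01 se]]] := aG N.
exists s; split => //.
have -> : e%:E = ((e / 2)%:E + (e / 2)%:E)%E by rewrite -EFinD -splitr.
apply: le_lt_trans (lteD se HNy).
apply: le_trans (measureU2 _ _ _); [|exact: mbadchi|exact: mH].
apply: le_measure; rewrite ?inE.
- by apply: mbad; apply: cmeasurable_chi; exact: bigcup_measurable.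
- by apply: measurableU => //; exact: mbadchi.
move=> z [Xz /= h].
have [Gz|Gz] := pselect (G N z).
  left; split => //= h'; apply: h; move: h'.
  rewrite !chiE (mem_set Gz) mem_set//; move: Gz; rewrite /G -bigcup_mkord.
  by move=> [n _ Fn]; exists n.
have [Fz|Fz] := pselect ((\bigcup_n F n) z); first by right.
left; split => //= h'; apply: h; move: h'.
by rewrite !chiE memNset// memNset.
Qed.

Let measurable_approx E : measurable E -> approx_set E.
Proof.
rewrite measurable_prod_measurableType; move: E; apply: smallest_sub.
  split => [|A|F]; first exact: approx0.
    by rewrite setTD; exact: approxC.
  exact: approx_bigcup.
by move=> E [A mA [B mB <-]]; exact: approx_rect.
Qed.

(** The bound [M] on the tensors does not depend on [e]; it provides the majorant for dominated
    convergence when norms and pairings pass to the limit. *)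
Let approx_fun (M : R) psi := cmeasurable psi /\ forall e : R, 0 < e ->
  exists s : tensor X1 X2, (forall z, cabs (ev s z) <= M) /\
    (mu (bad s psi e) < e%:E)%E.

Let approx_funD M N f g : approx_fun M f -> approx_fun N g ->
  approx_fun (M + N) (fun z => f z + g z).
Proof.
move=> [mf af] [mg ag]; split; first exact: cmeasurableD.
move=> e e0; have e2 : 0 < e / 2 by rewrite divr_gt0.
have [s [sM se]] := af _ e2; have [t [tN te]] := ag _ e2.
exists (s ++ t); split.
  move=> z; rewrite ev_cat; apply: le_trans (ler_cabsD _ _) _.
  exact: lerD.
have -> : e%:E = ((e / 2)%:E + (e / 2)%:E)%E by rewrite -EFinD -splitr.
apply: le_lt_trans (lteD se te).
apply: le_trans (measureU2 _ _ _); [|exact: mbad|exact: mbad].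
apply: le_measure; rewrite ?inE.
- by apply: mbad; exact: cmeasurableD.
- by apply: measurableU; exact: mbad.
move=> z [Xz /= h].
have [?|h1] := pselect (bad s f (e / 2) z); first by left.
have [?|h2] := pselect (bad t g (e / 2) z); first by right.
exfalso; apply: h; rewrite ev_cat.
have {}h1 : cabs (ev s z - f z) <= e / 2.
  by apply: contrapT => h1'; apply: h1; split.
have {}h2 : cabs (ev t z - g z) <= e / 2.
  by apply: contrapT => h2'; apply: h2; split.
rewrite opprD addrACA; apply: le_trans (ler_cabsD _ _) _.
by rewrite [leRHS](splitr e); exact: lerD.
Qed.

Let approx_funZ M c f : approx_fun M f ->
  approx_fun (cabs c * M) (fun z => c * f z).
Proof.
move=> [mf af]; split; first by apply: cmeasurableM => //; exact: cmeasurable_cst.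
move=> e e0; pose k := cabs c + 1.
have k1 : 1 <= k by rewrite lerDr cabs_ge0.
have k0 : 0 < k by exact: lt_le_trans k1.
have ek : 0 < e / k by rewrite divr_gt0.
have [s [sM se]] := af _ ek; exists (tensZ c s); split.
  by move=> z; rewrite ev_Z cabsM ler_wpM2l ?cabs_ge0.
apply: (@lt_le_trans _ _ (e / k)%:E); last first.
  by rewrite lee_fin ler_pdivrMr// ler_peMr// ltW.
apply: le_lt_trans se; apply: le_measure; rewrite ?inE.
- by apply: mbad; apply: cmeasurableM => //; exact: cmeasurable_cst.
- exact: mbad.
move=> z [Xz /= h]; split => //= h1; apply: h.
rewrite ev_Z -mulrBr cabsM; apply: (@le_trans _ _ (k * (e / k))).
  by apply: ler_pM; rewrite ?cabs_ge0// lerDl.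
by rewrite mulrC divfK// gt_eqF.
Qed.

(** Each binary digit of [r] is the indicator of a measurable set and is approximated by a
    0/1-valued tensor. Weighting the digits by powers of 1/2 keeps the partial sums below
    [1 - 2^-k], uniformly in the accuracy. *)
Let approx_real (r : T1 * T2 -> R) : measurable_fun setT r ->
  (forall z, 0 <= r z <= 1) -> approx_fun 1 (fun z => (r z)%:C%C).
Proof.
move=> mr r01; split; first exact: cmeasurable_real.
pose h k : R := 2^-1 ^+ k.
have h0 k : 0 < h k by rewrite exprn_gt0// invr_gt0.
have hS k : h k = h k.+1 + h k.+1.
  by rewrite /h exprS -mulrDl [X in X * _](_ : _ = 1) ?mul1r//; lra.
pose rem k z := dyadic_rem (r z) k.
have remS k z : rem k.+1 z = rem k z - (if h k.+1 <= rem k z then h k.+1 else 0).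
  by [].
have remB k z : 0 <= rem k z <= h k.
  elim: k => [|k /andP[ih1 ih2]]; first by rewrite /h expr0; exact: r01.
  rewrite remS; case: ifPn => [hk|/negP hk].
    by rewrite subr_ge0 hk/= lerBlDr -hS.
  by rewrite subr0 ih1/= ltW// ltNge; apply/negP.
have mrem k : measurable_fun setT (rem k).
  elim: k => [//|k ih]; rewrite (_ : rem k.+1 = fun z =>
    rem k z - (if h k.+1 <= rem k z then h k.+1 else 0))//.
  apply: measurable_funB => //.
  by apply: measurable_fun_ifT => //; apply: measurable_fun_ler.
have step k : forall e : R, 0 < e -> exists s : tensor X1 X2,
    (forall z, cabs (ev s z) <= 1 - h k) /\
    (mu (bad s (fun z => (r z - rem k z)%:C%C) 0) < e%:E)%E.
  elim: k => [|k ih] e e0.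
    exists [::]; split.
      by move=> z; rewrite /ev big_nil cabs0 /h expr0 subrr.
    rewrite (_ : bad _ _ _ = set0) ?measure0//; apply/seteqP; split => // z [_ /=].
    by rewrite /ev big_nil subrr subr0 cabs0 lexx.
  have e2 : 0 < e / 2 by rewrite divr_gt0.
  have [s [sM se]] := ih _ e2.
  pose E := [set z | h k.+1 <= rem k z].
  have mE : measurable E.
    rewrite -[X in measurable X]setTI.
    have := @measurable_fun_ler _ _ _ setT (cst (h k.+1)) (rem k)
      (measurable_cst _) (mrem k) measurableT [set true].
    by apply.
  have [_ /(_ _ e2)[t [t01 te]]] := measurable_approx mE.
  exists (s ++ tensZ (h k.+1)%:C%C t); split.
    move=> z; rewrite ev_cat ev_Z; apply: le_trans (ler_cabsD _ _) _.
    rewrite cabsM cabs_real gtr0_norm//.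
    have : cabs (ev t z) <= 1 by have [->|->] := t01 z; rewrite ?cabs0 ?cabs1.
    move=> /(ler_wpM2l (ltW (h0 k.+1))); rewrite mulr1.
    by have := sM z; have := hS k; lra.
  have -> : e%:E = ((e / 2)%:E + (e / 2)%:E)%E by rewrite -EFinD -splitr.
  apply: le_lt_trans (lteD se te).
  have mrr j : cmeasurable (fun z => (r z - rem j z)%:C%C).
    by apply: cmeasurable_real; exact: measurable_funB.
  apply: le_trans (measureU2 _ _ _); [|exact: mbad|exact: mbadchi].
  apply: le_measure; rewrite ?inE.
  - exact: mbad.
  - by apply: measurableU; [exact: mbad|exact: mbadchi].
  move=> z [Xz bz].
  have [?|h1] := pselect (bad s (fun z => (r z - rem k z)%:C%C) 0 z); first by left.
  have [?|h2] := pselect (bad t (chi E) 0 z); first by right.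
  exfalso; apply: bz; rewrite /mkset remS.
  have {}h1 : cabs (ev s z - (r z - rem k z)%:C%C) <= 0.
    by apply: contrapT => h1'; apply: h1; split.
  have {}h2 : cabs (ev t z - chi E z) <= 0.
    by apply: contrapT => h2'; apply: h2; split.
  have /eqP : cabs (ev s z - (r z - rem k z)%:C%C) == 0 by rewrite eq_le h1 cabs_ge0.
  have /eqP : cabs (ev t z - chi E z) == 0 by rewrite eq_le h2 cabs_ge0.
  move=> /cabs_eq0/eqP; rewrite subr_eq0 => /eqP tE.
  move=> /cabs_eq0/eqP; rewrite subr_eq0 => /eqP sE.
  rewrite ev_cat ev_Z sE tE chiE.
  rewrite (_ : (z \in E) = (h k.+1 <= rem k z)); last first.
    by apply/idP/idP => [/set_mem//|?]; exact: mem_set.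
  case: ifP => _; rewrite ?mulr1 ?mulr0 -!rmorphD ?addr0 ?subr0 -?rmorphB;
    rewrite cabs_real ?subrr ?normr0//.
  by rewrite [X in `|X|](_ : _ = 0) ?normr0//; ring.
move=> e e0.
have [k hk] : exists k, h k <= e.
  have : h @ \oo --> 0 by apply: cvg_expr; rewrite ger0_norm//; lra.
  move=> /cvgrPdist_le/(_ _ e0)[N _ /(_ N (leqnn N))] /=.
  by rewrite sub0r normrN gtr0_norm// => ?; exists N.
have [s [sM se]] := step k e e0; exists s; split.
  by move=> z; apply: le_trans (sM z) _; rewrite gerBl ltW.
apply: le_lt_trans se; apply: le_measure; rewrite ?inE.
- by apply: mbad; exact: cmeasurable_real.
- by apply: mbad; apply: cmeasurable_real; exact: measurable_funB.
move=> z [Xz /= bz]; split => //= h1; apply: bz.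
have /eqP : cabs (ev s z - (r z - rem k z)%:C%C) == 0 by rewrite eq_le h1 cabs_ge0.
move=> /cabs_eq0/eqP; rewrite subr_eq0 => /eqP ->.
have /andP[r0 rh] := remB k z.
rewrite -rmorphB cabs_real addrAC subrr sub0r normrN ger0_norm//.
exact: le_trans hk.
Qed.

(** Real and imaginary parts are moved affinely into [[0, 1]], approximated there, and recombined
    with the coefficients [2L], [2L i] and [-(L + L i)]. *)
Let approx_bounded psi : cmeasurable psi ->
  (exists M : R, forall z, cabs (psi z) <= M) -> exists N, approx_fun N psi.
Proof.
move=> mpsi [M psiM]; have [mRe mIm] := mpsi.
pose L := `|M| + 1.
have L0 : 0 < L by rewrite ltr_wpDl.
have psiL z : cabs (psi z) <= L.
  by apply: le_trans (psiM z) _; apply: le_trans (ler_norm M) _; rewrite lerDl.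
have bnd (x : R) z : `|x| <= cabs (psi z) -> 0 <= (x / L + 1) / 2 <= 1.
  move=> xz; have : `|x / L| <= 1.
    by rewrite normrM normfV (gtr0_norm L0) ler_pdivrMr// mul1r (le_trans xz).
  by rewrite ler_norml => /andP[? ?]; apply/andP; split; lra.
have a1 := @approx_real (fun z => (complex.Re (psi z) / L + 1) / 2).
have a2 := @approx_real (fun z => (complex.Im (psi z) / L + 1) / 2).
have {}a1 := a1 _ (fun z => bnd _ z (ler_Re_cabs _)).
have {}a2 := a2 _ (fun z => bnd _ z (ler_Im_cabs _)).
have mm (u : T1 * T2 -> R) : measurable_fun setT u ->
    measurable_fun setT (fun z => (u z / L + 1) / 2).
  move=> mu'; apply: measurable_funM => //; apply: measurable_funD => //.
  by apply: measurable_funM.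
have {}a1 := a1 (mm _ mRe); have {}a2 := a2 (mm _ mIm).
have a0 : approx_fun 1 (fun=> 1) by apply: (@approx_real (cst 1)) => // z; rewrite ler01 lexx.
have := approx_funD (approx_funD (approx_funZ (2 * L)%:C%C a1)
  (approx_funZ (Complex 0 (2 * L)) a2)) (approx_funZ (- Complex L L) a0).
set N := (X in approx_fun X _) => aN; exists N.
rewrite (_ : psi = fun x => (2 * L)%:C%C * ((complex.Re (psi x) / L + 1) / 2)%:C%C +
  Complex 0 (2 * L) * ((complex.Im (psi x) / L + 1) / 2)%:C%C + - Complex L L * 1)//.
apply/funext => z; case: (psi z) => x y; apply/eqP.
by rewrite eq_complex /=; apply/andP; split; apply/eqP; field; rewrite gt_eqF.
Qed.

(** Borel-Cantelli: the exceptional sets have measure at most [2^-(n+1)], a summable sequence, so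
    almost every point lies in finitely many of them only. *)
Lemma tensor_dense psi : cmeasurable psi ->
  (exists M : R, forall z, cabs (psi z) <= M) ->
  (forall z, ~ (X1 `*` X2) z -> psi z = 0) ->
  exists (s : nat -> tensor X1 X2) (M : R), (forall n z, cabs (ev (s n) z) <= M) /\
    {ae mu, forall z, (fun n => cabs (ev (s n) z - psi z)) @ \oo --> 0}.
Proof.
move=> mpsi /(approx_bounded mpsi)[M [_ apsi]] psi0.
pose e n : R := 1 / (2 ^ (n + 1))%:R.
have e0 n : 0 < e n by rewrite divr_gt0// ltr0n expn_gt0.
have /choice[s sP] := fun n => apsi (e n) (e0 n).
exists s, M; split; first by move=> n; have [] := sP n.
pose B n := bad (s n) psi (e n).
have mB n : measurable (B n) by exact: mbad.
have sumB : (\sum_(0 <= n <oo) mu (B n) < +oo)%E.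
  apply: (@le_lt_trans _ _ (\sum_(0 <= n <oo) (e n)%:E)%E).
    by apply: lee_nneseries => // n _; have [_ /ltW] := sP n.
  have /cvg_lim := @cvg_geometric_eseries_half R 1 0.
  by move=> ->; rewrite ?ltry.
have B0 := lim_sup_set_cvg0 mB sumB.
exists (lim_sup_set B); split => //.
  by apply: bigcap_measurable => // n _; exact: bigcup_measurable.
move=> z /= h; apply: contrapT => zB; apply: h.
have [Xz|Xz] := pselect (X z); last first.
  rewrite psi0// (_ : (fun n => _) = cst 0); first exact: cvg_cst.
  by apply/funext => n; rewrite ev_off// subrr cabs0.
have [N zN] : exists N, forall n, (N <= n)%N -> ~ B n z.
  apply: contrapT => /forallNP h; apply: zB => n _.
  by have /existsNP[m /not_implyP[nm /contrapT Bm]] := h n; exists m.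
have ecvg : e n @[n --> \oo] --> 0.
  rewrite (_ : e = fun n => 2^-1 ^+ n.+1).
    under eq_fun do rewrite exprS.
    rewrite -(mulr0 2^-1); apply: cvgMr; apply: cvg_expr.
    by rewrite ger0_norm//; lra.
  by apply/funext => n; rewrite /e addn1 natrX div1r exprVn.
apply: (@squeeze_cvgr _ _ _ _ (cst 0) e) => //; last exact: cvg_cst.
near=> n; rewrite /= cabs_ge0/=.
have : ~ B n z by apply: zN; near: n; exact: nbhs_infty_ge.
by move=> Bn; apply: contrapT => h'; apply: Bn; split.
Unshelve. all: by end_near. Qed.

End density.

Section tensor_duality_section.
Context {R : realType} {d1 d2 : measure_display}
  {T1 : measurableType d1} {T2 : measurableType d2}.
Variables (m1 : {sigma_finite_measure set T1 -> \bar R})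
  (m2 : {sigma_finite_measure set T2 -> \bar R}).

Lemma ae_prod_iter (P : T1 * T2 -> Prop) : {ae (m1 \x m2)%E, forall z, P z} ->
  {ae m1, forall x, {ae m2, forall y, P (x, y)}}.
Proof.
move=> [N [mN N0 NP]].
have : {ae (m1 \x m2)%E, forall z, ~ N z} by apply/ae_notP.
move=> /(ae_prod1P _ _ mN); apply: filterS => x; apply: filterS => y Nxy.
by apply: contrapT => Pxy; apply: Nxy; exact: NP.
Qed.

Variables (X1 : set T1) (X2 : set T2).
Hypotheses (mX1 : measurable X1) (mX2 : measurable X2)
  (X1y : (m1 X1 < +oo)%E) (X2y : (m2 X2 < +oo)%E).

Lemma ler_cabs_dist (z w : R[i]) : `|cabs z - cabs w| <= cabs (z - w).
Proof.
rewrite ler_norml; apply/andP; split.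
  rewrite lerNl opprB lerBlDr cabs_distC -{1}(subrK z w).
  exact: ler_cabsD.
by rewrite lerBlDr -{1}(subrK w z) ler_cabsD.
Qed.

(** A bounded test function is an almost-everywhere limit of uniformly bounded tensors. Dominated
    convergence carries both the pairing and the mixed norm to the limit, and the converse Hölder
    inequality applies. *)
Lemma tensor_duality (h : T1 * T2 -> R[i]) p1 p2 (C : R) : cint (m1 \x m2)%E h ->
  (forall z, ~ (X1 `*` X2) z -> h z = 0) -> 1 < p1 -> 1 < p2 -> 0 <= C ->
  (forall s : tensor X1 X2,
    ((cabs (cintegral (m1 \x m2)%E setT (fun z => (h z * ev s z)%R)))%:E <=
      C%:E * mixnorm m1 m2 p1 p2 (ev s))%E) ->
  (mixnorm m1 m2 (p1 / (p1 - 1)) (p2 / (p2 - 1)) h <= C%:E)%E.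
Proof.
move=> ih h0 p11 p21 C0 hC; have [mh _] := ih.
have p10 : 0 < p1 by rewrite (lt_trans _ p11).
have p20 : 0 < p2 by rewrite (lt_trans _ p21).
apply: (converse_hoelder mX1 mX2) => // psi mpsi psiM psi0.
have [s [M [sM scvg]]] := tensor_dense mX1 mX2 X1y X2y mpsi psiM psi0.
have [N psiN] := psiM.
pose F0 z := `|M| * \1_(X1 `*` X2) z.
have mX : measurable (X1 `*` X2) by exact: measurableX.
have mF0 : measurable_fun setT F0.
  by apply: measurable_funM => //; exact: measurable_indic.
have F00 z : 0 <= F0 z <= `|M|.
  by rewrite /F0 indicE; case: (_ \in _); rewrite ?mulr1 ?mulr0 ?lexx ?normr_ge0.
have F0off z : ~ (X1 `*` X2) z -> F0 z = 0.
  by move=> Xz; rewrite /F0 indicE memNset// mulr0.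
have evF0 n z : 0 <= cabs (ev (s n) z) <= F0 z.
  rewrite cabs_ge0/=; have [Xz|Xz] := pselect ((X1 `*` X2) z).
    rewrite /F0 indicE mem_set// mulr1.
    exact: le_trans (sM n z) (ler_norm M).
  by rewrite ev_off// cabs0 F0off.
have mixcvg : (fun n => mixI m1 m2 p1 p2 (fun z => cabs (ev (s n) z))) @ \oo -->
    mixI m1 m2 p1 p2 (fun z => cabs (psi z)).
  apply: (mixI_dominated _ _ mF0 evF0) => //.
  - by move=> n; apply: measurable_cabs; exact: ev_meas.
  - exact: measurable_cabs.
  - by move=> z; exact: cabs_ge0.
  - apply: (@ae_prod_iter (fun z => (fun n => cabs (ev (s n) z)) @ \oo --> cabs (psi z))).
    apply: filterS scvg => z /cvgrPdist_lt zc.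
    apply/cvgrPdist_lt => e /zc; apply: filterS => n.
    rewrite sub0r normrN ger0_norm ?cabs_ge0//; apply: le_lt_trans.
    by rewrite distrC; exact: ler_cabs_dist.
  - exact: (mixI_bounded_lty mX1 mX2 X1y X2y mF0 F00 F0off).
have ucvg : (fun n => C%:E * mixnorm m1 m2 p1 p2 (ev (s n)))%E @ \oo -->
    (C%:E * mixnorm m1 m2 p1 p2 psi)%E.
  apply: cvgeZl => //; rewrite mixnormE//.
  under eq_fun do rewrite mixnormE//.
  by apply: cvg_poweR => [|n|//]; [rewrite invr_gt0|exact: mixI_ge0].
have iev n : cint (m1 \x m2)%E (fun z => h z * ev (s n) z).
  apply: (@cint_le _ _ _ _ _ (fun z => (`|M|)%:C%C * h z)).
  - by apply: cmeasurableM => //; exact: ev_meas.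
  - exact: cintZ.
  - move=> z; rewrite !cabsM cabs_real normr_id mulrC ler_wpM2r ?cabs_ge0//.
    exact: le_trans (sM n z) (ler_norm M).
have ipsi : cint (m1 \x m2)%E (fun z => h z * psi z).
  apply: (@cint_le _ _ _ _ _ (fun z => (`|N|)%:C%C * h z)).
  - exact: cmeasurableM.
  - exact: cintZ.
  - move=> z; rewrite !cabsM cabs_real normr_id mulrC ler_wpM2r ?cabs_ge0//.
    exact: le_trans (psiN z) (ler_norm N).
have wcvg : (fun n => \int[(m1 \x m2)%E]_z
    (cabs (h z * (psi z - ev (s n) z)%R))%:E)%E @ \oo --> 0%E.
  have [] // := @dominated_convergence _ _ _ (m1 \x m2)%E setT measurableT
    (fun n z => (cabs (h z * (psi z - ev (s n) z)))%:E) (cst 0%E)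
    (fun z => ((`|M| + `|N|) * cabs (h z))%:E).
  - move=> n; apply: emeasurable_cabs; apply: cmeasurableM => //.
    by apply: cmeasurableB => //; exact: ev_meas.
  - apply: filterS scvg => z zc _; apply: cvg_EFin; first exact: nearW.
    rewrite -(mulr0 (cabs (h z))).
    rewrite [X in X @ _ --> _](_ : _ =
      fun n => cabs (h z) * cabs (ev (s n) z - psi z)); first exact: cvgMr.
    by apply/funext => n /=; rewrite cabsM cabs_distC.
  - have /(@cint_integrable _ _ _ _ _) := cintZ (`|M| + `|N|)%:C%C ih.
    by apply: eq_integrable => // z _ /=; rewrite cabsM cabs_real ger0_norm ?addr_ge0.
  - apply: aeW => z n _; rewrite gee0_abs ?lee_fin ?cabs_ge0// cabsM mulrC.
    rewrite ler_wpM2r ?cabs_ge0//; apply: le_trans (ler_cabsB _ _) _.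
    rewrite addrC lerD//; first exact: le_trans (sM n z) (ler_norm M).
    exact: le_trans (psiN z) (ler_norm N).
  by rewrite integral0.
have main n : ((cabs (cintegral (m1 \x m2)%E setT (fun z => (h z * psi z)%R)))%:E <=
    C%:E * mixnorm m1 m2 p1 p2 (ev (s n)) + \int[(m1 \x m2)%E]_z
    (cabs (h z * (psi z - ev (s n) z)%R))%:E)%E.
  have -> : cintegral (m1 \x m2)%E setT (fun z => h z * psi z) =
      cintegral (m1 \x m2)%E setT (fun z => h z * ev (s n) z) +
      cintegral (m1 \x m2)%E setT (fun z => h z * psi z - h z * ev (s n) z).
    by rewrite -cintegralD//; [congr cintegral; apply/funext => z; ring|exact: cintB].
  apply: (@le_trans _ _ ((cabs (cintegral (m1 \x m2)%E setT (fun z => h z * ev (s n) z)))%:E +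
    (cabs (cintegral (m1 \x m2)%E setT (fun z => h z * psi z - h z * ev (s n) z)))%:E)%E).
    by rewrite -EFinD lee_fin ler_cabsD.
  apply: leeD; first exact: hC.
  under [in leRHS]eq_integral do rewrite mulrBr.
  by apply: le_cabs_cintegral; exact: cintB.
have cvgD : (fun n => C%:E * mixnorm m1 m2 p1 p2 (ev (s n)) + \int[(m1 \x m2)%E]_z
    (cabs (h z * (psi z - ev (s n) z)%R))%:E)%E @ \oo -->
    (C%:E * mixnorm m1 m2 p1 p2 psi)%E.
  rewrite -[X in _ --> X]adde0; apply: cvgeD => //.
  by rewrite fin_num_adde_defl.
rewrite -(cvg_lim _ cvgD)//; apply: lime_ge; first exact: cvgP cvgD.
exact: nearW.
Qed.

End tensor_duality_section.

(** * Cubes and kernels *)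

Section euclidean_space.
Context {R : realType}.
Implicit Types (n : nat) (l : R).

Lemma enormE n (x : Rn R n) : enorm x = edist x [tuple of nseq n (0 : R)].
Proof.
rewrite /enorm /edist; congr Num.sqrt; apply: eq_bigr => i _.
by rewrite tnth_nseq subr0.
Qed.

Lemma edist_ge0 n (x y : Rn R n) : 0 <= edist x y.
Proof. exact: sqrtr_ge0. Qed.

Lemma sqr_edist n (x y : Rn R n) :
  edist x y ^+ 2 = \sum_(i < n) (tnth x i - tnth y i) ^+ 2.
Proof. by rewrite sqr_sqrtr// sumr_ge0// => i _; exact: sqr_ge0. Qed.

Lemma edist_sym n (x y : Rn R n) : edist x y = edist y x.
Proof.
by congr Num.sqrt; apply: eq_bigr => i _; rewrite -opprB sqrrN.
Qed.

Lemma edistxx n (x : Rn R n) : edist x x = 0.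
Proof.
rewrite /edist (eq_bigr (fun=> 0)) ?big1 ?sqrtr0// => i _.
by rewrite subrr expr0n.
Qed.

Lemma cauchy_schwarz n (a b : 'I_n -> R) :
  \sum_i a i * b i <= Num.sqrt (\sum_i a i ^+ 2) * Num.sqrt (\sum_i b i ^+ 2).
Proof.
set A := \sum_i a i ^+ 2; set B := \sum_i b i ^+ 2; set S := \sum_i _ * _.
have A0 : 0 <= A by apply: sumr_ge0 => i _; exact: sqr_ge0.
have B0 : 0 <= B by apply: sumr_ge0 => i _; exact: sqr_ge0.
have [A00|A00] := eqVneq A 0.
  rewrite A00 sqrtr0 mul0r /S big1// => i _.
  have /eqP := A00; rewrite psumr_eq0 => [/allP/(_ i)|j _]; last exact: sqr_ge0.
  by rewrite mem_index_enum => /(_ isT)/=; rewrite sqrf_eq0 => /eqP ->; rewrite mul0r.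
have Ap : 0 < A by rewrite lt_def A00.
(* This sum of squares equals [A (A B - S^2)], whence [S^2 <= A B] after division by [A > 0]. *)
have : 0 <= \sum_i (A * b i - S * a i) ^+ 2.
  by apply: sumr_ge0 => i _; exact: sqr_ge0.
have -> : \sum_i (A * b i - S * a i) ^+ 2 = A * (A * B - S ^+ 2).
  rewrite (eq_bigr (fun i => A ^+ 2 * b i ^+ 2 - (2 * A * S) * (a i * b i) +
    S ^+ 2 * a i ^+ 2)) => [|i _]; last ring.
  rewrite big_split/= big_split/= sumrN -!mulr_sumr -/A -/B -/S; ring.
rewrite pmulr_rge0// subr_ge0 => SAB.
rewrite -sqrtrM//; apply: le_trans (ler_norm S) _.
by rewrite -sqrtr_sqr ler_wsqrtr.
Qed.

Lemma edist_triangle n (x y z : Rn R n) : edist x z <= edist x y + edist y z.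
Proof.
rewrite -[leRHS]ger0_norm ?addr_ge0 ?edist_ge0// -sqrtr_sqr ler_wsqrtr//.
rewrite sqrrD !sqr_edist.
rewrite (eq_bigr (fun i => (tnth x i - tnth y i) ^+ 2 +
  2 * ((tnth x i - tnth y i) * (tnth y i - tnth z i)) +
  (tnth y i - tnth z i) ^+ 2)) => [|i _]; last ring.
rewrite big_split/= big_split/= lerD2r lerD2l -mulr_sumr -[leRHS]mulr_natl.
by rewrite ler_wpM2l// cauchy_schwarz.
Qed.

Lemma ler_edist_coord n (x y : Rn R n) i : `|tnth x i - tnth y i| <= edist x y.
Proof.
rewrite -sqrtr_sqr ler_wsqrtr// (bigD1 i)//= lerDl.
by apply: sumr_ge0 => j _; exact: sqr_ge0.
Qed.

Lemma ler_edist_sup n (x y : Rn R n) l : 0 <= l ->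
  (forall i, `|tnth x i - tnth y i| <= l) -> edist x y <= n%:R * l.
Proof.
move=> l0 xyl; have nl : 0 <= n%:R * l by rewrite mulr_ge0.
rewrite -[leRHS]ger0_norm// -sqrtr_sqr ler_wsqrtr//.
apply: (@le_trans _ _ (\sum_(i < n) l ^+ 2)).
  by apply: ler_sum => i _; rewrite -[leLHS]real_normK ?num_real// lerXn2r ?nnegrE.
rewrite sumr_const card_ord -[l ^+ 2 *+ n]mulr_natl exprMn ler_wpM2r ?sqr_ge0//.
by rewrite -natrX ler_nat; case: n {x y xyl nl} => // n; rewrite leq_pmulr.
Qed.

Lemma cube_edist n (a x y : Rn R n) l : 0 <= l -> cube a l x -> cube a l y ->
  edist x y <= n%:R * l.
Proof.
move=> l0 ax ay; apply: ler_edist_sup => // i.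
have /andP[? ?] := ax i; have /andP[? ?] := ay i.
by rewrite ler_norml; apply/andP; split; lra.
Qed.

Lemma cube_corner n (a : Rn R n) l : 0 <= l -> cube a l a.
Proof. by move=> l0 i; rewrite lexx lerDl. Qed.

Lemma measurable_cube n (a : Rn R n) l : measurable (cube a l).
Proof.
rewrite (_ : cube a l = \bigcap_(i in [set: 'I_n])
   ((fun x : Rn R n => tnth x i) @^-1` `[tnth a i, tnth a i + l]%classic)).
  apply: fin_bigcap_measurable => // i _; rewrite -[X in measurable X]setTI.
  exact: measurable_tnth.
apply/seteqP; split => x ax i; first by move=> _ /=; rewrite in_itv/=; exact: ax.
by have := ax i I; rewrite /= in_itv.
Qed.

Lemma leb_cons_cube n (m : {sigma_finite_measure set (Rn R n) -> \bar R})
    (a : Rn R n.+1) l :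
  leb_cons m (cube a l) =
  (lebesgue_measure `[thead a, (thead a + l)%R]%classic *
   m (cube [tuple of behead a] l))%E.
Proof.
rewrite /leb_cons /pushforward -product_measure1E//; last exact: measurable_cube.
congr (product_measure1 _ _ _); apply/seteqP; split => -[x t] /=.
  move=> h; split => /=; first by have := h ord0; rewrite in_itv.
  move=> i; have := h (lift ord0 i).
  by rewrite !(tnth_nth 0)/= nth_behead.
move=> [/= xa ta] i; case: (unliftP ord0 i) => [j|] ->.
  by have := ta j; rewrite !(tnth_nth 0)/= nth_behead.
by move: xa; rewrite in_itv.
Qed.

Lemma leb_cube n (a : Rn R n) l : 0 <= l -> leb n (cube a l) = (l ^+ n)%:E.
Proof.
move=> l0; elim: n a => [|n ih] a.
  rewrite /= /dirac (_ : cube a l = setT) ?indicT//.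
  by apply/seteqP; split => // x _ [].
rewrite [LHS](leb_cons_cube (leb n)) ih lebesgue_measure_itv/=.
rewrite lte_fin; case: ltP => [_|].
  by rewrite -EFinB -EFinM exprS addrAC subrr add0r.
rewrite gerDl => l0'; have -> : l = 0 by apply/eqP; rewrite eq_le l0 l0'.
by rewrite mul0e exprS mul0r.
Qed.

Lemma leb_cube_lty n (a : Rn R n) l : 0 <= l -> (leb n (cube a l) < +oo)%E.
Proof. by move=> /leb_cube ->; rewrite ltry. Qed.

Lemma enorm_triangle n (x y : Rn R n) : enorm x <= enorm y + edist x y.
Proof. by rewrite !enormE addrC; exact: edist_triangle. Qed.

Lemma enorm_ge0 n (x : Rn R n) : 0 <= enorm x.
Proof. exact: sqrtr_ge0. Qed.

Lemma ler_enorm2_fst d1 d2 (x : Rn R d1 * Rn R d2) : enorm x.1 <= enorm2 x.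
Proof.
rewrite -[leLHS]ger0_norm ?enorm_ge0// -sqrtr_sqr ler_wsqrtr// lerDl.
exact: sqr_ge0.
Qed.

Lemma ler_enorm2_snd d1 d2 (x : Rn R d1 * Rn R d2) : enorm x.2 <= enorm2 x.
Proof.
rewrite -[leLHS]ger0_norm ?enorm_ge0// -sqrtr_sqr ler_wsqrtr// lerDr.
exact: sqr_ge0.
Qed.

Lemma ler_enorm2_add d1 d2 (x : Rn R d1 * Rn R d2) :
  enorm2 x <= enorm x.1 + enorm x.2.
Proof.
rewrite -[leRHS]ger0_norm ?addr_ge0 ?enorm_ge0// -sqrtr_sqr ler_wsqrtr//.
by rewrite sqrrD lerD2r lerDl mulrn_wge0// mulr_ge0 ?enorm_ge0.
Qed.

Lemma cube_enorm n (a x : Rn R n) l : 0 <= l -> cube a l x ->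
  enorm x <= enorm a + n%:R * l.
Proof.
move=> l0 ax; apply: le_trans (enorm_triangle _ a) _; rewrite lerD2l.
by apply: cube_edist ax _ => //; exact: cube_corner.
Qed.

Lemma ball_cube n (r : R) (x : Rn R n) : 0 <= r -> enorm x <= r ->
  cube [tuple of nseq n (- r)] (2 * r) x.
Proof.
move=> r0 xr i; have := ler_edist_coord x [tuple of nseq n (0 : R)] i.
rewrite -enormE !tnth_nseq subr0 => /le_trans/(_ xr).
by rewrite ler_norml => /andP[? ?]; apply/andP; split; lra.
Qed.

(** The cube is closed: at a point outside, some coordinate misses its interval by [e > 0], so the
    ball of radius [e] does not meet the cube. *)
Lemma supp_cube n (f : Rn R n -> R[i]) (a : Rn R n) l :
  (forall x, ~ cube a l x -> f x = 0) -> supp f `<=` cube a l.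
Proof.
move=> f0 x sx i; apply: contrapT => /negP; rewrite negb_and -!ltNge => h.
pose e := Num.max (tnth a i - tnth x i) (tnth x i - (tnth a i + l)).
have e0 : 0 < e.
  by rewrite /e lt_max; case/orP: h => h; rewrite !subr_gt0 h ?orbT.
have [y xy fy] := sx _ e0.
have ay : cube a l y by apply: contrapT => /f0; move/eqP: fy.
have := le_lt_trans (ler_edist_coord x y i) xy; have /andP[ya1 ya2] := ay i.
rewrite ltr_norml /e => /andP[]; case: (leP (tnth a i - tnth x i)) => _.
  by move=> _; lra.
by move=> ? ?; lra.
Qed.

End euclidean_space.

(** * Measurability from uniform continuity *)

Section uniformly_continuous_measurable.
Context {R : realType}.

Definition grid n (N : nat) (x : Rn R n) : n.-tuple int :=
  [tuple Num.floor (N.+1%:R * tnth x i) | i < n].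

Lemma measurable_grid n N (t : n.-tuple int) :
  measurable [set x : Rn R n | grid N x = t].
Proof.
rewrite (_ : [set x | _] = \bigcap_(i in [set: 'I_n])
  ((fun x : Rn R n => N.+1%:R * tnth x i) @^-1`
     `[(tnth t i)%:~R, (tnth t i + 1)%:~R[%classic)).
  apply: fin_bigcap_measurable => // i _; rewrite -[X in measurable X]setTI.
  by apply: measurable_funM => //; exact: measurable_tnth.
apply/seteqP; split => [x <- i _|x xt].
  rewrite /= in_itv/= /grid tnth_mktuple.
  by rewrite Num.Theory.floor_le_tmp Num.Theory.floorD1_gt.
apply/eq_from_tnth => i; rewrite tnth_mktuple; have := xt i I.
by rewrite /= in_itv/= => /andP[? ?]; apply: Num.Theory.floor_def; apply/andP; split.
Qed.

Lemma grid_edist n N (x y : Rn R n) : grid N x = grid N y ->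
  edist x y <= n%:R * N.+1%:R^-1.
Proof.
move=> xy; apply: ler_edist_sup; first by rewrite invr_ge0.
move=> i; have := congr1 (fun t => tnth t i) xy; rewrite !tnth_mktuple => fxy.
have N0 : 0 < N.+1%:R :> R by rewrite ltr0n.
rewrite -(ler_pM2l N0) divff ?gt_eqF// -[X in X * _](ger0_norm (ltW N0)).
rewrite -normrM mulrBr.
have := Num.Theory.floor_itv (N.+1%:R * tnth x i).
have := Num.Theory.floor_itv (N.+1%:R * tnth y i).
rewrite -fxy intrD => /andP[? ?] /andP[? ?].
by rewrite ler_norml; apply/andP; split; lra.
Qed.

(** A standard kernel is given by size and smoothness bounds alone, so its measurability has to be
    derived: on [D] the function is the limit of functions that are constant on the countably many
    cells of a grid of mesh [1/(N+1)]. *)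
Lemma unif_cont_measurable n (D : set (Rn R n)) (F : Rn R n -> R[i]) :
  measurable D ->
  (forall e : R, 0 < e -> exists2 de : R, 0 < de & forall x y, D x -> D y ->
     edist x y <= de -> cabs (F x - F y) <= e) ->
  cmeasurable (fun x => if x \in D then F x else 0).
Proof.
move=> mD Fuc.
(* A point of [D] in the cell [t]; the default value is taken only on cells that miss [D], where [G]
   is 0. *)
pose rep N t := xget [tuple of nseq n (0 : R)] [set x | D x /\ grid N x = t].
pose G N x := if x \in D then F (rep N (grid N x)) else 0.
have mDb : measurable_fun setT (fun x => x \in D).
  apply: (measurable_fun_bool true).
  rewrite setTI (_ : _ @^-1` _ = D)//.
  by apply/seteqP; split => x /=; [move=> /set_mem|exact: mem_set].
have mG N : cmeasurable (G N).
  apply: cmeasurable_if; [exact: mDb| |exact: cmeasurable_cst].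
  have mcount (h : n.-tuple int -> R) :
      measurable_fun setT (fun x : Rn R n => h (grid N x)).
    move=> _ B mB; rewrite setTI.
    rewrite (_ : _ @^-1` _ = \bigcup_(m : nat)
      (if unpickle m is Some t then
         (if h t \in B then [set x | grid N x = t] else set0) else set0)).
      apply: bigcup_measurable => m _; case: (unpickle m) => [t|//].
      by case: ifP => _ //; exact: measurable_grid.
    apply/seteqP; split => [x Bx|x [m _]].
      by exists (pickle (grid N x)) => //; rewrite pickleK mem_set.
    case: (unpickle m) => // t; case: ifP => // /set_mem Bt /= xt.
    by rewrite xt.
  split; first exact: (mcount (fun t => complex.Re (F (rep N t)))).
  exact: (mcount (fun t => complex.Im (F (rep N t)))).
have GF x : (fun N => cabs (G N x - (if x \in D then F x else 0))) @ \oo --> 0.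
  rewrite /G; case: ifPn => [/set_mem Dx|_]; last first.
    by rewrite subrr cabs0; exact: cvg_cst.
  apply/cvgrPdist_le => e e0; have [de de0 Fde] := Fuc e e0.
  near=> N; rewrite sub0r normrN ger0_norm ?cabs_ge0//.
  have [Dr gr] : [set y | D y /\ grid N y = grid N x] (rep N (grid N x)).
    by apply: (@xgetPex _ _ [set y | D y /\ grid N y = grid N x]); exists x.
  apply: Fde => //; apply: le_trans (grid_edist gr) _.
  rewrite ler_pdivrMr ?ltr0n// -ler_pdivrMl// mulrC.
  apply: (@le_trans _ _ N%:R); last by rewrite ler_nat.
  by near: N; exact: nbhs_infty_ger.
have cvgRe x : (fun N => complex.Re (G N x)) @ \oo -->
    complex.Re (if x \in D then F x else 0).
  apply/cvgrPdist_le => e e0; move/cvgrPdist_le : (GF x) => /(_ _ e0).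
  apply: filterS => N; rewrite sub0r normrN ger0_norm ?cabs_ge0//.
  by rewrite distrC; apply: le_trans; rewrite -ReN -ReD ler_Re_cabs.
have cvgIm x : (fun N => complex.Im (G N x)) @ \oo -->
    complex.Im (if x \in D then F x else 0).
  apply/cvgrPdist_le => e e0; move/cvgrPdist_le : (GF x) => /(_ _ e0).
  apply: filterS => N; rewrite sub0r normrN ger0_norm ?cabs_ge0//.
  by rewrite distrC; apply: le_trans; rewrite -ImN -ImD ler_Im_cabs.
split.
- apply: (measurable_fun_cvg (fun N => (mG N).1)) => x _; exact: cvgRe.
- apply: (measurable_fun_cvg (fun N => (mG N).2)) => x _; exact: cvgIm.
Unshelve. all: by end_near. Qed.

End uniformly_continuous_measurable.

(** * Kernels on distant cubes *)

Section kernel_estimates.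
Context {R : realType} {n : nat}.
Variable K : Rn R n -> Rn R n -> R[i].

Lemma kernel_unif_cont (s : R) : standard_kernel K -> 0 < s ->
  forall e : R, 0 < e -> exists2 de : R, 0 < de & forall x x' y,
    s <= edist x y -> edist x x' <= de ->
    cabs (K x y - K x' y) <= e /\ cabs (K y x - K y x') <= e.
Proof.
move=> [C [al [/andP[al0 _] _ Ksm]]] s0 e e0.
pose S := s `^ (n%:R + al); have S0 : 0 < S by exact: powR_gt0.
pose C' := `|C| + 1; have C0 : 0 < C' by rewrite ltr_wpDl.
pose q := e * S / C'; have q0 : 0 < q by rewrite divr_gt0// mulr_gt0.
(* The first entry brings [x'] within the range of the smoothness condition; the second makes the
   resulting bound [C' |x - x'|^al / S] at most [e]. *)
exists (Num.min (s / 2) (q `^ al^-1)).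
  by rewrite lt_min divr_gt0//= powR_gt0.
move=> x x' y sxy; rewrite le_min => /andP[xx1 xx2].
have xy0 : x != y.
  by apply: contraTneq sxy => ->; rewrite edistxx -ltNge.
have h : edist x x' <= edist x y / 2.
  by apply: le_trans xx1 _; rewrite ler_pM2r ?invr_gt0.
have := Ksm x x' y xy0 h; set A := cabs _; set B := cabs _ => AB.
suff : A + B <= e.
  by have := cabs_ge0 (K x y - K x' y); have := cabs_ge0 (K y x - K y x');
    rewrite -/A -/B => ? ? ?; split; lra.
apply: le_trans AB _.
have p1 : edist x x' `^ al <= q.
  apply: (@le_trans _ _ ((q `^ al^-1) `^ al)).
    by apply: ge0_ler_powR; rewrite ?nnegrE ?edist_ge0 ?powR_ge0// ltW.
  by rewrite -powRrM mulVf ?gt_eqF// powRr1// ltW.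
have p2 : S <= edist x y `^ (n%:R + al).
  apply: ge0_ler_powR; rewrite ?nnegrE ?edist_ge0// ?ltW//.
  by rewrite ltr_wpDl.
have D0 : 0 < edist x y `^ (n%:R + al) by exact: lt_le_trans p2.
apply: (@le_trans _ _ (C' * (q / S))).
  apply: (@le_trans _ _ (C' * (edist x x' `^ al / edist x y `^ (n%:R + al)))).
    apply: ler_wpM2r; first by rewrite divr_ge0 ?powR_ge0.
    by apply: le_trans (ler_norm C) _; rewrite lerDl.
  apply: ler_wpM2l; first exact: ltW.
  apply: ler_pM; rewrite ?powR_ge0 ?invr_ge0 ?powR_ge0//.
  by rewrite lef_pV2 ?posrE.
by rewrite /q (_ : C' * _ = e)//; field; rewrite !gt_eqF.
Qed.

(* The distance [A * l] makes the oscillation of [K] over the two cubes a small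
   multiple, of order [A `^ - alpha], of its size at the corners. *)
Lemma kernel_almost_const (eps : R) : (0 < n)%N -> standard_kernel K ->
  symmetrically_nondegenerate K -> 0 < eps ->
  exists A B c0 : R, [/\ 0 < A, 0 < c0, 0 <= B & forall (a : Rn R n) (l : R), 0 < l ->
    exists (a' : Rn R n) (k k' : R[i]),
    [/\ edist a a' <= B * l,
        forall x y, cube a' l x -> cube a l y -> n%:R * l <= edist x y,
        (c0 * (A * l) ^+ n)^-1 <= cabs k /\ (c0 * (A * l) ^+ n)^-1 <= cabs k' &
        forall x y, cube a' l x -> cube a l y ->
          cabs (K x y - k) <= eps * cabs k /\
          cabs (K y x - k') <= eps * cabs k']].
Proof.
move=> n0 [C [al [/andP[al0 al1] Ksz Ksm]]] [c0 c00 Knd] eps0.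
pose N : R := n%:R; have N0 : 0 < N by rewrite ltr0n.
have N1 : 1 <= N by rewrite ler1n.
pose C' := `|C| + 1; have C0 : 0 < C' by rewrite ltr_wpDl.
(* [q] is chosen so that [2 * C' * c0 * 2 ^+ n.+1 * N * q = eps] *)
pose q := eps / (2 * C' * c0 * 2 ^+ n.+1 * N).
have q0 : 0 < q by rewrite divr_gt0// !mulr_gt0// exprn_gt0.
(* The summand [3 N] separates the cubes, whose points lie within [N l] of the corners; the other
   one yields [A^(-al) <= q]. *)
pose A := 3 * N + (q^-1) `^ al^-1.
have A3 : 3 * N <= A by rewrite lerDl powR_ge0.
have A0 : 0 < A by apply: lt_le_trans A3; rewrite mulr_gt0.
have Aq : A `^ (- al) <= q.
  rewrite powRN -[leRHS]invrK lef_pV2 ?posrE ?invr_gt0 ?powR_gt0//.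
  apply: (@le_trans _ _ (((q^-1) `^ al^-1) `^ al)).
    by rewrite -powRrM mulVf ?gt_eqF// powRr1// invr_ge0 ltW.
  apply: ge0_ler_powR; rewrite ?nnegrE ?powR_ge0 ?(ltW A0) ?(ltW al0)//.
  by rewrite lerDr mulr_ge0// ltW.
exists A, (A * (1 + C' * c0)), c0; split => //.
  by rewrite mulr_ge0 ?(ltW A0)// addr_ge0// mulr_ge0// ltW.
move=> a l l0; pose r := A * l; have r0 : 0 < r by rewrite mulr_gt0.
have [a' [ra k1 k2]] := Knd a r r0.
exists a', (K a' a), (K a a').
have aa' : a != a'.
  by apply: contraTneq ra => ->; rewrite edistxx -ltNge.
have a'a : a' != a by rewrite eq_sym.
have r0n : 0 < c0 * r ^+ n by rewrite mulr_gt0// exprn_gt0.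
move: k1 k2; rewrite !div1r => k1 k2.
have Nl0 : 0 < N * l by rewrite mulr_gt0.
have Nlr : 3 * (N * l) <= r by rewrite mulrA ler_pM2r.
pose D := edist a a'; have Dr : r <= D by rewrite /D edist_sym.
have D0 : 0 < D by exact: lt_le_trans Dr.
have xa' x : cube a' l x -> edist x a' <= N * l.
  by move=> cx; apply: (cube_edist (ltW l0) cx); exact: cube_corner (ltW l0).
have ya y : cube a l y -> edist y a <= N * l.
  by move=> cy; apply: (cube_edist (ltW l0) cy); exact: cube_corner (ltW l0).
pose osc := 2 * C' * 2 ^+ n.+1 * N * A `^ (- al) / r ^+ n.
have osc1 z z' : (c0 * r ^+ n)^-1 <= cabs z -> cabs (z' - z) <= osc ->
    cabs (z' - z) <= eps * cabs z.
  move=> zk /le_trans; apply.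
  apply: (@le_trans _ _ (eps * (c0 * r ^+ n)^-1)); last by rewrite ler_pM2l.
  rewrite invfM mulrA /osc ler_pM2r ?invr_gt0 ?exprn_gt0//.
  apply: (@le_trans _ _ (2 * C' * 2 ^+ n.+1 * N * q)).
    by rewrite ler_pM2l// !mulr_gt0// exprn_gt0.
  rewrite /q le_eqVlt; apply/orP; left; apply/eqP; field.
  by rewrite !gt_eqF// exprn_gt0.
(* The two arguments of the kernel are moved from the corners one at a time, and each move costs at
   most [osc / 2]. *)
have smooth u v w : D / 2 <= edist u w -> edist u v <= N * l -> u != w ->
    edist u v <= edist u w / 2 -> cabs (K u w - K v w) <= osc / 2 /\
    cabs (K w u - K w v) <= osc / 2.
  move=> Duw uvl uw uv2; have := Ksm u v w uw uv2.
  set X1 := cabs _; set X2 := cabs _ => X12.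
  suff : X1 + X2 <= osc / 2.
    have := cabs_ge0 (K u w - K v w); have := cabs_ge0 (K w u - K w v).
    by rewrite -/X1 -/X2 => ? ? ?; split; lra.
  apply: le_trans X12 _.
  have al0' := ltW al0; have A0' := ltW A0; have l0' := ltW l0; have N0' := ltW N0.
  have e1 : edist u v `^ al <= N * l `^ al.
    apply: (@le_trans _ _ ((N * l) `^ al)).
      by apply: ge0_ler_powR; rewrite ?nnegrE ?edist_ge0 ?mulr_ge0.
    rewrite powRM// ler_wpM2r ?powR_ge0// -[leRHS](powRr1 N0').
    by rewrite ler_powR.
  have r2 : 0 < r / 2 by rewrite divr_gt0.
  have e2 : (r ^+ n / 2 ^+ n) * (A `^ al * l `^ al / 2) <=
      edist u w `^ (n%:R + al).
    apply: (@le_trans _ _ ((r / 2) `^ (n%:R + al))); last first.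
      apply: ge0_ler_powR; rewrite ?nnegrE ?edist_ge0 ?(ltW r2) ?addr_ge0//.
      by apply: le_trans Duw; rewrite ler_pM2r// invr_gt0.
    rewrite powRD ?(gt_eqF r2) ?implybT// powR_mulrn ?(ltW r2)// expr_div_n.
    rewrite ler_wpM2l ?divr_ge0 ?exprn_ge0 ?(ltW r0)//.
    rewrite powRM ?(ltW r0) ?invr_ge0// powRM// ler_wpM2l ?mulr_ge0 ?powR_ge0//.
    rewrite -[X in X <= _](powRr1 (_ : 0 <= 2^-1)) ?invr_ge0//.
    by apply: ger_powR => //; apply/andP; split; [rewrite invr_gt0|rewrite invf_le1// ler1n].
  have la0 : 0 < l `^ al by rewrite powR_gt0.
  have Aa0 : 0 < A `^ al by rewrite powR_gt0.
  have rn0 : 0 < r ^+ n by rewrite exprn_gt0.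
  have tn0 : 0 < (2 : R) ^+ n by rewrite exprn_gt0.
  have e2p : 0 < (r ^+ n / 2 ^+ n) * (A `^ al * l `^ al / 2).
    by rewrite mulr_gt0// divr_gt0// mulr_gt0.
  have e2q := lt_le_trans e2p e2.
  apply: (@le_trans _ _ (C' * (N * l `^ al /
      ((r ^+ n / 2 ^+ n) * (A `^ al * l `^ al / 2))))).
    apply: (@le_trans _ _ (C' * (edist u v `^ al / edist u w `^ (n%:R + al)))).
      apply: ler_wpM2r; first by rewrite divr_ge0 ?powR_ge0.
      by apply: le_trans (ler_norm C) _; rewrite lerDl.
    apply: ler_wpM2l; first exact: ltW.
    have edV0 : 0 <= (edist u w `^ (n%:R + al))^-1 by rewrite invr_ge0 powR_ge0.
    apply: (ler_pM (powR_ge0 _ _) edV0 e1).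
    by rewrite lef_pV2 ?posrE.
  rewrite /osc powRN exprS le_eqVlt; apply/orP; left; apply/eqP; field.
  by rewrite !gt_eqF.
split.
- rewrite -/D mulrAC -/r.
  (* Nondegeneracy only places [a'] at distance at least [r]. An upper bound follows by comparing
     the lower bound for the kernel at [(a', a)] with the size condition. *)
  have Dn : D ^+ n <= C' * c0 * r ^+ n.
    have := le_trans k1 (Ksz _ _ a'a); rewrite edist_sym -/D => h.
    have Dn0 : 0 < D ^+ n by rewrite exprn_gt0.
    have : (c0 * r ^+ n)^-1 <= C' / D ^+ n.
      apply: le_trans h _; apply: ler_wpM2r; first by rewrite invr_ge0 ltW.
      by apply: le_trans (ler_norm C) _; rewrite lerDl.
    by rewrite ler_pdivlMr// ler_pdivrMl// mulrC mulrA.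
  have [Dlr|rD] := leP D r.
    by apply: le_trans Dlr _; rewrite ler_peMr ?(ltW r0)// lerDl mulr_ge0// ltW.
  (* Since [D / r] is at least 1 here, it is at most its [n]-th power, so no [n]-th root is taken;
     this gives [1 + C' c0] in the bound. *)
  have Drn : D / r <= (D / r) ^+ n.
    case: (n) n0 => // m _; rewrite exprS ler_peMr ?divr_ge0 ?(ltW D0) ?(ltW r0)//.
    by rewrite exprn_ege1// ler_pdivlMr// mul1r ltW.
  have : D / r <= C' * c0.
    apply: le_trans Drn _; rewrite expr_div_n ler_pdivrMr ?exprn_gt0//.
  rewrite ler_pdivrMr// => /le_trans; apply; rewrite mulrC ler_pM2l//.
  by rewrite lerDr.
- move=> x y cx cy.
  have := edist_triangle a' x a; have := edist_triangle x y a.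
  have := xa' _ cx; have := ya _ cy.
  rewrite (edist_sym a' x) (edist_sym a' a) -/D -/N; lra.
- by split.
move=> x y cx cy; have xl := xa' _ cx; have yl := ya _ cy.
have t1 := edist_triangle a' y a; rewrite (edist_sym a' a) -/D in t1.
have Da'y : D / 2 <= edist a' y by lra.
have a'y : a' != y.
  apply/eqP => E; move: Da'y; rewrite -E edistxx; lra.
have s1 := smooth a' x y Da'y _ a'y.
rewrite (edist_sym a' x) in s1.
have [|s11 s12] := s1 xl; first lra.
have Daa : D / 2 <= edist a a' by rewrite -/D; lra.
have s2 := smooth a y a' Daa _ aa'.
rewrite (edist_sym a y) -/D in s2.
have [|s21 s22] := s2 yl; first lra.
split; apply: osc1 => //.
- rewrite (_ : K x y - K a' a = - (K a' y - K x y) - (K a' a - K a' y)); last ring.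
  apply: le_trans (ler_cabsB _ _) _; rewrite cabsN; lra.
- rewrite (_ : K y x - K a a' = - (K y a' - K y x) - (K a a' - K y a')); last ring.
  apply: le_trans (ler_cabsB _ _) _; rewrite cabsN; lra.
Qed.

End kernel_estimates.

(** * Near averages on reflected cubes *)

Section integral_tools.
Context {R : realType} {d : measure_display} {T : measurableType d}.
Variable mu : {measure set T -> \bar R}.
Implicit Types f g : T -> R[i].

Definition l1norm f : R := \int[mu]_x cabs (f x).

Lemma l1normE f : cint mu f -> ((l1norm f)%:E = \int[mu]_x (cabs (f x))%:E)%E.
Proof.
move=> [mf fy]; rewrite /l1norm /Rintegral fineK// ge0_fin_numE//.
by apply: integral_ge0 => x _; rewrite lee_fin cabs_ge0.
Qed.

Lemma l1norm_ge0 f : 0 <= l1norm f.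
Proof. by apply: Rintegral_ge0 => x _; exact: cabs_ge0. Qed.

Lemma ler_cabs_cintegral f : cint mu f -> cabs (cintegral mu setT f) <= l1norm f.
Proof. by move=> cf; rewrite -lee_fin l1normE//; exact: le_cabs_cintegral. Qed.

Lemma ler_l1norm f g (c : R) : cint mu f -> cint mu g -> 0 <= c ->
  {ae mu, forall x, cabs (f x) <= c * cabs (g x)} -> l1norm f <= c * l1norm g.
Proof.
move=> cf cg c0 fg; have [mf _] := cf; have [mg _] := cg.
rewrite -lee_fin EFinM !l1normE// -ge0_integralZl_EFin//; last 2 first.
- by move=> x _; rewrite lee_fin cabs_ge0.
- exact: emeasurable_cabs.
apply: ae_ge0_le_integral => //.
- by move=> x _; rewrite lee_fin cabs_ge0.
- exact: emeasurable_cabs.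
- by move=> x _; rewrite mule_ge0// lee_fin ?cabs_ge0.
- by apply: emeasurable_funM => //; exact: emeasurable_cabs.
- by apply: filterS fg => x h _; rewrite -EFinM lee_fin.
Qed.

Lemma cint_chi (A : set T) : measurable A -> (mu A < +oo)%E -> cint mu (chi A).
Proof.
move=> mA Ay; apply: (@cint_bounded _ _ _ mu _ A 1) => //.
- exact: cmeasurable_chi.
- by move=> x; rewrite chiE; case: ifP; rewrite ?cabs1 ?cabs0.
- by move=> x Ax; rewrite chiE memNset.
Qed.

Lemma cabs_chi (A : set T) x : cabs (chi A x : R[i]) = \1_A x.
Proof. by rewrite cabs_real ger0_norm. Qed.

Lemma l1norm_chi (A : set T) : measurable A -> (mu A < +oo)%E ->
  l1norm (chi A) = fine (mu A).
Proof.
move=> mA Ay; rewrite /l1norm /Rintegral; congr fine.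
under eq_integral do rewrite cabs_chi.
by rewrite integral_indic// setIT.
Qed.

(* Testing against [g = conj F / |F|] on [{c < |F| <= m}], where [F] is integrable. *)
Lemma ae_bound_by_testing (Y : set T) f (c : R) : measurable Y -> (mu Y < +oo)%E ->
  cmeasurable f -> 0 <= c ->
  (forall g : bfun Y, cabs (cintegral mu setT (fun x => f x * g x)) <= c * l1norm g) ->
  {ae mu, forall x, Y x -> cabs (f x) <= c}.
Proof.
move=> mY Yy mf c0 fg.
have key (m : nat) : {ae mu, forall x, Y x -> cabs (f x) <= m%:R -> cabs (f x) <= c}.
  pose E := Y `&` [set x | cabs (f x) <= m%:R] `&` ~` [set x | cabs (f x) <= c].
  have mle (r : R) : 0 <= r -> measurable [set x | cabs (f x) <= r].
    move=> r0; have -> : r = cabs (r%:C%C) by rewrite cabs_real ger0_norm.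
    by apply: measurable_cabs_le => //; exact: cmeasurable_cst.
  have mE : measurable E.
    by apply: measurableI; [apply: measurableI|apply: measurableC] => //; exact: mle.
  have Ey : (mu E < +oo)%E.
    by apply: le_lt_trans Yy; apply: le_measure; rewrite ?inE// => x [[]].
  pose gv x := cconj (f x) * ((cabs (f x))^-1)%:C%C * chi E x.
  have mg : cmeasurable gv.
    apply: cmeasurableM; last exact: cmeasurable_chi.
    apply: cmeasurableM; first exact: cmeasurable_conj.
    apply: cmeasurable_real; rewrite (_ : (fun x => _) = fun x => cabs (f x) `^ (-1)).
      by apply: (measurableT_comp (measurable_powR _)); exact: measurable_cabs.
    by apply/funext => x; rewrite powR_inv1// cabs_ge0.
  have fpos x : E x -> 0 < cabs (f x).
    by move=> [_ /negP]; rewrite -ltNge; exact: le_lt_trans.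
  have gE x : cabs (gv x) = \1_E x.
    rewrite /gv !cabsM cabs_chi cabs_conj cabs_real ger0_norm ?invr_ge0 ?cabs_ge0//.
    have [Ex|Ex] := pselect (E x); last by rewrite indicE memNset// mulr0.
    by rewrite divff ?mul1r// gt_eqF// fpos.
  have gb : exists M : R, forall x, cabs (gv x) <= M.
    by exists 1 => x; rewrite gE indicE; case: (_ \in _).
  have g0 x : ~ Y x -> gv x = 0.
    move=> Yx; apply: cabs_eq0; rewrite gE indicE memNset// => -[[]].
    by move=> /Yx.
  have fgE x : f x * gv x = (cabs (f x) * \1_E x)%:C%C.
    rewrite /gv /chi mulrA (mulrA (f x)) cconjM -!rmorphM/=; congr (_%:C%C).
    have [Ex|Ex] := pselect (E x); last by rewrite indicE memNset// !mulr0.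
    by rewrite expr2 mulfK// gt_eqF// fpos.
  have := fg (BFun mg gb g0) : cabs (cintegral mu setT (fun x => f x * gv x)) <=
    c * l1norm gv.
  rewrite (_ : (fun x => f x * gv x) = fun x => (cabs (f x) * \1_E x)%:C%C); last first.
    by apply/funext.
  rewrite cintegral_real cabs_real ger0_norm; last first.
    by apply: Rintegral_ge0 => x _; rewrite mulr_ge0 ?cabs_ge0.
  have -> : l1norm gv = fine (mu E).
    rewrite -l1norm_chi//; apply: eq_Rintegral => x _.
    by rewrite gE cabs_chi.
  have i1 : mu.-integrable setT (fun x => (cabs (f x) * \1_E x)%:E).
    have : cint mu (fun x => f x * chi E x).
      apply: (@cint_bounded _ _ _ mu _ E m%:R) => //.
      - by apply: cmeasurableM => //; exact: cmeasurable_chi.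
      - move=> x; rewrite cabsM cabs_chi indicE.
        have [Ex|Ex] := pselect (E x).
          by rewrite mem_set// mulr1; case: Ex => -[].
        by rewrite memNset// mulr0.
      - by move=> x Ex; rewrite chiE memNset// mulr0.
    move=> /cint_integrable; apply: eq_integrable => // x _.
    by rewrite cabsM cabs_chi.
  have i2 : mu.-integrable setT (fun x => (c * \1_E x)%:E).
    have := cint_integrable (cintZ c%:C%C (cint_chi mE Ey)).
    apply: eq_integrable => // x _.
    by rewrite cabsM cabs_chi cabs_real ger0_norm.
  have <- : \int[mu]_x (c * \1_E x) = c * fine (mu E).
    rewrite RintegralZl//; last first.
      have := cint_integrable (cint_chi mE Ey).
      by apply: eq_integrable => // x _; rewrite cabs_chi.
    rewrite -l1norm_chi//; congr (_ * _); apply: eq_Rintegral => x _.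
    by rewrite cabs_chi.
  rewrite -subr_le0 -RintegralB// => h.
  have pos x : 0 <= cabs (f x) * \1_E x - c * \1_E x.
    rewrite -mulrBl; have [Ex|Ex] := pselect (E x).
      by case: (Ex) => _ /negP; rewrite -ltNge => /ltW ?; rewrite mulr_ge0// subr_ge0.
    by rewrite indicE memNset// mulr0.
  have mpos : measurable_fun setT (fun x => (cabs (f x) * \1_E x - c * \1_E x)%:E).
    have := integrableB measurableT i1 i2 => /measurable_int.
    by apply: eq_measurable_fun => x _; rewrite EFinB.
  have int0 : (\int[mu]_x `|(cabs (f x) * \1_E x - c * \1_E x)%:E| = 0)%E.
    under eq_integral do rewrite gee0_abs ?lee_fin//.
    have : mu.-integrable setT (fun x => (cabs (f x) * \1_E x - c * \1_E x)%:E).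
      by have := integrableB measurableT i1 i2; apply: eq_integrable.
    move=> /(integrable_fin_num measurableT) fi.
    apply/eqP; rewrite eq_le integral_ge0 ?andbT => [|x _]; last by rewrite lee_fin.
    by rewrite -(fineK fi) lee_fin.
  have /(ae_eq_integral_abs mu measurableT mpos) := int0.
  apply: filterS => x /(_ I)/= [] /eqP; rewrite -mulrBl mulf_eq0 => xE Yx fm.
  rewrite leNgt; apply/negP => cf; move: xE.
  rewrite indicE mem_set; last by split=> //; apply/negP; rewrite -ltNge.
  by rewrite oner_eq0 orbF subr_eq0 gt_eqF.
(* Every modulus lies below some integer height, and countably many null sets have a null union. *)
have := ae_foralln key; apply: filterS => x h Yx.
apply: (h (Num.truncn (cabs (f x))).+1 Yx); apply: ltW.
exact: truncnS_gt.
Qed.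

Lemma bfun_in_Lp (X : set T) (f : bfun X) (p : R) : measurable X ->
  (mu X < +oo)%E -> 0 < p -> in_Lp mu p f.
Proof.
move=> mX Xy p0; split; first exact: bfun_meas.
rewrite /Lp_norm unlock/=; apply: poweR_lty.
have [M fM] := bfun_bound f.
under eq_integral do rewrite ger0_norm ?cabs_ge0//.
apply: (integral_powR_lty mX Xy p0 (M := M)).
- by apply: measurable_cabs; exact: bfun_meas.
- by move=> x; rewrite cabs_ge0 fM.
- by move=> x /(bfun_off f) ->; rewrite cabs0.
Qed.

(** From [t <= t^2 + 1] the product is dominated by [M (|f|^2 + 1)] on [X], where [M] bounds [g]. *)
Lemma in_L2_cint f (X : set T) (g : bfun X) : measurable X -> (mu X < +oo)%E ->
  in_Lp mu 2 f -> cint mu (fun x => f x * g x).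
Proof.
move=> mX Xy [mf]; rewrite /Lp_norm unlock/= => /lty_poweRy.
rewrite invr_eq0 pnatr_eq0 => /(_ isT) f2; have [M gM] := bfun_bound g.
have i2 : cint mu (fun x => f x * f x).
  split; first exact: cmeasurableM.
  apply: le_lt_trans f2; apply: ge0_le_integral => //.
  - by move=> x _; rewrite lee_fin cabs_ge0.
  - by apply: emeasurable_cabs; exact: cmeasurableM.
  - under eq_fun do rewrite ger0_norm ?cabs_ge0//.
    by apply: measurable_powR_fun; exact: measurable_cabs.
  - move=> x _; rewrite lee_fin cabsM ger0_norm ?cabs_ge0//.
    by rewrite powR_mulrn ?cabs_ge0// expr2.
have i3 := cintD i2 i2.
apply: (@cint_dom _ _ _ mu _ (fun x => `|M|%:C%C * ((cabs (f x * f x))%:C%C + chi X x))).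
- by apply: cmeasurableM => //; exact: bfun_meas.
- apply: cintZ; apply: cintD; last exact: cint_chi.
  apply: cint_le i2 _; first by apply: cmeasurable_real; apply: measurable_cabs; exact: cmeasurableM.
  by move=> x; rewrite cabs_real ger0_norm ?cabs_ge0.
apply: aeW => x; rewrite !cabsM cabs_real normr_id.
have [Xx|Xx] := pselect (X x); last by rewrite bfun_off// cabs0 mulr0 mulr_ge0// cabs_ge0.
rewrite mulrC; apply: ler_pM; rewrite ?cabs_ge0//.
  by apply: le_trans (gM x) _; exact: ler_norm.
rewrite chiE mem_set// -(rmorph1 (real_complex R)) -rmorphD cabs_real.
rewrite ger0_norm ?addr_ge0 ?mulr_ge0 ?cabs_ge0//.
have := sqr_ge0 (cabs (f x) - 1); have := cabs_ge0 (f x); rewrite expr2; nra.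
Qed.

End integral_tools.

(** * Functions in L^2 and bounded operators on representatives *)

Section L2_functions.
Context {R : realType} {d : measure_display} {T : measurableType d}.
Variable mu : {measure set T -> \bar R}.
Implicit Types f g : T -> R[i].

Lemma in_LpP (p : R) f : 0 < p ->
  in_Lp mu p f <-> cmeasurable f /\ (\int[mu]_x (cabs (f x) `^ p)%:E < +oo)%E.
Proof.
move=> p0; rewrite /in_Lp /Lp_norm unlock/=.
under eq_integral do rewrite ger0_norm ?cabs_ge0//.
split=> -[mf h]; split => //; last exact: poweR_lty.
by apply: lty_poweRy h; rewrite invr_neq0// gt_eqF.
Qed.

Lemma in_L2_lincomb (a : R[i]) f g : in_Lp mu 2 f -> in_Lp mu 2 g ->
  in_Lp mu 2 (fun x => a * f x + g x).
Proof.
have p2 : (0 : R) < 2 by [].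
move=> fL gL; have [mf f2] := (in_LpP f p2).1 fL; have [mg g2] := (in_LpP g p2).1 gL.
apply: (in_LpP _ p2).2.
have mfg : cmeasurable (fun x => a * f x + g x).
  by apply: cmeasurableD => //; apply: cmeasurableM => //; exact: cmeasurable_cst.
split; first exact: mfg.
have m2 h : cmeasurable h -> measurable_fun setT (fun x => (cabs (h x) `^ 2)%:E).
  by move=> mh; apply: measurable_powR_fun; exact: measurable_cabs.
apply: (@le_lt_trans _ _ (\int[mu]_x ((2 * cabs a ^+ 2)%:E * (cabs (f x) `^ 2)%:E
    + 2%:E * (cabs (g x) `^ 2)%:E))%E).
  apply: ge0_le_integral => //.
  - by move=> x _; rewrite lee_fin powR_ge0.
  - exact: m2.
  - by apply: emeasurable_funD; apply: emeasurable_funM => //; exact: m2.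
  - move=> x _; rewrite -!EFinM -EFinD lee_fin !powR_mulrn ?cabs_ge0//.
    have := ler_cabsD (a * f x) (g x); rewrite cabsM.
    have := cabs_ge0 (a * f x + g x); have := cabs_ge0 a; have := cabs_ge0 (f x).
    have := cabs_ge0 (g x); have := sqr_ge0 (cabs a * cabs (f x) - cabs (g x)).
    rewrite !expr2; nra.
rewrite ge0_integralD//; first last.
- by apply: emeasurable_funM => //; exact: m2.
- by move=> x _; rewrite -EFinM lee_fin; apply: mulr_ge0; rewrite ?powR_ge0// mulr_ge0// sqr_ge0.
- by apply: emeasurable_funM => //; exact: m2.
- by move=> x _; rewrite -EFinM lee_fin; apply: mulr_ge0; rewrite ?powR_ge0// mulr_ge0// sqr_ge0.
rewrite !ge0_integralZl_EFin ?mulr_ge0 ?sqr_ge0 ?cabs_ge0//; first last.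
- exact: m2.
- by move=> x _; rewrite lee_fin powR_ge0.
- exact: m2.
- by move=> x _; rewrite lee_fin powR_ge0.
have c0 : (0%:E <= (2 * cabs a ^+ 2)%:E)%E by rewrite lee_fin mulr_ge0// sqr_ge0.
have two0 : (0%:E <= 2%:E :> \bar R)%E by rewrite lee_fin.
exact: (lte_add_pinfty (lte_mul_pinfty c0 isT f2) (lte_mul_pinfty two0 isT g2)).
Qed.

Lemma in_Lp0 (p : R) : 0 < p -> in_Lp mu p (fun=> 0).
Proof.
move=> p0; apply: (in_LpP _ p0).2; split; first exact: cmeasurable_cst.
by under eq_integral do rewrite cabs0 powR0 ?gt_eqF//; rewrite integral0.
Qed.

Lemma in_L2_sum I (s : seq I) (c : I -> R[i]) (F : I -> T -> R[i]) :
  (forall i, in_Lp mu 2 (F i)) -> in_Lp mu 2 (fun x => \sum_(i <- s) c i * F i x).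
Proof.
move=> F2; elim: s => [|i s ih].
  by under eq_fun do rewrite big_nil; exact: in_Lp0.
by under eq_fun do rewrite big_cons; exact: in_L2_lincomb.
Qed.

Lemma in_Lp_ae (p : R) f g : 0 < p -> cmeasurable g -> {ae mu, forall x, g x = f x} ->
  in_Lp mu p f -> in_Lp mu p g.
Proof.
move=> p0 mg gf fL; have [mf fp] := (in_LpP f p0).1 fL.
apply: (in_LpP g p0).2; split; first exact: mg.
apply: le_lt_trans fp; apply: ae_ge0_le_integral => //.
- by move=> x _; rewrite lee_fin powR_ge0.
- by apply: measurable_powR_fun; exact: measurable_cabs.
- by move=> x _; rewrite lee_fin powR_ge0.
- by apply: measurable_powR_fun; exact: measurable_cabs.
- by apply: filterS gf => x -> _.
Qed.

Lemma ae_eq_sum I (s : seq I) (F G : I -> T -> R[i]) :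
  (forall i, {ae mu, forall x, F i x = G i x}) ->
  {ae mu, forall x, \sum_(i <- s) F i x = \sum_(i <- s) G i x}.
Proof.
move=> FG; elim: s => [|i s ih]; first by apply: aeW => x; rewrite !big_nil.
by apply: filterS2 (FG i) ih => x e1 e2; rewrite !big_cons e1 e2.
Qed.

End L2_functions.

Section bounded_operators.
Context {R : realType} {n : nat}.
Variable T : (Rn R n -> R[i]) -> (Rn R n -> R[i]).
Hypothesis Tb : Lp_bounded_operator T.

Local Notation mu := (leb n).

Let two1 : (1 : R) < 2. Proof. by rewrite ltr1n. Qed.
Let two0 : (0 : R) < 2. Proof. by []. Qed.

Lemma op_linear (a : R[i]) f g : in_Lp mu 2 f -> in_Lp mu 2 g ->
  {ae mu, forall x, T (fun y => a * f y + g y) x = a * T f x + T g x}.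
Proof. by have [+ _] := Tb two1; exact. Qed.

Lemma op_in_L2 f : in_Lp mu 2 f -> in_Lp mu 2 (T f).
Proof. by have [_ [M TM]] := Tb two1 => /TM[]. Qed.

(** The L^2 bound sends a function of norm 0 to a function of norm 0. *)
Lemma op_ae0 f : cmeasurable f -> {ae mu, forall x, f x = 0} ->
  {ae mu, forall x, T f x = 0}.
Proof.
move=> mf f0; have f2 : in_Lp mu 2 f by apply: (in_Lp_ae _ mf f0) => //; exact: in_Lp0.
have [_ [M TM]] := Tb two1; have [[mTf _] /=] := TM f f2.
have -> : Lp_norm mu 2 f = 0%E.
  rewrite /Lp_norm unlock/= (ae_eq_integral (cst 0%E))//.
  - by rewrite integral0 poweR0r// invr_neq0.
  - apply: measurable_powR_fun; under eq_fun do rewrite ger0_norm ?cabs_ge0//.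
    exact: measurable_cabs.
  - by apply: filterS f0 => x -> _; rewrite cabs0 normr0 powR0// gt_eqF.
rewrite mule0 /Lp_norm unlock/= => h.
have : (\int[mu]_x `|(cabs (T f x) `^ 2)%:E| = 0)%E.
  under eq_integral do rewrite gee0_abs ?lee_fin ?powR_ge0//.
  have : (0 <= \int[mu]_x (cabs (T f x) `^ 2)%:E)%E.
    by apply: integral_ge0 => x _; rewrite lee_fin powR_ge0.
  have {h} : ((\int[mu]_x (cabs (T f x) `^ 2)%:E) `^ 2^-1 <= 0%R)%E.
    have <- : (\int[mu]_x (`|cabs (T f x)| `^ 2)%:E = \int[mu]_x (cabs (T f x) `^ 2)%:E)%E.
      by apply: eq_integral => x _; rewrite ger0_norm ?cabs_ge0.
    exact: h.
  set J := (\int[mu]_x _)%E => h J0; apply/eqP; apply: contraTT h => Jn0.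
  by rewrite -ltNge lt_def poweR_ge0 andbT poweR_eq0// negb_and Jn0.
have mT : measurable_fun setT (fun x => (cabs (T f x) `^ 2)%:E).
  by apply: measurable_powR_fun; exact: measurable_cabs.
move=> /(ae_eq_integral_abs mu measurableT mT); apply: filterS => x /(_ I)[].
by move/eqP; rewrite powR_eq0 => /andP[/eqP/cabs_eq0].
Qed.

(** Operators act on representatives; linearity and the previous lemma make them respect
    almost-everywhere equality, so slices known up to null sets may be substituted. *)
Lemma op_ae_eq f g : cmeasurable f -> {ae mu, forall x, f x = g x} ->
  in_Lp mu 2 g -> {ae mu, forall x, T f x = T g x}.
Proof.
move=> mf fg g2; have f2 := in_Lp_ae two0 mf fg g2; have [mg _] := g2.
have h0 : {ae mu, forall x, -1 * g x + f x = 0}.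
  by apply: filterS fg => x ->; rewrite mulN1r addNr.
have mh : cmeasurable (fun x => -1 * g x + f x).
  by apply: cmeasurableD => //; apply: cmeasurableM => //; exact: cmeasurable_cst.
apply: filterS2 (op_ae0 mh h0) (op_linear (-1) g2 f2) => x -> /esym/eqP.
by rewrite mulN1r addrC subr_eq0 => /eqP.
Qed.

Lemma op_sum I (s : seq I) (c : I -> R[i]) (F : I -> Rn R n -> R[i]) :
  (forall i, in_Lp mu 2 (F i)) ->
  {ae mu, forall x, T (fun y => \sum_(i <- s) c i * F i y) x =
    \sum_(i <- s) c i * T (F i) x}.
Proof.
move=> F2; elim: s => [|i s ih].
  have -> : (fun y => \sum_(i <- [::]) c i * F i y) = fun=> 0.
    by apply/funext => y; rewrite big_nil.
  have := op_ae0 (cmeasurable_cst 0) (aeW _ (fun=> erefl)).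
  by apply: filterS => x ->; rewrite big_nil.
have -> : (fun y => \sum_(j <- i :: s) c j * F j y) =
    fun y => c i * F i y + \sum_(j <- s) c j * F j y.
  by apply/funext => y; rewrite big_cons.
apply: filterS2 ih (op_linear (c i) (F2 i) (in_L2_sum s c F2)) => x e1 ->.
by rewrite big_cons e1.
Qed.

End bounded_operators.

(* On functions supported in [X], [P] is [f |-> 1_Y T (v f)]; it is close to the
   average [(1 / V) \int f] for the weight [v = 1_X / T^*(1_Y)]. *)
Definition half_step {R : realType} {n : nat}
    (T Ts : (Rn R n -> R[i]) -> (Rn R n -> R[i])) (theta V D : R)
    (X Y : set (Rn R n)) (v : bfun X) (P : bfun X -> bfun Y) :=
  [/\ forall x, cabs (v x) <= D,
      {ae leb n, forall x, X x -> v x * Ts (chi Y) x = 1},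
      forall f, {ae leb n, forall x, Y x -> P f x = T (bfunM v f) x},
      forall f, cintegral (leb n) setT (P f) = cintegral (leb n) setT f &
      (forall (c : R[i]) (f g : bfun X),
        {ae leb n, forall x, P (bfunD (bfunZ c f) g) x = c * P f x + P g x}) /\
      forall f, {ae leb n, forall x, Y x ->
        cabs (P f x - (V^-1)%:C%C * cintegral (leb n) setT f) <=
        theta / V * l1norm (leb n) f}].

(** * Construction of the maps between a cube and its reflection *)

Section half_step_section.
Context {R : realType} {n : nat}.
Variables (T Ts : (Rn R n -> R[i]) -> (Rn R n -> R[i])).
Variable K : Rn R n -> Rn R n -> R[i].
Hypotheses (n0 : (0 < n)%N) (TK : CZO T K) (TTs : adjoint_operator T Ts).

Local Notation mu := (leb n).
Local Notation Int := (cintegral mu setT).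

Let two1 : (1 : R) < 2. Proof. by rewrite ltr1n. Qed.
Let Tb : Lp_bounded_operator T. Proof. by have [] := TK. Qed.

Section pair.
Variables (a a' : Rn R n) (l : R) (k : R[i]) (eps : R).
Hypotheses (l0 : 0 < l) (eps0 : 0 < eps) (eps2 : eps <= 2^-1).
Hypothesis sep : forall x y, cube a' l x -> cube a l y -> n%:R * l <= edist x y.
Hypothesis near_k :
  forall x y, cube a' l x -> cube a l y -> cabs (K x y - k) <= eps * cabs k.

Let X := cube a l.
Let Y := cube a' l.
Let mX : measurable X. Proof. exact: measurable_cube. Qed.
Let mY : measurable Y. Proof. exact: measurable_cube. Qed.
Let Xy : (mu X < +oo)%E. Proof. exact/leb_cube_lty/ltW. Qed.
Let Yy : (mu Y < +oo)%E. Proof. exact/leb_cube_lty/ltW. Qed.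
Let nl0 : 0 < n%:R * l. Proof. by rewrite mulr_gt0// ltr0n. Qed.
Let k0 := cabs_ge0 k.
Let epsk : 0 <= eps * cabs k. Proof. by rewrite mulr_ge0// ltW. Qed.

Let bfun_cpt (c : Rn R n) (f : bfun (cube c l)) : bounded_cpt_supp (@enorm R n) f.
Proof.
split; [exact: bfun_meas|exact: bfun_bound|].
exists (enorm c + n%:R * l) => x fx; apply: cube_enorm; first exact: ltW.
by apply: contrapT => /(bfun_off f)/eqP; apply/negP.
Qed.

Let kap (f : bfun X) x := Int (fun y => K x y * f y).

Let measK x : Y x -> cmeasurable (fun y => if y \in X then K x y else 0).
Proof.
move=> Yx; have [_ sK _] := TK.
apply: unif_cont_measurable => // e e0.
have [de de0 Kde] := kernel_unif_cont sK nl0 e0.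
exists de => // y y' Xy' Xy'' yy'; apply: (Kde y y' x _ yy').2.
by rewrite edist_sym; exact: sep.
Qed.

Let bfunK (f : bfun X) x y : (if y \in X then K x y else 0) * f y = K x y * f y.
Proof.
case: ifPn => // /negP yX; rewrite bfun_off ?mulr0// => Xy'.
by apply: yX; exact: mem_set.
Qed.

Let measKf (f : bfun X) x : Y x -> cmeasurable (fun y => K x y * f y).
Proof.
move=> Yx; under eq_fun do rewrite -bfunK.
by apply: cmeasurableM; [exact: measK|exact: bfun_meas].
Qed.

Let cintf (f : bfun X) : cint mu f. Proof. exact: bfun_cint. Qed.
Let cintg (g : bfun Y) : cint mu g. Proof. exact: bfun_cint. Qed.

Let cintKf (f : bfun X) x : Y x -> cint mu (fun y => K x y * f y).
Proof.
move=> Yx; apply: (@cint_le _ _ _ _ _ (fun y => ((1 + eps) * cabs k)%:C%C * f y)).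
- exact: measKf.
- exact: cintZ.
move=> y; rewrite !cabsM cabs_real; have [Xy'|Xy'] := pselect (X y); last first.
  by rewrite bfun_off// cabs0 !mulr0.
rewrite ler_wpM2r ?cabs_ge0// ger0_norm ?mulr_ge0 ?addr_ge0 ?(ltW eps0)//.
rewrite -(subrK k (K x y)); apply: le_trans (ler_cabsD _ _) _.
by rewrite mulrDl mul1r addrC lerD2l near_k.
Qed.

Let kap_near (f : bfun X) x : Y x ->
  cabs (kap f x - k * Int f) <= eps * cabs k * l1norm mu f.
Proof.
move=> Yx; rewrite /kap -cintegralZ// -cintegralB//; last 2 first.
- exact: cintKf.
- exact: cintZ.
apply: le_trans (ler_cabs_cintegral _) _.
  by apply: cintB; [exact: cintKf|exact: cintZ].
apply: ler_l1norm => //.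
  by apply: cintB; [exact: cintKf|exact: cintZ].
apply: aeW => y; rewrite -mulrBl cabsM; have [Xy'|Xy'] := pselect (X y); last first.
  by rewrite bfun_off// cabs0 !mulr0.
by rewrite ler_wpM2r ?cabs_ge0// near_k.
Qed.

(** The kernel is uniformly continuous at distance at least [n l], and integration against [f]
    scales its modulus of continuity by the L^1 norm of [f]. *)
Let meas_kap (f : bfun X) : cmeasurable (fun x => if x \in Y then kap f x else 0).
Proof.
have [_ sK _] := TK; apply: unif_cont_measurable => // e e0.
have L0 := l1norm_ge0 mu f.
have L1 : 0 < l1norm mu f + 1 by rewrite ltr_wpDl.
have e1 : 0 < e / (l1norm mu f + 1) by rewrite divr_gt0.
have [de de0 Kde] := kernel_unif_cont sK nl0 e1.
exists de => // x x' Yx Yx' xx'.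
rewrite /kap -cintegralB; [|exact: cintKf|exact: cintKf].
have cB : cint mu (fun y => K x y * f y - K x' y * f y).
  by apply: cintB; exact: cintKf.
apply: le_trans (ler_cabs_cintegral cB) _.
apply: (@le_trans _ _ (e / (l1norm mu f + 1) * l1norm mu f)).
  apply: ler_l1norm => //; first exact: ltW.
  apply: aeW => y; rewrite -mulrBl cabsM; have [Xy'|Xy'] := pselect (X y); last first.
    by rewrite bfun_off// cabs0 !mulr0.
  by rewrite ler_wpM2r ?cabs_ge0//; apply: (Kde x x' y _ xx').1; exact: sep.
by rewrite mulrAC ler_pdivrMr// ler_pM2l// lerDl.
Qed.

(** The separation [sep] makes the supports disjoint, so the kernel representation applies;
    replacing the kernel by the number [k] then costs the relative error [eps]. *)
Lemma kernel_pairing (f : bfun X) (g : bfun Y) :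
  cabs (Int (fun x => T f x * g x) - k * Int f * Int g) <=
    eps * cabs k * l1norm mu f * l1norm mu g.
Proof.
have [_ _ hK] := TK.
have disj : supp f `&` supp g = set0.
  apply/seteqP; split => // x [].
  move=> /(supp_cube (@bfun_off _ _ _ _ f)) Xx /(supp_cube (@bfun_off _ _ _ _ g)) Yx.
  by have := sep Yx Xx; rewrite edistxx leNgt nl0.
rewrite (hK f g (bfun_cpt f) (bfun_cpt g) disj).
pose kY x := if x \in Y then kap f x else 0.
have -> : (fun x => Int (fun y => K x y * f y * g x)) = (fun x => kY x * g x).
  apply/funext => x; have [Yx|Yx] := pselect (Y x); last first.
    rewrite bfun_off// mulr0; under eq_fun do rewrite mulr0; exact: cintegral0.
  rewrite /kY mem_set// mulrC -cintegralZ; last exact: cintKf.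
  by congr cintegral; apply/funext => y; rewrite mulrC.
have ckg : cint mu (fun x => (kY x - k * Int f) * g x).
  apply: (@cint_le _ _ _ _ _ (fun x => (eps * cabs k * l1norm mu f)%:C%C * g x)).
  - apply: cmeasurableM; last exact: bfun_meas.
    by apply: cmeasurableB; [exact: meas_kap|exact: cmeasurable_cst].
  - exact: cintZ.
  move=> x; rewrite !cabsM cabs_real; have [Yx|Yx] := pselect (Y x); last first.
    by rewrite bfun_off// cabs0 !mulr0.
  rewrite ler_wpM2r ?cabs_ge0// /kY mem_set// ger0_norm ?kap_near//.
  by rewrite mulr_ge0// l1norm_ge0.
have -> : (fun x => kY x * g x) =
    fun x => (kY x - k * Int f) * g x + (k * Int f) * g x.
  by apply/funext => x; ring.
rewrite cintegralD//; last exact: cintZ.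
rewrite cintegralZ// addrK; apply: le_trans (ler_cabs_cintegral ckg) _.
apply: ler_l1norm => //; first by rewrite mulr_ge0// l1norm_ge0.
apply: aeW => x; rewrite cabsM; have [Yx|Yx] := pselect (Y x); last first.
  by rewrite bfun_off// cabs0 !mulr0.
by rewrite ler_wpM2r ?cabs_ge0// /kY mem_set// kap_near.
Qed.

(** The kernel represents [T f] only in pairings. Testing with all bounded [g] on [Y] turns the
    error in the pairing into a pointwise one. *)
Lemma czo_near (f : bfun X) : {ae mu, forall x, Y x ->
  cabs (T f x - k * Int f) <= eps * cabs k * l1norm mu f}.
Proof.
have fL2 : in_Lp mu 2 f by exact: bfun_in_Lp.
have TfL2 := op_in_L2 Tb fL2; have [mTf _] := TfL2.
apply: (ae_bound_by_testing mY) => //.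
- by apply: cmeasurableB => //; exact: cmeasurable_cst.
- by rewrite mulr_ge0// l1norm_ge0.
move=> g; have := kernel_pairing f g.
have -> : (fun x => (T f x - k * Int f) * g x) =
    fun x => T f x * g x - (k * Int f) * g x.
  by apply/funext => x; ring.
rewrite cintegralB ?cintegralZ//; last exact: cintZ.
by apply: in_L2_cint.
Qed.

Let gY : bfun (R := R) Y := bfun_chi measurableT mY.

Let gYE : (gY : _ -> _) = chi Y.
Proof. by apply/funext => x; rewrite bfun_chiE setTI. Qed.

Let V := l ^+ n.
Let V0 : 0 < V. Proof. by rewrite exprn_gt0. Qed.

Let l1gY : l1norm mu gY = V.
Proof.
have YV : mu Y = V%:E by rewrite /Y leb_cube// ltW.
by rewrite gYE; exact: etrans (l1norm_chi mY Yy) (congr1 fine YV).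
Qed.

Let IntgY : Int gY = V%:C%C.
Proof.
rewrite gYE cintegral_real; congr (_%:C%C).
by rewrite -l1gY gYE; apply: eq_Rintegral => x _; rewrite cabs_chi.
Qed.

(** The same pairing with [g = 1_Y], read through the adjoint identity as a pairing of [Ts 1_Y] with
    an arbitrary [f] on [X]. *)
Lemma adjoint_near : {ae mu, forall x, X x ->
  cabs (Ts (chi Y) x - k * V%:C%C) <= eps * cabs k * V}.
Proof.
have gL2 : in_Lp mu 2 (chi Y) by rewrite -gYE; exact: bfun_in_Lp.
have [Tsb Tadj] := TTs; have [_ [M TsM]] := Tsb 2 two1.
have [uL2 _] := TsM _ gL2; have [mu' _] := uL2.
apply: (ae_bound_by_testing mX) => //.
- by apply: cmeasurableB => //; exact: cmeasurable_cst.
- by rewrite mulr_ge0// ltW.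
move=> f; have := kernel_pairing f gY; rewrite l1gY IntgY gYE.
have fL2 : in_Lp mu 2 f by exact: bfun_in_Lp.
have h2 : (2 : R) / (2 - 1) = 2 by field.
rewrite (Tadj 2 two1 f (chi Y) fL2) ?h2//.
have -> : (fun x => (Ts (chi Y) x - k * V%:C%C) * f x) =
    fun x => Ts (chi Y) x * f x - (k * V%:C%C) * f x.
  by apply/funext => x; ring.
rewrite cintegralB ?cintegralZ//; last 2 first.
- by apply: in_L2_cint.
- exact: cintZ.
have -> : (fun x => f x * Ts (chi Y) x) = fun x => Ts (chi Y) x * f x.
  by apply/funext => x; rewrite mulrC.
by rewrite (mulrAC k) (mulrAC _ (l1norm mu f)).
Qed.

Hypothesis kn0 : k != 0.

(** As [eps <= 1/2], the function [Ts 1_Y] has modulus at least [|k| V / 2] almost everywhere on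
    [X], so its inverse is bounded by [2 / (|k| V)] and close to [1 / (k V)]. The condition
    [v x != 0] singles out the set where the estimates hold. *)
Lemma half_step_weight : exists v : bfun X,
  [/\ forall x, cabs (v x) <= 2 / (cabs k * V),
      {ae mu, forall x, X x -> v x * Ts (chi Y) x = 1} &
      forall x, X x -> v x != 0 ->
        cabs (v x - (k * V%:C%C)^-1) <= 2 * eps / (cabs k * V)].
Proof.
have kp : 0 < cabs k by exact: cabs_gt0.
have kV0 : 0 < cabs k * V by rewrite mulr_gt0.
have [Tsb _] := TTs; have [_ [M TsM]] := Tsb 2 two1.
have gL2 : in_Lp mu 2 (chi Y) by rewrite -gYE; exact: bfun_in_Lp.
have [[mu' _] _] := TsM _ gL2; set u := Ts (chi Y) in mu' *.
(* The estimate [adjoint_near] holds almost everywhere, whereas a [bfun] is bounded at every point;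
   cutting down to [E] loses a null subset of [X]. *)
pose E := X `&` [set x | cabs (u x - k * V%:C%C) <= cabs ((eps * cabs k * V)%:C%C)].
have mE : measurable E.
  apply: measurableI => //; apply: measurable_cabs_le; last exact: cmeasurable_cst.
  by apply: cmeasurableB => //; exact: cmeasurable_cst.
have ebE : cabs ((eps * cabs k * V)%:C%C) = eps * cabs k * V.
  by rewrite cabs_real ger0_norm// mulr_ge0// ltW.
have uE x : E x -> cabs k * V / 2 <= cabs (u x).
  move=> [_ h]; have {}h : cabs (u x - k * V%:C%C) <= eps * cabs k * V by rewrite -ebE.
  have := ler_cabsD (u x) (k * V%:C%C - u x); rewrite addrC subrK cabs_distC.
  rewrite cabsM cabs_real (gtr0_norm V0).
  have : eps * cabs k * V <= 2^-1 * (cabs k * V).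
    by rewrite -mulrA ler_pM2r.
  lra.
have u0 x : E x -> 0 < cabs (u x).
  by move=> /uE; apply: lt_le_trans; rewrite divr_gt0.
pose vv x := (u x)^-1 * chi E x.
have mv : cmeasurable vv.
  by apply: cmeasurableM; [exact: cmeasurableV|exact: cmeasurable_chi].
have vb x : cabs (vv x) <= 2 / (cabs k * V).
  rewrite /vv cabsM cabs_chi cabsV; have [Ex|Ex] := pselect (E x).
    rewrite indicE mem_set// mulr1 -[leRHS]invrK lef_pV2 ?posrE ?u0//.
      by rewrite invf_div uE.
    by rewrite invr_gt0 divr_gt0.
  by rewrite indicE memNset// mulr0 divr_ge0// ltW.
have voff x : ~ X x -> vv x = 0.
  by move=> Xx; rewrite /vv chiE memNset ?mulr0// => -[].
exists (BFun mv (ex_intro _ _ vb) voff); split => //=.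
- apply: filterS adjoint_near => x h Xx; rewrite /vv chiE.
  have Ex : E x by split => //; rewrite /mkset ebE; exact: h.
  rewrite mem_set// mulr1 mulVf//; apply/eqP => ux.
  by have := u0 x Ex; rewrite ux cabs0 ltxx.
- move=> x Xx; rewrite /vv chiE; have [Ex|Ex] := pselect (E x); last first.
    by rewrite memNset// mulr0 eqxx.
  rewrite mem_set// mulr1 => _; have ux := u0 x Ex.
  have ux0 : u x != 0 by apply/eqP => ux0; rewrite ux0 cabs0 ltxx in ux.
  have kVn0 : k * V%:C%C != 0.
    rewrite mulf_neq0//; apply/eqP => /(congr1 (@complex.Re R))/= V00.
    by have := V0; rewrite V00 ltxx.
  have -> : (u x)^-1 - (k * V%:C%C)^-1 = (k * V%:C%C - u x) / (u x * (k * V%:C%C)).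
    move: kVn0 ux0; move: (k * _) (u x) => w1 w2 w10 w20.
    by field; rewrite w10 w20.
  have [_ h] := Ex; have {}h : cabs (u x - k * V%:C%C) <= eps * cabs k * V by rewrite -ebE.
  rewrite cabsM cabsV [cabs (u x * _)]cabsM cabs_distC.
  rewrite [cabs (k * _)]cabsM cabs_real (gtr0_norm V0).
  rewrite ler_pdivrMr ?mulr_gt0//; apply: le_trans h _.
  have := uE x Ex; rewrite -(@ler_pM2l _ (2 * eps)) ?mulr_gt0// => h2.
  apply: le_trans _ (_ : 2 * eps * cabs (u x) <= _); first by lra.
  rewrite le_eqVlt; apply/orP; left; apply/eqP.
  by field; rewrite !gt_eqF.
Qed.


Lemma half_step_exists : exists (v : bfun X) (P : bfun X -> bfun Y),
  half_step T Ts (4 * eps) V (2 / (cabs k * V)) v P.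
Proof.
have kp : 0 < cabs k by exact: cabs_gt0.
have [Tsb Tadj] := TTs.
have [v [vb v1 vn]] := half_step_weight.
have TvL2 f : in_Lp mu 2 (T (bfunM v f)) by apply: (op_in_L2 Tb); exact: bfun_in_Lp.
have Pex f : exists h : bfun Y, {ae mu, forall x, Y x -> h x = T (bfunM v f) x}.
  (* By [czo_near] with [eps <= 1], the value [T (v f)] is at most [B] almost everywhere on [Y];
     restricting it to the set [E] where this holds produces a bounded function. *)
  have [mT _] := TvL2 f; set B := 2 * cabs k * l1norm mu (bfunM v f).
  have B0 : 0 <= B by rewrite !mulr_ge0// l1norm_ge0.
  pose E := Y `&` [set x | cabs (T (bfunM v f) x) <= cabs B%:C%C].
  have mE : measurable E.
    by apply: measurableI => //; apply: measurable_cabs_le => //; exact: cmeasurable_cst.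
  pose h x := T (bfunM v f) x * chi E x.
  have mh : cmeasurable h by apply: cmeasurableM => //; exact: cmeasurable_chi.
  have hb x : cabs (h x) <= B.
    rewrite /h cabsM cabs_chi; have [Ex|Ex] := pselect (E x).
      rewrite indicE mem_set// mulr1; case: Ex => _ Ex.
      by apply: le_trans Ex _; rewrite cabs_real ger0_norm.
    by rewrite indicE memNset// mulr0.
  have h0 x : ~ Y x -> h x = 0 by move=> Yx; rewrite /h chiE memNset ?mulr0// => -[].
  exists (BFun mh (ex_intro _ _ hb) h0).
  apply: filterS (czo_near (bfunM v f)) => x hx Yx; rewrite /= /h chiE mem_set ?mulr1//.
  split => //; rewrite /mkset cabs_real (ger0_norm B0).
  rewrite -(subrK (k * Int (bfunM v f)) (T _ x)); apply: le_trans (ler_cabsD _ _) _.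
  rewrite /B -mulrA mulr2n mulrDl mul1r; apply: lerD.
    apply: le_trans (hx Yx) _; rewrite -mulrA ler_piMl ?mulr_ge0 ?l1norm_ge0//.
    by apply: le_trans eps2 _; rewrite invf_le1 ?ler1n.
  by rewrite cabsM ler_wpM2l// ler_cabs_cintegral.
have {Pex}[P PE] := choice Pex.
exists v, P; split => //.
- move=> f.
  have gL2 : in_Lp mu 2 (chi Y) by rewrite -gYE; exact: bfun_in_Lp.
  have vL2 : in_Lp mu 2 (bfunM v f) by exact: bfun_in_Lp.
  have h2 : (2 : R) / (2 - 1) = 2 by field.
  have [_ [M TsM]] := Tsb 2 two1; have [[mu' _] _] := TsM _ gL2.
  have [mT _] := TvL2 f.
  (* Moving [T] to [1_Y] leaves the integral of [v f Ts(1_Y)], which is the integral of [f] by the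
     choice of the weight. *)
  transitivity (Int (fun x => T (bfunM v f) x * chi Y x)).
    apply: ae_eq_cintegral; first exact: bfun_meas.
      by apply: cmeasurableM => //; exact: cmeasurable_chi.
    apply: filterS (PE f) => x h; rewrite chiE; have [Yx|Yx] := pselect (Y x).
      by rewrite mem_set// mulr1 h.
    by rewrite memNset// mulr0 bfun_off.
  rewrite (Tadj 2 two1 _ _ vL2) ?h2//.
  apply: ae_eq_cintegral; last 2 first.
  - exact: bfun_meas.
  - apply: filterS v1 => x h; have [Xx|Xx] := pselect (X x).
      by rewrite /= mulrAC h// mul1r.
    by rewrite /= (bfun_off f)// mulr0 mul0r.
  by apply: cmeasurableM => //; exact: bfun_meas.
split.
- move=> c f g; pose w := bfunD (bfunZ c (bfunM v f)) (bfunM v g).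
  have wE : (bfunM v (bfunD (bfunZ c f) g) : _ -> _) =
      fun y => c * bfunM v f y + bfunM v g y.
    by apply/funext => y /=; ring.
  have lin := @op_linear _ _ _ Tb c (bfunM v f) (bfunM v g).
  have vL2 g' : in_Lp mu 2 (bfunM v g') by exact: bfun_in_Lp.
  have {}lin := lin (vL2 f) (vL2 g).
  have Pfg := PE (bfunD (bfunZ c f) g); rewrite wE in Pfg.
  apply: filterS3 lin Pfg (filterI (PE f) (PE g)) => x h1 h2 [h3 h4].
  have [Yx|Yx] := pselect (Y x); last by rewrite !bfun_off// mulr0 addr0.
  by rewrite h2// h1 h3// h4.
- move=> f.
  have lvf : l1norm mu (bfunM v f) <= 2 / (cabs k * V) * l1norm mu f.
    apply: ler_l1norm => //; first by rewrite divr_ge0 ?mulr_ge0// ltW.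
    by apply: aeW => x; rewrite /= cabsM ler_wpM2r ?cabs_ge0.
  (* One half of the error [4 eps / V]: the weight deviates from [1 / (k V)] by [2 eps / (|k| V)].
     The other half is [czo_near] for [v f], whose L^1 norm is at most [2 / (|k| V)] times that of
     [f]. *)
  have kvf : cabs (k * Int (bfunM v f) - (V^-1)%:C%C * Int f) <=
      2 * eps / V * l1norm mu f.
    have cw : cint mu (fun x => (v x - (k * V%:C%C)^-1) * f x).
      have : cint mu (fun x => bfunM v f x - (k * V%:C%C)^-1 * f x).
        by apply: cintB => //; exact: cintZ.
      by under eq_fun do rewrite /= -mulrBl.
    have -> : k * Int (bfunM v f) - (V^-1)%:C%C * Int f =
        k * Int (fun x => (v x - (k * V%:C%C)^-1) * f x).
      under [in RHS]eq_fun do rewrite mulrBl.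
      rewrite (cintegralB (f := bfunM v f)) ?cintegralZ//; last exact: cintZ.
      by rewrite mulrBr mulrA invfM mulrA divff// mul1r fmorphV.
    rewrite cabsM; apply: le_trans (ler_wpM2l _ (ler_cabs_cintegral cw)) _ => //.
    have -> : 2 * eps / V * l1norm mu f =
        cabs k * (2 * eps / (cabs k * V) * l1norm mu f) by field; rewrite !gt_eqF.
    rewrite ler_wpM2l//; apply: ler_l1norm => //.
      by rewrite divr_ge0 ?mulr_ge0// ltW.
    apply: filterS v1 => x h; rewrite cabsM; have [Xx|Xx] := pselect (X x); last first.
      by rewrite (bfun_off f)// cabs0 !mulr0.
    rewrite ler_wpM2r ?cabs_ge0// vn//; apply/eqP => v0.
    by have := h Xx; rewrite v0 mul0r => /esym/eqP; rewrite oner_eq0.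
  apply: filterS2 (PE f) (czo_near (bfunM v f)) => x h1 h2 Yx.
  rewrite h1// -(subrK (k * Int (bfunM v f)) (T _ x)) -addrA.
  apply: le_trans (ler_cabsD _ _) _.
  apply: le_trans (lerD (h2 Yx) kvf) _.
  have : eps * cabs k * l1norm mu (bfunM v f) <=
      eps * cabs k * (2 / (cabs k * V) * l1norm mu f).
    by rewrite ler_wpM2l// ltW.
  have -> : eps * cabs k * (2 / (cabs k * V) * l1norm mu f) =
    2 * eps / V * l1norm mu f by field; rewrite !gt_eqF.
  have -> : 4 * eps / V * l1norm mu f = 2 * eps / V * l1norm mu f + 2 * eps / V * l1norm mu f.
    by field; rewrite gt_eqF.
  by rewrite lerD2r.
Qed.

End pair.
End half_step_section.

(** * One-variable actions on tensor products *)

Section partial_actions.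
Context {R : realType} {d1 d2 : nat}.
Notation R12 := (Rn R d1 * Rn R d2)%type.
Implicit Types h : R12 -> R[i].

Lemma ae_fst (P : Rn R d1 -> Prop) : {ae leb d1, forall x, P x} ->
  {ae @leb2 R d1 d2, forall z, P z.1}.
Proof.
move=> [N [mN N0 NP]]; exists (N `*` setT); split.
- exact: measurableX.
- apply: etrans (product_measure1E (leb d1) (leb d2) mN measurableT) _.
  exact: etrans (congr1 (fun t => (t * _)%E) N0) (mul0e _).
- by move=> z zP; split => //; apply: NP.
Qed.

Lemma ae_snd (P : Rn R d2 -> Prop) : {ae leb d2, forall x, P x} ->
  {ae @leb2 R d1 d2, forall z, P z.2}.
Proof.
move=> [N [mN N0 NP]]; exists (setT `*` N); split.
- exact: measurableX.
- apply: etrans (product_measure1E (leb d1) (leb d2) measurableT mN) _.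
  by rewrite N0 mule0.
- by move=> z zP; split => //; apply: NP.
Qed.

Lemma measurable_ceq d (T : measurableType d) (f g : T -> R[i]) :
  cmeasurable f -> cmeasurable g -> measurable [set x | f x = g x].
Proof.
move=> mf mg; rewrite (_ : [set x | _] = [set x | cabs (f x - g x) <= cabs (0 : R[i])]).
  by apply: measurable_cabs_le; [exact: cmeasurableB|exact: cmeasurable_cst].
apply/seteqP; split => x; rewrite /mkset; first by move=> ->; rewrite subrr.
rewrite cabs0 => h; apply/eqP; rewrite -subr_eq0; apply/eqP/cabs_eq0/eqP.
by rewrite eq_le h cabs_ge0.
Qed.

Lemma ae_leb2_eq1 h h' : cmeasurable h -> cmeasurable h' ->
  {ae leb d1, forall x, {ae leb d2, forall y, h (x, y) = h' (x, y)}} ->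
  {ae leb2, forall z, h z = h' z}.
Proof.
move=> mh mh' hh'; have mE := measurableC (measurable_ceq mh mh').
have : {ae leb2, forall z, ~ (~` [set z | h z = h' z]) z}.
  apply/(ae_prod1P _ _ mE); apply: filterS hh' => x.
  by apply: filterS => y /= ?; apply.
by apply: filterS => z; exact: contrapT.
Qed.

Lemma ae_leb2_eq2 h h' : cmeasurable h -> cmeasurable h' ->
  {ae leb d2, forall y, {ae leb d1, forall x, h (x, y) = h' (x, y)}} ->
  {ae leb2, forall z, h z = h' z}.
Proof.
move=> mh mh' hh'; have mE := measurableC (measurable_ceq mh mh').
have : {ae leb2, forall z, ~ (~` [set z | h z = h' z]) z}.
  apply/(ae_prod2P _ _ mE); apply: filterS hh' => x.
  by apply: filterS => y /= ?; apply.
by apply: filterS => z; exact: contrapT.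
Qed.

Lemma ae_leb2_iter1 (P : R12 -> Prop) : {ae leb2, forall z, P z} ->
  {ae leb d1, forall x, {ae leb d2, forall y, P (x, y)}}.
Proof. exact: ae_prod_iter. Qed.

Lemma ae_leb2_iter2 (P : R12 -> Prop) : {ae leb2, forall z, P z} ->
  {ae leb d2, forall y, {ae leb d1, forall x, P (x, y)}}.
Proof.
move=> [N [mN N0 NP]].
have : {ae leb2, forall z, ~ N z} by apply/ae_notP.
move=> /(ae_prod2P _ _ mN); apply: filterS => x; apply: filterS => y Nxy.
by apply: contrapT => Pxy; apply: Nxy; exact: NP.
Qed.

Variables (I : Type) (s : seq I) (A : I -> Rn R d1 -> R[i]) (B : I -> Rn R d2 -> R[i]).

Let AB z := \sum_(i <- s) A i z.1 * B i z.2.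

(** Applying [T] to the second factors gives a jointly measurable function with the right slices.
    The set from which [xget] chooses is therefore nonempty, and Tonelli identifies the choice with
    this function almost everywhere. The tensor form of [h] is assumed almost everywhere only, so
    that the outcome can be fed to another action. *)
Lemma act2_tensor T h : Lp_bounded_operator T ->
  (forall i, cmeasurable (A i)) -> (forall i, in_Lp (leb d2) 2 (B i)) ->
  cmeasurable h -> {ae leb2, forall z, h z = AB z} ->
  cmeasurable (act2 T h) /\
  {ae leb2, forall z, act2 T h z = \sum_(i <- s) A i z.1 * T (B i) z.2}.
Proof.
move=> Tb mA B2 mh hE.
pose h' z := \sum_(i <- s) A i z.1 * T (B i) z.2.
have mh' : cmeasurable h'.
  apply: cmeasurable_sum => i; apply: cmeasurableM.
    exact: (cmeasurable_comp measurable_fst (mA i)).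
  have [mTB _] := op_in_L2 Tb (B2 i).
  exact: (cmeasurable_comp measurable_snd mTB).
have h'P : {ae leb d1, forall x, {ae leb d2, forall y,
    h' (x, y) = T (fun y2 => h (x, y2)) y}}.
  apply: filterS (ae_leb2_iter1 hE) => x hx.
  have S2 := in_L2_sum s (A^~ x) B2.
  have := op_ae_eq Tb (cmeasurable_slice1 x mh) hx S2.
  apply: filterS2 (op_sum Tb s (A^~ x) B2) => y e1 e2.
  by rewrite e2 e1.
have [|ma hact] := @xgetPex _ (fun=> 0) [set k | cmeasurable k /\
    {ae leb d1, forall x1, {ae leb d2, forall x2,
       k (x1, x2) = T (fun y2 => h (x1, y2)) x2}}]; first by exists h'.
split => //; apply: ae_leb2_eq1 => //.
apply: filterS2 hact h'P => x; apply: filterS2 => y e1 e2.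
by rewrite /act2 e1 -e2.
Qed.

Lemma act1_tensor T h : Lp_bounded_operator T ->
  (forall i, in_Lp (leb d1) 2 (A i)) -> (forall i, cmeasurable (B i)) ->
  cmeasurable h -> {ae leb2, forall z, h z = AB z} ->
  cmeasurable (act1 T h) /\
  {ae leb2, forall z, act1 T h z = \sum_(i <- s) T (A i) z.1 * B i z.2}.
Proof.
move=> Tb A2 mB mh hE.
pose h' z := \sum_(i <- s) T (A i) z.1 * B i z.2.
have mh' : cmeasurable h'.
  apply: cmeasurable_sum => i; apply: cmeasurableM; last first.
    exact: (cmeasurable_comp measurable_snd (mB i)).
  have [mTA _] := op_in_L2 Tb (A2 i).
  exact: (cmeasurable_comp measurable_fst mTA).
have h'P : {ae leb d2, forall y, {ae leb d1, forall x,
    h' (x, y) = T (fun x1 => h (x1, y)) x}}.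
  apply: filterS (ae_leb2_iter2 hE) => y hy.
  have S2 := in_L2_sum s (B^~ y) A2.
  have hy' : {ae leb d1, forall x, h (x, y) = \sum_(i <- s) B i y * A i x}.
    by apply: filterS hy => x ->; apply: eq_bigr => i _; rewrite mulrC.
  have := op_ae_eq Tb (cmeasurable_slice2 y mh) hy' S2.
  apply: filterS2 (op_sum Tb s (B^~ y) A2) => x e1 e2.
  by rewrite e2 e1; apply: eq_bigr => i _; rewrite mulrC.
have [|ma hact] := @xgetPex _ (fun=> 0) [set k | cmeasurable k /\
    {ae leb d2, forall x2, {ae leb d1, forall x1,
       k (x1, x2) = T (fun y1 => h (y1, x2)) x1}}]; first by exists h'.
split => //; apply: ae_leb2_eq2 => //.
apply: filterS2 hact h'P => y; apply: filterS2 => x e1 e2.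
by rewrite /act1 e1 -e2.
Qed.

End partial_actions.

Section tensor_maps.
Context {R : realType} {d1 d2 : measure_display}
  {T1 : measurableType d1} {T2 : measurableType d2}.
Local Notation bfun := (@bfun R _ _).
Local Notation tensor := (@tensor R _ _ _ _).

Definition map1 (X1 Y1 : set T1) (X2 : set T2)
    (P : bfun X1 -> bfun Y1) (s : tensor X1 X2) : tensor Y1 X2 :=
  [seq (P t.1, t.2) | t <- s].

Definition map2 (X1 : set T1) (X2 Y2 : set T2)
    (P : bfun X2 -> bfun Y2) (s : tensor X1 X2) : tensor X1 Y2 :=
  [seq (t.1, P t.2) | t <- s].

End tensor_maps.

(** * The bi-commutator form on weighted tensor products *)

Section bicommutator_identity.
Context {R : realType} {d1 d2 : nat}.
Notation R12 := (Rn R d1 * Rn R d2)%type.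
Local Notation bfun := (@bfun R _ _).
Local Notation tensor := (@tensor R _ _ _ _).

Variables (T1 T1s : (Rn R d1 -> R[i]) -> (Rn R d1 -> R[i]))
  (T2 T2s : (Rn R d2 -> R[i]) -> (Rn R d2 -> R[i])).
Hypotheses (T1b : Lp_bounded_operator T1) (T1sb : Lp_bounded_operator T1s)
  (T2b : Lp_bounded_operator T2) (T2sb : Lp_bounded_operator T2s).
Variables (X1 Y1 : set (Rn R d1)) (X2 Y2 : set (Rn R d2)).
Hypotheses (mX1 : measurable X1) (mY1 : measurable Y1)
  (mX2 : measurable X2) (mY2 : measurable Y2).
Hypotheses (X1y : (leb d1 X1 < +oo)%E) (Y1y : (leb d1 Y1 < +oo)%E)
  (X2y : (leb d2 X2 < +oo)%E) (Y2y : (leb d2 Y2 < +oo)%E).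
Variables (v1 : bfun X1) (P1 : bfun X1 -> bfun Y1)
  (v2 : bfun X2) (P2 : bfun X2 -> bfun Y2) (th1 th2 V1 V2 D1 D2 : R).
Hypotheses (H1 : half_step T1 T1s th1 V1 D1 v1 P1)
  (H2 : half_step T2 T2s th2 V2 D2 v2 P2).
Variable b : R12 -> R[i].

Definition tens_v (s : tensor X1 X2) : tensor X1 X2 :=
  [seq (bfunM v1 t.1, bfunM v2 t.2) | t <- s].

Lemma ev_tens_v s z : ev (tens_v s) z = v1 z.1 * v2 z.2 * ev s z.
Proof.
rewrite /ev big_map mulr_sumr; apply: eq_bigr => t _ /=; ring.
Qed.

Let two0 : (0 : R) < 2. Proof. by []. Qed.

Let chi_L2 d (T : measurableType d) (mu : {measure set T -> \bar R}) (A : set T) :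
  measurable A -> (mu A < +oo)%E -> in_Lp mu 2 (chi A).
Proof.
move=> mA Ay; have := bfun_in_Lp (bfun_chi measurableT mA) mA Ay two0.
by congr in_Lp; apply/funext => x; rewrite bfun_chiE setTI.
Qed.

Let g := chi (Y1 `*` Y2) : R12 -> R[i].

Let gE z : g z = \sum_(i <- [:: tt]) chi Y1 z.1 * chi Y2 z.2.
Proof.
rewrite big_seq1 /g !chiE if_mul; congr (if _ then _ else _).
by apply/idP/andP => [/set_mem[? ?]|[/set_mem ? /set_mem ?]]; [split|]; exact: mem_set.
Qed.

(** In each variable, [v a] times [Ts 1_Y] is [a], and [T (v a)] times [1_Y] is [P a]. The four
    products in the form therefore become [P2 s], [s], [P1 P2 s] and [P1 s] with signs [+], [-],
    [-], [+], the negative of the expansion of [(1 - P1)(1 - P2) s]. *)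
Lemma bicommutator_half_steps s :
  cmeasurable b ->
  cint leb2 (fun z => b z * ev s z) ->
  cint leb2 (fun z => b z * ev (map1 P1 s) z) ->
  cint leb2 (fun z => b z * ev (map2 P2 s) z) ->
  cint leb2 (fun z => b z * ev (map1 P1 (map2 P2 s)) z) ->
  bicommutator_form T1 T1s T2 T2s b (ev (tens_v s)) (chi (Y1 `*` Y2)) =
  - (cintegral leb2 setT (fun z => b z * ev s z)
     - cintegral leb2 setT (fun z => b z * ev (map1 P1 s) z)
     - cintegral leb2 setT (fun z => b z * ev (map2 P2 s) z)
     + cintegral leb2 setT (fun z => b z * ev (map1 P1 (map2 P2 s)) z)).
Proof.
move=> mb c0 c1 c2 c12; have [_ v1E P1E _ _] := H1; have [_ v2E P2E _ _] := H2.
pose A (t : bfun X1 * bfun X2) := bfunM v1 t.1 : Rn R d1 -> R[i].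
pose B (t : bfun X1 * bfun X2) := bfunM v2 t.2 : Rn R d2 -> R[i].
have A2 t : in_Lp (leb d1) 2 (A t) by exact: bfun_in_Lp.
have B2 t : in_Lp (leb d2) 2 (B t) by exact: bfun_in_Lp.
have mA t : cmeasurable (A t) by exact: bfun_meas.
have mB t : cmeasurable (B t) by exact: bfun_meas.
set f := ev (tens_v s); have mf : cmeasurable f by exact: ev_meas.
have fE : {ae leb2, forall z, f z = \sum_(t <- s) A t z.1 * B t z.2}.
  by apply: aeW => z; rewrite /f /ev big_map.
have [mf2 f2E] := act2_tensor T2b mA B2 mf fE.
have mTB t : cmeasurable (T2 (B t)) by have [] := op_in_L2 T2b (B2 t).
have [mf12 f12E] := act1_tensor T1b A2 mTB mf2 f2E.
have [mf1 f1E] := act1_tensor T1b A2 mB mf fE.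
have Y1L := chi_L2 mY1 Y1y; have Y2L := chi_L2 mY2 Y2y.
have [mY1' _] := Y1L; have [mY2' _] := Y2L.
have mg : cmeasurable g by apply: cmeasurable_chi; exact: measurableX.
have gE' : {ae leb2, forall z, g z = \sum_(i <- [:: tt]) chi Y1 z.1 * chi Y2 z.2}.
  exact: aeW.
have [mg2 g2E] := act2_tensor T2sb (fun=> mY1') (fun=> Y2L) mg gE'.
have mTg2 : cmeasurable (T2s (chi Y2)) by have [] := op_in_L2 T2sb Y2L.
have [mg12 g12E] := act1_tensor T1sb (fun=> Y1L) (fun=> mTg2) mg2 g2E.
have [mg1 g1E] := act1_tensor T1sb (fun=> Y1L) (fun=> mY2') mg gE'.
have a1E (a : bfun X1) : {ae leb d1, forall x, bfunM v1 a x * T1s (chi Y1) x = a x}.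
  apply: filterS v1E => x h; have [Xx|Xx] := pselect (X1 x).
    by rewrite /= mulrAC h// mul1r.
  by rewrite /= (bfun_off a)// mulr0 mul0r.
have a2E (a : bfun X2) : {ae leb d2, forall x, bfunM v2 a x * T2s (chi Y2) x = a x}.
  apply: filterS v2E => x h; have [Xx|Xx] := pselect (X2 x).
    by rewrite /= mulrAC h// mul1r.
  by rewrite /= (bfun_off a)// mulr0 mul0r.
have p1E (a : bfun X1) : {ae leb d1, forall x, T1 (bfunM v1 a) x * chi Y1 x = P1 a x}.
  apply: filterS (P1E a) => x h; rewrite chiE; have [Xx|Xx] := pselect (Y1 x).
    by rewrite mem_set// mulr1 h.
  by rewrite memNset// (bfun_off (P1 a))// mulr0.
have p2E (a : bfun X2) : {ae leb d2, forall x, T2 (bfunM v2 a) x * chi Y2 x = P2 a x}.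
  apply: filterS (P2E a) => x h; rewrite chiE; have [Xx|Xx] := pselect (Y2 x).
    by rewrite mem_set// mulr1 h.
  by rewrite memNset// (bfun_off (P2 a))// mulr0.
have comb (F G F' G' : _ -> _) (Z Z' : bfun X1 * bfun X2 -> _ -> R[i]) :
    (forall t, {ae leb d1, forall x, F t x * F' x = Z t x}) ->
    (forall t, {ae leb d2, forall x, G t x * G' x = Z' t x}) ->
    {ae @leb2 R d1 d2, forall z, (\sum_(t <- s) F t z.1 * G t z.2) * (F' z.1 * G' z.2) =
      \sum_(t <- s) Z t z.1 * Z' t z.2}.
  move=> h1 h2.
  have : {ae @leb2 R d1 d2, forall z, \sum_(t <- s) (F t z.1 * F' z.1) * (G t z.2 * G' z.2) =
      \sum_(t <- s) Z t z.1 * Z' t z.2}.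
    by apply: ae_eq_sum => t; apply: filterS2 (ae_fst (h1 t)) (ae_snd (h2 t)) => z -> ->.
  apply: filterS => z <-; rewrite mulr_suml; apply: eq_bigr => t _; exact: mulrACA.
have e1 := comb _ _ _ _ _ _ (fun t => a1E t.1) (fun t => p2E t.2).
have e2 := comb _ _ _ _ _ _ (fun t => a1E t.1) (fun t => a2E t.2).
have e3 := comb _ _ _ _ _ _ (fun t => p1E t.1) (fun t => p2E t.2).
have e4 := comb _ _ _ _ _ _ (fun t => p1E t.1) (fun t => a2E t.2).
have E1 : {ae @leb2 R d1 d2, forall z, act2 T2 f z * act1 T1s g z = ev (map2 P2 s) z}.
  apply: filterS3 f2E g1E e1 => z -> ->; rewrite big_seq1 => ->.
  by rewrite /ev big_map.
have E2 : {ae @leb2 R d1 d2, forall z, f z * act1 T1s (act2 T2s g) z = ev s z}.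
  by apply: filterS3 fE g12E e2 => z -> ->; rewrite big_seq1.
have E3 : {ae @leb2 R d1 d2, forall z, act1 T1 (act2 T2 f) z * g z =
    ev (map1 P1 (map2 P2 s)) z}.
  apply: filterS2 f12E e3 => z ->; rewrite gE big_seq1 => ->.
  by rewrite /ev !big_map.
have E4 : {ae @leb2 R d1 d2, forall z, act1 T1 f z * act2 T2s g z = ev (map1 P1 s) z}.
  apply: filterS3 f1E g2E e4 => z -> ->; rewrite big_seq1 => ->.
  by rewrite /ev big_map.
have cc01 := cintB c0 c1; have cc2 := cintB cc01 c2; have cc := cintD cc2 c12.
rewrite /bicommutator_form.
transitivity (cintegral leb2 setT (fun z => - (b z * ev s z - b z * ev (map1 P1 s) z
    - b z * ev (map2 P2 s) z + b z * ev (map1 P1 (map2 P2 s)) z))).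
  apply: ae_eq_cintegral.
  - apply: (cmeasurableM mb).
    exact: (cmeasurableD (cmeasurableB (cmeasurableB (cmeasurableM mf2 mg1)
      (cmeasurableM mf mg12)) (cmeasurableM mf12 mg)) (cmeasurableM mf1 mg2)).
  - by have [] := cintN cc.
  - apply: filterS2 (filterI E1 E2) (filterI E3 E4) => z [h1 h2] [h3 h4].
    by rewrite h1 h2 h3 h4; ring.
by rewrite (cintegralN cc) (cintegralD cc2 c12) (cintegralB cc01 c2) (cintegralB c0 c1).
Qed.

End bicommutator_identity.

(** * Contraction on functions of mean zero *)

Section near_average_section.
Context {R : realType} {d : measure_display} {T : measurableType d}.
Variable mu : {measure set T -> \bar R}.
Local Notation bfun := (@bfun R _ _).

(** What the iteration retains of [half_step], free of operators and weights. *)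
Definition near_average (theta V : R) (X Y : set T) (P : bfun X -> bfun Y) :=
  [/\ forall f, cintegral mu setT (P f) = cintegral mu setT f,
      forall (c : R[i]) (f g : bfun X),
        {ae mu, forall x, P (bfunD (bfunZ c f) g) x = c * P f x + P g x} &
      forall f, {ae mu, forall x, Y x ->
        cabs (P f x - (V^-1)%:C%C * cintegral mu setT f) <=
        theta / V * l1norm mu f}].

(** The linear combination is first assembled into a single function and the estimate applied once
    to it, so that the constant does not grow with the number of terms. *)
Lemma near_average_sum theta V X Y (P : bfun X -> bfun Y) I (s : seq I)
    (c : I -> R[i]) (f : I -> bfun X) : 0 <= theta -> 0 < V ->
  near_average theta V P ->
  (cintegral mu setT (fun x => \sum_(i <- s) c i * f i x) = 0) ->
  {ae mu, forall x, cabs (\sum_(i <- s) c i * P (f i) x) <=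
    theta / V * l1norm mu (fun x => \sum_(i <- s) c i * f i x)}.
Proof.
move=> th0 V0 [_ Plin Pnear] s0; pose comb := foldr (fun i g => bfunD (bfunZ (c i) (f i)) g) (bfun0 X).
have combE r x : comb r x = \sum_(i <- r) c i * f i x.
  by elim: r => [|i r ih]; rewrite ?big_nil ?big_cons//= ih.
have PcombE r : {ae mu, forall x, P (comb r) x = \sum_(i <- r) c i * P (f i) x}.
  elim: r => [|i r ih]; last first.
    by apply: filterS2 ih (Plin (c i) (f i) (comb r)) => x e1 e2; rewrite big_cons e2 e1.
  (* That [P] sends the zero function to 0 is read off the near-average estimate, whose right-hand
     side vanishes there. *)
  apply: filterS (Pnear (bfun0 X)) => x h; rewrite big_nil.
  have [Yx|Yx] := pselect (Y x); last by rewrite bfun_off.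
  apply: cabs_eq0; apply/eqP; rewrite eq_le cabs_ge0 andbT.
  have := h Yx; rewrite /= cintegral0 mulr0 subr0 /l1norm.
  by under eq_Rintegral do rewrite cabs0; rewrite Rintegral_cst//= mul0r mulr0.
have l1E : l1norm mu (fun x => \sum_(i <- s) c i * f i x) = l1norm mu (comb s).
  by congr l1norm; apply/funext => x; rewrite combE.
have int0 : cintegral mu setT (comb s) = 0.
  by rewrite -[RHS]s0; congr cintegral; apply/funext => x; rewrite combE.
apply: filterS2 (PcombE s) (Pnear (comb s)) => x e h; rewrite -e l1E.
have [Yx|Yx] := pselect (Y x); first by have := h Yx; rewrite int0 mulr0 subr0.
by rewrite bfun_off// cabs0 mulr_ge0 ?divr_ge0 ?l1norm_ge0// ltW.
Qed.

End near_average_section.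

Section contraction.
Context {R : realType} {d1 d2 : measure_display}
  {T1 : measurableType d1} {T2 : measurableType d2}.
Variables (m1 : {sigma_finite_measure set T1 -> \bar R})
  (m2 : {sigma_finite_measure set T2 -> \bar R}).
Local Notation bfun := (@bfun R _ _).
Local Notation tensor := (@tensor R _ _ _ _).
Local Notation mixI := (mixI m1 m2).

(** Vanishing means are asked of the individual factors, not just of the slices of [ev s], since the
    maps act on the factors and preserve the condition term by term. *)
Definition mean0 (X1 : set T1) (X2 : set T2) (s : tensor X1 X2) : Prop :=
  foldr (fun (t : bfun X1 * bfun X2) A => [/\ cintegral m1 setT t.1 = 0, cintegral m2 setT t.2 = 0 & A]) True s.

Variables (X1 Y1 : set T1) (X2 Y2 : set T2).
Hypotheses (mX1 : measurable X1) (mY1 : measurable Y1)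
  (mX2 : measurable X2) (mY2 : measurable Y2).
Variables V1 V2 th1 th2 : R.
Hypotheses (X1V : (m1 X1 = V1%:E)%E) (Y1V : (m1 Y1 = V1%:E)%E)
  (X2V : (m2 X2 = V2%:E)%E) (Y2V : (m2 Y2 = V2%:E)%E).
Hypotheses (V10 : 0 < V1) (V20 : 0 < V2) (th10 : 0 <= th1) (th20 : 0 <= th2).
Variables (P1 : bfun X1 -> bfun Y1) (P2 : bfun X2 -> bfun Y2).
Hypotheses (P1n : near_average m1 th1 V1 P1) (P2n : near_average m2 th2 V2 P2).
Variable s : tensor X1 X2.
Hypothesis s0 : mean0 s.

Let X1y : (m1 X1 < +oo)%E. Proof. by rewrite X1V ltry. Qed.
Let X2y : (m2 X2 < +oo)%E. Proof. by rewrite X2V ltry. Qed.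

Lemma mean0_map1 : mean0 (map1 P1 s).
Proof.
have [PI _ _] := P1n; elim: s s0 => //= t r ih [t1 t2 /ih r0].
by split => //; rewrite PI.
Qed.

Lemma mean0_map2 : mean0 (map2 P2 s).
Proof.
have [PI _ _] := P2n; elim: s s0 => //= t r ih [t1 t2 /ih r0].
by split => //; rewrite PI.
Qed.

Let ev1 x := fun y => \sum_(t <- s) t.1 x * t.2 y.
Let ev2 y := fun x => \sum_(t <- s) t.2 y * t.1 x.

Let ev2E y x : ev2 y x = ev s (x, y).
Proof. by apply: eq_bigr => t _; rewrite mulrC. Qed.

Let int_ev1 x : cintegral m2 setT (ev1 x) = 0.
Proof.
rewrite /ev1; have cF (t : bfun X1 * bfun X2) : cint m2 (fun y => t.1 x * t.2 y).
  by apply: cintZ; exact: bfun_cint.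
rewrite cintegral_sum//; elim: s s0 => [|t r ih] /=; first by rewrite big_nil.
move=> [_ t0 /ih r0]; rewrite big_cons r0 addr0 cintegralZ ?t0 ?mulr0//.
exact: bfun_cint.
Qed.

Let int_ev2 y : cintegral m1 setT (ev2 y) = 0.
Proof.
rewrite /ev2; have cF (t : bfun X1 * bfun X2) : cint m1 (fun x => t.2 y * t.1 x).
  by apply: cintZ; exact: bfun_cint.
rewrite cintegral_sum//; elim: s s0 => [|t r ih] /=; first by rewrite big_nil.
move=> [t0 _ /ih r0]; rewrite big_cons r0 addr0 cintegralZ ?t0 ?mulr0//.
exact: bfun_cint.
Qed.

Let F z := cabs (ev s z).
Let mF : measurable_fun setT F.
Proof. by apply: measurable_cabs; exact: ev_meas. Qed.
Let F0 z : 0 <= F z. Proof. exact: cabs_ge0. Qed.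
Let Foff z : ~ (X1 `*` X2) z -> F z = 0.
Proof. by move=> Xz; rewrite /F ev_off// cabs0. Qed.

Let cF : cint (m1 \x m2)%E (fun z => (F z)%:C%C).
Proof.
have [M FM] := ev_bound s.
apply: (@cint_bounded _ _ _ _ _ (X1 `*` X2) M).
- exact: measurableX.
- rewrite [X in (X < _)%E](_ : _ = (V1 * V2)%:E) ?ltry//.
  exact: etrans (product_measure1E m1 m2 mX1 mX2)
    (congr2 (fun u v => u * v)%E X1V X2V).
- exact: cmeasurable_real.
- by move=> z; rewrite cabs_real (ger0_norm (F0 z)) FM.
- by move=> z /Foff ->.
Qed.

Let L1 x := l1norm m2 (ev1 x).
Let L2 y := l1norm m1 (ev2 y).

Let mL1 : cmeasurable (fun x => (L1 x)%:C%C).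
Proof.
have := cmeasurable_cintegral2 cF; under eq_fun do rewrite cintegral_real.
exact.
Qed.

Let mL2 : cmeasurable (fun y => (L2 y)%:C%C).
Proof.
have := cmeasurable_cintegral1 cF; under eq_fun do rewrite cintegral_real.
rewrite (_ : (fun y => _) = fun y => (L2 y)%:C%C)//.
apply/funext => y; congr (_%:C%C); apply: eq_Rintegral => x _; by rewrite ev2E.
Qed.

Let L1E x : ((L1 x)%:E = \int[m2]_y (F (x, y))%:E)%E.
Proof. by rewrite /L1 l1normE//; apply: cint_sum => t; apply: cintZ; exact: bfun_cint. Qed.

Let L2E y : ((L2 y)%:E = \int[m1]_x (F (x, y))%:E)%E.
Proof.
rewrite /L2 l1normE//; last by apply: cint_sum => t; apply: cintZ; exact: bfun_cint.
by apply: eq_integral => x _; rewrite ev2E.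
Qed.

(** On each slice the mean vanishes, so the near average is only its error, at most [th1 / V1] times
    the L^1 norm of the slice. The averaging inequality then yields the factor [th1]. *)
Lemma mixI_map1 p1 p2 (r : R) : 1 < p1 -> 1 < p2 -> 0 <= r ->
  (mixI p1 p2 F <= (r `^ p1)%:E)%E ->
  (mixI p1 p2 (fun z => cabs (ev (map1 P1 s) z)) <= ((th1 * r) `^ p1)%:E)%E.
Proof.
move=> p11 p21 r0 Fr; have [M FM] := ev_bound s.
have -> : th1 * r = th1 / V1 * V1 * r by rewrite divfK// gt_eqF.
apply: (@mixI_avg1 _ _ _ _ _ m1 m2 X1 Y1 X2 X2 F _ L2 p1 p2 M) => //.
- by move=> z; rewrite F0 FM.
- by apply: measurable_cabs; exact: ev_meas.
- by move=> z; exact: cabs_ge0.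
- by move=> z h; rewrite ev_off// cabs0.
- by rewrite divr_ge0// ltW.
set G := ev (map1 P1 s).
have GE y : {ae m1, forall x, cabs (G (x, y)) <= th1 / V1 * L2 y}.
  have := near_average_sum th10 V10 P1n (int_ev2 y).
  apply: filterS => x; rewrite /G /ev big_map.
  by under [in X in _ -> X]eq_bigr do rewrite mulrC.
(* The bound is known for each fixed second variable, whereas the outer integral of [mixI] runs over
   the first; measurability of [E] allows the exchange. *)
pose E := [set z | cabs (G z) <= cabs ((th1 / V1)%:C%C * (L2 z.2)%:C%C)].
have EE z : cabs ((th1 / V1)%:C%C * (L2 z)%:C%C) = th1 / V1 * L2 z.
  by rewrite -rmorphM cabs_real ger0_norm// mulr_ge0 ?divr_ge0 ?l1norm_ge0// ltW.
have mE : measurable (~` E).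
  apply: measurableC; apply: measurable_cabs_le; first exact: ev_meas.
  apply: cmeasurableM; first exact: cmeasurable_cst.
  exact: (cmeasurable_comp measurable_snd mL2).
have h2 : {ae m2, forall y, {ae m1, forall x, ~ (~` E) (x, y)}}.
  by apply: aeW => y; apply: filterS (GE y) => x h; apply; rewrite /E /mkset EE.
apply: filterS (ae_prod_swap mE h2) => x; apply: filterS => y /contrapT.
by rewrite /E /mkset EE.
Qed.

Lemma mixI_map2 p1 p2 (r : R) : 1 < p1 -> 1 < p2 -> 0 <= r ->
  (mixI p1 p2 F <= (r `^ p1)%:E)%E ->
  (mixI p1 p2 (fun z => cabs (ev (map2 P2 s) z)) <= ((th2 * r) `^ p1)%:E)%E.
Proof.
move=> p11 p21 r0 Fr.
apply: (@le_trans _ _ (((th2 / V2 * V2) `^ p1)%:E * mixI p1 p2 F)%E); last first.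
  rewrite divfK ?gt_eqF// powRM// EFinM.
  by apply: lee_pmul => //; rewrite ?lee_fin ?powR_ge0 ?mixI_ge0.
apply: (@mixI_avg2 _ _ _ _ _ m1 m2 X1 X1 X2 Y2 F _ L1 p1 p2) => //.
- by apply: measurable_cabs; exact: ev_meas.
- by move=> z; exact: cabs_ge0.
- by move=> z h; rewrite ev_off// cabs0.
- by rewrite divr_ge0// ltW.
apply: aeW => x; have := near_average_sum th20 V20 P2n (int_ev1 x).
by apply: filterS => y; rewrite /ev big_map.
Qed.

End contraction.

(** * Absorption by iteration *)

Section absorption_section.
Context {R : realType} {d1 d2 : measure_display}
  {T1 : measurableType d1} {T2 : measurableType d2}.
Variables (m1 : {sigma_finite_measure set T1 -> \bar R})
  (m2 : {sigma_finite_measure set T2 -> \bar R}).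
Local Notation bfun := (@bfun R _ _).
Local Notation tensor := (@tensor R _ _ _ _).

Definition tensor_le p1 p2 (r : R) (Z1 : set T1) (Z2 : set T2) (s : tensor Z1 Z2) :=
  (mixI m1 m2 p1 p2 (fun z => cabs (ev s z)) <= (r `^ p1)%:E)%E.

Lemma tensor_le_mono p1 p2 (r r' : R) (Z1 : set T1) (Z2 : set T2) (s : tensor Z1 Z2) :
  0 <= p1 -> 0 <= r -> r <= r' -> tensor_le p1 p2 r s -> tensor_le p1 p2 r' s.
Proof.
move=> p10 r0 rr' h; apply: le_trans h _; rewrite lee_fin.
by rewrite ge0_ler_powR// nnegrE// (le_trans r0).
Qed.

Definition tpair (b : T1 * T2 -> R[i]) (Z1 : set T1) (Z2 : set T2) (s : tensor Z1 Z2) :=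
  cintegral (m1 \x m2)%E setT (fun z => b z * ev s z).

(** The expansion of the pairing of [b] with [(1 - U1)(1 - U2) s]; its four tensors live on four
    different rectangles. *)
Definition alt_sum b (Z1 W1 : set T1) (Z2 W2 : set T2) (U1 : bfun Z1 -> bfun W1)
    (U2 : bfun Z2 -> bfun W2) (s : tensor Z1 Z2) :=
  tpair b s - tpair b (map1 U1 s) - tpair b (map2 U2 s)
    + tpair b (map1 U1 (map2 U2 s)).

Lemma map12C (Z1 W1 : set T1) (Z2 W2 : set T2) (U1 : bfun Z1 -> bfun W1)
    (U2 : bfun Z2 -> bfun W2) (s : tensor Z1 Z2) :
  map2 U2 (map1 U1 s) = map1 U1 (map2 U2 s).
Proof. by rewrite /map1 /map2 -!map_comp. Qed.

Variables (X1 Y1 : set T1) (X2 Y2 : set T2).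
Hypotheses (mX1 : measurable X1) (mY1 : measurable Y1)
  (mX2 : measurable X2) (mY2 : measurable Y2).
Variables V1 V2 th : R.
Hypotheses (X1V : (m1 X1 = V1%:E)%E) (Y1V : (m1 Y1 = V1%:E)%E)
  (X2V : (m2 X2 = V2%:E)%E) (Y2V : (m2 Y2 = V2%:E)%E).
Hypotheses (V10 : 0 < V1) (V20 : 0 < V2) (th0 : 0 <= th) (th6 : th <= 6^-1).
Variables (P1 : bfun X1 -> bfun Y1) (P2 : bfun X2 -> bfun Y2)
  (Q1 : bfun Y1 -> bfun X1) (Q2 : bfun Y2 -> bfun X2).
Hypotheses (P1n : near_average m1 th V1 P1) (P2n : near_average m2 th V2 P2)
  (Q1n : near_average m1 th V1 Q1) (Q2n : near_average m2 th V2 Q2).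

Let th1 : th <= 1. Proof. by apply: le_trans th6 _; rewrite invf_le1 ?ler1n. Qed.

Let le_map1 Z1 W1 Z2 (U : bfun Z1 -> bfun W1) (s : tensor Z1 Z2) p1 p2 (r : R) :
  measurable Z1 -> measurable W1 -> measurable Z2 ->
  m1 Z1 = V1%:E -> m1 W1 = V1%:E -> m2 Z2 = V2%:E -> near_average m1 th V1 U ->
  mean0 m1 m2 s -> 1 < p1 -> 1 < p2 -> 0 <= r -> tensor_le p1 p2 r s ->
  tensor_le p1 p2 (th * r) (map1 U s).
Proof.
by move=> *; rewrite /tensor_le; apply: (@mixI_map1 _ _ _ _ _ m1 m2 Z1 W1 Z2 _ _ _ V1 V2).
Qed.

Let le_map2 Z1 Z2 W2 (U : bfun Z2 -> bfun W2) (s : tensor Z1 Z2) p1 p2 (r : R) :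
  measurable Z2 -> measurable W2 ->
  m2 Z2 = V2%:E -> m2 W2 = V2%:E -> near_average m2 th V2 U ->
  mean0 m1 m2 s -> 1 < p1 -> 1 < p2 -> 0 <= r -> tensor_le p1 p2 r s ->
  tensor_le p1 p2 (th * r) (map2 U s).
Proof. by move=> mZ mW ZV WV Un s0 *; exact: (mixI_map2 mZ mW ZV WV V20 th0 Un s0). Qed.

Variables (b : T1 * T2 -> R[i]) (p1 p2 Xi beta : R).
Hypotheses (p11 : 1 < p1) (p21 : 1 < p2) (Xi0 : 0 <= Xi) (beta0 : 0 <= beta).
Hypothesis base : forall (s : tensor X1 X2) (M : R), 0 <= M ->
  tensor_le 2 2 M s -> cabs (tpair b s) <= beta * M.
Hypothesis HPP : forall (s : tensor X1 X2) (r : R), 0 <= r -> tensor_le p1 p2 r s ->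
  cabs (alt_sum b P1 P2 s) <= Xi * r.
Hypothesis HQP : forall (s : tensor Y1 X2) (r : R), 0 <= r -> tensor_le p1 p2 r s ->
  cabs (alt_sum b Q1 P2 s) <= Xi * r.
Hypothesis HPQ : forall (s : tensor X1 Y2) (r : R), 0 <= r -> tensor_le p1 p2 r s ->
  cabs (alt_sum b P1 Q2 s) <= Xi * r.
Hypothesis HQQ : forall (s : tensor Y1 Y2) (r : R), 0 <= r -> tensor_le p1 p2 r s ->
  cabs (alt_sum b Q1 Q2 s) <= Xi * r.

Let S1 (s : tensor X1 X2) := map1 Q1 (map1 P1 s).
Let S2 (s : tensor X1 X2) := map2 Q2 (map2 P2 s).

(* [(1 - Q1 P1)(1 - Q2 P2)] with [1 - Q P = (1 - P) + (1 - Q) P] in each variable *)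
Let expand (s : tensor X1 X2) :
  tpair b s = alt_sum b P1 P2 s + alt_sum b Q1 P2 (map1 P1 s) +
    alt_sum b P1 Q2 (map2 P2 s) + alt_sum b Q1 Q2 (map1 P1 (map2 P2 s)) +
    (tpair b (S1 s) + tpair b (S2 s) - tpair b (S1 (S2 s))).
Proof. by rewrite /alt_sum /S1 /S2 !map12C; ring. Qed.

(** Two sizes are tracked: [r] in the exponents [p1], [p2], which controls the four alternating
    sums, and [M] in L^2, which controls what is left after [n] rounds. Each of the three remainders
    gains 1/6 in both, so the L^2 term is halved, and [8] solves [4 + 3 (8/6) = 8]. *)
Let iterate n : forall (s : tensor X1 X2) (r M : R), 0 <= r -> 0 <= M ->
  mean0 m1 m2 s -> tensor_le p1 p2 r s -> tensor_le 2 2 M s ->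
  cabs (tpair b s) <= 8 * Xi * r + 2^-1 ^+ n * (beta * M).
Proof.
have two1 : (1 : R) < 2 by rewrite ltr1n.
elim: n => [|n ih] s r M r0 M0 s0 sr sM.
  rewrite expr0 mul1r; apply: le_trans (base M0 sM) _.
  by rewrite lerDr !mulr_ge0.
have S q1 q2 (t : R) : 1 < q1 -> 1 < q2 -> 0 <= t -> tensor_le q1 q2 t s ->
    [/\ tensor_le q1 q2 t (map1 P1 s), tensor_le q1 q2 t (map2 P2 s),
        tensor_le q1 q2 t (map1 P1 (map2 P2 s)), tensor_le q1 q2 (t / 6) (S1 s) &
        tensor_le q1 q2 (t / 6) (S2 s) /\ tensor_le q1 q2 (t / 6) (S1 (S2 s))].
  move=> q11 q21 t0 st; have q10 : 0 <= q1 by rewrite (le_trans ler01)// ltW.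
  have tt0 : 0 <= th * t by rewrite mulr_ge0.
  have le1 : th * t <= t by rewrite ler_piMl.
  have le6 u : 0 <= u -> u <= t -> th * u <= t / 6.
    by move=> u0 ut; rewrite (mulrC t); exact: ler_pM.
  have h1 := le_map1 mX1 mY1 mX2 X1V Y1V X2V P1n s0 q11 q21 t0 st.
  have h2 := le_map2 mX2 mY2 X2V Y2V P2n s0 q11 q21 t0 st.
  have n1 := mean0_map1 P1n s0; have n2 := mean0_map2 P2n s0.
  have h2' := tensor_le_mono q10 tt0 le1 h2.
  have h12 := le_map1 mX1 mY1 mY2 X1V Y1V Y2V P1n n2 q11 q21 t0 h2'.
  have g1 := le_map1 mY1 mX1 mX2 Y1V X1V X2V Q1n n1 q11 q21 tt0 h1.
  have g2 := le_map2 mY2 mX2 Y2V X2V Q2n n2 q11 q21 tt0 h2.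
  have tth0 : 0 <= th * (th * t) by rewrite !mulr_ge0.
  have g6 : th * (th * t) <= t / 6 by exact: le6.
  have g2' : tensor_le q1 q2 t (S2 s).
    by apply: tensor_le_mono g2 => //; apply: le_trans le1; rewrite ler_piMl.
  have n22 : mean0 m1 m2 (S2 s) := mean0_map2 Q2n n2.
  have k1 := le_map1 mX1 mY1 mX2 X1V Y1V X2V P1n n22 q11 q21 t0 g2'.
  have n221 := mean0_map1 P1n n22.
  have k2 := le_map1 mY1 mX1 mX2 Y1V X1V X2V Q1n n221 q11 q21 tt0 k1.
  split; [| | | |split].
  - exact: tensor_le_mono h1.
  - exact: h2'.
  - exact: tensor_le_mono h12.
  - exact: tensor_le_mono g1.
  - exact: tensor_le_mono g2.
  - exact: tensor_le_mono k2.
have [a1 a2 a3 a4 [a5 a6]] := S p1 p2 r p11 p21 r0 sr.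
have [_ _ _ b4 [b5 b6]] := S 2 2 M two1 two1 M0 sM.
have r6 : 0 <= r / 6 by rewrite divr_ge0.
have M6 : 0 <= M / 6 by rewrite divr_ge0.
have n2 : mean0 m1 m2 (S2 s) := mean0_map2 Q2n (mean0_map2 P2n s0).
have n1 : mean0 m1 m2 (S1 s) := mean0_map1 Q1n (mean0_map1 P1n s0).
have n12 : mean0 m1 m2 (S1 (S2 s)) := mean0_map1 Q1n (mean0_map1 P1n n2).
have i1 := ih _ _ _ r6 M6 n1 a4 b4; have i2 := ih _ _ _ r6 M6 n2 a5 b5.
have i3 := ih _ _ _ r6 M6 n12 a6 b6.
have c1 := HPP r0 sr; have c2 := HQP r0 a1; have c3 := HPQ r0 a2; have c4 := HQQ r0 a3.
rewrite (expand s).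
set w1 := alt_sum b P1 P2 s in c1 *; set w2 := alt_sum _ _ _ _ in c2 *.
set w3 := alt_sum _ _ _ _ in c3 *; set w4 := alt_sum _ _ _ _ in c4 *.
have e1 := ler_cabsD (w1 + w2 + w3 + w4)
  (tpair b (S1 s) + tpair b (S2 s) - tpair b (S1 (S2 s))).
have e2 := ler_cabsD (w1 + w2 + w3) w4; have e3 := ler_cabsD (w1 + w2) w3.
have e4 := ler_cabsD w1 w2.
have e5 := ler_cabsB (tpair b (S1 s) + tpair b (S2 s)) (tpair b (S1 (S2 s))).
have e6 := ler_cabsD (tpair b (S1 s)) (tpair b (S2 s)).
have -> : 2^-1 ^+ n.+1 * (beta * M) = 3 * (2^-1 ^+ n * (beta * (M / 6))) :> R.
  by rewrite exprS; field.
have -> : 8 * Xi * r = 4 * (Xi * r) + 3 * (8 * Xi * (r / 6)) :> R by field.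
lra.
Qed.

(** Letting the number of rounds tend to infinity removes [beta] and [M], of which only finiteness
    matters. This replaces absorption of the oscillation itself, which may be infinite. *)
Lemma absorption (s : tensor X1 X2) (r : R) : 0 <= r -> mean0 m1 m2 s ->
  tensor_le p1 p2 r s -> (exists2 M : R, 0 <= M & tensor_le 2 2 M s) ->
  cabs (tpair b s) <= 8 * Xi * r.
Proof.
move=> r0 s0 sr [M M0 sM]; apply/ler_addgt0Pr => e e0.
have bM : 0 <= beta * M by rewrite mulr_ge0.
have [n nP] : exists n, 2^-1 ^+ n * (beta * M) < e.
  have h : (fun n => 2^-1 ^+ n * (beta * M)) @ \oo --> (0 : R).
    rewrite -(mul0r (beta * M)); apply: cvgMl; apply: cvg_expr.
    by rewrite ger0_norm//; lra.
  move/cvgrPdist_lt : h => /(_ e e0)[n _ /(_ n (leqnn n))] /=.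
  rewrite sub0r normrN ger0_norm ?mulr_ge0 ?exprn_ge0//.
  by exists n.
apply: le_trans (iterate n r0 M0 s0 sr sM) _.
by rewrite lerD2l ltW.
Qed.

End absorption_section.

(** * Centering and oscillation *)

Section averaging.
Context {R : realType} {d1 d2 : measure_display}
  {T1 : measurableType d1} {T2 : measurableType d2}.
Variables (m1 : {sigma_finite_measure set T1 -> \bar R})
  (m2 : {sigma_finite_measure set T2 -> \bar R}).
Local Notation bfun := (@bfun R _ _).
Local Notation tensor := (@tensor R _ _ _ _).
Local Notation mu := (m1 \x m2)%E.
Implicit Types u : T1 * T2 -> R[i].

Lemma cint_slice1 u : cint mu u -> {ae m1, forall x, cint m2 (fun y => u (x, y))}.
Proof.
move=> cu; have [mu' _] := cu; have := ae_integrable1 (cint_integrable cu).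
apply: filterS => x /integrableP[_ h]; split; first exact: cmeasurable_slice1.
by move: h; congr (_ < _)%E; apply: eq_integral => y _; rewrite gee0_abs// lee_fin cabs_ge0.
Qed.

Lemma cint_slice2 u : cint mu u -> {ae m2, forall y, cint m1 (fun x => u (x, y))}.
Proof.
move=> cu; have [mu' _] := cu; have := ae_integrable2 (cint_integrable cu).
apply: filterS => x /integrableP[_ h]; split; first exact: cmeasurable_slice2.
by move: h; congr (_ < _)%E; apply: eq_integral => y _; rewrite gee0_abs// lee_fin cabs_ge0.
Qed.

Lemma cint_mul_bounded d (T : measurableType d) (nu : {measure set T -> \bar R})
    (f g : T -> R[i]) (M : R) : cint nu f -> cmeasurable g ->
  (forall x, cabs (g x) <= M) -> cint nu (fun x => f x * g x).
Proof.
move=> cf mg gM; have [mf _] := cf.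
apply: (cint_le _ (cintZ `|M|%:C%C cf)); first exact: cmeasurableM.
move=> x; rewrite !cabsM cabs_real normr_id mulrC ler_wpM2r ?cabs_ge0//.
by apply: le_trans (gM x) _; exact: ler_norm.
Qed.

Variables (X1 : set T1) (X2 : set T2).
Hypotheses (mX1 : measurable X1) (mX2 : measurable X2).
Variables V1 V2 : R.
Hypotheses (X1V : (m1 X1 = V1%:E)%E) (X2V : (m2 X2 = V2%:E)%E).
Hypotheses (V10 : 0 < V1) (V20 : 0 < V2).

Let X1y : (m1 X1 < +oo)%E. Proof. by rewrite X1V ltry. Qed.
Let X2y : (m2 X2 < +oo)%E. Proof. by rewrite X2V ltry. Qed.

(** For [u] supported in the rectangle, this is the average in the first variable, cut off to [X1]
    so that supports stay in the rectangle. *)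
Definition mean1 u z := (V1^-1)%:C%C * chi X1 z.1 * cintegral m1 setT (fun x => u (x, z.2)).
Definition mean2 u z := (V2^-1)%:C%C * chi X2 z.2 * cintegral m2 setT (fun y => u (z.1, y)).

Let cint_chi1 : cint m1 (chi X1). Proof. exact: cint_chi. Qed.
Let cint_chi2 : cint m2 (chi X2). Proof. exact: cint_chi. Qed.

Lemma integral_chi d (T : measurableType d) (nu : {measure set T -> \bar R}) (A : set T)
  (V : R) : measurable A -> nu A = V%:E ->
  (\int[nu]_x (cabs (chi A x : R[i]))%:E = V%:E)%E.
Proof.
move=> mA AV; under eq_integral do rewrite cabs_chi.
by rewrite integral_indic// setIT.
Qed.

Lemma cmeasurable_mean1 u : cint mu u -> cmeasurable (mean1 u).
Proof.
move=> cu; apply: cmeasurableM.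
  apply: cmeasurableM; first exact: cmeasurable_cst.
  by apply: (cmeasurable_comp measurable_fst); exact: cmeasurable_chi.
exact: (cmeasurable_comp measurable_snd (cmeasurable_cintegral1 cu)).
Qed.

Lemma cmeasurable_mean2 u : cint mu u -> cmeasurable (mean2 u).
Proof.
move=> cu; apply: cmeasurableM.
  apply: cmeasurableM; first exact: cmeasurable_cst.
  by apply: (cmeasurable_comp measurable_snd); exact: cmeasurable_chi.
exact: (cmeasurable_comp measurable_fst (cmeasurable_cintegral2 cu)).
Qed.

Lemma cint_mean1 u : cint mu u -> cint mu (mean1 u).
Proof.
move=> cu; have mE := cmeasurable_mean1 cu; split => //.
have [mu' uy] := cu.
have mI := cmeasurable_cintegral1 cu.
rewrite fubini_tonelli2//; [|exact: emeasurable_cabs|by move=> z; rewrite lee_fin cabs_ge0].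
apply: le_lt_trans uy.
rewrite [leRHS]fubini_tonelli2//; [|exact: emeasurable_cabs|by move=> z; rewrite lee_fin cabs_ge0].
apply: ae_ge0_le_integral => //.
- by move=> y _; apply: integral_ge0 => x _; rewrite lee_fin cabs_ge0.
- apply: measurable_fun_fubini_tonelli_G; first exact: emeasurable_cabs.
  by move=> z; rewrite lee_fin cabs_ge0.
- by move=> y _; apply: integral_ge0 => x _; rewrite lee_fin cabs_ge0.
- apply: measurable_fun_fubini_tonelli_G; first exact: emeasurable_cabs.
  by move=> z; rewrite lee_fin cabs_ge0.
apply: filterS (cint_slice2 cu) => y cy _; rewrite /fubini_G.
apply: le_trans _ (le_cabs_cintegral cy).
set c := cintegral _ _ _.
have E x : ((cabs (mean1 u (x, y)))%:E = (V1^-1 * cabs c)%:E * (cabs (chi X1 x : R[i]))%:E)%E.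
  rewrite /mean1 -/c !cabsM cabs_real ger0_norm ?invr_ge0 ?(ltW V10)//.
  by rewrite -EFinM mulrAC.
under eq_integral do rewrite E.
rewrite ge0_integralZl_EFin//.
- rewrite (integral_chi mX1 X1V) -EFinM lee_fin mulrAC mulVf ?mul1r//.
  by rewrite gt_eqF.
- by move=> x _; rewrite lee_fin cabs_ge0.
- by apply: emeasurable_cabs; exact: cmeasurable_chi.
- by rewrite mulr_ge0 ?cabs_ge0// invr_ge0 ltW.
Qed.

Lemma cint_mean2 u : cint mu u -> cint mu (mean2 u).
Proof.
move=> cu; have mE := cmeasurable_mean2 cu; split => //.
have [mu' uy] := cu.
have mI := cmeasurable_cintegral2 cu.
rewrite fubini_tonelli1//; [|exact: emeasurable_cabs|by move=> z; rewrite lee_fin cabs_ge0].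
apply: le_lt_trans uy.
rewrite [leRHS]fubini_tonelli1//; [|exact: emeasurable_cabs|by move=> z; rewrite lee_fin cabs_ge0].
apply: ae_ge0_le_integral => //.
- by move=> y _; apply: integral_ge0 => x _; rewrite lee_fin cabs_ge0.
- apply: measurable_fun_fubini_tonelli_F; first exact: emeasurable_cabs.
  by move=> z; rewrite lee_fin cabs_ge0.
- by move=> y _; apply: integral_ge0 => x _; rewrite lee_fin cabs_ge0.
- apply: measurable_fun_fubini_tonelli_F; first exact: emeasurable_cabs.
  by move=> z; rewrite lee_fin cabs_ge0.
apply: filterS (cint_slice1 cu) => x cx _; rewrite /fubini_F.
apply: le_trans _ (le_cabs_cintegral cx).
set c := cintegral _ _ _.
have E y : ((cabs (mean2 u (x, y)))%:E = (V2^-1 * cabs c)%:E * (cabs (chi X2 y : R[i]))%:E)%E.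
  rewrite /mean2 -/c !cabsM cabs_real ger0_norm ?invr_ge0 ?(ltW V20)//.
  by rewrite -EFinM mulrAC.
under eq_integral do rewrite E.
rewrite ge0_integralZl_EFin//.
- rewrite (integral_chi mX2 X2V) -EFinM lee_fin mulrAC mulVf ?mul1r//.
  by rewrite gt_eqF.
- by move=> y _; rewrite lee_fin cabs_ge0.
- by apply: emeasurable_cabs; exact: cmeasurable_chi.
- by rewrite mulr_ge0 ?cabs_ge0// invr_ge0 ltW.
Qed.

Let one1 : bfun X1 := bfun_chi measurableT mX1.
Let one2 : bfun X2 := bfun_chi measurableT mX2.

Definition bmean1 (a : bfun X1) : bfun X1 :=
  bfunZ ((V1^-1)%:C%C * cintegral m1 setT a) one1.
Definition bmean2 (a : bfun X2) : bfun X2 :=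
  bfunZ ((V2^-1)%:C%C * cintegral m2 setT a) one2.

Let bmean1E a x : bmean1 a x = (V1^-1)%:C%C * chi X1 x * cintegral m1 setT a.
Proof. by rewrite /= setTI mulrAC. Qed.

Let bmean2E a x : bmean2 a x = (V2^-1)%:C%C * chi X2 x * cintegral m2 setT a.
Proof. by rewrite /= setTI mulrAC. Qed.

Let cb1 (a : bfun X1) : cint m1 a. Proof. exact: bfun_cint. Qed.
Let cb2 (a : bfun X2) : cint m2 a. Proof. exact: bfun_cint. Qed.

Lemma ev_bmean1 (s : tensor X1 X2) : ev (map1 bmean1 s) = mean1 (ev s).
Proof.
apply/funext => z; rewrite /mean1 /ev big_map.
rewrite (_ : (fun x => \sum_(t <- s) t.1 (x, z.2).1 * t.2 (x, z.2).2) =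
  fun x => \sum_(t <- s) t.2 z.2 * t.1 x); last first.
  by apply/funext => x; apply: eq_bigr => t _; rewrite mulrC.
rewrite cintegral_sum; last by move=> t; exact: cintZ.
rewrite mulr_sumr; apply: eq_bigr => t _; rewrite cintegralZ// bmean1E.
by rewrite mulrAC mulrA.
Qed.

Lemma ev_bmean2 (s : tensor X1 X2) : ev (map2 bmean2 s) = mean2 (ev s).
Proof.
apply/funext => z; rewrite /mean2 /ev big_map.
rewrite cintegral_sum; last by move=> t; exact: (cintZ (t.1 z.1)).
rewrite mulr_sumr; apply: eq_bigr => t _.
transitivity (t.1 z.1 * bmean2 t.2 z.2) => //; rewrite bmean2E.
have -> : cintegral m2 setT (fun y => t.1 (z.1, y).1 * t.2 (z.1, y).2) =
  t.1 z.1 * cintegral m2 setT t.2 by exact: (cintegralZ (t.1 z.1) (cb2 t.2)).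
by rewrite /=; ring.
Qed.

Let supported u := forall z, ~ (X1 `*` X2) z -> u z = 0.

Lemma mean1_off u : supported u -> supported (mean1 u).
Proof.
move=> u0 z Xz; rewrite /mean1; have [X1z|X1z] := pselect (X1 z.1); last first.
  by rewrite chiE memNset// mulr0 mul0r.
rewrite [X in _ * X](_ : _ = 0) ?mulr0// -[RHS](cintegral0 m1).
by congr cintegral; apply/funext => x; apply: u0 => -[_ /= X2z]; apply: Xz.
Qed.

Lemma mean2_off u : supported u -> supported (mean2 u).
Proof.
move=> u0 z Xz; rewrite /mean2; have [X2z|X2z] := pselect (X2 z.2); last first.
  by rewrite chiE memNset// mulr0 mul0r.
rewrite [X in _ * X](_ : _ = 0) ?mulr0// -[RHS](cintegral0 m2).
by congr cintegral; apply/funext => x; apply: u0 => -[/= X1z _]; apply: Xz.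
Qed.

(** Averaging is symmetric for the bilinear pairing: for almost every second variable both inner
    integrals equal [I J / V1], with [I] and [J] the slice integrals of [u] and [ev s]. *)
Lemma mean1_sym u (s : tensor X1 X2) : cint mu u -> supported u ->
  cintegral mu setT (fun z => u z * ev (map1 bmean1 s) z) =
  cintegral mu setT (fun z => mean1 u z * ev s z).
Proof.
move=> cu u0.
have [M sM] := ev_bound s; have [M' sM'] := ev_bound (map1 bmean1 s).
have c1 : cint mu (fun z => u z * ev (map1 bmean1 s) z).
  by apply: (cint_mul_bounded cu _ sM'); exact: ev_meas.
have c2 : cint mu (fun z => mean1 u z * ev s z).
  by apply: (cint_mul_bounded (cint_mean1 cu) _ sM); exact: ev_meas.
rewrite (cfubini2 c1) (cfubini2 c2); apply: ae_eq_cintegral.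
- exact: (cmeasurable_cintegral1 c1).
- exact: (cmeasurable_cintegral1 c2).
apply: filterS (cint_slice2 cu) => y cy.
rewrite ev_bmean1.
have cs : cint m1 (fun x => ev s (x, y)).
  rewrite (_ : (fun x => _) = fun x => \sum_(t <- s) t.2 y * t.1 x); last first.
    by apply/funext => x; apply: eq_bigr => t _; rewrite mulrC.
  by apply: cint_sum => t; exact: cintZ.
set I := cintegral m1 setT (fun x => u (x, y)).
set J := cintegral m1 setT (fun x => ev s (x, y)).
transitivity ((V1^-1)%:C%C * J * I).
  rewrite -cintegralZ//; congr cintegral; apply/funext => x.
  rewrite /mean1 -/J /=; have [Xx|Xx] := pselect (X1 x).
    by rewrite chiE mem_set// mulr1 mulrC.
  by rewrite u0 ?mul0r ?mulr0// => -[].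
transitivity ((V1^-1)%:C%C * I * J); first by rewrite mulrAC.
rewrite -cintegralZ//; congr cintegral; apply/funext => x.
rewrite /mean1 -/I /=; have [Xx|Xx] := pselect (X1 x).
  by rewrite chiE mem_set// mulr1.
by rewrite ev_off ?mulr0// => -[].
Qed.

Lemma mean2_sym u (s : tensor X1 X2) : cint mu u -> supported u ->
  cintegral mu setT (fun z => u z * ev (map2 bmean2 s) z) =
  cintegral mu setT (fun z => mean2 u z * ev s z).
Proof.
move=> cu u0.
have [M sM] := ev_bound s; have [M' sM'] := ev_bound (map2 bmean2 s).
have c1 : cint mu (fun z => u z * ev (map2 bmean2 s) z).
  by apply: (cint_mul_bounded cu _ sM'); exact: ev_meas.
have c2 : cint mu (fun z => mean2 u z * ev s z).
  by apply: (cint_mul_bounded (cint_mean2 cu) _ sM); exact: ev_meas.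
rewrite (cfubini1 c1) (cfubini1 c2); apply: ae_eq_cintegral.
- exact: (cmeasurable_cintegral2 c1).
- exact: (cmeasurable_cintegral2 c2).
apply: filterS (cint_slice1 cu) => x cx.
rewrite ev_bmean2.
have cs : cint m2 (fun y => ev s (x, y)).
  by apply: cint_sum => t; exact: (cintZ (t.1 x) (cb2 t.2)).
set I := cintegral m2 setT (fun y => u (x, y)).
set J := cintegral m2 setT (fun y => ev s (x, y)).
transitivity ((V2^-1)%:C%C * J * I).
  rewrite -cintegralZ//; congr cintegral; apply/funext => y.
  rewrite /mean2 -/J /=; have [Xy|Xy] := pselect (X2 y).
    by rewrite chiE mem_set// mulr1 mulrC.
  by rewrite u0 ?mul0r ?mulr0// => -[].
transitivity ((V2^-1)%:C%C * I * J); first by rewrite mulrAC.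
rewrite -cintegralZ//; congr cintegral; apply/funext => y.
rewrite /mean2 -/I /=; have [Xy|Xy] := pselect (X2 y).
  by rewrite chiE mem_set// mulr1.
by rewrite ev_off ?mulr0// => -[].
Qed.

Definition bcenter1 a := bfunD (bfunZ (-1) (bmean1 a)) a.
Definition bcenter2 a := bfunD (bfunZ (-1) (bmean2 a)) a.

Let int_one1 : cintegral m1 setT one1 = V1%:C%C.
Proof.
transitivity (cintegral m1 setT (chi X1)); first by rewrite /= setTI.
rewrite cintegral_real; congr (_%:C%C); rewrite -[V1]/(fine V1%:E) -X1V.
by rewrite -(l1norm_chi mX1 X1y); apply: eq_Rintegral => x _; rewrite cabs_chi.
Qed.

Let int_one2 : cintegral m2 setT one2 = V2%:C%C.
Proof.
transitivity (cintegral m2 setT (chi X2)); first by rewrite /= setTI.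
rewrite cintegral_real; congr (_%:C%C); rewrite -[V2]/(fine V2%:E) -X2V.
by rewrite -(l1norm_chi mX2 X2y); apply: eq_Rintegral => x _; rewrite cabs_chi.
Qed.

Let int_center1 a : cintegral m1 setT (bcenter1 a) = 0.
Proof.
rewrite (cintegralD (cintZ (-1) (cb1 (bmean1 a))) (cb1 a)) (cintegralZ (-1) (cb1 (bmean1 a))).
rewrite (cintegralZ _ (cb1 one1)).
rewrite int_one1 mulrAC -rmorphM mulVf ?gt_eqF// mul1r; ring.
Qed.

Let int_center2 a : cintegral m2 setT (bcenter2 a) = 0.
Proof.
rewrite (cintegralD (cintZ (-1) (cb2 (bmean2 a))) (cb2 a)) (cintegralZ (-1) (cb2 (bmean2 a))).
rewrite (cintegralZ _ (cb2 one2)).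
rewrite int_one2 mulrAC -rmorphM mulVf ?gt_eqF// mul1r; ring.
Qed.

Lemma mean0_center (s : tensor X1 X2) :
  mean0 m1 m2 (map1 bcenter1 (map2 bcenter2 s)).
Proof. by elim: s => //= t s ih; split => //; [exact: int_center1|exact: int_center2]. Qed.

(** The expansion of [(1 - mean1)(1 - mean2) u], which is the function measured by the
    oscillation. *)
Definition center u z := u z - mean1 u z - mean2 u z + mean1 (mean2 u) z.

Lemma ev_center1 (s : tensor X1 X2) z :
  ev (map1 bcenter1 s) z = ev s z - ev (map1 bmean1 s) z.
Proof.
rewrite /ev !big_map -sumrB; apply: eq_bigr => t _ /=; ring.
Qed.

Lemma ev_center2 (s : tensor X1 X2) z :
  ev (map2 bcenter2 s) z = ev s z - ev (map2 bmean2 s) z.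
Proof.
rewrite /ev !big_map -sumrB; apply: eq_bigr => t _ /=; ring.
Qed.

Lemma cint_center u : cint mu u -> cint mu (center u).
Proof.
move=> cu; apply: cintD; last exact/cint_mean1/cint_mean2.
by apply: cintB; [apply: cintB => //; exact: cint_mean1|exact: cint_mean2].
Qed.

Lemma center_off u : supported u -> supported (center u).
Proof.
move=> u0 z Xz; rewrite /center u0// !mean1_off// ?mean2_off// ?subr0 ?addr0//.
exact: mean2_off.
Qed.

(** The centering passes from [u] to the tensor, so an arbitrary test tensor may be replaced by one
    with mean zero in each variable. *)
Lemma center_sym u (s : tensor X1 X2) : cint mu u -> supported u ->
  cintegral mu setT (fun z => center u z * ev s z) =
  cintegral mu setT (fun z => u z * ev (map1 bcenter1 (map2 bcenter2 s)) z).
Proof.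
move=> cu u0.
have cM w (r : tensor X1 X2) : cint mu w -> cint mu (fun z => w z * ev r z).
  by move=> cw; have [M rM] := ev_bound r; apply: (cint_mul_bounded cw _ rM); exact: ev_meas.
have cu1 := cint_mean1 cu; have cu2 := cint_mean2 cu; have cu12 := cint_mean1 cu2.
have e1 := mean1_sym s cu u0; have e2 := mean2_sym s cu u0.
have e12 := mean1_sym s cu2 (mean2_off u0).
have e21 := mean2_sym (map1 bmean1 s) cu u0.
have g0 := cM u s cu; have g1 := cM _ s cu1; have g2 := cM _ s cu2.
have g12 := cM _ s cu12.
transitivity (cintegral mu setT (fun z => u z * ev s z)
  - cintegral mu setT (fun z => mean1 u z * ev s z)
  - cintegral mu setT (fun z => mean2 u z * ev s z)
  + cintegral mu setT (fun z => mean1 (mean2 u) z * ev s z)).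
  rewrite -(cintegralB g0 g1) -(cintegralB (cintB g0 g1) g2).
  rewrite -(cintegralD (cintB (cintB g0 g1) g2) g12).
  by congr cintegral; apply/funext => z; rewrite /center; ring.
rewrite -e12 -e21 -e1 -e2.
have f1 := cM u (map1 bmean1 s) cu; have f2 := cM u (map2 bmean2 s) cu.
have f12 := cM u (map2 bmean2 (map1 bmean1 s)) cu.
rewrite -(cintegralB g0 f1) -(cintegralB (cintB g0 f1) f2).
rewrite -(cintegralD (cintB (cintB g0 f1) f2) f12).
congr cintegral; apply/funext => z.
rewrite ev_center1 ev_center2 -map12C ev_center2; ring.
Qed.

End averaging.

(** * A quasi-triangle inequality and the cost of centering *)

Section quasi_triangle.
Context {R : realType} {d1 d2 : measure_display}
  {T1 : measurableType d1} {T2 : measurableType d2}.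
Variables (m1 : {sigma_finite_measure set T1 -> \bar R})
  (m2 : {sigma_finite_measure set T2 -> \bar R}).

Lemma quasi_powR (q x y : R) : 0 < q -> 0 <= x -> 0 <= y ->
  (x + y) `^ q <= 2 `^ q * (x `^ q + y `^ q).
Proof.
move=> q0; wlog xy : x y / x <= y.
  move=> h x0 y0; have [xy|yx] := leP x y; first exact: h.
  by rewrite addrC [leRHS in _ <= leRHS](_ : _ = 2 `^ q * (y `^ q + x `^ q)) ?h// ?ltW// addrC.
move=> x0 y0; apply: (@le_trans _ _ ((2 * y) `^ q)).
  rewrite ge0_ler_powR ?nnegrE ?addr_ge0 ?mulr_ge0//; first exact: ltW.
  by rewrite mulr2n mulrDl !mul1r lerD2r.
by rewrite powRM// ler_wpM2l ?powR_ge0// lerDr powR_ge0.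
Qed.

Lemma quasi_poweR (q : R) (x y : \bar R) : 0 < q -> (0 <= x)%E -> (0 <= y)%E ->
  ((x + y) `^ q <= (2 `^ q)%:E * (x `^ q + y `^ q))%E.
Proof.
move=> q0; have qn0 : q != 0 by rewrite gt_eqF.
have two0 : (0 < (2 `^ q)%:E)%E by rewrite lte_fin powR_gt0.
case: x => [x| |]//; case: y => [y| |]//.
- by rewrite !lee_fin => x0 y0; exact: quasi_powR.
- move=> x0 _; apply: le_trans (leey _) _.
  by rewrite (poweRyr qn0) [X in (_ * X)%E]addey// gt0_muley.
- move=> _ y0; apply: le_trans (leey _) _.
  by rewrite (poweRyr qn0) [X in (_ * X)%E]addye// gt0_muley.
- move=> _ _; apply: le_trans (leey _) _.
  by rewrite (poweRyr qn0) gt0_muley.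
Qed.

Lemma ge0_integral_quasi d (T : measurableType d) (mu : {measure set T -> \bar R})
    (f g h : T -> \bar R) (c : R) : 0 <= c ->
  measurable_fun setT f -> measurable_fun setT g -> measurable_fun setT h ->
  (forall x, 0 <= f x)%E -> (forall x, 0 <= g x)%E -> (forall x, 0 <= h x)%E ->
  (forall x, h x <= c%:E * (f x + g x))%E ->
  (\int[mu]_x h x <= c%:E * (\int[mu]_x f x + \int[mu]_x g x))%E.
Proof.
move=> c0 mf mg mh f0 g0 h0 hfg.
rewrite -ge0_integralD// -ge0_integralZl_EFin//; last 2 first.
- by move=> x _; rewrite adde_ge0.
- exact: emeasurable_funD.
apply: ge0_le_integral => //.
by apply: emeasurable_funM => //; exact: emeasurable_funD.
Qed.

(** The elementary [(x + y)^q <= 2^q (x^q + y^q)] is used for the inner exponent [p2] and for the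
    outer exponent [p1 / p2], which cost [2^p1] and [2^(p1/p2) <= 2^p1]; adding two equal bounds
    costs another 2. Hence the constant [8 = 2 * 2 * 2]. *)
Lemma mixI_quasi p1 p2 (F G : T1 * T2 -> R) (r : R) : 1 < p1 -> 1 < p2 -> 0 <= r ->
  measurable_fun setT F -> measurable_fun setT G ->
  (forall z, 0 <= F z) -> (forall z, 0 <= G z) ->
  (mixI m1 m2 p1 p2 F <= (r `^ p1)%:E)%E -> (mixI m1 m2 p1 p2 G <= (r `^ p1)%:E)%E ->
  (mixI m1 m2 p1 p2 (fun z => F z + G z)%R <= ((8 * r) `^ p1)%:E)%E.
Proof.
move=> p11 p21 r0 mF mG F0 G0 Fr Gr.
have p10 : 0 < p1 by exact: lt_trans p11.
have p20 : 0 < p2 by exact: lt_trans p21.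
have q0 : 0 < p1 / p2 by rewrite divr_gt0.
have inrFG x : (inr m2 p2 (fun z => F z + G z)%R x <=
    (2 `^ p2)%:E * (inr m2 p2 F x + inr m2 p2 G x))%E.
  apply: ge0_integral_quasi.
  - exact: powR_ge0.
  - by apply: measurable_powR_fun; exact: (measurableT_comp mF (pair1_measurable x)).
  - by apply: measurable_powR_fun; exact: (measurableT_comp mG (pair1_measurable x)).
  - apply: measurable_powR_fun; apply: measurable_funD.
      exact: (measurableT_comp mF (pair1_measurable x)).
    exact: (measurableT_comp mG (pair1_measurable x)).
  - by move=> y; rewrite lee_fin powR_ge0.
  - by move=> y; rewrite lee_fin powR_ge0.
  - by move=> y; rewrite lee_fin powR_ge0.
  - by move=> y; rewrite -EFinD -EFinM lee_fin quasi_powR.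
have iF x := inr_ge0 m2 p2 F x; have iG x := inr_ge0 m2 p2 G x.
have mF' := measurable_inr_pow m2 p2 (p1 / p2) mF.
have mG' := measurable_inr_pow m2 p2 (p1 / p2) mG.
have point x : (inr m2 p2 (fun z => F z + G z)%R x `^ (p1 / p2) <=
    (2 `^ p1 * 2 `^ (p1 / p2))%:E *
      (inr m2 p2 F x `^ (p1 / p2) + inr m2 p2 G x `^ (p1 / p2)))%E.
  apply: le_trans (le_poweR (ltW q0) (inr_ge0 _ _ _ _) (inrFG x)) _.
  rewrite poweRM; [|by rewrite lee_fin powR_ge0|exact: adde_ge0].
  rewrite [X in (X * _ <= _)%E]poweR_EFin -powRrM.
  rewrite (_ : p2 * (p1 / p2) = p1); last by field; rewrite gt_eqF.
  rewrite EFinM -muleA; apply: lee_wpmul2l; first by rewrite lee_fin powR_ge0.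
  exact: quasi_poweR.
have c0 : 0 <= 2 `^ p1 * 2 `^ (p1 / p2) by rewrite mulr_ge0 ?powR_ge0.
have mFG := measurable_inr_pow m2 p2 (p1 / p2) (measurable_funD mF mG).
have pow0 (H : T1 * T2 -> R) x : (0 <= inr m2 p2 H x `^ (p1 / p2))%E by exact: poweR_ge0.
have key : (mixI m1 m2 p1 p2 (fun z => F z + G z)%R <=
    (2 `^ p1 * 2 `^ (p1 / p2))%:E * (mixI m1 m2 p1 p2 F + mixI m1 m2 p1 p2 G))%E.
  exact: (ge0_integral_quasi m1 c0 mF' mG' mFG (pow0 F) (pow0 G) (pow0 _) point).
have c0' : (0 <= (2 `^ p1 * 2 `^ (p1 / p2))%:E)%E by rewrite lee_fin.
apply: le_trans key _; apply: le_trans (lee_wpmul2l c0' (leeD Fr Gr)) _.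
rewrite -EFinD -EFinM lee_fin powRM//.
have -> : r `^ p1 + r `^ p1 = 2 * r `^ p1 by rewrite mulr2n mulrDl mul1r.
rewrite mulrA ler_wpM2r ?powR_ge0//.
have -> : (8 : R) = 2 * 2 * 2 by ring.
rewrite !powRM// ; apply: ler_pM; rewrite ?mulr_ge0 ?powR_ge0//.
  rewrite ler_wpM2l ?powR_ge0// ler_powR ?ler1n//.
  by rewrite ler_pdivrMr// ler_peMr ?ltW.
by rewrite -[leLHS]powRr1// ler_powR ?ler1n// ltW.
Qed.

End quasi_triangle.

Section center_bound_section.
Context {R : realType} {d1 d2 : measure_display}
  {T1 : measurableType d1} {T2 : measurableType d2}.
Variables (m1 : {sigma_finite_measure set T1 -> \bar R})
  (m2 : {sigma_finite_measure set T2 -> \bar R}).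
Local Notation bfun := (@bfun R _ _).
Local Notation tensor := (@tensor R _ _ _ _).
Local Notation mu := (m1 \x m2)%E.
Variables (X1 : set T1) (X2 : set T2).
Hypotheses (mX1 : measurable X1) (mX2 : measurable X2).
Variables V1 V2 : R.
Hypotheses (X1V : (m1 X1 = V1%:E)%E) (X2V : (m2 X2 = V2%:E)%E).
Hypotheses (V10 : 0 < V1) (V20 : 0 < V2).
Variables p1 p2 : R.
Hypotheses (p11 : 1 < p1) (p21 : 1 < p2).

Let X1y : (m1 X1 < +oo)%E. Proof. by rewrite X1V ltry. Qed.
Let X2y : (m2 X2 < +oo)%E. Proof. by rewrite X2V ltry. Qed.
Let p10 : 0 < p1. Proof. exact: lt_trans p11. Qed.
Let p20 : 0 < p2. Proof. exact: lt_trans p21. Qed.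

Lemma tensor_le_exists q1 q2 (s : tensor X1 X2) : 0 < q1 -> 0 < q2 ->
  exists2 M : R, 0 <= M & tensor_le m1 m2 q1 q2 M s.
Proof.
move=> q10 q20; have [M sM] := ev_bound s.
have fin : (mixI m1 m2 q1 q2 (fun z => cabs (ev s z)) < +oo)%E.
  apply: (mixI_bounded_lty mX1 mX2 X1y X2y (M := M)) => //.
  - by apply: measurable_cabs; exact: ev_meas.
  - by move=> z; rewrite cabs_ge0 sM.
  - by move=> z Xz; rewrite ev_off// cabs0.
have J0 := mixI_ge0 m1 m2 q1 q2 (fun z => cabs (ev s z)).
exists (fine (mixI m1 m2 q1 q2 (fun z => cabs (ev s z))) `^ q1^-1); first exact: powR_ge0.
rewrite /tensor_le -powRrM mulVf ?gt_eqF// powRr1 ?fine_ge0// fineK//.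
by rewrite ge0_fin_numE.
Qed.

Lemma tensor_le_quasi (s t u : tensor X1 X2) (r : R) : 0 <= r ->
  (forall z, ev u z = ev s z - ev t z) ->
  tensor_le m1 m2 p1 p2 r s -> tensor_le m1 m2 p1 p2 r t ->
  tensor_le m1 m2 p1 p2 (8 * r) u.
Proof.
move=> r0 uE sr tr.
apply: le_trans _ (mixI_quasi p11 p21 r0 _ _ _ _ sr tr); last 4 first.
- by apply: measurable_cabs; exact: ev_meas.
- by apply: measurable_cabs; exact: ev_meas.
- by move=> z; exact: cabs_ge0.
- by move=> z; exact: cabs_ge0.
apply: mixI_mono => //.
- by apply: measurable_cabs; exact: ev_meas.
- by apply: measurable_funD; apply: measurable_cabs; exact: ev_meas.
- by move=> z; exact: cabs_ge0.
- by move=> z; rewrite addr_ge0 ?cabs_ge0.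
- by apply: aeW => x; apply: aeW => y; rewrite uE ler_cabsB.
Qed.

Let cb1 (a : bfun X1) : cint m1 a. Proof. exact: bfun_cint. Qed.
Let cb2 (a : bfun X2) : cint m2 a. Proof. exact: bfun_cint. Qed.

Let slice1 (s : tensor X1 X2) x : cint m2 (fun y => ev s (x, y)).
Proof. by apply: cint_sum => t; exact: (cintZ (t.1 x) (cb2 t.2)). Qed.

Let slice2 (s : tensor X1 X2) y : cint m1 (fun x => ev s (x, y)).
Proof.
rewrite (_ : (fun x => _) = fun x => \sum_(t <- s) t.2 y * t.1 x); last first.
  by apply/funext => x; apply: eq_bigr => t _; rewrite mulrC.
by apply: cint_sum => t; exact: (cintZ _ (cb1 t.1)).
Qed.

Let chi_le1 d (T : measurableType d) (A : set T) x : cabs (chi A x : R[i]) <= 1.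
Proof. by rewrite chiE; case: ifP; rewrite ?cabs1 ?cabs0. Qed.

Lemma tensor_le_bmean1 (s : tensor X1 X2) (r : R) : 0 <= r ->
  tensor_le m1 m2 p1 p2 r s -> tensor_le m1 m2 p1 p2 r (map1 (bmean1 m1 mX1 V1) s).
Proof.
move=> r0 sr; have [M sM] := ev_bound s.
rewrite /tensor_le -[X in (X `^ _)%:E]mul1r -[X in (X * _) `^ _](@mulVf _ V1) ?gt_eqF//.
apply: (@mixI_avg1 _ _ _ _ _ m1 m2 X1 X1 X2 X2 (fun z => cabs (ev s z)) _
   (fun y => l1norm m1 (fun x => ev s (x, y))) p1 p2 M) => //.
- by apply: measurable_cabs; exact: ev_meas.
- by move=> z; rewrite cabs_ge0 sM.
- by move=> z h; rewrite ev_off// cabs0.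
- by apply: measurable_cabs; exact: ev_meas.
- by move=> z; exact: cabs_ge0.
- by move=> z h; rewrite ev_off// cabs0.
- by move=> y; rewrite l1normE.
- by rewrite invr_ge0 ltW.
apply: aeW => x; apply: aeW => y; rewrite (ev_bmean1 mX1 X1V) /mean1 !cabsM cabs_real.
rewrite ger0_norm ?invr_ge0 ?(ltW V10)// -mulrA ler_wpM2l ?invr_ge0 ?(ltW V10)//.
by rewrite -[leRHS]mul1r ler_pM ?cabs_ge0// ler_cabs_cintegral.
Qed.

Lemma tensor_le_bmean2 (s : tensor X1 X2) (r : R) : 0 <= r ->
  tensor_le m1 m2 p1 p2 r s -> tensor_le m1 m2 p1 p2 r (map2 (bmean2 m2 mX2 V2) s).
Proof.
move=> r0 sr.
have : (mixI m1 m2 p1 p2 (fun z => cabs (ev (map2 (bmean2 m2 mX2 V2) s) z)) <=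
    ((V2^-1 * V2) `^ p1)%:E * mixI m1 m2 p1 p2 (fun z => cabs (ev s z)))%E.
  apply: (@mixI_avg2 _ _ _ _ _ m1 m2 X1 X1 X2 X2 (fun z => cabs (ev s z)) _
    (fun x => l1norm m2 (fun y => ev s (x, y))) p1 p2) => //.
  - by apply: measurable_cabs; exact: ev_meas.
  - by move=> z; exact: cabs_ge0.
  - by move=> z h; rewrite ev_off// cabs0.
  - by apply: measurable_cabs; exact: ev_meas.
  - by move=> z; exact: cabs_ge0.
  - by move=> z h; rewrite ev_off// cabs0.
  - by move=> y; rewrite l1normE.
  - by rewrite invr_ge0 ltW.
  apply: aeW => x; apply: aeW => y; rewrite (ev_bmean2 mX2 X2V) /mean2 !cabsM cabs_real.
  rewrite ger0_norm ?invr_ge0 ?(ltW V20)// -mulrA ler_wpM2l ?invr_ge0 ?(ltW V20)//.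
  by rewrite -[leRHS]mul1r ler_pM ?cabs_ge0// ler_cabs_cintegral.
rewrite (mulVf (lt0r_neq0 V20)) powR1 mul1e => h.
exact: le_trans h sr.
Qed.

(** By duality and symmetry it suffices to test [u] on centered tensors. Subtracting a mean costs a
    factor 8, and this happens once in each variable: [64 = 8 * 8]. *)
Lemma center_bound (u : T1 * T2 -> R[i]) (K : R) : cint mu u ->
  (forall z, ~ (X1 `*` X2) z -> u z = 0) -> 0 <= K ->
  (forall (s : tensor X1 X2) (r : R), 0 <= r -> mean0 m1 m2 s ->
    tensor_le m1 m2 p1 p2 r s ->
    cabs (cintegral mu setT (fun z => u z * ev s z)) <= K * r) ->
  (mixnorm m1 m2 (p1 / (p1 - 1)) (p2 / (p2 - 1)) (center m1 m2 X1 X2 V1 V2 u)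
    <= (64 * K)%:E)%E.
Proof.
move=> cu u0 K0 uK.
apply: (tensor_duality mX1 mX2 X1y X2y) => //.
- exact: (cint_center mX1 mX2 X1V X2V).
- exact: center_off.
- by rewrite mulr_ge0.
move=> s; rewrite (center_sym mX1 mX2 X1V X2V V10 V20 s cu u0).
(* Duality asks for a bound by the norm of [ev s] itself; [M] serves to make this norm finite, so
   that it can play the role of [r]. *)
have [M M0 sM] := tensor_le_exists s p10 p20.
have fin : (mixnorm m1 m2 p1 p2 (ev s) <= M%:E)%E by apply/mixnorm_le.
have N0 : (0 <= mixnorm m1 m2 p1 p2 (ev s))%E.
  by rewrite mixnormE// poweR_ge0.
have Nf : mixnorm m1 m2 p1 p2 (ev s) \is a fin_num.
  by rewrite ge0_fin_numE// (le_lt_trans fin)// ltry.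
move: N0; rewrite -(fineK Nf) lee_fin; set r := fine _ => r0.
have sr : tensor_le m1 m2 p1 p2 r s by apply/mixnorm_le => //; rewrite /r fineK.
rewrite -EFinM lee_fin -mulrA mulrCA mulrA mulrC mulrC.
have s2 := tensor_le_quasi r0 (ev_center2 m2 mX2 V2 s) sr (tensor_le_bmean2 r0 sr).
have r80 : 0 <= 8 * r by rewrite mulr_ge0.
have s12 := tensor_le_quasi r80 (ev_center1 m1 mX1 V1 _) s2 (tensor_le_bmean1 r80 s2).
apply: le_trans (uK _ _ _ (mean0_center mX1 mX2 X1V X2V V10 V20 s) s12) _.
  by rewrite mulr_ge0.
by rewrite le_eqVlt; apply/orP; left; apply/eqP; ring.
Qed.

End center_bound_section.

Section reflected_cubes.
Context {R : realType} {n : nat}.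
Local Notation bfun := (@bfun R _ _).

Lemma half_step_weaken (T Ts : (Rn R n -> R[i]) -> (Rn R n -> R[i])) (th V D D' : R)
    (X Y : set (Rn R n)) (v : bfun X) (P : bfun X -> bfun Y) : D <= D' ->
  half_step T Ts th V D v P -> half_step T Ts th V D' v P.
Proof. by move=> DD' [vD h1 h2 h3 h4]; split => // x; apply: le_trans (vD x) _. Qed.

Lemma half_step_near_average (T Ts : (Rn R n -> R[i]) -> (Rn R n -> R[i])) (th V D : R)
    (X Y : set (Rn R n)) (v : bfun X) (P : bfun X -> bfun Y) :
  half_step T Ts th V D v P -> near_average (leb n) th V P.
Proof. by move=> [_ _ _ h3 [h4 h5]]; split. Qed.

Lemma reflected_half_steps (T Ts : (Rn R n -> R[i]) -> (Rn R n -> R[i])) K :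
  (0 < n)%N -> CZO T K -> symmetrically_nondegenerate K -> adjoint_operator T Ts ->
  exists B D : R, [/\ 0 <= B, 0 <= D & forall (a : Rn R n) (l : R), 0 < l ->
    exists2 a' : Rn R n, edist a a' <= B * l &
      (exists (v : bfun (cube a l)) (P : bfun (cube a l) -> bfun (cube a' l)),
         half_step T Ts 6^-1 (l ^+ n) D v P) /\
      (exists (v : bfun (cube a' l)) (P : bfun (cube a' l) -> bfun (cube a l)),
         half_step T Ts 6^-1 (l ^+ n) D v P)].
Proof.
(* The near-average error is [4 eps], so [1/24] gives the [1/6] required by the absorption. *)
move=> n0 TK Knd TTs; have [_ sK _] := TK; pose eps : R := 24^-1.
have eps0 : 0 < eps by rewrite invr_gt0.
have eps2 : eps <= 2^-1 by rewrite lef_pV2 ?posrE// ler_nat.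
have th6 : 4 * eps = 6^-1 by rewrite /eps; field.
have [A [B [c0 [A0 c00 B0 H]]]] := kernel_almost_const n0 sK Knd eps0.
(* The weight is at most [2 / (|k| l^n)], and [|k|] is at least [1 / (c0 (A l)^n)]: the side [l]
   cancels and the bound is uniform over all cubes. *)
pose D := 2 * (c0 * A ^+ n).
have D0 : 0 <= D by rewrite !mulr_ge0 ?exprn_ge0// ltW.
exists B, D; split => // a l l0.
have [a' [k [k' [aa' sep [kA k'A] near]]]] := H a l l0.
exists a' => //.
have kD (q : R[i]) : (c0 * (A * l) ^+ n)^-1 <= cabs q ->
    q != 0 /\ 2 / (cabs q * l ^+ n) <= D.
  move=> qA.
  have c1 : 0 < c0 * (A * l) ^+ n by rewrite mulr_gt0// exprn_gt0// mulr_gt0.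
  have q0 : 0 < cabs q by apply: lt_le_trans qA; rewrite invr_gt0.
  split; first by apply/eqP => q00; move: q0; rewrite q00 cabs0 ltxx.
  have ln0 : 0 < l ^+ n by rewrite exprn_gt0.
  rewrite /D ler_pM2l// -[leRHS]invrK lef_pV2 ?posrE ?mulr_gt0 ?invr_gt0 ?mulr_gt0 ?exprn_gt0//.
  apply: le_trans (ler_wpM2r (ltW ln0) qA).
  rewrite exprMn le_eqVlt; apply/orP; left; apply/eqP.
  by field; rewrite !gt_eqF ?exprn_gt0.
split.
- have [k0 kle] := kD k kA.
  have nk x y : cube a' l x -> cube a l y -> cabs (K x y - k) <= eps * cabs k.
    by move=> ax ay; have [] := near x y ax ay.
  have [v [P vP]] := half_step_exists n0 TK TTs l0 eps0 eps2 sep nk k0.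
  by exists v, P; rewrite -th6; exact: half_step_weaken vP.
(* The way back uses the kernel with its arguments exchanged, whose lower bound is the second half
   of symmetric nondegeneracy. *)
- have [k0 kle] := kD k' k'A.
  have nk x y : cube a l x -> cube a' l y -> cabs (K x y - k') <= eps * cabs k'.
    by move=> ax ay; have [] := near y x ay ax.
  have sep' x y : cube a l x -> cube a' l y -> n%:R * l <= edist x y.
    by move=> ax ay; rewrite edist_sym sep.
  have [v [P vP]] := half_step_exists n0 TK TTs l0 eps0 eps2 sep' nk k0.
  by exists v, P; rewrite -th6; exact: half_step_weaken vP.
Qed.

End reflected_cubes.

(** * Local square integrability and the oscillation as a centered norm *)

Section local_L2.
Context {R : realType} {d1 d2 : nat}.
Notation R12 := (Rn R d1 * Rn R d2)%type.
Local Notation bfun := (@bfun R _ _).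
Local Notation tensor := (@tensor R _ _ _ _).
Variable b : R12 -> R[i].
Hypothesis bL2 : in_L2loc b.

Lemma measurable_enorm n : measurable_fun setT (@enorm R n).
Proof.
rewrite (_ : @enorm R n = fun x => Num.sqrt (\sum_(i < n) tnth x i ^+ 2))//.
apply: measurableT_comp; first exact: measurable_sqrt.
apply: measurable_sum => i.
by apply: measurable_funX; exact: measurable_tnth.
Qed.

Lemma measurable_enorm2 : measurable_fun setT (@enorm2 R d1 d2).
Proof.
rewrite (_ : @enorm2 R d1 d2 = fun z => Num.sqrt (enorm z.1 ^+ 2 + enorm z.2 ^+ 2))//.
apply: measurableT_comp; first exact: measurable_sqrt.
apply: measurable_funD.
  by apply: measurable_funX; apply: (measurableT_comp (@measurable_enorm d1)).
by apply: measurable_funX; apply: (measurableT_comp (@measurable_enorm d2)).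
Qed.

Lemma measurable_ball2 (r : R) : measurable [set z : R12 | enorm2 z <= r].
Proof.
rewrite -[X in measurable X]setTI (_ : [set z : R12 | _] = @enorm2 R d1 d2 @^-1` `]-oo, r]%classic).
  exact: measurable_enorm2.
by apply/seteqP; split => z /=; rewrite in_itv.
Qed.

Lemma rect_in_ball (a1 : Rn R d1) l1 (a2 : Rn R d2) l2 : 0 <= l1 -> 0 <= l2 ->
  exists r : R, forall z, (cube a1 l1 `*` cube a2 l2) z -> enorm2 z <= r.
Proof.
move=> l10 l20; exists ((enorm a1 + d1%:R * l1) + (enorm a2 + d2%:R * l2)) => z [z1 z2].
by apply: le_trans (ler_enorm2_add _) _; apply: lerD; exact: cube_enorm.
Qed.

Variables (a1 : Rn R d1) (l1 : R) (a2 : Rn R d2) (l2 : R).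
Hypotheses (l10 : 0 <= l1) (l20 : 0 <= l2).

Let X1 := cube a1 l1.
Let X2 := cube a2 l2.
Let mX1 : measurable X1. Proof. exact: measurable_cube. Qed.
Let mX2 : measurable X2. Proof. exact: measurable_cube. Qed.
Let mX : measurable (X1 `*` X2). Proof. exact: measurableX. Qed.

Definition cut (z : R12) := chi (X1 `*` X2) z * b z.

Lemma cmeasurable_cut : cmeasurable cut.
Proof. by have [mb _] := bL2; apply: cmeasurableM => //; exact: cmeasurable_chi. Qed.

Lemma cut_L2 : in_Lp leb2 2 cut.
Proof.
have [mb bint] := bL2; apply: (in_LpP leb2 cut (ltr0Sn R 1)).2; split; first exact: cmeasurable_cut.
have [r rP] := rect_in_ball a1 a2 l10 l20.
apply: le_lt_trans (bint r); rewrite [leRHS]integral_mkcond.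
have mbb : measurable_fun setT (fun z => (cabs (b z) ^+ 2)%:E).
  by apply/measurable_EFinP; apply: measurable_funX; exact: measurable_cabs.
apply: ge0_le_integral => //.
- by move=> z _; rewrite lee_fin powR_ge0.
- by apply: measurable_powR_fun; apply: measurable_cabs; exact: cmeasurable_cut.
- by apply/measurable_restrict; rewrite ?setTI //; [exact: measurable_ball2|exact: measurable_funS mbb].
move=> z _; rewrite powR_mulrn ?cabs_ge0// /cut cabsM cabs_chi patchE.
have [Xz|Xz] := pselect ((X1 `*` X2) z).
  by rewrite indicE mem_set// mul1r mem_set//; exact: rP.
rewrite indicE memNset// mul0r expr0n /=; case: ifP => // _.
by rewrite lee_fin sqr_ge0.
Qed.

Let bev (s : tensor X1 X2) : bfun (X1 `*` X2) := BFun (ev_meas s) (ev_bound s) (ev_off s).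

Lemma leb2_rect : leb2 (X1 `*` X2) = (l1 ^+ d1 * l2 ^+ d2)%:E.
Proof.
exact: etrans (product_measure1E (leb d1) (leb d2) mX1 mX2)
  (congr2 (fun u v => u * v)%E (leb_cube a1 l10) (leb_cube a2 l20)).
Qed.

Let Xy : (leb2 (X1 `*` X2) < +oo)%E. Proof. by rewrite leb2_rect ltry. Qed.

Lemma cut_cint : cint leb2 cut.
Proof.
have := in_L2_cint (bfun_chi measurableT mX) mX Xy cut_L2.
congr cint; apply/funext => z; rewrite bfun_chiE setTI /cut !chiE.
by case: ifP => _; rewrite ?mulr1// mulr0 mul0r.
Qed.

Lemma cut_evE (s : tensor X1 X2) z : cut z * ev s z = b z * ev s z.
Proof.
rewrite /cut chiE; have [Xz|Xz] := pselect ((X1 `*` X2) z).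
  by rewrite mem_set// mul1r.
by rewrite ev_off// !mulr0.
Qed.

Lemma cint_b_ev (s : tensor X1 X2) : cint leb2 (fun z => b z * ev s z).
Proof.
under eq_fun do rewrite -cut_evE.
exact: (in_L2_cint (bev s) mX Xy cut_L2).
Qed.

(** Cauchy-Schwarz, with [beta] the L^2 norm of [b] on the rectangle. It varies with the rectangle
    without harm, as it disappears in the absorption. *)
Lemma cut_base : exists2 beta : R, 0 <= beta & forall (s : tensor X1 X2) (M : R), 0 <= M ->
  tensor_le (leb d1) (leb d2) 2 2 M s -> cabs (tpair (leb d1) (leb d2) b s) <= beta * M.
Proof.
have [mc c2] := (in_LpP leb2 cut (ltr0Sn R 1)).1 cut_L2.
set J := (\int[leb2]_z (cabs (cut z) `^ 2)%:E)%E in c2.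
have J0 : (0 <= J)%E by apply: integral_ge0 => z _; rewrite lee_fin powR_ge0.
have Jf : J \is a fin_num by rewrite ge0_fin_numE.
exists (fine J `^ 2^-1); first exact: powR_ge0.
move=> s M M0 sM.
have csE : (fun z => b z * ev s z) = (fun z => cut z * ev s z).
  by apply/funext => z; rewrite cut_evE.
have cI : cint leb2 (fun z => cut z * ev s z) := in_L2_cint (bev s) mX Xy cut_L2.
rewrite -lee_fin /tpair csE; apply: le_trans (le_cabs_cintegral cI) _.
under eq_integral do rewrite cabsM.
have h2 : (2 : R)^-1 + 2^-1 = 1 by field.
apply: le_trans (ge0_hoelder leb2 (measurable_cabs mc) (measurable_cabs (ev_meas s))
  (fun z => cabs_ge0 _) (fun z => cabs_ge0 _) (ltr0Sn R 1) (ltr0Sn R 1) h2) _.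
rewrite -/J -(fineK Jf) poweR_EFin EFinM; apply: lee_wpmul2l.
  by rewrite lee_fin powR_ge0.
have -> : M%:E = ((M `^ 2)%:E `^ 2^-1)%E.
  by rewrite poweR_EFin -powRrM divff// powRr1.
have half0 : (0 : R) <= 2^-1 by rewrite invr_ge0.
have ev0 : (0 <= \int[leb2]_z (cabs (ev s z) `^ 2)%:E)%E.
  by apply: integral_ge0 => z _; rewrite lee_fin powR_ge0.
apply: (le_poweR half0 ev0).
apply: le_trans sM; rewrite /mixI /inr divff//.
rewrite fubini_tonelli1//; last 2 first.
- by apply: measurable_powR_fun; apply: measurable_cabs; exact: ev_meas.
- by move=> z; rewrite lee_fin powR_ge0.
rewrite le_eqVlt; apply/orP; left; apply/eqP; apply: eq_integral => x _.
by rewrite poweRe1// integral_ge0// => y _; rewrite lee_fin powR_ge0.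
Qed.

End local_L2.

Section oscillation_center.
Context {R : realType} {d1 d2 : nat}.
Notation R12 := (Rn R d1 * Rn R d2)%type.
Local Notation bfun := (@bfun R _ _).
Local Notation tensor := (@tensor R _ _ _ _).

Lemma cintegral_restrict d (T : measurableType d) (mu : {measure set T -> \bar R})
    (D : set T) (f : T -> R[i]) :
  cintegral mu D f = cintegral mu setT (fun x => chi D x * f x).
Proof.
rewrite /cintegral; congr Complex; rewrite Rintegral_mkcond; apply: eq_Rintegral => x _;
  rewrite patchE chiE; case: ifP => _; by rewrite ?mul1r ?mul0r.
Qed.

Lemma cint_cintegral2 d d' (T1 : measurableType d) (T2 : measurableType d')
    (m1 : {sigma_finite_measure set T1 -> \bar R})
    (m2 : {sigma_finite_measure set T2 -> \bar R}) (u : T1 * T2 -> R[i]) :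
  cint (m1 \x m2)%E u -> cint m1 (fun x => cintegral m2 setT (fun y => u (x, y))).
Proof.
move=> cu; have mI := cmeasurable_cintegral2 cu; split => //.
have [mu' uy] := cu; apply: le_lt_trans uy.
have mE := emeasurable_cabs mu'.
have E0 z : (0 <= (cabs (u z))%:E)%E by rewrite lee_fin cabs_ge0.
rewrite (fubini_tonelli1 _ mE E0); apply: ae_ge0_le_integral => //.
- by move=> x _; rewrite lee_fin cabs_ge0.
- exact: emeasurable_cabs.
- by move=> x _; apply: integral_ge0.
- exact: measurable_fun_fubini_tonelli_F.
by apply: filterS (cint_slice1 cu) => x cx _; exact: le_cabs_cintegral.
Qed.

Variable b : R12 -> R[i].
Hypothesis bL2 : in_L2loc b.

(** Inside the rectangle the partial averages of [b] are those of its restriction, and by Fubini the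
    average over the rectangle is the iterated one. *)
Lemma osc_center (beta1 beta2 v1 v2 : R) (a1 : Rn R d1) (l1 : R) (a2 : Rn R d2) (l2 : R) :
  0 < l1 -> 0 < l2 ->
  osc beta1 beta2 v1 v2 b a1 l1 a2 l2 =
  ((l1 `^ (- beta1) * l2 `^ (- beta2) /
    ((l1 ^+ d1) `^ v1^-1 * (l2 ^+ d2) `^ v2^-1))%:E *
   mixnorm (leb d1) (leb d2) v1 v2
     (center (leb d1) (leb d2) (cube a1 l1) (cube a2 l2) (l1 ^+ d1) (l2 ^+ d2)
       (cut b a1 l1 a2 l2)))%E.
Proof.
move=> l10 l20; have l1w := ltW l10; have l2w := ltW l20.
have f1 : fine (leb d1 (cube a1 l1)) = l1 ^+ d1 by rewrite leb_cube.
have f2 : fine (leb d2 (cube a2 l2)) = l2 ^+ d2 by rewrite leb_cube.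
have f12 : fine (leb2 (cube a1 l1 `*` cube a2 l2)) = l1 ^+ d1 * l2 ^+ d2.
  by rewrite leb2_rect.
rewrite /osc f1 f2; congr (_ * _)%E.
rewrite /mixnorm /mixed_norm; congr Lnorm; apply/funext => x1.
congr Lp_norm; apply/funext => x2.
set I1 := cube a1 l1; set I2 := cube a2 l2; set u := cut b a1 l1 a2 l2.
have cu : cint leb2 u by exact: cut_cint.
have mI1 : measurable I1 by exact: measurable_cube.
have mI2 : measurable I2 by exact: measurable_cube.
have V1 : leb d1 I1 = (l1 ^+ d1)%:E by exact: leb_cube.
have V2 : leb d2 I2 = (l2 ^+ d2)%:E by exact: leb_cube.
have u0 z : ~ (I1 `*` I2) z -> u z = 0.
  by move=> Iz; rewrite /u /cut chiE memNset// mul0r.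
have [Iz|Iz] := pselect ((I1 `*` I2) (x1, x2)); last first.
  by rewrite memNset// center_off.
have [/= I1x I2x] := Iz; rewrite mem_set// /center.
have uE x y : u (x, y) = chi I1 x * chi I2 y * b (x, y).
  rewrite /u /cut; congr (_ * _); rewrite !chiE if_mul; congr (if _ then _ else _).
  by apply/idP/andP => [/set_mem[? ?]|[/set_mem ? /set_mem ?]]; [split|]; exact: mem_set.
have c1 : chi I1 x1 = 1 :> R[i] by rewrite chiE mem_set.
have c2 : chi I2 x2 = 1 :> R[i] by rewrite chiE mem_set.
congr (_ - _ - _ + _).
- by rewrite uE c1 c2 !mul1r.
- rewrite /avg f1 cintegral_restrict /mean1 /= c1 mulr1; congr (_ * cintegral _ _ _).
  by apply/funext => x; rewrite uE c2 mulr1.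
- rewrite /avg f2 cintegral_restrict /mean2 /= c2 mulr1; congr (_ * cintegral _ _ _).
  by apply/funext => x; rewrite uE c1 mul1r.
rewrite /avg f12 cintegral_restrict [RHS]/mean1 /= c1 mulr1.
have -> : (fun x => mean2 (leb d2) I2 (l2 ^+ d2) u (x, x2)) =
    fun x => ((l2 ^+ d2)^-1)%:C%C * cintegral (leb d2) setT (fun y => u (x, y)).
  by apply/funext => x; rewrite /mean2 /= c2 mulr1.
rewrite cintegralZ; last exact: cint_cintegral2.
have <- := cfubini1 cu.
by rewrite mulrA -rmorphM invfM.
Qed.

End oscillation_center.

(** The exponents of [l] add up to [d] times [-(1/p - 1/q) - (1 - 1/p) + (1 - 1/q) = 0]. It is this
    cancellation that determines the value of [beta]. *)
Lemma scale_exponents {R : realType} d (l p q : R) : 0 < l -> 1 < p ->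
  l `^ (- (d%:R * (p^-1 - q^-1))) / (l ^+ d) `^ (p / (p - 1))^-1 * (l ^+ d) `^ (1 - q^-1) = 1.
Proof.
move=> l0 pgt1; have ln0 : l != 0 by rewrite gt_eqF.
rewrite -powR_mulrn ?ltW// -!powRrM -powRN.
rewrite -powRD ?ln0 ?implybT// -powRD ?ln0 ?implybT//.
rewrite (_ : _ + _ = 0) ?powRr0//.
have pn0 : p != 0 by rewrite gt_eqF// (lt_trans _ pgt1).
have p1n0 : p - 1 != 0 by rewrite gt_eqF// subr_gt0.
by move: q^-1 => q'; rewrite invf_div; field.
Qed.

(** * Oscillation controlled by the form on nearby rectangles *)

Section testing.
Context {R : realType} {d1 d2 : nat}.
Notation R12 := (Rn R d1 * Rn R d2)%type.
Local Notation bfun := (@bfun R _ _).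
Local Notation tensor := (@tensor R _ _ _ _).
Variables (T1 T1s : (Rn R d1 -> R[i]) -> (Rn R d1 -> R[i]))
  (K1 : Rn R d1 -> Rn R d1 -> R[i])
  (T2 T2s : (Rn R d2 -> R[i]) -> (Rn R d2 -> R[i]))
  (K2 : Rn R d2 -> Rn R d2 -> R[i])
  (p1 p2 q1 q2 : R) (b : R12 -> R[i]).
Hypotheses (d10 : (0 < d1)%N) (d20 : (0 < d2)%N).
Hypotheses (T1K : CZO T1 K1) (K1nd : symmetrically_nondegenerate K1)
  (T1T1s : adjoint_operator T1 T1s).
Hypotheses (T2K : CZO T2 K2) (K2nd : symmetrically_nondegenerate K2)
  (T2T2s : adjoint_operator T2 T2s).
Hypotheses (p11 : 1 < p1) (p21 : 1 < p2).
Hypothesis bL2 : in_L2loc b.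

Let p10 : 0 < p1. Proof. exact: lt_trans p11. Qed.
Let p20 : 0 < p2. Proof. exact: lt_trans p21. Qed.
Let T1b : Lp_bounded_operator T1. Proof. by have [] := T1K. Qed.
Let T2b : Lp_bounded_operator T2. Proof. by have [] := T2K. Qed.
Let T1sb : Lp_bounded_operator T1s. Proof. by have [] := T1T1s. Qed.
Let T2sb : Lp_bounded_operator T2s. Proof. by have [] := T2T2s. Qed.

Local Notation form := (bicommutator_form T1 T1s T2 T2s b).

(** A bound for the functional [f |-> form f 1_W] on a rectangle [W]: this is the size of the form
    on [W]. *)
Definition form_le (w1 : Rn R d1) (l1 : R) (w2 : Rn R d2) (l2 : R) (e : R) :=
  forall (f : R12 -> R[i]) (r : R), bounded_cpt_supp (@enorm2 R d1 d2) f -> 0 <= r ->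
    (mixed_norm p1 p2 f <= r%:E)%E ->
    cabs (form f (chi (cube w1 l1 `*` cube w2 l2))) <= e * r.

Let rect_cpt (a1 : Rn R d1) (l1 : R) (a2 : Rn R d2) (l2 : R)
    (s : tensor (cube a1 l1) (cube a2 l2)) : 0 <= l1 -> 0 <= l2 ->
  bounded_cpt_supp (@enorm2 R d1 d2) (ev s).
Proof.
move=> l10 l20; split; [exact: ev_meas|exact: ev_bound|].
have [r rP] := rect_in_ball a1 a2 l10 l20.
exists r => z sz; apply: rP; apply: contrapT => /(ev_off s) s0.
by rewrite s0 eqxx in sz.
Qed.

(** The alternating sum is, up to sign, the form on the weighted tensor, and the weights enlarge the
    mixed norm by at most [D1 D2]. *)
Let alt_sum_le (a1 c1 : Rn R d1) (l1 : R) (a2 c2 : Rn R d2) (l2 D1 D2 e : R)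
    (v1 : bfun (cube a1 l1)) (P1 : bfun (cube a1 l1) -> bfun (cube c1 l1))
    (v2 : bfun (cube a2 l2)) (P2 : bfun (cube a2 l2) -> bfun (cube c2 l2)) :
  0 < l1 -> 0 < l2 -> 0 <= D1 -> 0 <= D2 ->
  half_step T1 T1s 6^-1 (l1 ^+ d1) D1 v1 P1 ->
  half_step T2 T2s 6^-1 (l2 ^+ d2) D2 v2 P2 ->
  form_le c1 l1 c2 l2 e ->
  forall (s : tensor (cube a1 l1) (cube a2 l2)) (r : R), 0 <= r ->
    tensor_le (leb d1) (leb d2) p1 p2 r s ->
    cabs (alt_sum (leb d1) (leb d2) b P1 P2 s) <= e * (D1 * D2) * r.
Proof.
move=> l10 l20 D10 D20 H1 H2 He s r r0 sr; have l1w := ltW l10; have l2w := ltW l20.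
have [mb _] := bL2.
have id := bicommutator_half_steps T1b T1sb T2b T2sb (measurable_cube a1 l1)
  (measurable_cube c1 l1) (measurable_cube a2 l2) (measurable_cube c2 l2)
  (leb_cube_lty a1 l1w) (leb_cube_lty c1 l1w) (leb_cube_lty a2 l2w)
  (leb_cube_lty c2 l2w) H1 H2 mb
  (cint_b_ev bL2 l1w l2w s) (cint_b_ev bL2 l1w l2w (map1 P1 s))
  (cint_b_ev bL2 l1w l2w (map2 P2 s))
  (cint_b_ev bL2 l1w l2w (map1 P1 (map2 P2 s))).
rewrite -cabsN -[X in cabs X]id.
rewrite -mulrA; apply: He.
- exact: rect_cpt.
- by rewrite !mulr_ge0.
apply/mixnorm_le => //; first by rewrite !mulr_ge0.
have [v1D _ _ _ _] := H1; have [v2D _ _ _ _] := H2.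
rewrite powRM ?mulr_ge0// EFinM.
have DD0 : (0 <= ((D1 * D2) `^ p1)%:E)%E by rewrite lee_fin powR_ge0.
have D12 : 0 <= D1 * D2 by rewrite mulr_ge0.
have mev : measurable_fun setT (fun z => cabs (ev s z)).
  by apply: measurable_cabs; exact: ev_meas.
have ev0 z : 0 <= cabs (ev s z) by exact: cabs_ge0.
have mDev : measurable_fun setT (fun z => D1 * D2 * cabs (ev s z)) by exact: measurable_funM.
have Dev0 z : 0 <= D1 * D2 * cabs (ev s z) by rewrite mulr_ge0.
have mvev : measurable_fun setT (fun z => cabs (ev (tens_v v1 v2 s) z)).
  by apply: measurable_cabs; exact: ev_meas.
have vev0 z : 0 <= cabs (ev (tens_v v1 v2 s) z) by exact: cabs_ge0.
have le1 z : cabs (ev (tens_v v1 v2 s) z) <= D1 * D2 * cabs (ev s z).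
  by rewrite ev_tens_v !cabsM ler_wpM2r ?cabs_ge0// ler_pM ?cabs_ge0.
have := mixI_mono mvev mDev vev0 Dev0 p10 p20
  (aeW (leb d1) (fun x => aeW (leb d2) (fun y => le1 (x, y)))).
rewrite (mixIZ (leb d1) (leb d2) mev ev0 D12 p10 p20) => h.
exact: le_trans h (lee_wpmul2l DD0 sr).
Qed.

(** The four alternating sums of the absorption involve the form on four rectangles with the sides
    of the given one, displaced by at most [B] times these sides. Duality then bounds the
    oscillation, and its normalization cancels the weight of the rectangle. *)
Lemma osc_test : exists B C : R, [/\ 0 <= B, 0 <= C &
  forall (a1 : Rn R d1) (l1 : R) (a2 : Rn R d2) (l2 e : R), 0 < l1 -> 0 < l2 -> 0 <= e ->
  (forall w1 w2, edist a1 w1 <= B * l1 -> edist a2 w2 <= B * l2 ->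
    form_le w1 l1 w2 l2 (e * ((l1 ^+ d1) `^ (1 - q1^-1) * (l2 ^+ d2) `^ (1 - q2^-1)))) ->
  (osc (d1%:R * (p1^-1 - q1^-1)) (d2%:R * (p2^-1 - q2^-1)) (p1 / (p1 - 1)) (p2 / (p2 - 1))
     b a1 l1 a2 l2 <= (C * e)%:E)%E].
Proof.
have [B1 [D1 [B10 D10 H1]]] := reflected_half_steps d10 T1K K1nd T1T1s.
have [B2 [D2 [B20 D20 H2]]] := reflected_half_steps d20 T2K K2nd T2T2s.
exists (B1 + B2), (64 * (8 * (D1 * D2))); split.
- by rewrite addr_ge0.
- by rewrite !mulr_ge0.
move=> a1 l1 a2 l2 e l10 l20 e0 He.
have l1w := ltW l10; have l2w := ltW l20.
have [c1 ac1 [[v1 [P1 P1h]] [v1' [Q1 Q1h]]]] := H1 a1 l1 l10.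
have [c2 ac2 [[v2 [P2 P2h]] [v2' [Q2 Q2h]]]] := H2 a2 l2 l20.
set N := (l1 ^+ d1) `^ (1 - q1^-1) * (l2 ^+ d2) `^ (1 - q2^-1) in He.
have N0 : 0 <= N by rewrite mulr_ge0// powR_ge0.
have eN0 : 0 <= e * N by rewrite mulr_ge0.
(* The maps [Q1], [Q2] end in the original cubes, so undisplaced cubes occur among the targets as
   well. *)
have aa1 : edist a1 a1 <= (B1 + B2) * l1 by rewrite edistxx mulr_ge0// addr_ge0.
have aa2 : edist a2 a2 <= (B1 + B2) * l2 by rewrite edistxx mulr_ge0// addr_ge0.
have {}ac1 : edist a1 c1 <= (B1 + B2) * l1.
  by apply: le_trans ac1 _; rewrite ler_wpM2r// lerDl.
have {}ac2 : edist a2 c2 <= (B1 + B2) * l2.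
  by apply: le_trans ac2 _; rewrite ler_wpM2r// lerDr.
have hPP := alt_sum_le l10 l20 D10 D20 P1h P2h (He _ _ ac1 ac2).
have hQP := alt_sum_le l10 l20 D10 D20 Q1h P2h (He _ _ aa1 ac2).
have hPQ := alt_sum_le l10 l20 D10 D20 P1h Q2h (He _ _ ac1 aa2).
have hQQ := alt_sum_le l10 l20 D10 D20 Q1h Q2h (He _ _ aa1 aa2).
have [beta beta0 base] := cut_base bL2 a1 a2 l1w l2w.
have V1 : 0 < l1 ^+ d1 by rewrite exprn_gt0.
have V2 : 0 < l2 ^+ d2 by rewrite exprn_gt0.
have th0 : (0 : R) <= 6^-1 by rewrite invr_ge0.
have Xi0 : 0 <= e * N * (D1 * D2) by rewrite mulr_ge0// mulr_ge0.
have abs := absorption (measurable_cube a1 l1) (measurable_cube c1 l1)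
  (measurable_cube a2 l2) (measurable_cube c2 l2)
  (leb_cube a1 l1w) (leb_cube c1 l1w) (leb_cube a2 l2w) (leb_cube c2 l2w)
  V1 V2 th0 (lexx _)
  (half_step_near_average P1h) (half_step_near_average P2h)
  (half_step_near_average Q1h) (half_step_near_average Q2h)
  p11 p21 Xi0 beta0 base hPP hQP hPQ hQQ.
have K0 : 0 <= 8 * (e * N * (D1 * D2)) by rewrite mulr_ge0.
have cb : (mixnorm (leb d1) (leb d2) (p1 / (p1 - 1)) (p2 / (p2 - 1))
    (center (leb d1) (leb d2) (cube a1 l1) (cube a2 l2) (l1 ^+ d1) (l2 ^+ d2)
       (cut b a1 l1 a2 l2)) <= (64 * (8 * (e * N * (D1 * D2))))%:E)%E.
  apply: (center_bound (measurable_cube a1 l1) (measurable_cube a2 l2)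
    (leb_cube a1 l1w) (leb_cube a2 l2w) V1 V2 p11 p21 (cut_cint bL2 a1 a2 l1w l2w) _ K0).
    by move=> z Xz; rewrite /cut chiE memNset// mul0r.
  move=> s r r0 s0 sr.
  have -> : (fun z => cut b a1 l1 a2 l2 z * ev s z) = fun z => b z * ev s z.
    by apply/funext => z; rewrite cut_evE.
  apply: abs => //.
  exact: (tensor_le_exists (measurable_cube a1 l1) (measurable_cube a2 l2)
    (leb_cube a1 l1w) (leb_cube a2 l2w)).
rewrite osc_center//.
set nrm := (X in (X%:E * _ <= _)%E).
have nrm0 : 0 <= nrm by rewrite divr_ge0 ?mulr_ge0 ?powR_ge0.
apply: le_trans (lee_wpmul2l _ cb) _; first by rewrite lee_fin.
rewrite -EFinM lee_fin.
have nN : nrm * N = 1.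
  have e1 := @scale_exponents R d1 l1 p1 q1 l10 p11.
  have e2 := @scale_exponents R d2 l2 p2 q2 l20 p21.
  apply: etrans (mulr1 1); apply: etrans (congr2 *%R e1 e2).
  by rewrite /nrm /N invfM; ring.
have -> : nrm * (64 * (8 * (e * N * (D1 * D2)))) = nrm * N * (64 * (8 * (D1 * D2)) * e) by ring.
by rewrite nN mul1r.
Qed.

End testing.

(** * Compactness *)

Section small_weights.
Context {R : realType}.

Lemma weight_le (q m V L : R) : 1 < q -> 0 <= m -> m <= V -> m <= L ->
  m <= L `^ q^-1 * V `^ (1 - q^-1).
Proof.
move=> q1 m0 mV mL; have q0 : 0 < q by rewrite (lt_trans _ q1).
have qi : 0 <= 1 - q^-1 by rewrite subr_ge0 invf_le1// ltW.
have qi0 : 0 <= q^-1 by rewrite invr_ge0 ltW.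
have [->|mn0] := eqVneq m 0; first by rewrite mulr_ge0 ?powR_ge0.
rewrite -[leLHS]powRr1// -[X in m `^ X](subrKC q^-1) powRD ?mn0 ?implybT//.
by apply: ler_pM; rewrite ?powR_ge0// ge0_ler_powR// nnegrE// (le_trans m0).
Qed.

(** To be applied with [m] the measure of the part of a cube of side [l] in a fixed cube of measure
    [L]. For small [l], [m <= l^d] gains the factor [(l^d)^(1/q)]; for large [l], the constant [L]
    is outgrown by [(l^d)^(1-1/q)]. *)
Lemma weight_small (d : nat) (q L eta : R) : (0 < d)%N -> 1 < q -> 0 < L -> 0 < eta ->
  exists2 t : R, 0 < t & forall l m : R, 0 < l -> l < t \/ t^-1 < l ->
    0 <= m -> m <= l ^+ d -> m <= L -> m <= eta * (l ^+ d) `^ (1 - q^-1).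
Proof.
move=> d0 q1 L0 eta0; have q0 : 0 < q by rewrite (lt_trans _ q1).
have qi : 0 < 1 - q^-1 by rewrite subr_gt0 invf_lt1.
pose S := (L / eta) `^ (1 - q^-1)^-1.
have S0 : 0 < S by rewrite powR_gt0// divr_gt0.
have E0 : 0 < eta `^ q by rewrite powR_gt0.
(* The entry 1 allows comparing [l^d] with [l]: from above when [l < t], from below when
   [l > 1/t]. *)
pose t := Num.min 1 (Num.min (eta `^ q) S^-1).
have t0 : 0 < t by rewrite !lt_min ltr01 E0 invr_gt0 S0.
have t1 : t <= 1 by rewrite ge_min lexx.
exists t => // l m l0 lt m0 mV mL.
have ld0 : 0 < l ^+ d by rewrite exprn_gt0.
case: lt => lt.
  have lE : l ^+ d <= eta `^ q.
    apply: (@le_trans _ _ l).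
      rewrite -[leRHS]expr1; exact: (ler_wiXn2l (ltW l0) (le_trans (ltW lt) t1) d0).
    by apply: le_trans (ltW lt) _; rewrite !ge_min lexx orbT.
  apply: le_trans (weight_le q1 m0 mV (le_trans mV lE)) _.
  by rewrite -powRrM divff ?gt_eqF// powRr1// ltW.
have tS : S <= t^-1.
  by rewrite -[leLHS]invrK lef_pV2 ?posrE ?invr_gt0// !ge_min lexx !orbT.
have l1 : 1 <= l by apply: le_trans (ltW lt); rewrite -[leLHS]invr1 lef_pV2 ?posrE.
have Sl : S <= l ^+ d.
  apply: le_trans tS _; apply: le_trans (ltW lt) _.
  by rewrite -[leLHS]expr1 ler_weXn2l.
apply: le_trans mL _; rewrite -ler_pdivrMl// mulrC.
have -> : L / eta = S `^ (1 - q^-1).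
  by rewrite /S -powRrM mulVf ?gt_eqF// powRr1// divr_ge0// ltW.
by rewrite ge0_ler_powR ?nnegrE// ltW.
Qed.

End small_weights.

(** * Decay of pairings with indicators of degenerate rectangles *)

Section mixed_norm_decay.
Context {R : realType} {d1 d2 : nat}.
Notation R12 := (Rn R d1 * Rn R d2)%type.
Variables (q1 q2 : R).
Hypotheses (q11 : 1 < q1) (q21 : 1 < q2).
Hypotheses (d10 : (0 < d1)%N) (d20 : (0 < d2)%N).
Implicit Types h : R12 -> R[i].

Let q10 : 0 < q1. Proof. exact: lt_trans q11. Qed.
Let q20 : 0 < q2. Proof. exact: lt_trans q21. Qed.

(** The norm of the indicator of the rectangle in the dual of [L^q1 L^q2], the natural normalization
    of a pairing with this indicator. *)
Definition rect_weight (l1 l2 : R) :=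
  (l1 ^+ d1) `^ (1 - q1^-1) * (l2 ^+ d2) `^ (1 - q2^-1).

Local Notation rect w1 l1 w2 l2 := (cube w1 l1 `*` cube w2 l2 : set R12).

Lemma rect_weight_ge0 l1 l2 : 0 <= rect_weight l1 l2.
Proof. by rewrite mulr_ge0 ?powR_ge0. Qed.

Lemma measurable_rect (w1 : Rn R d1) l1 (w2 : Rn R d2) l2 :
  measurable (rect w1 l1 w2 l2).
Proof. by apply: measurableX; exact: measurable_cube. Qed.

Lemma rect_integral h (w1 : Rn R d1) l1 (w2 : Rn R d2) l2 : 0 <= l1 -> 0 <= l2 ->
  cmeasurable h ->
  (\int[leb2]_z (cabs (h z * chi (rect w1 l1 w2 l2) z))%:E <=
   (rect_weight l1 l2)%:E * mixed_norm q1 q2 h)%E.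
Proof.
move=> l10 l20 mh; have mW := measurable_rect w1 l1 w2 l2.
have mF : measurable_fun setT (fun z => cabs (h z * chi (rect w1 l1 w2 l2) z)).
  by apply: measurable_cabs; apply: cmeasurableM => //; exact: cmeasurable_chi.
have F0 z : 0 <= cabs (h z * chi (rect w1 l1 w2 l2) z) by exact: cabs_ge0.
have Foff z : ~ (rect w1 l1 w2 l2) z -> cabs (h z * chi (rect w1 l1 w2 l2) z) = 0.
  by move=> Wz; rewrite chiE memNset// mulr0 cabs0.
have := mixI_rectangle (measurable_cube w1 l1) (measurable_cube w2 l2)
  (leb_cube w1 l10) (leb_cube w2 l20) mF F0 Foff q11 q21.
move=> /le_trans; apply.
have rw0 : (0 <= (rect_weight l1 l2)%:E)%E by rewrite lee_fin rect_weight_ge0.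
apply: (lee_wpmul2l rw0).
have qi0 : 0 <= q1^-1 by rewrite invr_ge0 ltW.
have hge z : 0 <= cabs (h z) by exact: cabs_ge0.
have le1 z : cabs (h z * chi (rect w1 l1 w2 l2) z) <= cabs (h z).
  rewrite cabsM; apply: ler_piMr; first exact: cabs_ge0.
  by rewrite chiE; case: ifP; rewrite ?cabs1 ?cabs0.
have mono : (mixI (leb d1) (leb d2) q1 q2 (fun z => cabs (h z * chi (rect w1 l1 w2 l2) z)%R) <=
    mixI (leb d1) (leb d2) q1 q2 (fun z => cabs (h z)))%E :=
  mixI_mono mF (measurable_cabs mh) F0 hge q10 q20
    (aeW (leb d1) (fun x => aeW (leb d2) (fun y => le1 (x, y)))).
have -> : mixed_norm q1 q2 h =
    (mixI (leb d1) (leb d2) q1 q2 (fun z => cabs (h z)) `^ q1^-1)%E.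
  exact: (mixnormE (leb d1) (leb d2) h q10 q20).
exact: (le_poweR qi0 (mixI_ge0 _ _ _ _ _) mono).
Qed.

Lemma in_mixed_cint h (w1 : Rn R d1) l1 (w2 : Rn R d2) l2 : 0 <= l1 -> 0 <= l2 ->
  in_mixed q1 q2 h -> cint leb2 (fun z => h z * chi (rect w1 l1 w2 l2) z).
Proof.
move=> l10 l20 [mh hy]; split.
  by apply: cmeasurableM => //; apply: cmeasurable_chi; exact: measurable_rect.
apply: le_lt_trans (rect_integral w1 w2 l10 l20 mh) _.
by apply: lte_mul_pinfty => //; rewrite lee_fin rect_weight_ge0.
Qed.

Let good h (M : R) := [set z | cabs (h z) <= M] `&` [set z | enorm2 z <= M].

Let mgood h M : cmeasurable h -> 0 <= M -> measurable (good h M).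
Proof.
move=> mh M0; apply: measurableI; last exact: measurable_ball2.
have -> : M = cabs (M%:C%C) by rewrite cabs_real ger0_norm.
by apply: measurable_cabs_le => //; exact: cmeasurable_cst.
Qed.

(** Each point is eventually [good], so the discarded parts tend to 0 everywhere under the majorant
    [|h|], and dominated convergence applies in the mixed norm. *)
Lemma mixed_truncation h (e : R) : in_mixed q1 q2 h -> 0 < e ->
  exists2 M : R, 0 < M &
    (mixed_norm q1 q2 (fun z => (h z * chi (~` good h M) z)%R) <= e%:E)%E.
Proof.
move=> [mh hy] e0.
pose Fn (n : nat) z := cabs (h z * chi (~` good h n%:R) z).
have mFn n : measurable_fun setT (Fn n).
  apply: measurable_cabs; apply: cmeasurableM => //; apply: cmeasurable_chi.
  by apply: measurableC; exact: mgood.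
have FnE n z : Fn n z = cabs (h z) * \1_(~` good h n%:R) z by rewrite /Fn cabsM cabs_chi.
have mh' := measurable_cabs mh.
have dom n z : 0 <= Fn n z <= cabs (h z).
  apply/andP; split; first exact: cabs_ge0.
  rewrite /Fn cabsM; apply: ler_piMr; first exact: cabs_ge0.
  by rewrite chiE; case: ifP; rewrite ?cabs1 ?cabs0.
have lim0 : {ae leb d1, forall x, {ae leb d2, forall y,
    (fun n => Fn n (x, y)) @ \oo --> (cst 0 : R12 -> R) (x, y)}}.
  apply: aeW => x; apply: aeW => y; apply: cvg_near_cst.
  near=> n; rewrite FnE indicE memNset ?mulr0//; apply; split => /=.
    by near: n; exact: nbhs_infty_ger.
  by near: n; exact: nbhs_infty_ger.
have hI : (mixI (leb d1) (leb d2) q1 q2 (fun z => cabs (h z)) < +oo)%E.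
  have : (mixnorm (leb d1) (leb d2) q1 q2 h < +oo)%E by [].
  by rewrite mixnormE// => /lty_poweRy; apply; rewrite invr_neq0// gt_eqF.
have m0 : measurable_fun setT (cst 0 : R12 -> R) by exact: measurable_cst.
have := mixI_dominated mFn m0 mh' dom (fun z => lexx 0) lim0 q10 q20 hI.
have -> : mixI (leb d1) (leb d2) q1 q2 (cst 0) = 0%E.
  rewrite /mixI /inr; apply: integral0_eq => x _.
  rewrite integral0_eq ?poweR0r// ?gt_eqF ?divr_gt0// => y _.
  by rewrite powR0// gt_eqF.
move=> /fine_cvgP[fin] /cvgrPdist_lt/(_ (e `^ q1)) h1.
have eq0 : 0 < e `^ q1 by rewrite powR_gt0.
have {}h1 := h1 eq0; near \oo => n; exists n%:R; first by near: n; exact: nbhs_infty_gtr.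
apply/mixnorm_le => //; first exact: ltW.
have fn : mixI (leb d1) (leb d2) q1 q2 (Fn n) \is a fin_num by near: n.
have : `|0 - fine (mixI (leb d1) (leb d2) q1 q2 (Fn n))| < e `^ q1 by near: n.
rewrite sub0r normrN ger0_norm ?fine_ge0 ?mixI_ge0// => h2.
by rewrite -[leLHS](fineK fn) lee_fin ltW.
Unshelve. all: by end_near. Qed.

(** The third alternative bounds every point of the rectangle instead of the infimum of the norms,
    which is the form that triangle inequalities produce. *)
Definition degenerate (t : R) (w1 : Rn R d1) (l1 : R) (w2 : Rn R d2) (l2 : R) :=
  [\/ l1 < t \/ t^-1 < l1, l2 < t \/ t^-1 < l2 |
    forall z, (rect w1 l1 w2 l2) z -> t^-1 < enorm2 z].

Lemma degenerate_mono t t' w1 l1 w2 l2 : 0 < t -> t <= t' ->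
  degenerate t w1 l1 w2 l2 -> degenerate t' w1 l1 w2 l2.
Proof.
move=> t0 tt'; have t'0 : 0 < t' by exact: lt_le_trans tt'.
have V : t'^-1 <= t^-1 by rewrite lef_pV2.
case=> [[h|h]|[h|h]|h].
- by constructor 1; left; exact: lt_le_trans tt'.
- by constructor 1; right; exact: le_lt_trans h.
- by constructor 2; left; exact: lt_le_trans tt'.
- by constructor 2; right; exact: le_lt_trans h.
- by constructor 3 => z /h; exact: le_lt_trans.
Qed.

(** The tail of [h] costs [e / 2] by Hölder. The rest is bounded with support in a ball, and
    contributes [M] times the measure of a product: a degenerate side makes one factor small, while
    the other obeys the interpolated bound [weight_le]. Far rectangles miss the ball. *)
Lemma mixed_decay h (e : R) : in_mixed q1 q2 h -> 0 < e ->
  exists2 t : R, 0 < t & forall w1 l1 w2 l2, 0 < l1 -> 0 < l2 ->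
    degenerate t w1 l1 w2 l2 ->
    (\int[leb2]_z (cabs (h z * chi (rect w1 l1 w2 l2) z))%:E <=
      (e * rect_weight l1 l2)%:E)%E.
Proof.
move=> hm e0; have [mh _] := hm.
have e2 : 0 < e / 2 by rewrite divr_gt0.
have [M M0 hM] := mixed_truncation hm e2.
pose c1 : Rn R d1 := [tuple of nseq d1 (- M)].
pose c2 : Rn R d2 := [tuple of nseq d2 (- M)].
have M2 : 0 < 2 * M by rewrite mulr_gt0.
pose L1 := (2 * M) ^+ d1; pose L2 := (2 * M) ^+ d2.
have L10 : 0 < L1 by rewrite exprn_gt0.
have L20 : 0 < L2 by rewrite exprn_gt0.
(* Chosen so that [M L1^(1/q1) eta2 = e / 2]: the first factor pays for the variable that is not
   assumed degenerate. *)
pose eta2 := e / 2 / (M * L1 `^ q1^-1).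
have eta20 : 0 < eta2 by rewrite divr_gt0// mulr_gt0// powR_gt0.
pose eta1 := e / 2 / (M * L2 `^ q2^-1).
have eta10 : 0 < eta1 by rewrite divr_gt0// mulr_gt0// powR_gt0.
have [t1 t10 T1] := weight_small d10 q11 L10 eta10.
have [t2 t20 T2] := weight_small d20 q21 L20 eta20.
(* The entry [1/M] ensures that a rectangle beyond distance [1/t] lies outside the ball of radius
   [M]. *)
pose t := Num.min (Num.min t1 t2) M^-1.
have t0 : 0 < t by rewrite !lt_min t10 t20 invr_gt0.
have tt1 : t <= t1 by rewrite !ge_min lexx.
have tt2 : t <= t2 by rewrite !ge_min lexx orbT.
have tM : M <= t^-1 by rewrite -[leLHS]invrK lef_pV2 ?posrE ?invr_gt0// !ge_min lexx orbT.
exists t => // w1 l1 w2 l2 l10 l20 deg.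
have l1w := ltW l10; have l2w := ltW l20.
pose W := rect w1 l1 w2 l2; have mW : measurable W by exact: measurable_rect.
pose A1 := cube w1 l1 `&` cube c1 (2 * M).
pose A2 := cube w2 l2 `&` cube c2 (2 * M).
have mA1 : measurable A1 by apply: measurableI; exact: measurable_cube.
have mA2 : measurable A2 by apply: measurableI; exact: measurable_cube.
have A1V : (leb d1 A1 <= (l1 ^+ d1)%:E)%E.
  rewrite -(leb_cube w1 l1w); apply: le_measure; rewrite ?inE//; last exact: subIsetl.
  exact: measurable_cube.
have A1L : (leb d1 A1 <= L1%:E)%E.
  rewrite -(leb_cube c1 (ltW M2)); apply: le_measure; rewrite ?inE//; last exact: subIsetr.
  exact: measurable_cube.
have A2V : (leb d2 A2 <= (l2 ^+ d2)%:E)%E.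
  rewrite -(leb_cube w2 l2w); apply: le_measure; rewrite ?inE//; last exact: subIsetl.
  exact: measurable_cube.
have A2L : (leb d2 A2 <= L2%:E)%E.
  rewrite -(leb_cube c2 (ltW M2)); apply: le_measure; rewrite ?inE//; last exact: subIsetr.
  exact: measurable_cube.
have A1f : leb d1 A1 \is a fin_num by rewrite ge0_fin_numE// (le_lt_trans A1L)// ltry.
have A2f : leb d2 A2 \is a fin_num by rewrite ge0_fin_numE// (le_lt_trans A2L)// ltry.
move: A1V A1L A2V A2L; rewrite -(fineK A1f) -(fineK A2f) !lee_fin.
have m10 : 0 <= fine (leb d1 A1) by rewrite fine_ge0.
have m20 : 0 <= fine (leb d2 A2) by rewrite fine_ge0.
have A12 : leb2 (A1 `*` A2) = (fine (leb d1 A1) * fine (leb d2 A2))%:E.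
  rewrite EFinM !fineK//; exact: (product_measure1E (leb d1) (leb d2) mA1 mA2).
move: m10 m20 A12; move: (fine (leb d1 A1)) (fine (leb d2 A2)) => m1 m2.
move=> m10 m20 A12 A1V A1L A2V A2L.
have mg := mgood mh (ltW M0).
(* On [good h M] the modulus is at most [M], and such points of [W] lie in [A1] times [A2]. The
   intersection with the ball is kept for the far rectangles, where it is empty. *)
have split_le : (\int[leb2]_z (cabs (h z * chi W z))%:E <=
    \int[leb2]_z (cabs (h z * chi (~` good h M) z * chi W z))%:E +
    \int[leb2]_z (M%:E * (\1_((A1 `*` A2) `&` [set z | enorm2 z <= M]) z)%:E))%E.
  have mEE : measurable ((A1 `*` A2) `&` [set z : R12 | enorm2 z <= M]).
    by apply: measurableI; [exact: measurableX|exact: measurable_ball2].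
  have mc1 : measurable_fun setT (fun z => (cabs (h z * chi (~` good h M) z * chi W z))%:E).
    apply: emeasurable_cabs; apply: cmeasurableM; last exact: cmeasurable_chi.
    by apply: cmeasurableM => //; apply: cmeasurable_chi; exact: measurableC.
  have mc2 : measurable_fun setT (fun z : R12 =>
      (M%:E * (\1_((A1 `*` A2) `&` [set z | (enorm2 z <= M)%R]) z)%:E)%E).
    by apply: emeasurable_funM => //; exact: emeasurable_indic.
  have mc0 : measurable_fun setT (fun z => (cabs (h z * chi W z))%:E).
    by apply: emeasurable_cabs; apply: cmeasurableM => //; exact: cmeasurable_chi.
  have z1 z : (0 <= (cabs (h z * chi (~` good h M) z * chi W z))%:E)%E.
    by rewrite lee_fin cabs_ge0.
  have z2 z : (0 <= M%:E * (\1_((A1 `*` A2) `&` [set z | (enorm2 z <= M)%R]) z)%:E)%E.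
    by rewrite -EFinM lee_fin mulr_ge0// ltW.
  rewrite -ge0_integralD//; apply: ge0_le_integral => //.
  - by move=> z _; rewrite lee_fin cabs_ge0.
  - exact: emeasurable_funD.
  move=> z _; rewrite -EFinM -EFinD lee_fin.
  have [gz|gz] := pselect (good h M z); last first.
    rewrite [chi (~` _) z]chiE mem_set// mulr1 lerDl mulr_ge0//; exact: ltW.
  have [Wz|Wz] := pselect (W z); last first.
    by rewrite [chi W z]chiE memNset// !mulr0 cabs0 add0r mulr_ge0// ltW.
  have [hz nz] := gz; have [Wz1 Wz2] := Wz.
  rewrite [chi W z]chiE mem_set// !mulr1.
  rewrite indicE mem_set; last first.
    split => //; split; split => //.
      exact: (ball_cube (ltW M0) (le_trans (ler_enorm2_fst z) nz)).
    exact: (ball_cube (ltW M0) (le_trans (ler_enorm2_snd z) nz)).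
  by rewrite mulr1 (le_trans hz)// lerDr cabs_ge0.
apply: le_trans split_le _.
have -> : e * rect_weight l1 l2 = rect_weight l1 l2 * (e / 2) + e / 2 * rect_weight l1 l2.
  by field.
rewrite EFinD; apply: leeD.
  have mhg : cmeasurable (fun z => h z * chi (~` good h M) z).
    by apply: cmeasurableM => //; apply: cmeasurable_chi; exact: measurableC.
  apply: le_trans (rect_integral w1 w2 l1w l2w mhg) _.
  have rw0 : (0 <= (rect_weight l1 l2)%:E)%E by rewrite lee_fin rect_weight_ge0.
  exact: (lee_wpmul2l rw0 hM).
have mEE : measurable ((A1 `*` A2) `&` [set z : R12 | enorm2 z <= M]).
  by apply: measurableI; [exact: measurableX|exact: measurable_ball2].
rewrite integral_cst_indic ?(ltW M0)//.
have le12 : (leb2 ((A1 `*` A2) `&` [set z | (enorm2 z <= M)%R]) <= (m1 * m2)%:E)%E.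
  rewrite -A12; apply: le_measure; rewrite ?inE//; exact: measurableX.
have M0' : (0 <= M%:E)%E by rewrite lee_fin ltW.
have weights (x1 x2 : R) : m1 <= x1 -> m2 <= x2 -> M * (x1 * x2) = e / 2 * rect_weight l1 l2 ->
    (M%:E * leb2 ((A1 `*` A2) `&` [set z | (enorm2 z <= M)%R]) <=
      (e / 2 * rect_weight l1 l2)%R%:E)%E.
  move=> h1 h2 <-; apply: le_trans (lee_wpmul2l M0' le12) _.
  by rewrite -EFinM lee_fin ler_wpM2l ?(ltW M0)// ler_pM.
have Mn0 : M != 0 by rewrite gt_eqF.
have P1 : L1 `^ q1^-1 != 0 by rewrite gt_eqF// powR_gt0.
have P2 : L2 `^ q2^-1 != 0 by rewrite gt_eqF// powR_gt0.
have tV1 : t1^-1 <= t^-1 by rewrite lef_pV2 ?posrE.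
have tV2 : t2^-1 <= t^-1 by rewrite lef_pV2 ?posrE.
case: deg => [deg|deg|deg].
- apply: (weights (eta1 * (l1 ^+ d1) `^ (1 - q1^-1)) (L2 `^ q2^-1 * (l2 ^+ d2) `^ (1 - q2^-1))).
  + apply: T1 => //; case: deg => deg; first by left; exact: lt_le_trans tt1.
    by right; exact: le_lt_trans deg.
  + exact: weight_le.
  + rewrite /eta1 /rect_weight; move: (L2 `^ q2^-1) P2 ((l1 ^+ d1) `^ _) ((l2 ^+ d2) `^ _) => x x0 y z.
    by field; rewrite x0 Mn0.
- apply: (weights (L1 `^ q1^-1 * (l1 ^+ d1) `^ (1 - q1^-1)) (eta2 * (l2 ^+ d2) `^ (1 - q2^-1))).
  + exact: weight_le.
  + apply: T2 => //; case: deg => deg; first by left; exact: lt_le_trans tt2.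
    by right; exact: le_lt_trans deg.
  + rewrite /eta2 /rect_weight; move: (L1 `^ q1^-1) P1 ((l1 ^+ d1) `^ _) ((l2 ^+ d2) `^ _) => x x0 y z.
    by field; rewrite x0 Mn0.
- rewrite (_ : _ `&` _ = set0) ?measure0 ?mule0.
    by rewrite lee_fin mulr_ge0 ?rect_weight_ge0// ltW.
  apply/seteqP; split => // z [[[z1 _] [z2 _]] zM].
  by have := deg z (conj z1 z2); rewrite ltNge (le_trans zM).
Qed.

End mixed_norm_decay.

(** * Consequences of compactness for the form *)

Section compactness.
Context {R : realType} {d1 d2 : nat}.
Notation R12 := (Rn R d1 * Rn R d2)%type.
Variables (T1 T1s : (Rn R d1 -> R[i]) -> (Rn R d1 -> R[i]))
  (T2 T2s : (Rn R d2 -> R[i]) -> (Rn R d2 -> R[i]))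
  (p1 p2 q1 q2 : R) (b : R12 -> R[i]) (U : (R12 -> R[i]) -> (R12 -> R[i])).
Hypotheses (d10 : (0 < d1)%N) (d20 : (0 < d2)%N).
Hypotheses (p11 : 1 < p1) (p21 : 1 < p2) (q11 : 1 < q1) (q21 : 1 < q2).
Hypothesis Ucpt : compact_operator p1 p2 q1 q2 U.
Hypothesis Uform : forall f g, bounded_cpt_supp (@enorm2 R d1 d2) f ->
  bounded_cpt_supp (@enorm2 R d1 d2) g ->
  cintegral leb2 setT (fun x => U f x * g x) =
  bicommutator_form T1 T1s T2 T2s b f g.

Let p10 : 0 < p1. Proof. exact: lt_trans p11. Qed.
Let p20 : 0 < p2. Proof. exact: lt_trans p21. Qed.

Local Notation rect w1 l1 w2 l2 := (cube w1 l1 `*` cube w2 l2 : set R12).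
Local Notation weight := (@rect_weight R d1 d2 q1 q2).
Local Notation form_le := (form_le T1 T1s T2 T2s p1 p2 b).

Lemma bounded_in_mixed (f : R12 -> R[i]) :
  bounded_cpt_supp (@enorm2 R d1 d2) f -> in_mixed p1 p2 f.
Proof.
move=> [mf [M fM] [r fr]]; split => //.
pose c1 : Rn R d1 := [tuple of nseq d1 (- `|r|)].
pose c2 : Rn R d2 := [tuple of nseq d2 (- `|r|)].
have r0 : 0 <= 2 * `|r| by rewrite mulr_ge0.
have fM' z : 0 <= cabs (f z) <= M by rewrite cabs_ge0 fM.
have foff z : ~ (rect c1 (2 * `|r|) c2 (2 * `|r|)) z -> cabs (f z) = 0.
  move=> Wz; have [->|fz] := eqVneq (f z) 0; first exact: cabs0.
  exfalso; apply: Wz; have zr := le_trans (fr z fz) (ler_norm r).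
  split; apply: ball_cube => //.
    exact: le_trans (ler_enorm2_fst z) zr.
  exact: le_trans (ler_enorm2_snd z) zr.
have h := mixI_bounded_lty (measurable_cube c1 _) (measurable_cube c2 _)
  (leb_cube_lty c1 r0) (leb_cube_lty c2 r0) (measurable_cabs mf) fM' foff p10 p20.
have -> : mixed_norm p1 p2 f =
    (mixI (leb d1) (leb d2) p1 p2 (fun z => cabs (f z)) `^ p1^-1)%E.
  exact: (mixnormE (leb d1) (leb d2) f p10 p20).
exact: poweR_lty.
Qed.

Lemma chi_rect_cpt (w1 : Rn R d1) l1 (w2 : Rn R d2) l2 : 0 <= l1 -> 0 <= l2 ->
  bounded_cpt_supp (@enorm2 R d1 d2) (chi (rect w1 l1 w2 l2)).
Proof.
move=> l10 l20; split.
- by apply: cmeasurable_chi; exact: measurable_rect.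
- by exists 1 => z; rewrite chiE; case: ifP; rewrite ?cabs1 ?cabs0.
have [r rP] := rect_in_ball w1 w2 l10 l20.
exists r => z; rewrite chiE; case: ifPn => [/set_mem /rP//|_].
by rewrite eqxx.
Qed.

Let in_mixed0 : in_mixed p1 p2 ((fun=> 0) : R12 -> R[i]).
Proof.
apply: bounded_in_mixed; split; first exact: cmeasurable_cst.
  by exists 0 => z; rewrite cabs0.
by exists 0 => z; rewrite eqxx.
Qed.

Let U_scale (a : R[i]) f : in_mixed p1 p2 f ->
  {ae leb2, forall x, U (fun y => a * f y) x = a * U f x}.
Proof.
move=> fm; have [Ulin _ _] := Ucpt.
(* Linearity at [1 * 0 + 0] gives [U 0 = U 0 + U 0], so [U 0] vanishes almost everywhere and
   homogeneity follows from the combined linearity rule. *)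
have := Ulin 1 _ _ in_mixed0 in_mixed0.
rewrite (_ : (fun y : R12 => 1 * 0 + 0) = (fun=> 0) :> (R12 -> R[i])); last first.
  by apply/funext => y; rewrite mulr0 addr0.
move=> U0; have := Ulin a _ _ fm in_mixed0.
rewrite (_ : (fun y => a * f y + 0) = fun y => a * f y); last first.
  by apply/funext => y; rewrite addr0.
apply: filterS2 U0 => x; rewrite mul1r => /eqP; rewrite -subr_eq0 opprD addrA subrr sub0r.
by rewrite oppr_eq0 => /eqP -> ->; rewrite addr0.
Qed.

Lemma form_le_witness w1 l1 w2 l2 (e : R) : 0 <= l1 -> 0 <= l2 -> 0 <= e ->
  ~ form_le w1 l1 w2 l2 e ->
  exists f : R12 -> R[i], [/\ in_mixed p1 p2 f, (mixed_norm p1 p2 f <= 1%:E)%E &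
    e <= cabs (cintegral leb2 setT (fun z => U f z * chi (rect w1 l1 w2 l2) z))].
Proof.
move=> l10 l20 e0 /existsNP[f] /existsNP[r] /not_implyP[fc] /not_implyP[r0].
move=> /not_implyP[fr /negP]; rewrite -ltNge -Uform//; last exact: chi_rect_cpt.
set I := cintegral _ _ _ => eI.
have fm := bounded_in_mixed fc; have [mf _] := fm.
have e1 : 0 < e + 1 by rewrite ltr_wpDl.
pose de := (cabs I - e * r) / (e + 1).
have de0 : 0 < de by rewrite divr_gt0// subr_gt0.
have s0 : 0 < r + de by rewrite ltr_wpDl.
have eI' : e * (r + de) <= cabs I.
  have : (e + 1) * de = cabs I - e * r by rewrite /de mulrCA divff ?mulr1// gt_eqF.
  by rewrite mulrDr; nra.
pose a : R[i] := ((r + de)^-1)%:C%C.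
have ca : cabs a = (r + de)^-1 by rewrite cabs_real ger0_norm// invr_ge0 ltW.
exists (fun z => a * f z).
have c' : bounded_cpt_supp (@enorm2 R d1 d2) (fun z => a * f z).
  have [_ [M fM] [s fs]] := fc; split.
  - by apply: cmeasurableM => //; exact: cmeasurable_cst.
  - by exists (cabs a * M) => z; rewrite cabsM ler_wpM2l ?cabs_ge0.
  - by exists s => z az; apply: fs; apply: contra_neq az => ->; rewrite mulr0.
have am := bounded_in_mixed c'.
split => //.
- apply/(mixnorm_le (leb d1) (leb d2) _ p10 p20 ler01).
  have fI := (mixnorm_le (leb d1) (leb d2) f p10 p20 r0).1 fr.
  have mfc := measurable_cabs mf; have ca0 := cabs_ge0 a.
  have cE : (fun z => cabs (a * f z)) = fun z => cabs a * cabs (f z).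
    by apply/funext => z; rewrite cabsM.
  rewrite cE (mixIZ (leb d1) (leb d2) mfc (fun z => cabs_ge0 _) ca0 p10 p20).
  have cap : (0 <= (cabs a `^ p1)%:E)%E by rewrite lee_fin powR_ge0.
  apply: le_trans (lee_wpmul2l cap fI) _.
  rewrite -EFinM lee_fin -powRM ?cabs_ge0//; apply: ge0_ler_powR => //.
  + exact: ltW.
  + by rewrite nnegrE mulr_ge0.
  + by rewrite nnegrE.
  + by rewrite ca mulrC ler_pdivrMr// mul1r lerDl ltW.
- have [_ Um _] := Ucpt.
  have cUf := in_mixed_cint q11 q21 w1 w2 l10 l20 (Um _ fm).
  have [mUaf _] := in_mixed_cint q11 q21 w1 w2 l10 l20 (Um _ am).
  have -> : cintegral leb2 setT (fun z => U (fun y => a * f y) z * chi (rect w1 l1 w2 l2) z) =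
      a * I.
    rewrite /I -cintegralZ//; apply: ae_eq_cintegral => //.
      by apply: cmeasurableM; [exact: cmeasurable_cst|case: cUf].
    by apply: filterS (U_scale a fm) => z ->; rewrite mulrA.
  by rewrite cabsM ca mulrC ler_pdivlMr.
Qed.

(** Along a subsequence the images of the normalized witnesses approach [h], and Hölder bounds the
    pairing of the difference with [1_W] by [eta] times the weight. The lower bounds [e k] are free:
    growing ones serve for boundedness, a constant one for vanishing. *)
Lemma extraction (w1 : nat -> Rn R d1) (l1 : nat -> R) (w2 : nat -> Rn R d2)
    (l2 : nat -> R) (e : nat -> R) :
  (forall k, 0 < l1 k) -> (forall k, 0 < l2 k) -> (forall k, 0 <= e k) ->
  (forall k, ~ form_le (w1 k) (l1 k) (w2 k) (l2 k) (e k * weight (l1 k) (l2 k))) ->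
  exists (phi : nat -> nat) (h : R12 -> R[i]),
    [/\ {homo phi : m n / (m < n)%N}, in_mixed q1 q2 h & forall eta : R, 0 < eta ->
    \forall k \near \oo,
      ((e (phi k) * weight (l1 (phi k)) (l2 (phi k)))%:E <=
       (eta * weight (l1 (phi k)) (l2 (phi k)))%:E +
       \int[leb2]_z (cabs (h z *
         chi (rect (w1 (phi k)) (l1 (phi k)) (w2 (phi k)) (l2 (phi k))) z)%R)%:E)%E].
Proof.
move=> l10 l20 e0 nform.
have wit k := form_le_witness (ltW (l10 k)) (ltW (l20 k))
  (mulr_ge0 (e0 k) (rect_weight_ge0 q1 q2 _ _)) (nform k).
have {wit}[F FP] := choice wit.
have [_ Um Uc] := Ucpt.
have [||phi [h [phi_mono hm cvgh]]] := Uc F.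
- by move=> k; have [] := FP k.
- by exists 1 => k; have [] := FP k.
exists phi, h; split => // eta eta0.
have [mh _] := hm.
move/fine_cvgP: cvgh => [fin] /cvgrPdist_lt/(_ eta eta0) small.
near=> k.
have fk : mixed_norm q1 q2 (fun x => U (F (phi k)) x - h x) \is a fin_num by near: k.
have : `|0 - fine (mixed_norm q1 q2 (fun x => U (F (phi k)) x - h x))| < eta by near: k.
set nrm := mixed_norm _ _ _ in fk * => nrm_lt.
have {nrm_lt}nrm_le : (nrm <= eta%:E)%E.
  rewrite -(fineK fk) lee_fin; apply: le_trans (ler_norm _) _.
  by move: nrm_lt; rewrite sub0r normrN => /ltW.
have [Fm _ eF] := FP (phi k).
move: (phi k) Fm eF @nrm fk nrm_le => j Fm eF nrm fk nrm_le.
have l1w := ltW (l10 j); have l2w := ltW (l20 j).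
have UFm := Um _ Fm; have [mUF _] := UFm.
have cUF := in_mixed_cint q11 q21 (w1 j) (w2 j) l1w l2w UFm.
pose W := rect (w1 j) (l1 j) (w2 j) (l2 j).
have mW : measurable W by exact: measurable_rect.
have mchi := cmeasurable_chi (R := R) mW.
have mdiff : cmeasurable (fun z => U (F j) z - h z) by exact: cmeasurableB.
have rI := rect_integral q11 q21 (w1 j) (w2 j) l1w l2w mdiff.
have w0 : (0 <= (weight (l1 j) (l2 j))%:E)%E by rewrite lee_fin rect_weight_ge0.
have {}rI := le_trans rI (lee_wpmul2l w0 nrm_le).
apply: (@le_trans _ _ (\int[leb2]_z (cabs (U (F j) z * chi W z)%R)%:E)%E).
  apply: le_trans (le_cabs_cintegral cUF); by rewrite lee_fin.
have m1 : measurable_fun setT (fun z => (cabs ((U (F j) z - h z) * chi W z)%R)%:E).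
  by apply: emeasurable_cabs; exact: cmeasurableM.
have m2 : measurable_fun setT (fun z => (cabs (h z * chi W z)%R)%:E).
  by apply: emeasurable_cabs; exact: cmeasurableM.
have m3 : measurable_fun setT (fun z => (cabs (U (F j) z * chi W z)%R)%:E).
  by apply: emeasurable_cabs; exact: cmeasurableM.
have g1 z : (0 <= (cabs ((U (F j) z - h z) * chi W z)%R)%:E)%E by rewrite lee_fin cabs_ge0.
have g2 z : (0 <= (cabs (h z * chi W z)%R)%:E)%E by rewrite lee_fin cabs_ge0.
have g3 z : (0 <= (cabs (U (F j) z * chi W z)%R)%:E)%E by rewrite lee_fin cabs_ge0.
have tri : (\int[leb2]_z (cabs (U (F j) z * chi W z)%R)%:E <=
    \int[leb2]_z (cabs ((U (F j) z - h z) * chi W z)%R)%:E +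
    \int[leb2]_z (cabs (h z * chi W z)%R)%:E)%E.
  rewrite -ge0_integralD//; apply: ge0_le_integral => //.
    exact: emeasurable_funD.
  move=> z _; rewrite -EFinD lee_fin.
  by rewrite (_ : U (F j) z * chi W z = (U (F j) z - h z) * chi W z + h z * chi W z) ?ler_cabsD//; ring.
apply: le_trans tri _; rewrite leeD2r// (mulrC eta); exact: rI.
Unshelve. all: by end_near. Qed.

Lemma mono_ge_id (phi : nat -> nat) : {homo phi : m n / (m < n)%N} -> forall k, (k <= phi k)%N.
Proof.
move=> h; elim => // k ih; exact: leq_ltn_trans ih (h _ _ (ltnSn k)).
Qed.

Let weight_gt0 l1 l2 : 0 < l1 -> 0 < l2 -> 0 < weight l1 l2.
Proof. by move=> l10 l20; rewrite mulr_gt0// powR_gt0// exprn_gt0. Qed.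

(** If every bound [k] failed on some rectangle, the normalized pairings of the limit [h] would be
    unbounded, whereas Hölder bounds them by the norm [H] of [h]: this yields [k <= 1 + H] for all
    large [k]. *)
Lemma form_bounded : exists2 M : R, 0 <= M & forall w1 l1 w2 l2, 0 < l1 -> 0 < l2 ->
  form_le w1 l1 w2 l2 (M * weight l1 l2).
Proof.
apply: contrapT => nM.
have /choice[x xP] (k : nat) : exists x : Rn R d1 * R * (Rn R d2 * R),
    [/\ 0 < x.1.2, 0 < x.2.2 &
     ~ form_le x.1.1 x.1.2 x.2.1 x.2.2 (k%:R * weight x.1.2 x.2.2)].
  apply: contrapT => nx; apply: nM; exists k%:R => // w1 l1 w2 l2 l10 l20.
  by apply: contrapT => nf; apply: nx; exists ((w1, l1), (w2, l2)).
have [||||phi [h [phi_mono hm bnd]]] :=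
  @extraction (fun k => (x k).1.1) (fun k => (x k).1.2) (fun k => (x k).2.1)
    (fun k => (x k).2.2) (fun k => k%:R).
- by move=> k; have [] := xP k.
- by move=> k; have [] := xP k.
- by [].
- by move=> k; have [] := xP k.
have [mh hy] := hm.
have H0 : (0 <= mixed_norm q1 q2 h)%E by exact: Lnorm_ge0.
have Hf : mixed_norm q1 q2 h \is a fin_num by rewrite ge0_fin_numE.
set H := fine (mixed_norm q1 q2 h).
have b1 := bnd 1 ltr01; near \oo => k.
have : (k%:R : R) <= 1 + H.
  have kphi : (k%:R : R) <= (phi k)%:R by rewrite ler_nat mono_ge_id.
  apply: le_trans kphi _.
  have [y1 y2 _] := xP (phi k); have wk := weight_gt0 y1 y2.
  rewrite -(ler_pM2r wk).
  have : (((phi k)%:R * weight (x (phi k)).1.2 (x (phi k)).2.2)%:E <=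
      (1 * weight (x (phi k)).1.2 (x (phi k)).2.2)%:E +
      \int[leb2]_z (cabs (h z * chi (rect (x (phi k)).1.1 (x (phi k)).1.2
         (x (phi k)).2.1 (x (phi k)).2.2) z)%R)%:E)%E by near: k.
  have rI := rect_integral q11 q21 (x (phi k)).1.1 (x (phi k)).2.1 (ltW y1) (ltW y2) mh.
  rewrite -(fineK Hf) -/H in rI.
  move=> h1; have h2 := le_trans h1 (leeD (lexx _) rI).
  by rewrite mulrDl (mulrC H) -lee_fin.
by apply/negP; rewrite -ltNge; near: k; exact: nbhs_infty_gtr.
Unshelve. all: by end_near. Qed.

(** Failure at every threshold [1/(k+1)] gives increasingly degenerate rectangles. Along the
    subsequence both the distance to [h] and the normalized pairing of [h] fall below [eps / 4],
    which contradicts the lower bound [eps]. *)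
Lemma form_vanishing (eps : R) : 0 < eps -> exists2 t : R, 0 < t &
  forall w1 l1 w2 l2, 0 < l1 -> 0 < l2 -> degenerate t w1 l1 w2 l2 ->
  form_le w1 l1 w2 l2 (eps * weight l1 l2).
Proof.
move=> eps0; apply: contrapT => nt.
have tk (k : nat) : 0 < k.+1%:R^-1 :> R by rewrite invr_gt0 ltr0n.
have /choice[x xP] (k : nat) : exists x : Rn R d1 * R * (Rn R d2 * R),
    [/\ 0 < x.1.2, 0 < x.2.2, degenerate k.+1%:R^-1 x.1.1 x.1.2 x.2.1 x.2.2 &
     ~ form_le x.1.1 x.1.2 x.2.1 x.2.2 (eps * weight x.1.2 x.2.2)].
  apply: contrapT => nx; apply: nt; exists k.+1%:R^-1 => // w1 l1 w2 l2 l10 l20 dg.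
  by apply: contrapT => nf; apply: nx; exists ((w1, l1), (w2, l2)).
have [||||phi [h [phi_mono hm bnd]]] :=
  @extraction (fun k => (x k).1.1) (fun k => (x k).1.2) (fun k => (x k).2.1)
    (fun k => (x k).2.2) (fun=> eps).
- by move=> k; have [] := xP k.
- by move=> k; have [] := xP k.
- by move=> k; exact: ltW.
- by move=> k; have [] := xP k.
have e4 : 0 < eps / 4 by rewrite divr_gt0.
have [t t0 dec] := mixed_decay q11 q21 d10 d20 hm e4.
have b4 := bnd _ e4; near \oo => k.
have [y1 y2 dg _] := xP (phi k); have wk := weight_gt0 y1 y2.
have kt : (phi k).+1%:R^-1 <= t.
  rewrite -[leRHS]invrK lef_pV2 ?posrE ?invr_gt0 ?ltr0n//.
  apply: (@le_trans _ _ (k%:R : R)); first by near: k; exact: nbhs_infty_ger.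
  by rewrite ler_nat (leq_trans (mono_ge_id phi_mono k)).
have {}dg := degenerate_mono (tk _) kt dg.
have h1 := dec _ _ _ _ y1 y2 dg.
have : ((eps * weight (x (phi k)).1.2 (x (phi k)).2.2)%:E <=
    (eps / 4 * weight (x (phi k)).1.2 (x (phi k)).2.2)%:E +
    \int[leb2]_z (cabs (h z * chi (rect (x (phi k)).1.1 (x (phi k)).1.2
       (x (phi k)).2.1 (x (phi k)).2.2) z)%R)%:E)%E by near: k.
move=> h2; have := le_trans h2 (leeD (lexx _) h1).
rewrite -EFinD lee_fin -mulrDl ler_pM2r// => h3; lra.
Unshelve. all: by end_near. Qed.

End compactness.

(** * Degeneracy of displaced rectangles, and the conclusion *)

Section reflected_degenerate.
Context {R : realType} {d1 d2 : nat}.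
Variable B : R.
Hypothesis B0 : 0 <= B.

(** A displacement keeps the sides, so only distant rectangles need an argument. If a side exceeds
    [1/t], the displaced rectangle is degenerate through that side; otherwise it has moved by at
    most [B / t] in each variable and is still far away. *)
Lemma degenerate_reflect (t : R) : 0 < t -> exists2 t0 : R, 0 < t0 &
  forall (a1 : Rn R d1) l1 (a2 : Rn R d2) l2 w1 w2, 0 < l1 -> 0 < l2 ->
    edist a1 w1 <= B * l1 -> edist a2 w2 <= B * l2 ->
    degenerate t0 a1 l1 a2 l2 -> degenerate t w1 l1 w2 l2.
Proof.
move=> t0; have V0 : 0 < t^-1 by rewrite invr_gt0.
(* For [z] in the displaced rectangle, [|a1| + |a2|] is at most [2 |z|] plus the displacements and
   diameters, which total at most [(2 B + d1 + d2) / t]; if it exceeds [S], then [|z| > 1/t]. *)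
pose S := 2 * t^-1 + (2 * B + d1%:R + d2%:R) * t^-1.
have S0 : 0 < S by rewrite ltr_wpDr ?mulr_gt0// mulr_ge0 ?(ltW V0)// !addr_ge0 ?mulr_ge0.
pose s := Num.min t S^-1.
have s0 : 0 < s by rewrite lt_min t0 invr_gt0.
have st : s <= t by rewrite ge_min lexx.
have sS : S <= s^-1 by rewrite -[leLHS]invrK lef_pV2 ?posrE ?invr_gt0// ge_min lexx orbT.
have sV : t^-1 <= s^-1 by rewrite lef_pV2 ?posrE.
exists s => // a1 l1 a2 l2 w1 w2 l10 l20 aw1 aw2.
have [L1|L1] := ltP t^-1 l1; first by constructor 1; right.
have [L2|L2] := ltP t^-1 l2; first by constructor 2; right.
case=> [[h|h]|[h|h]|h].
- by constructor 1; left; exact: lt_le_trans st.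
- by constructor 1; right; exact: le_lt_trans h.
- by constructor 2; left; exact: lt_le_trans st.
- by constructor 2; right; exact: le_lt_trans h.
constructor 3 => z [z1 z2].
have := h (a1, a2) (conj (cube_corner a1 (ltW l10)) (cube_corner a2 (ltW l20))).
have := ler_enorm2_add (a1, a2) => /= n12.
have n1 := enorm_triangle a1 z.1; have n2 := enorm_triangle a2 z.2.
have e1 := edist_triangle a1 w1 z.1; have e2 := edist_triangle a2 w2 z.2.
have f1 := cube_edist (ltW l10) (cube_corner w1 (ltW l10)) z1.
have f2 := cube_edist (ltW l20) (cube_corner w2 (ltW l20)) z2.
have z1n := ler_enorm2_fst z; have z2n := ler_enorm2_snd z.
have b1 : B * l1 <= B * t^-1 by rewrite ler_wpM2l.
have b2 : B * l2 <= B * t^-1 by rewrite ler_wpM2l.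
have c1 : d1%:R * l1 <= d1%:R * t^-1 by rewrite ler_wpM2l.
have c2 : d2%:R * l2 <= d2%:R * t^-1 by rewrite ler_wpM2l.
have SE : S = 2 * t^-1 + 2 * (B * t^-1) + d1%:R * t^-1 + d2%:R * t^-1.
  by rewrite /S; ring.
lra.
Qed.

End reflected_degenerate.

Theorem theorem5p15 (R : realType) (d1 d2 : nat)
    (T1 T1s : (Rn R d1 -> R[i]) -> (Rn R d1 -> R[i]))
    (K1 : Rn R d1 -> Rn R d1 -> R[i])
    (T2 T2s : (Rn R d2 -> R[i]) -> (Rn R d2 -> R[i]))
    (K2 : Rn R d2 -> Rn R d2 -> R[i])
    (p1 p2 q1 q2 : R) (b : Rn R d1 * Rn R d2 -> R[i]) :
  (0 < d1)%N -> (0 < d2)%N ->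
  CZO T1 K1 -> symmetrically_nondegenerate K1 -> adjoint_operator T1 T1s ->
  CZO T2 K2 -> symmetrically_nondegenerate K2 -> adjoint_operator T2 T2s ->
  1 < p1 -> p1 <= q1 -> 1 < p2 -> p2 <= q2 ->
  in_L2loc b ->
  compact_bicommutator T1 T1s T2 T2s b p1 p2 q1 q2 ->
  VMO (d1%:R * (p1^-1 - q1^-1)) (d2%:R * (p2^-1 - q2^-1))
    (p1 / (p1 - 1)) (p2 / (p2 - 1)) b.
Proof.
move=> d10 d20 T1K K1nd T1T1s T2K K2nd T2T2s p11 pq1 p21 pq2 bL2 [U Ucpt Uform].
have q11 := lt_le_trans p11 pq1; have q21 := lt_le_trans p21 pq2.
have [B [C [B0 C0 test]]] :=
  osc_test q1 q2 d10 d20 T1K K1nd T1T1s T2K K2nd T2T2s p11 p21 bL2.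
split.
  have [M M0 fM] := form_bounded p11 p21 q11 q21 Ucpt Uform.
  apply: (@le_lt_trans _ _ (C * M)%:E); last exact: ltry.
  apply: ge_ereal_sup => o [a1 [l1 [a2 [l2 [l10 l20 ->]]]]].
  by apply: test => // w1 w2 _ _; exact: fM.
move=> eps eps0.
have C1 : 0 < C + 1 by rewrite ltr_wpDl.
(* The denominator [C + 1] is positive also for [C = 0] and makes the final inequality
   [C eps / (C + 1) < eps] strict. *)
have e0 : 0 < eps / (C + 1) by rewrite divr_gt0.
have [t t0 ft] := form_vanishing d10 d20 p11 p21 q11 q21 Ucpt Uform e0.
have [s s0 sP] := degenerate_reflect (d1 := d1) (d2 := d2) B0 t0.
exists s => // a1 l1 a2 l2 l10 l20 deg.
(* The distance condition of [VMO] is an infimum, which lies below the norm of every point of the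
   rectangle. *)
have {}deg : degenerate s a1 l1 a2 l2.
  case: deg => deg; [by constructor 1|by constructor 2|constructor 3 => z Wz].
  apply: lt_le_trans deg _; apply: ge_inf; last by exists z.
  by exists 0 => _ [x _ <-]; exact: sqrtr_ge0.
apply: (@le_lt_trans _ _ (C * (eps / (C + 1)))%:E).
  apply: test => //; first exact: ltW.
  move=> w1 w2 aw1 aw2; apply: ft => //.
  exact: (sP _ _ _ _ _ _ l10 l20 aw1 aw2 deg).
by rewrite lte_fin mulrCA -[ltRHS]mulr1 ltr_pM2l// ltr_pdivrMr// mul1r ltrDl.
Qed.
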